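(* Let $k$ be an algebraically closed field and let $S\subseteq\mathbb{P}^3_k$ be a smooth cubic surface. For every integer $n\ge1$, a set of $n$ general points on $S$ is glicci.
   Context: ''A general $X$ has property $Y$'' means that there is a nonempty Zariski open subset of the family of all $X$'s having property $Y$; here the $X$'s are the reduced sets of $n$ points of $S$. A closed subscheme of $\mathbb{P}^m$ is arithmetically Gorenstein (AG) if its homogeneous coordinate ring is Gorenstein. Let $V_1,V_2\subseteq\mathbb{P}^m$ be equidimensional closed subschemes of the same dimension $r$ without embedded components. They are linked by an AG scheme $X$ if $X$ is an AG scheme of dimension $r$ containing $V_1,V_2$ with $\mathcal{I}_{V_2,X}\cong\mathcal{H}om(\mathcal{O}_{V_1},\mathcal{O}_X)$ and $\mathcal{I}_{V_1,X}\cong\mathcal{H}om(\mathcal{O}_{V_2},\mathcal{O}_X)$. The equivalence relation generated by such links is Gorenstein liaison ($G$-liaison). A scheme is glicci if it is in the $G$-liaison class of a complete intersection. *)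

(* Defs.v *)
From HB Require Import structures.
From mathcomp Require Import all_boot all_order all_fingroup all_algebra.
From mathcomp Require Export mpoly.
From Stdlib Require Export Relation_Operators.

Set Implicit Arguments.
Unset Strict Implicit.
Unset Printing Implicit Defensive.

Import GRing.Theory.
Local Open Scope ring_scope.

Section Ideals.
Variable R : comNzRingType.

Definition is_ideal (I : R -> Prop) : Prop :=
  [/\ I 0, (forall x y, I x -> I y -> I (x + y)) & (forall a x, I x -> I (a * x))].

Definition is_prime (P : R -> Prop) : Prop :=
  [/\ is_ideal P, ~ P 1 & forall x y, P (x * y) -> P x \/ P y].

Definition gen_ideal (s : seq R) (x : R) : Prop :=
  exists c : 'I_(size s) -> R, x = \sum_(i < size s) c i * s`_i.

Definition noetherian : Prop :=
  forall I, is_ideal I -> exists s, forall x, I x <-> gen_ideal s x.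

Definition is_localization (P : R -> Prop) (A : comNzRingType)
    (phi : {rmorphism R -> A}) : Prop :=
  [/\ (forall s, ~ P s -> exists u, u * phi s = 1),
      (forall a, exists r s, ~ P s /\ a * phi s = phi r)
    & (forall r, phi r = 0 <-> exists2 s, ~ P s & s * r = 0)].

Definition injective_module (E : lmodType R) : Prop :=
  forall (M N : lmodType R) (i : {linear M -> N}) (f : {linear M -> E}),
    injective i -> exists g : {linear N -> E}, forall x, g (i x) = f x.

(* An injective resolution 0 -> M -> E 0 -> E 1 -> ... with E i = 0 for i > n *)
Definition finite_injective_dimension (M : lmodType R) : Prop :=
  exists (n : nat) (E : nat -> lmodType R) (eps : {linear M -> E 0%N})
         (d : forall i, {linear E i -> E i.+1}),
    [/\ (forall i, injective_module (E i)),
        injective eps,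
        (forall x, d 0%N x = 0 <-> exists y, x = eps y),
        (forall i x, d i.+1 x = 0 <-> exists y, x = d i y)
      & (forall i, (n < i)%N -> forall x : E i, x = 0)].

End Ideals.

Definition gorenstein (R : comNzRingType) : Prop :=
  noetherian R /\
  forall P, is_prime P ->
    exists (A : comNzRingType) (phi : {rmorphism R -> A}),
      is_localization P phi /\ finite_injective_dimension (A^o : lmodType A).

(* A closed subscheme of P^m is represented by its saturated homogeneous ideal
   in k[x_0, ..., x_m]; its scheme-theoretic points are the homogeneous primes
   that contain the ideal but not all of x_0, ..., x_m. *)
Section ProjectiveSchemes.
Variables (k : closedFieldType) (m : nat).
Local Notation S := {mpoly k[m.+1]}.
Implicit Types (I V X P : S -> Prop) (f g h : S).

Definition is_homogeneous I : Prop :=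
  forall f d, I f -> I (pihomog mdeg d f).

Definition is_saturated I : Prop :=
  forall f, (forall i : 'I_m.+1, exists e : nat, I ('X_i ^+ e * f)) -> I f.

Definition is_subscheme I : Prop :=
  [/\ is_ideal I, is_homogeneous I & is_saturated I].

Definition arithmetically_gorenstein X : Prop :=
  exists (R : comNzRingType) (q : {rmorphism S -> R}),
    [/\ (forall y, exists f, q f = y), (forall f, q f = 0 <-> X f)
      & gorenstein R].

Definition included I V : Prop := forall f, I f -> V f.

Definition is_point P : Prop :=
  [/\ is_prime P, is_homogeneous P & exists i : 'I_m.+1, ~ P 'X_i].

Definition has_chain V (r : nat) : Prop :=
  exists c : nat -> S -> Prop,
    (forall i, (i <= r)%N -> is_point (c i) /\ included V (c i)) /\
    (forall i, (i < r)%N -> included (c i) (c i.+1) /\ ~ included (c i.+1) (c i)).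

Definition has_dim V (r : nat) : Prop := has_chain V r /\ ~ has_chain V r.+1.

(* [is_component V P]: P is the generic point of an irreducible component *)
Definition is_component V P : Prop :=
  [/\ is_point P, included V P
    & forall P', is_point P' -> included V P' -> included P' P -> included P P'].

Definition equidimensional V (r : nat) : Prop :=
  has_dim V r /\ forall P, is_component V P -> has_dim P r.

Definition is_associated V P : Prop :=
  is_point P /\ exists f, forall g, P g <-> V (g * f).

Definition no_embedded_components V : Prop :=
  forall P, is_associated V P -> is_component V P.

(* The nonempty opens D_+(f), for f satisfying [basic], form a basis of the
   topology of P^m, stable under products since D_+(f) /\ D_+(h) = D_+(f * h).
   A sheaf of O-modules is described by its values on this basis: sections over
   D_+(f) are the s such that [is_section f s], taken up to [eqv f], and [res f h]
   restricts them from D_+(f) to D_+(f * h).  Only raw data are recorded. *)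
Definition basic f : Prop := f != 0 /\ exists2 d : nat, (0 < d)%N & f \is d.-homog.

Definition deg f : nat := (msize f).-1.

(* the fraction numer / f ^ expo, where f is known from the context *)
Record frac : Type := Frac { numer : S; expo : nat }.

Record modsheaf : Type := Modsheaf {
  sec : Type;
  is_section : S -> sec -> Prop;
  eqv : S -> sec -> sec -> Prop;
  add : S -> sec -> sec -> sec;
  scale : S -> frac -> sec -> sec;
  res : S -> S -> sec -> sec }.

(* The sheaf associated with the graded module M / N, for homogeneous ideals
   N <= M: its sections over D_+(f) are the elements of degree 0 of (M / N)_f. *)
Definition quot_sheaf (M N : S -> Prop) : modsheaf := {|
  sec := frac;
  is_section f s := M (numer s) /\ numer s \is (expo s * deg f).-homog;
  eqv f s t :=
    exists c : nat, N (f ^+ c * (numer s * f ^+ expo t - numer t * f ^+ expo s));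
  add f s t :=
    Frac (numer s * f ^+ expo t + numer t * f ^+ expo s) (expo s + expo t);
  scale f a s := Frac (numer a * numer s) (expo a + expo s);
  res f h s := Frac (numer s * h ^+ expo s) (expo s) |}.

(* All sheaves are regarded as sheaves of O-modules on P^m (push-forward along
   a closed immersion is fully faithful, and compatible with sheaf Hom). *)
Definition structure_sheaf V : modsheaf := quot_sheaf (fun _ => True) V.
Definition ideal_sheaf V X : modsheaf := quot_sheaf V X.
Definition O_P : modsheaf := structure_sheaf (fun f => f = 0).

(* [is_morphism F G f Phi]: Phi is a morphism of O-modules from F|D_+(f) to
   G|D_+(f), with component [Phi h] over D_+(f * h), for h in the basis (the
   component over D_+(f) itself is [Phi f]); for f = 1 it is a morphism over the
   whole of P^m. *)
Definition is_morphism (F G : modsheaf) f (Phi : S -> sec F -> sec G) : Prop :=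
  forall h, basic h ->
  [/\ (forall s, is_section (f * h) s -> is_section (f * h) (Phi h s)),
      (forall s t, is_section (f * h) s -> is_section (f * h) t ->
         eqv (f * h) s t -> eqv (f * h) (Phi h s) (Phi h t)),
      (forall s t, is_section (f * h) s -> is_section (f * h) t ->
         eqv (f * h) (Phi h (add (f * h) s t))
                     (add (f * h) (Phi h s) (Phi h t))),
      (forall (a : sec O_P) s, is_section (f * h) a -> is_section (f * h) s ->
         eqv (f * h) (Phi h (scale (f * h) a s)) (scale (f * h) a (Phi h s)))
    & (forall g s, basic g -> is_section (f * h) s ->
         eqv (f * h * g) (Phi (h * g) (res (f * h) g s))
                         (res (f * h) g (Phi h s)))].

Definition hom_sheaf (F G : modsheaf) : modsheaf := {|
  sec := S -> sec F -> sec G;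
  is_section f Phi := is_morphism f Phi;
  eqv f Phi Psi :=
    forall h s, basic h -> is_section (f * h) s -> eqv (f * h) (Phi h s) (Psi h s);
  add f Phi Psi := fun h s => add (f * h) (Phi h s) (Psi h s);
  scale f a Phi := fun h s => scale (f * h) (@res O_P f h a) (Phi h s);
  res f g Phi := fun h s => Phi (g * h) s |}.

Definition isomorphic_sheaves (F G : modsheaf) : Prop :=
  exists2 Phi : S -> sec F -> sec G, is_morphism 1 Phi &
    forall h, basic h ->
      (forall s t, is_section h s -> is_section h t ->
         eqv h (Phi h s) (Phi h t) -> eqv h s t)
      /\ (forall t, is_section h t -> exists2 s, is_section h s & eqv h (Phi h s) t).

Definition linked_by X V1 V2 (r : nat) : Prop :=
  [/\ is_subscheme X, arithmetically_gorenstein X & has_dim X r] /\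
  [/\ included X V1, included X V2,
      isomorphic_sheaves (ideal_sheaf V2 X)
        (hom_sheaf (structure_sheaf V1) (structure_sheaf X))
    & isomorphic_sheaves (ideal_sheaf V1 X)
        (hom_sheaf (structure_sheaf V2) (structure_sheaf X))].

Definition g_linked V1 V2 : Prop :=
  exists r : nat,
    [/\ is_subscheme V1, equidimensional V1 r & no_embedded_components V1] /\
    [/\ is_subscheme V2, equidimensional V2 r & no_embedded_components V2] /\
    exists X, linked_by X V1 V2 r.

Definition g_liaison : (S -> Prop) -> (S -> Prop) -> Prop :=
  clos_refl_sym_trans (S -> Prop) g_linked.

Definition complete_intersection V : Prop :=
  is_subscheme V /\
  exists (s : seq S) (r : nat),
    [/\ (forall f, f \in s -> exists d : nat, f \is d.-homog),
        (forall f, V f <-> gen_ideal s f), has_dim V r & (r + size s = m)%N].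

Definition glicci V : Prop :=
  exists2 C, complete_intersection C & g_liaison V C.

Section PointSets.
Variable n : nat.
Local Notation T := {mpoly k[n * m.+1]}.
Implicit Types (p q : 'M[k]_(n, m.+1)).

(* The rows of p are homogeneous coordinates of n points of P^m. *)

(* the saturated homogeneous ideal of the reduced scheme supported at the rows:
   f vanishes there when each of its homogeneous components does *)
Definition points_ideal p : S -> Prop :=
  fun f => forall (i : 'I_n) (d : nat), (pihomog mdeg d f).@[p i] = 0.

Definition distinct_points_on (F : S) p : Prop :=
  (forall i, row i p != 0 /\ F.@[p i] = 0) /\
  (forall i j, i != j -> forall c : k, row i p <> c *: row j p).

Definition multihomogeneous (g : T) : Prop :=
  exists e : 'I_n -> nat, forall u, u \in msupp g ->
    forall i, (\sum_(j < m.+1) u (mxvec_index i j))%N = e i.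

(* Zariski open subsets of (P^m)^n, as predicates on homogeneous coordinates *)
Definition zariski_open (U : 'M[k]_(n, m.+1) -> Prop) : Prop :=
  exists2 G : T -> Prop, (forall g : T, G g -> multihomogeneous g) &
    forall p, U p <-> exists2 g : T, G g & g.@[mxvec p 0] != 0.

(* The reduced sets of n points of {F = 0} are parametrized by the quotient of
   the ordered n-tuples of distinct points by the symmetric group, so its open
   subsets are the symmetric open sets of n-tuples. *)
Definition holds_for_general_point_set (F : S) (Y : (S -> Prop) -> Prop) : Prop :=
  exists U : 'M[k]_(n, m.+1) -> Prop,
    [/\ zariski_open U,
        (forall (s : 'S_n) p,
           distinct_points_on F p -> U p -> U (row_perm s p)),
        (exists2 p, distinct_points_on F p & U p)
      & forall p, distinct_points_on F p -> U p -> Y (points_ideal p)].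

End PointSets.
End ProjectiveSchemes.

(* Jacobian criterion at the closed points of the surface F = 0 in P^3; it
   forces F != 0 *)
Definition smooth_cubic_surface (k : closedFieldType) (F : {mpoly k[4]}) : Prop :=
  F \is 3.-homog /\
  forall v : 'rV[k]_4, v != 0 -> F.@[v 0] = 0 -> exists i, (F^`M(i)).@[v 0] != 0.

(* Main.v *)
Require Import Defs.
From HB Require Import structures.
From mathcomp Require Import all_boot all_order all_fingroup all_algebra mpoly.
From mathcomp Require Import closed_field generic_quotient ring_quotient fraction.
From mathcomp Require Import boolp classical_sets zify ring.

Set Implicit Arguments.
Unset Strict Implicit.
Unset Printing Implicit Defensive.

Import GRing.Theory.
Local Open Scope ring_scope.

(** Why the theorem holds.  Two disjoint sets Z and Q of points are linked as soon as their union is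
    arithmetically Gorenstein, so it suffices to join a general set of n points of the surface to a
    single point by a chain of such unions.

    Gorenstein unions are recognised by dual weights ([gorenstein_weights]): coefficients c_P such that
    c kills the forms of some degree s on the points, while every functional killing the forms of
    degree s - e is c multiplied by a form of degree e.  For a complete intersection of the surface with
    forms of degrees q and a, Koszul cohomology shows that the Artinian quotient by a plane has a socle
    of dimension one, and the functional dual to that socle supplies weights with s = q + a - 1
    ([ci_weights]).  Conversely, weights make the homogeneous coordinate ring of the points Gorenstein
    ([points_ring_gorenstein]).  Inside the product of the function fields of the lines over the points,
    Baer's criterion gives each local ring A the injective resolution 0 -> A -> K -> K / A -> 0; at the
    vertex, the weights provide the self-injectivity of A modulo a power of the parameter that makes
    K / A injective.

    The number of points is changed by a variant of a complete intersection.  Take G of degree q, A of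
    degree m and a linear form lf, let X be cut out by G and A and L by G and lf, and choose e = 1 or 2
    points Y of L, where m + e = q + 1, and n points Z'' of X.  If Z'' and Y satisfy a linear relation on
    the forms of degree q - 1 that involves all points of Y, this relation, divided by the weights of
    X and L together, is the restriction of a form B of degree m + 1 vanishing on the remaining points
    Z' of X and on L - Y.  In the pencil A lf + t B the points of Z'' and Y move to n + e points Zt, while
    Z' and L - Y stay, and the weights survive the removal of L - Y ([moved_weights]): Z' is linked
    both to Z'' and to Zt.  Since the roots of a polynomial system move algebraically ([reduced_ci_open],
    by the traces of commuting multiplication matrices), the sets Zt come arbitrarily close to Z'' and Y
    in the Zariski sense ([near]).

    The required configuration exists on one explicit family: a line meeting the surface in three
    points spreads to a grid of lines, whose intersections with the surface are complete intersections
    of all degrees ([grids]).  Cramer's rule spreads the configuration from there to an open set of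
    n + e points ([near_generic]).  So the sets of n + e points reached by two links from a good
    set of n points, or the converse, are dense; being described by a first-order formula they are
    constructible (elimination of quantifiers), and on the irreducible variety of n-tuples of points of
    the surface a dense constructible set contains a nonempty open one ([generically_dense]).
    With h(q) = (3 q^2 + 3 q + 2) / 2 the Hilbert function of the surface, the step e = 1 covers
    h(q - 1) <= n <= h(q) - 2 upwards and downwards, and e = 2 leads from n = h(q - 1) - 1 to n + 2, so that
    every number of points is reached from one ([general_all]).

    Finally an open condition in the coordinates that is invariant under rescaling each point contains a
    multihomogeneous one ([multihomogeneous_component]). *)

(** * Polynomial functions and constructible sets *)

Section PolynomialFunctions.
Variable k : closedFieldType.

(** Polynomial functions of variables indexed by an arbitrary type: composition
    and finitely many operations stay inside the class without any bookkeeping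
    of the number of variables. *)
Inductive polyfun (I : Type) : ((I -> k) -> k) -> Prop :=
| polyfun_const c : polyfun (fun=> c)
| polyfun_var i : polyfun (fun v => v i)
| polyfun_add f g : polyfun f -> polyfun g -> polyfun (fun v => f v + g v)
| polyfun_mul f g : polyfun f -> polyfun g -> polyfun (fun v => f v * g v).

Lemma polyfun_ext I (f g : (I -> k) -> k) : f =1 g -> polyfun f -> polyfun g.
Proof. by move=> /funext->. Qed.

Lemma polyfun_opp I (f : (I -> k) -> k) : polyfun f -> polyfun (fun v => - f v).
Proof.
move=> pf; apply: (@polyfun_ext _ (fun v => -1 * f v)) => [v|]; first by rewrite mulN1r.
by apply: polyfun_mul => //; exact: polyfun_const.
Qed.

Lemma polyfun_sub I (f g : (I -> k) -> k) :
  polyfun f -> polyfun g -> polyfun (fun v => f v - g v).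
Proof. by move=> pf pg; apply: polyfun_add => //; apply: polyfun_opp. Qed.

Lemma polyfun_sum I T (r : seq T) (P : pred T) (f : T -> (I -> k) -> k) :
  (forall i, polyfun (f i)) -> polyfun (fun v => \sum_(i <- r | P i) f i v).
Proof.
move=> pf; elim: r => [|i r IH].
  by apply: (@polyfun_ext _ (fun=> 0)) => [v|]; [rewrite big_nil | exact: polyfun_const].
apply: (@polyfun_ext _ (fun v => (if P i then f i v else 0) +
                                  \sum_(i <- r | P i) f i v)) => [v|].
  by rewrite big_cons; case: ifP => //; rewrite add0r.
by apply: polyfun_add => //; case: (P i) => //; exact: polyfun_const.
Qed.

Lemma polyfun_prod I T (r : seq T) (P : pred T) (f : T -> (I -> k) -> k) :
  (forall i, polyfun (f i)) -> polyfun (fun v => \prod_(i <- r | P i) f i v).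
Proof.
move=> pf; elim: r => [|i r IH].
  by apply: (@polyfun_ext _ (fun=> 1)) => [v|]; [rewrite big_nil | exact: polyfun_const].
apply: (@polyfun_ext _ (fun v => (if P i then f i v else 1) *
                                  \prod_(i <- r | P i) f i v)) => [v|].
  by rewrite big_cons; case: ifP => //; rewrite mul1r.
by apply: polyfun_mul => //; case: (P i) => //; exact: polyfun_const.
Qed.

Lemma polyfun_exp I (f : (I -> k) -> k) n : polyfun f -> polyfun (fun v => f v ^+ n).
Proof.
move=> pf; elim: n => [|n IH].
  by apply: (@polyfun_ext _ (fun=> 1)) => [v|]; rewrite ?expr0; last exact: polyfun_const.
by apply: (@polyfun_ext _ (fun v => f v * f v ^+ n)) => [v|]; [rewrite exprS | apply: polyfun_mul].
Qed.

Lemma polyfun_comp I J (f : (J -> k) -> k) (g : J -> (I -> k) -> k) :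
  polyfun f -> (forall j, polyfun (g j)) -> polyfun (fun v => f (fun j => g j v)).
Proof.
by move=> pf pg; elim: pf; intros; [exact: polyfun_const | apply: pg
  | apply: polyfun_add | apply: polyfun_mul].
Qed.

Lemma polyfun_meval I n (f : {mpoly k[n]}) (g : 'I_n -> (I -> k) -> k) :
  (forall j, polyfun (g j)) -> polyfun (fun v => f.@[fun j => g j v]).
Proof.
move=> pg; apply: (@polyfun_ext _ (fun v =>
  \sum_(m <- msupp f) f@_m * \prod_i (g i v) ^+ m i)) => [v|]; first by rewrite mevalE.
apply: polyfun_sum => m; apply: polyfun_mul; first exact: polyfun_const.
by apply: polyfun_prod => i; apply: polyfun_exp.
Qed.

Lemma polyfun_det I n (f : 'I_n -> 'I_n -> (I -> k) -> k) :
  (forall i j, polyfun (f i j)) -> polyfun (fun v => \det (\matrix_(i, j) f i j v)).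
Proof.
move=> pf; apply: (@polyfun_ext _ (fun v => \sum_(s : 'S_n) (-1) ^+ s * \prod_i f i (s i) v)).
  by move=> v; apply: eq_bigr => s _; congr (_ * _); apply: eq_bigr => i _; rewrite mxE.
apply: polyfun_sum => s; apply: polyfun_mul; first exact: polyfun_const.
exact: polyfun_prod.
Qed.

Lemma polyfun_mpoly n (f : ('I_n -> k) -> k) :
  polyfun f -> exists g : {mpoly k[n]}, forall v, f v = g.@[v].
Proof.
elim=> [c|i|f1 f2 _ [g1 e1] _ [g2 e2]|f1 f2 _ [g1 e1] _ [g2 e2]].
- by exists c%:MP => v; rewrite mevalC.
- by exists 'X_i => v; rewrite mevalXU.
- by exists (g1 + g2) => v; rewrite mevalD e1 e2.
- by exists (g1 * g2) => v; rewrite mevalM e1 e2.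
Qed.

Lemma polyfun_curve I (f : (I -> k) -> k) (u : I -> {poly k}) :
  polyfun f -> exists p : {poly k}, forall t, f (fun i => (u i).[t]) = p.[t].
Proof.
elim=> [c|i|f1 f2 _ [g1 e1] _ [g2 e2]|f1 f2 _ [g1 e1] _ [g2 e2]].
- by exists c%:P => t; rewrite hornerC.
- by exists (u i).
- by exists (g1 + g2) => t; rewrite hornerD e1 e2.
- by exists (g1 * g2) => t; rewrite hornerM e1 e2.
Qed.

Lemma poly_nonroot (p : {poly k}) : p != 0 -> exists x, p.[x] != 0.
Proof.
move=> p0; have [x] := closed_nonrootP p p0.
by rewrite rootE; exists x.
Qed.

Lemma polyfun_curve_nonroot I (f : (I -> k) -> k) (u : I -> {poly k}) t0 (r : seq k) :
  polyfun f -> f (fun i => (u i).[t0]) != 0 ->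
  exists2 t, t \notin r & f (fun i => (u i).[t]) != 0.
Proof.
move=> /(polyfun_curve u)[p pE]; rewrite pE => p0.
have nz : p * \prod_(a <- r) ('X - a%:P) != 0.
  rewrite mulf_neq0 //; first by apply: contraNneq p0 => ->; rewrite horner0.
  by rewrite monic_neq0 // monic_prod_XsubC.
have [t] := poly_nonroot nz; rewrite hornerM mulf_eq0 => /norP[pt rt].
exists t; last by rewrite pE.
by apply: contra rt; rewrite -root_prod_XsubC rootE.
Qed.

(** ** Constructible sets *)

Inductive constructible (I : Type) : ((I -> k) -> Prop) -> Prop :=
| constr_eq f : polyfun f -> constructible (fun v => f v = 0)
| constr_and D1 D2 : constructible D1 -> constructible D2 ->
    constructible (fun v => D1 v /\ D2 v)
| constr_not D : constructible D -> constructible (fun v => ~ D v).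

Lemma constr_ext I (D1 D2 : (I -> k) -> Prop) :
  (forall v, D1 v <-> D2 v) -> constructible D1 -> constructible D2.
Proof. by move=> e; suff -> : D1 = D2 by []; apply/funext => v; apply/propext. Qed.

Lemma constr_or I (D1 D2 : (I -> k) -> Prop) :
  constructible D1 -> constructible D2 -> constructible (fun v => D1 v \/ D2 v).
Proof.
move=> c1 c2; apply: (@constr_ext _ (fun v => ~ (~ D1 v /\ ~ D2 v))).
  move=> v; split; last by case=> h [].
  by move=> h; apply: contrapT => h'; apply: h; split => h''; apply: h'; [left|right].
by apply: constr_not; apply: constr_and; apply: constr_not.
Qed.

Lemma constr_imp I (D1 D2 : (I -> k) -> Prop) :
  constructible D1 -> constructible D2 -> constructible (fun v => D1 v -> D2 v).
Proof.
move=> c1 c2; apply: (@constr_ext _ (fun v => ~ D1 v \/ D2 v)).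
  move=> v; split; first by case.
  by move=> h; case: (pselect (D1 v)) => h1; [right; apply: h | left].
by apply: constr_or => //; apply: constr_not.
Qed.

Lemma constr_true I : constructible (fun _ : I -> k => True).
Proof.
apply: (@constr_ext _ (fun _ : I -> k => 0 = 0 :> k)) => //.
by apply: constr_eq; exact: polyfun_const.
Qed.

Lemma constr_const I (P : Prop) : constructible (fun _ : I -> k => P).
Proof.
case: (pselect P) => h.
  by apply: (constr_ext _ (constr_true I)).
by apply: (constr_ext _ (constr_not (constr_true I))) => v; split.
Qed.

Lemma constr_neq I (f : (I -> k) -> k) : polyfun f -> constructible (fun v => f v != 0).
Proof.
move=> pf; apply: (@constr_ext _ (fun v => ~ f v = 0)); last by apply/constr_not/constr_eq.
by move=> v; split=> /eqP.
Qed.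

Lemma constr_forall I (T : finType) (D : T -> (I -> k) -> Prop) :
  (forall t, constructible (D t)) -> constructible (fun v => forall t, D t v).
Proof.
move=> cD.
have: constructible (fun v => forall t, t \in enum T -> D t v).
  elim: (enum T) => [|t s IH].
    by apply: (constr_ext _ (constr_true I)).
  apply: (constr_ext _ (constr_and (cD t) IH)) => v; split.
    by case=> h1 h2 u; rewrite inE => /orP[/eqP->|/h2].
  by move=> h; split; [apply: h; rewrite inE eqxx | move=> u us; apply: h; rewrite inE us orbT].
by apply: constr_ext => v; split=> h t; [apply: h; rewrite mem_enum | move=> _; apply: h].
Qed.

Lemma constr_comp I J (D : (J -> k) -> Prop) (g : J -> (I -> k) -> k) :
  (forall j, polyfun (g j)) -> constructible D -> constructible (fun v => D (fun j => g j v)).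
Proof.
move=> pg; elim=> [f pf|D1 D2 _ c1 _ c2|D' _ c].
- by apply: constr_eq; apply: polyfun_comp.
- exact: constr_and.
- exact: constr_not.
Qed.

(** Projection along one variable, by elimination of an existential quantifier. *)
Section Projection.

Lemma polyfun_term J (idx : J -> nat) (f : (J -> k) -> k) : polyfun f ->
  exists2 t : GRing.term k, GRing.rterm t &
    forall e, GRing.eval e t = f (fun j => nth 0 e (idx j)).
Proof.
elim=> [c|i|f1 f2 _ [t1 r1 e1] _ [t2 r2 e2]|f1 f2 _ [t1 r1 e1] _ [t2 r2 e2]].
- by exists (GRing.Const c).
- by exists (GRing.Var k (idx i)).
- by exists (GRing.Add t1 t2) => [|e] /=; rewrite ?r1 ?e1 ?e2.
- by exists (GRing.Mul t1 t2) => [|e] /=; rewrite ?r1 ?e1 ?e2.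
Qed.

Lemma constr_formula J (idx : J -> nat) (D : (J -> k) -> Prop) : constructible D ->
  exists2 f : GRing.formula k, GRing.rformula f &
    forall e, GRing.holds e f <-> D (fun j => nth 0 e (idx j)).
Proof.
elim=> [f /(polyfun_term idx)[t rt et]|D1 D2 _ [f1 r1 e1] _ [f2 r2 e2]|D' _ [f r e]].
- by exists (GRing.Equal t (GRing.Const 0)) => [|e] /=; rewrite ?rt ?et.
- by exists (GRing.And f1 f2) => [|e] /=; rewrite ?r1 // e1 e2.
- by exists (GRing.Not f) => [|e'] //=; rewrite e.
Qed.

Lemma qf_constr I (e : (I -> k) -> seq k) (f : GRing.formula k) :
  (forall n, polyfun (fun v => nth 0 (e v) n)) ->
  GRing.qf_form f && GRing.rformula f -> constructible (fun v => GRing.qf_eval (e v) f).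
Proof.
move=> pe.
have pt t : GRing.rterm t -> polyfun (fun v => GRing.eval (e v) t).
  elim: t => /=.
  - by move=> n _; apply: pe.
  - by move=> c _; exact: polyfun_const.
  - by move=> n _; exact: polyfun_const.
  - by move=> t1 IH1 t2 IH2 /andP[/IH1 ? /IH2 ?]; apply: polyfun_add.
  - by move=> t IH /IH ?; apply: polyfun_opp.
  - move=> t IH n /IH ?.
    apply: (@polyfun_ext _ (fun v => n%:R * GRing.eval (e v) t)) => [v|].
      by rewrite mulr_natl.
    by apply: polyfun_mul => //; exact: polyfun_const.
  - by move=> t1 IH1 t2 IH2 /andP[/IH1 ? /IH2 ?]; apply: polyfun_mul.
  - by [].
  - by move=> t IH n /IH ?; apply: polyfun_exp.
elim: f => //=.
- by move=> b _; apply: constr_const.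
- move=> t1 t2 /andP[/pt p1 /pt p2].
  apply: (constr_ext _ (constr_eq (polyfun_sub p1 p2))) => v.
  by split=> [/eqP|/eqP ->]; [rewrite subr_eq0 | rewrite subrr].
- move=> f1 IH1 f2 IH2 /andP[/andP[q1 q2] /andP[r1 r2]].
  apply: (constr_ext _ (constr_and (IH1 _) (IH2 _))); rewrite ?q1 ?q2 // => v.
  by split=> [[-> ->]|/andP].
- move=> f1 IH1 f2 IH2 /andP[/andP[q1 q2] /andP[r1 r2]].
  apply: (constr_ext _ (constr_or (IH1 _) (IH2 _))); rewrite ?q1 ?q2 // => v.
  by split=> [[->|->]|/orP] //; rewrite orbT.
- move=> f1 IH1 f2 IH2 /andP[/andP[q1 q2] /andP[r1 r2]].
  apply: (constr_ext _ (constr_imp (IH1 _) (IH2 _))); rewrite ?q1 ?q2 // => v.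
  by split=> /implyP.
- move=> f IH /IH c.
  by apply: (constr_ext _ (constr_not c)) => v; split=> /negP.
Qed.

Definition extend_var I (v : I -> k) (x : k) (o : option I) : k :=
  if o is Some i then v i else x.

Lemma constr_ex1 (I : finType) (D : (option I -> k) -> Prop) :
  constructible D -> constructible (fun v : I -> k => exists x, D (extend_var v x)).
Proof.
pose idx (o : option I) := if o is Some i then (enum_rank i).+1 else 0%N.
move=> /(constr_formula idx)[f rf fE].
pose e (v : I -> k) := 0 :: [seq v i | i <- enum I].
pose g := GRing.quantifier_elim (@ClosedFieldQE.ex_elim k) (GRing.Exists 0 f).
have wf := @ClosedFieldQE.wf_ex_elim k.
have ok := @ClosedFieldQE.holds_ex_elim k (@solve_monicpoly k).
have nth_e v i : nth 0 (e v) (enum_rank i).+1 = v i.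
  by rewrite /= (nth_map i) ?nth_enum_rank // -cardE.
have /(constr_ext _) : constructible (fun v => GRing.qf_eval (e v) g).
  apply: qf_constr; last by apply: (GRing.quantifier_elim_wf wf).
  case=> [|n] /=; first exact: polyfun_const.
  have [ltn|len] := ltnP n #|I|; last first.
    apply: (@polyfun_ext _ (fun=> 0)) => [v|]; last exact: polyfun_const.
    by rewrite nth_default // size_map -cardE.
  apply: (@polyfun_ext _ (fun v => v (enum_val (Ordinal ltn)))) => [v|]; last exact: polyfun_var.
  by rewrite -nth_e /= enum_valK.
apply=> v; rewrite -(rwP (GRing.quantifier_elim_rformP wf ok (e v) (f := GRing.Exists 0 f) rf)) /=.
have E x : (fun j : option I => nth 0 (x :: [seq v i | i <- enum I]) (idx j)) = extend_var v x.
  by apply/funext => -[i|] //=; rewrite -[RHS]nth_e.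
by split=> -[x]; [move=> /fE /= | move=> Dx]; exists x; [rewrite -E | apply/fE; rewrite /= E].
Qed.

End Projection.

Definition glue I J (v : I -> k) (w : J -> k) (s : I + J) : k :=
  match s with inl i => v i | inr j => w j end.

Lemma constr_ex_ord r (I : finType) (D : (I + 'I_r -> k) -> Prop) :
  constructible D -> constructible (fun v => exists w, D (glue v w)).
Proof.
elim: r I D => [|r IH] I D cD.
  apply: (@constr_ext _ (fun v => D (glue v (fun=> 0)))).
    move=> v; split=> [h|[w]]; first by exists (fun=> 0).
    by congr (D (glue v _)); apply/funext => -[].
  apply: (@constr_comp _ _ D (fun s v => glue v (fun=> 0) s)) => // -[i|j] /=.
    exact: polyfun_var.
  exact: polyfun_const.
pose D' (u : option I + 'I_r -> k) := D (fun s => match s with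
  | inl i => u (inl (Some i))
  | inr j => if unlift ord0 j is Some j' then u (inr j') else u (inl None) end).
have cD' : constructible D'.
  apply: (constr_comp (g := fun s u => _) _ cD) => -[i|j]; first exact: polyfun_var.
  by case: (unlift _ _) => [j'|]; apply: polyfun_var.
apply: (constr_ext _ (constr_ex1 (IH _ _ cD'))) => v; split.
  move=> [x [w]]; rewrite /D' => h; exists (fun j => if unlift ord0 j is Some j' then w j' else x).
  by congr D : h; apply/funext => -[i|j] //=; case: (unlift _ _).
move=> [w h]; exists (w ord0), (fun j => w (lift ord0 j)); congr D : h.
by apply/funext => -[i|j] //=; case: unliftP => [j'|] ->.
Qed.

Lemma constr_ex (I J : finType) (D : (I -> k) -> (J -> k) -> Prop) :
  constructible (fun u : I + J -> k => D (fun i => u (inl i)) (fun j => u (inr j))) ->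
  constructible (fun v => exists w, D v w).
Proof.
move=> cD.
have cD' : constructible (fun u : I + 'I_#|J| -> k =>
    D (fun i => u (inl i)) (fun j => u (inr (enum_rank j)))).
  apply: (constr_comp (g := fun s u => match s with inl i => u (inl i)
    | inr j => u (inr (enum_rank j)) end) _ cD) => -[i|j]; exact: polyfun_var.
apply: (constr_ext _ (constr_ex_ord cD')) => v; split=> -[w h] /=.
  by exists (fun j => w (enum_rank j)).
exists (fun j => w (enum_val j)); rewrite /=.
by congr (D v) : h; apply/funext => j; rewrite enum_rankK.
Qed.

Lemma constr_all (I J : finType) (D : (I -> k) -> (J -> k) -> Prop) :
  constructible (fun u : I + J -> k => D (fun i => u (inl i)) (fun j => u (inr j))) ->
  constructible (fun v => forall w, D v w).
Proof.
move=> cD; apply: (@constr_ext _ (fun v => ~ exists w, ~ D v w)).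
  move=> v; split; last by move=> h [w]; apply.
  by move=> h w; apply: contrapT => h'; apply: h; exists w.
by apply: constr_not; apply: constr_ex; apply: constr_not.
Qed.

(** ** Generic truth on an irreducible set *)

(** Irreducibility of the closure of X, in terms of functions only. *)
Definition irreducible_set I (X : (I -> k) -> Prop) : Prop :=
  forall f g, polyfun f -> polyfun g ->
  (exists2 v, X v & f v != 0) -> (exists2 v, X v & g v != 0) ->
  exists2 v, X v & f v * g v != 0.

Definition generically I (X D : (I -> k) -> Prop) : Prop :=
  exists f, [/\ polyfun f, (exists2 v, X v & f v != 0)
    & forall v, X v -> f v != 0 -> D v].

Lemma generically_and I (X D1 D2 : (I -> k) -> Prop) : irreducible_set X ->
  generically X D1 -> generically X D2 -> generically X (fun v => D1 v /\ D2 v).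
Proof.
move=> irr [f [pf nf hf]] [g [pg ng hg]]; exists (fun v => f v * g v); split.
- exact: polyfun_mul.
- exact: irr.
- by move=> v Xv; rewrite mulf_eq0 => /norP[/(hf v Xv) ? /(hg v Xv) ?].
Qed.

Lemma generically_imp I (X D1 D2 : (I -> k) -> Prop) :
  (forall v, X v -> D1 v -> D2 v) -> generically X D1 -> generically X D2.
Proof. by move=> h [f [pf nf hf]]; exists f; split=> // v Xv /hf/h; apply. Qed.

Lemma generically_ex I (X D : (I -> k) -> Prop) :
  generically X D -> exists2 v, X v & D v.
Proof. by move=> [f [_ [v Xv nf] hf]]; exists v => //; apply: hf. Qed.

(** The 0-1 law: on an irreducible set, a constructible condition holds
    generically or fails generically, so a dense one holds generically. *)
Lemma constructible_01 I (X D : (I -> k) -> Prop) : irreducible_set X ->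
  (exists v, X v) -> constructible D -> generically X D \/ generically X (fun v => ~ D v).
Proof.
move=> irr [v0 X0].
have all (D' : (I -> k) -> Prop) : (forall v, X v -> D' v) -> generically X D'.
  move=> h; exists (fun=> 1); split; [exact: polyfun_const | | by move=> v /h].
  by exists v0; rewrite ?oner_neq0.
elim=> [f pf|D1 D2 _ c1 _ c2|D' _ [c|c]].
- case: (pselect (exists2 v, X v & f v != 0)) => h.
    by right; exists f; split=> // v _ /eqP.
  left; apply: all => v Xv; apply/eqP; apply: contrapT => fv; apply: h.
  by exists v => //; apply/negP.
- case: c1 => [c1|c1]; last by right; apply: generically_imp c1 => v _ h [].
  case: c2 => [c2|c2]; last by right; apply: generically_imp c2 => v _ h [].
  by left; apply: generically_and.
- by right; apply: generically_imp c => v _ h; apply.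
- by left.
Qed.

Lemma generically_dense I (X D : (I -> k) -> Prop) : irreducible_set X ->
  (exists v, X v) -> constructible D ->
  (forall f, polyfun f -> (exists2 v, X v & f v != 0) -> exists v, [/\ X v, f v != 0 & D v]) ->
  generically X D.
Proof.
move=> irr X0 /(constructible_01 irr X0)[//|[f [pf nf hf]]] dense.
by have [v [Xv fv Dv]] := dense f pf nf; have := hf v Xv fv.
Qed.

End PolynomialFunctions.

(** * Evaluation of multivariate polynomials *)

Section MPolyTools.

Lemma rmorph_mmap n (R : nzRingType) (A B : comNzRingType) (phi : {rmorphism A -> B})
    (g : R -> A) (h : 'I_n -> A) (f : {mpoly R[n]}) :
  phi (mmap g h f) = mmap (phi \o g) (phi \o h) f.
Proof.
rewrite /mmap rmorph_sum; apply: eq_bigr => m _; rewrite rmorphM; congr (_ * _).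
by rewrite /mmap1 rmorph_prod; apply: eq_bigr => i _; rewrite rmorphXn.
Qed.

Lemma eq_mmap n (R : nzRingType) (A : nzRingType) (g1 g2 : R -> A) (h1 h2 : 'I_n -> A)
    (f : {mpoly R[n]}) : g1 =1 g2 -> h1 =1 h2 -> mmap g1 h1 f = mmap g2 h2 f.
Proof.
by move=> eg eh; apply: eq_bigr => m _; rewrite eg; congr (_ * _); apply: mmap1_eq.
Qed.

Lemma mmap_homog n (R : nzRingType) (A : comNzRingType) (g : R -> A) (h : 'I_n -> A)
    (f : {mpoly R[n]}) d (c : A) : f \is d.-homog ->
  mmap g (fun i => c * h i) f = c ^+ d * mmap g h f.
Proof.
move=> /dhomogP hf; rewrite /mmap mulr_sumr big_seq [RHS]big_seq.
apply: eq_bigr => m /hf md; rewrite mulrCA; congr (_ * _).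
rewrite /mmap1 (eq_bigr (fun i => c ^+ m i * h i ^+ m i)); last by move=> i _; rewrite exprMn.
rewrite big_split /= prodrXr -md; congr (_ ^+ _ * _); exact/esym/mdegE.
Qed.

Lemma meval_homog n (R : comNzRingType) (f : {mpoly R[n]}) d (c : R) (v : 'I_n -> R) :
  f \is d.-homog -> f.@[fun i => c * v i] = c ^+ d * f.@[v].
Proof. exact: mmap_homog. Qed.

Lemma mmap_congr n (R : nzRingType) (A : comNzRingType) (g : R -> A) (h1 h2 : 'I_n -> A)
    (f : {mpoly R[n]}) (r : A) : (forall i, exists c, h1 i - h2 i = r * c) ->
  exists c, mmap g h1 f - mmap g h2 f = r * c.
Proof.
pose cg x y := exists c, x - y = r * c.
have cgM a b a' b' : cg a b -> cg a' b' -> cg (a * a') (b * b').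
  move=> [c e] [c' e']; exists (a * c' + c * b').
  have -> : a = b + r * c by rewrite -e addrC subrK.
  have -> : a' = b' + r * c' by rewrite -e' addrC subrK.
  by ring.
move=> H; have c0 a : cg a a by exists 0; rewrite mulr0 subrr.
have cgX a b j : cg a b -> cg (a ^+ j) (b ^+ j).
  by move=> ab; elim: j => [|j IH]; rewrite ?expr0 // !exprS; apply: cgM.
rewrite /mmap -sumrB.
have : forall m, cg (mmap1 h1 m) (mmap1 h2 m).
  move=> m; rewrite /mmap1; elim/big_rec2: _ => // i x y _ xy.
  by apply: cgM => //; apply: cgX; apply: H.
move=> Hm; elim/big_rec: _ => [|m x _ [c ->]]; first by exists 0; rewrite mulr0.
have [c' e'] := cgM _ _ _ _ (c0 (g f@_m)) (Hm m).
by exists (c' + c); rewrite e' mulrDr.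
Qed.

End MPolyTools.

Section Homogeneous.
Variables (n : nat) (R : comNzRingType).
Implicit Types (f l : {mpoly R[n]}).

Lemma pihomogM b d l f : l \is b.-homog -> pihomog mdeg (b + d) (l * f) = l * pihomog mdeg d f.
Proof.
move=> hl; rewrite {1}(pihomog_partitionE (leqnn (mmeasure mdeg f))).
rewrite [in RHS](pihomog_partitionE (leqnn (mmeasure mdeg f))).
rewrite mulr_sumr !linear_sum mulr_sumr /=; apply: eq_bigr => i _.
have h := dhomogM hl (pihomogP mdeg i f).
have [e|ne] := eqVneq (i : nat) d; first by rewrite -e pihomog_id pihomog_dE.
rewrite (pihomog_ne0 _ h) ?eqn_add2l //; first by rewrite (pihomog_ne0 ne) ?mulr0 ?pihomogP.
Qed.

Lemma pihomogM_small b d l f : l \is b.-homog -> (d < b)%N -> pihomog mdeg d (l * f) = 0.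
Proof.
move=> hl lt; rewrite (pihomog_partitionE (leqnn (mmeasure mdeg f))).
rewrite mulr_sumr linear_sum big1 //= => i _.
have h := dhomogM hl (pihomogP mdeg i f).
by rewrite (pihomog_ne0 _ h) // gtn_eqF // ltn_addr.
Qed.

(** Homogeneous of degree d - b, with only 0 in negative degrees. *)
Definition homog_sub d b f : bool := if (b <= d)%N then f \is (d - b).-homog else f == 0.

Lemma homog_dvd b d (l f c : {mpoly R[n]}) : l \is b.-homog -> f \is d.-homog -> f = l * c ->
  exists2 c', f = l * c' & homog_sub d b c'.
Proof.
move=> hl hf e; rewrite /homog_sub; case: leqP => bd.
  exists (pihomog mdeg (d - b) c); last exact: pihomogP.
  by rewrite -(pihomogM _ _ hl) subnKC // -e pihomog_dE.
by exists 0 => //; rewrite mulr0 -(pihomog_dE hf) e (pihomogM_small _ hl).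
Qed.

End Homogeneous.

Section Vanishing.
Variables (k : closedFieldType) (n : nat).
Implicit Types (f : {mpoly k[n]}).

Lemma base_inj (B r : nat) (m1 m2 : 'I_r -> nat) :
  (forall i, (m1 i < B)%N) -> (forall i, (m2 i < B)%N) ->
  (\sum_i m1 i * B ^ i = \sum_i m2 i * B ^ i)%N -> m1 =1 m2.
Proof.
elim: r m1 m2 => [|r IH] m1 m2 h1 h2; first by move=> _ [].
have step (m : 'I_r.+1 -> nat) :
    (\sum_i m i * B ^ i = m ord0 + B * \sum_(i < r) m (lift ord0 i) * B ^ i)%N.
  rewrite big_ord_recl /= expn0 muln1 big_distrr /=; congr (_ + _)%N.
  by apply: eq_bigr => i _; rewrite /bump /= add1n expnS mulnCA.
rewrite !step => e.
have B0 : (0 < B)%N by apply: leq_ltn_trans (h1 ord0).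
have e0 : m1 ord0 = m2 ord0.
  have := congr1 (modn^~ B) e.
  by rewrite /= ![(_ + B * _)%N]addnC ![(B * _)%N]mulnC !modnMDl !modn_small.
move/eqP: e; rewrite e0 eqn_add2l eqn_pmul2l // => /eqP e.
have := IH (fun i => m1 (lift ord0 i)) (fun i => m2 (lift ord0 i)) (fun i => h1 _) (fun i => h2 _) e.
by move=> h i; case: (unliftP ord0 i) => [j ->|->].
Qed.

(* Kronecker's substitution of powers of one variable reduces this to
   univariate polynomials *)
Lemma mpoly_nonroot f : f != 0 -> exists v, f.@[v] != 0.
Proof.
move=> f0; pose B := msize f.
pose u (i : 'I_n) : {poly k} := 'X^(B ^ i).
pose kap (m : 'X_{1..n}) := (\sum_i m i * B ^ i)%N.
pose p : {poly k} := \sum_(m <- msupp f) f@_m *: 'X^(kap m).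
have pE t : p.[t] = f.@[fun i => (u i).[t]].
  rewrite mevalE /p horner_sum; apply: eq_bigr => m _.
  rewrite hornerZ hornerXn; congr (_ * _).
  rewrite /kap; transitivity (\prod_i t ^+ (m i * B ^ i)).
    by rewrite prodrXr.
  by apply: eq_bigr => i _; rewrite hornerXn mulnC exprM.
suff /poly_nonroot[t] : p != 0 by rewrite pE; exists (fun i => (u i).[t]).
have m0 := mlead_supp f0; set m := mlead f in m0.
have : p`_(kap m) != 0; last by apply: contraNneq => ->; rewrite coef0.
rewrite /p coef_sum (bigD1_seq m) ?msupp_uniq //= coefZ coefXn eqxx mulr1.
rewrite big_seq_cond big1 ?addr0 ?mcoeff_eq0 ?negbK // => m' /andP[m's ne].
rewrite coefZ coefXn; case: eqP => [e|]; last by rewrite mulr0.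
have lt m'' : m'' \in msupp f -> forall i, (m'' i < B)%N.
  move=> /msize_mdeg_lt lt i; apply: leq_ltn_trans lt.
  by rewrite mdegE (bigD1 i) //= leq_addr.
case/eqP: ne; apply/mnmP; apply: (base_inj (lt _ m's) (lt _ m0)).
exact: (esym e).
Qed.

Lemma mpoly_fun0 f : (forall v, f.@[v] = 0) -> f = 0.
Proof.
by move=> f0; apply/eqP; apply: contrapT => /negP /mpoly_nonroot[v]; rewrite f0 eqxx.
Qed.

(** ** Restriction to lines *)

Definition line_poly (v w : 'I_n -> k) f : {poly k} :=
  locked (mmap polyC (fun i => (v i)%:P + w i *: 'X) f).

Lemma line_polyE v w f : line_poly v w f = mmap polyC (fun i => (v i)%:P + w i *: 'X) f.
Proof. by rewrite /line_poly -lock. Qed.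

Lemma line_polyM v w f g : line_poly v w (f * g) = line_poly v w f * line_poly v w g.
Proof. by rewrite !line_polyE rmorphM. Qed.

Lemma horner_line v w f t : (line_poly v w f).[t] = f.@[fun i => v i + w i * t].
Proof.
rewrite line_polyE -horner_evalE rmorph_mmap; apply: eq_mmap => i /=.
  by rewrite horner_evalE hornerC.
by rewrite horner_evalE hornerD hornerC hornerZ hornerX.
Qed.

(** The same, for the line through the generic point. *)
Definition shift_poly (e : 'I_n -> k) f : {poly {mpoly k[n]}} :=
  locked (mmap (@polyC _ \o @mpolyC n k) (fun i => ('X_i)%:P + (e i)%:MP *: 'X) f).

Lemma shift_polyE e f : shift_poly e f =
  mmap (@polyC _ \o @mpolyC n k) (fun i => ('X_i)%:P + (e i)%:MP *: 'X) f.
Proof. by rewrite /shift_poly -lock. Qed.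

Lemma shift_polyM e f g : shift_poly e (f * g) = shift_poly e f * shift_poly e g.
Proof. by rewrite !shift_polyE rmorphM. Qed.

Lemma map_shift_poly v e f : map_poly (meval v) (shift_poly e f) = line_poly v e f.
Proof.
rewrite shift_polyE line_polyE rmorph_mmap; apply: eq_mmap => i /=; first by rewrite map_polyC /= mevalC.
by rewrite rmorphD /= map_polyC /= mevalXU map_polyZ map_polyX /= mevalC.
Qed.

Lemma shift_poly0 e f : (shift_poly e f).[0] = f.
Proof.
rewrite shift_polyE -horner_evalE rmorph_mmap -[RHS]comp_mpoly_id; apply: eq_mmap => i /=.
  by rewrite horner_evalE hornerC.
by rewrite horner_evalE hornerD hornerC hornerZ hornerX mulr0 addr0 tnth_mktuple.
Qed.

Lemma shift_coef0 e f : (shift_poly e f)`_0 = f.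
Proof. by have := shift_poly0 e f; rewrite horner_coef0. Qed.

Definition top_coef (p : {poly {mpoly k[n]}}) d c := (size p <= d.+1)%N /\ p`_d = c.

Lemma top_coefM p q a b c c' : top_coef p a c -> top_coef q b c' ->
  top_coef (p * q) (a + b) (c * c').
Proof.
move=> [sp <-] [sq <-]; split.
  apply: leq_trans (size_polyMleq _ _) _.
  rewrite -ltnS; case: (size p + size q)%N (leq_add sp sq) => //= s.
  by rewrite addSn addnS.
have lt : (a < (a + b).+1)%N by rewrite ltnS leq_addr.
rewrite coefM (bigD1 (Ordinal lt)) //= addKn big1 ?addr0 // => i ne.
have [lti|gei] := ltnP i a.
  by rewrite [q`__]nth_default ?mulr0 // (leq_trans sq) // ltn_subRL ltn_add2r.
rewrite nth_default ?mul0r // (leq_trans sp) // ltn_neqAle gei andbT eq_sym.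
by apply: contra ne => /eqP e; apply/eqP/val_inj.
Qed.

Lemma top_coef_mmap1 e (m : 'X_{1..n}) :
  top_coef (mmap1 (fun i => ('X_i)%:P + (e i)%:MP *: 'X) m) (mdeg m) (\prod_i e i ^+ m i)%:MP.
Proof.
rewrite /mmap1 mdegE rmorph_prod /=.
elim: (index_enum _) => [|i r IH].
  by rewrite !big_nil; split; rewrite ?size_poly1 // coef1.
rewrite !big_cons; apply: top_coefM => //; elim: (m i) => [|j IHj].
  by rewrite !expr0; split; rewrite ?size_poly1 // coef1.
rewrite !exprS rmorphM /= -add1n; apply: top_coefM => //; split.
  apply: leq_trans (size_polyD _ _) _; rewrite geq_max (leq_trans (size_polyC_leq1 _)) //=.
  by apply: leq_trans (size_scale_leq _ _) _; rewrite size_polyX.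
by rewrite coefD coefC coefZ coefX /= add0r mulr1.
Qed.

Lemma top_coef_shift e f d : (msize f <= d.+1)%N ->
  top_coef (shift_poly e f) d ((pihomog mdeg d f).@[e])%:MP.
Proof.
move=> sf; rewrite shift_polyE /mmap pihomogE (big_morph (meval e) (mevalD e) (meval0 e)) (big_morph _ (@mpolyCD n k) (mpolyC0 _ _)) /=.
rewrite [in X in top_coef _ _ X]big_mkcond /=.
have : forall m, m \in msupp f -> (mdeg m <= d)%N.
  by move=> m /msize_mdeg_lt lt; rewrite -ltnS (leq_trans lt).
elim: (msupp f) => [|m r IH] H.
  by rewrite !big_nil; split; rewrite ?size_poly0 // coef0.
rewrite !big_cons.
have [s1 c1] : top_coef (\sum_(i <- r) (f@_i)%:MP%:P *
    mmap1 (fun i0 : 'I_n => ('X_i0)%:P + (e i0)%:MP *: 'X) i) d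
   (\sum_(i <- r) (if mdeg i == d then ((f@_i *: 'X_[i]).@[e])%:MP else 0)).
  by apply: IH => m' m'r; apply: H; rewrite inE m'r orbT.
have [s2 c2] := top_coef_mmap1 e m.
have le : (mdeg m <= d)%N by apply: H; rewrite inE eqxx.
split.
  apply: leq_trans (size_polyD _ _) _; rewrite geq_max s1 andbT.
  by rewrite mul_polyC (leq_trans (size_scale_leq _ _)) // (leq_trans s2).
rewrite coefD c1; congr (_ + _); rewrite coefCM.
case: eqP => [<-|ne]; first by rewrite c2 mevalZ mevalX rmorphM.
by rewrite nth_default ?mulr0 // (leq_trans s2) // ltn_neqAle le andbT; apply/eqP.
Qed.

End Vanishing.

(** * Irreducibility of a smooth cubic surface *)

Lemma frac_repr (R : idomainType) (x : {fraction R}) :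
  exists n d, d != 0 /\ x * tofrac d = tofrac n.
Proof.
elim/quotW: x => r; exists (\n_r), (\d_r); split; first exact: denom_ratioP.
unlock tofrac; rewrite -[LHS]/(FracField.mul _ _) !piE.
apply/eqmodP => /=; rewrite /FracField.equivf /FracField.mulf /=.
rewrite !numden_Ratio ?mulf_neq0 ?oner_neq0 ?denom_ratioP //.
by rewrite !mulr1 mulrC.
Qed.

Lemma coef0_scaled_factor (A : comNzRingType) (p q r : {poly A}) (c a b : A) :
  p = q * (c *: r) -> p`_0 = b -> r`_0 = a -> b = a * (q`_0 * c).
Proof. by move=> -> <- <-; rewrite coef0M coefZ; ring. Qed.

Lemma horner_map_affine (A B : comNzRingType) (f : {rmorphism A -> B}) (a b : A) (z : B) :
  horner_eval z (map_poly f (a%:P + b *: 'X)) = f a + f b * z.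
Proof.
by rewrite horner_evalE rmorphD /= map_polyC map_polyZ map_polyX hornerD hornerC hornerZ hornerX.
Qed.

Lemma map_dvd_scaled (A : comNzRingType) (B : fieldType) (f : {rmorphism A -> B})
    (p q : {poly A}) (c : A) : map_poly f p %| map_poly f ((c *: p) * q).
Proof.
by rewrite rmorphM /= map_polyZ -mul_polyC -mulrA mulrCA dvdp_mulr.
Qed.

Section Divisibility.
Variables (k : closedFieldType) (n : nat).
Implicit Types (f W U : {mpoly k[n]}).

Definition divides (f g : {mpoly k[n]}) : Prop := exists c, g = f * c.

Lemma monic_dvd_pointwise (A B : {poly {mpoly k[n]}}) : A \is monic ->
  (forall v, map_poly (meval v) A %| map_poly (meval v) B) -> exists Q, B = Q * A.
Proof.
move=> mA H; have B_eq := Pdiv.RingMonic.rdivp_eq mA B.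
set Q := Pdiv.CommonRing.rdivp B A in B_eq.
set R := Pdiv.CommonRing.rmodp B A in B_eq.
exists Q; rewrite {1}B_eq; suff -> : R = 0 by rewrite addr0.
apply/polyP => i; rewrite coef0; apply: mpoly_fun0 => v.
have : map_poly (meval v) A %| map_poly (meval v) R.
  have := H v; rewrite B_eq rmorphD rmorphM /=.
  by rewrite dvdp_addr // dvdp_mull.
have lcA : meval v (lead_coef A) != 0 by rewrite (eqP mA) meval1 oner_neq0.
have sR : (size (map_poly (meval v) R) < size (map_poly (meval v) A))%N.
  rewrite (size_map_poly_id0 lcA); apply: leq_ltn_trans (size_poly _ _) _.
  by apply: Pdiv.Ring.ltn_rmodpN0; apply: monic_neq0.
move=> dv; have R0 : map_poly (meval v) R = 0.
  by apply/eqP/negPn/negP => R0; have := dvdp_leq R0 dv; rewrite leqNgt sR.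
by have := congr1 (fun p : {poly k} => p`_i) R0; rewrite coef0 coef_map.
Qed.

(* the inverse c of the leading coefficient is kept abstract *)
Lemma size_shift e f d (c : k) : (msize f <= d.+1)%N -> c * (pihomog mdeg d f).@[e] = 1 ->
  size (c%:MP *: shift_poly e f) = d.+1 /\ c%:MP *: shift_poly e f \is monic.
Proof.
move=> sf f0; have [s cE] := top_coef_shift e sf.
have c1 : (c%:MP *: shift_poly e f)`_d = 1 by rewrite coefZ cE -rmorphM /= f0 rmorph1.
have sz : size (c%:MP *: shift_poly e f) = d.+1.
  apply/eqP; rewrite eqn_leq (leq_trans (size_scale_leq _ _)) //= ltnNge.
  by apply/negP => /leq_sizeP/(_ d (leqnn _)); rewrite c1 => /eqP; rewrite oner_eq0.
by split=> //; rewrite monicE lead_coefE sz c1.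
Qed.

Lemma map_meval_scale v (c : k) (p : {poly {mpoly k[n]}}) :
  map_poly (meval v) (c%:MP *: p) = c *: map_poly (meval v) p.
Proof. by apply/polyP => i; rewrite coefZ !coef_map coefZ /= mevalM mevalC. Qed.

Lemma divides_of_shift e f g d : (msize f <= d.+1)%N -> (pihomog mdeg d f).@[e] != 0 ->
  (forall v, line_poly v e f %| line_poly v e g) -> divides f g.
Proof.
move=> sf f0 H; have [c c0 cE] : exists2 c : k, c != 0 & c * (pihomog mdeg d f).@[e] = 1.
  by exists ((pihomog mdeg d f).@[e])^-1; rewrite ?invr_eq0 // mulVf.
have [Q E] : exists Q, shift_poly e g = Q * (c%:MP *: shift_poly e f).
  apply: monic_dvd_pointwise; first by have [] := size_shift sf cE.
  move=> v; have := map_meval_scale v c (shift_poly e f).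
  have : c *: line_poly v e f %| line_poly v e g by rewrite dvdpZl.
  by rewrite -(map_shift_poly v e f) -(map_shift_poly v e g) => dv cf; move: dv; rewrite -cf.
exists (Q`_0 * c%:MP).
exact: coef0_scaled_factor E (shift_coef0 e g) (shift_coef0 e f).
Qed.

Lemma divides_of_lines f g : f != 0 ->
  (forall v w, line_poly v w f %| line_poly v w g) -> divides f g.
Proof.
move=> f0 H; pose d := (msize f).-1.
have sf : (msize f <= d.+1)%N by rewrite leqSpred.
suff /mpoly_nonroot[e fe] : pihomog mdeg d f != 0 by apply: (divides_of_shift sf fe).
have lm := mlead_supp f0; apply/eqP => /mpolyP/(_ (mlead f)).
rewrite mcoeff0.
have md : mdeg (mlead f) = d by rewrite /d -(mlead_deg f0).
have : forall m, m \in msupp f -> mdeg m = d -> (pihomog mdeg d f)@_m = f@_m.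
  move=> m ms md'; rewrite pihomogE linear_sum /= big_mkcond (bigD1_seq m) ?msupp_uniq //=.
  rewrite md' eqxx mcoeffZ mcoeffX eqxx mulr1 big1_seq ?addr0 // => m' /andP[ne _].
  by case: ifP => // _; rewrite mcoeffZ mcoeffX (negbTE ne) mulr0.
by move/(_ _ lm md) => -> /eqP; rewrite mcoeff_eq0 lm.
Qed.

End Divisibility.

Section LinearForms.
Variables (k : fieldType) (n : nat).
Implicit Types (l f : {mpoly k[n]}).

Lemma homog1E l : l \is 1.-homog -> l = \sum_i l@_U_(i) *: 'X_i.
Proof.
move=> hl; apply/mpolyP => m; rewrite linear_sum /=.
have [/mdeg1P[i /eqP ->]|m1] := boolP (mdeg m == 1%N).
  rewrite (bigD1 i) //= mcoeffZ mcoeffX eqxx mulr1 big1 ?addr0 // => j ji.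
  by rewrite mcoeffZ mcoeffX eq_mnm1 (negbTE ji) mulr0.
rewrite (dhomog_nemf_coeff hl m1) big1 // => i _.
rewrite mcoeffZ mcoeffX; case: eqP => [e|]; last by rewrite mulr0.
by rewrite -e mdeg1 in m1.
Qed.

Lemma meval_linear l (v : 'I_n -> k) : l \is 1.-homog -> l.@[v] = \sum_i l@_U_(i) * v i.
Proof.
move=> hl; rewrite {1}(homog1E hl) (big_morph _ (mevalD v) (meval0 v)).
by apply: eq_bigr => i _; rewrite mevalZ mevalXU.
Qed.

Lemma meval_linearD l v w (c : k) : l \is 1.-homog ->
  l.@[fun i => v i + w i * c] = l.@[v] + l.@[w] * c.
Proof.
move=> hl; rewrite !meval_linear // mulr_suml -big_split /=.
by apply: eq_bigr => i _; rewrite mulrDr mulrA.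
Qed.

Lemma mpolyX_homog (i : 'I_n) : ('X_i : {mpoly k[n]}) \is 1.-homog.
Proof. by rewrite dhomogX /= mdeg1. Qed.

End LinearForms.

Section LineCoefficients.
Variables (k : closedFieldType) (n : nat).
Implicit Types (f : {mpoly k[n]}).

Lemma homog_msize_le f d : f \is d.-homog -> (msize f <= d.+1)%N.
Proof.
move=> /dhomogP hf; rewrite msizeE; apply/bigmax_leqP_seq => m ms _.
by rewrite ltnS; have := hf m ms => /= ->.
Qed.

Lemma line_coef_top v w f d : f \is d.-homog -> (line_poly v w f)`_d = f.@[w].
Proof.
move=> hf; have [_ c] := top_coef_shift w (homog_msize_le hf).
by rewrite -map_shift_poly coef_map c /= mevalC pihomog_dE.
Qed.

Lemma size_line_poly v w f d : f \is d.-homog -> (size (line_poly v w f) <= d.+1)%N.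
Proof.
move=> hf; have [s _] := top_coef_shift w (homog_msize_le hf).
by rewrite -map_shift_poly; apply: leq_trans (size_poly _ _) s.
Qed.

(* the homogeneous components are the Taylor coefficients along lines through 0 *)
Lemma line_coef0 v f d : (line_poly (fun=> 0) v f)`_d = (pihomog mdeg d f).@[v].
Proof.
rewrite [in LHS](pihomog_partitionE (leqnn (mmeasure mdeg f))).
rewrite line_polyE raddf_sum /= coef_sum.
have E (i : nat) : mmap polyC (fun i => 0%:P + v i *: 'X) (pihomog mdeg i f) =
    (pihomog mdeg i f).@[v] *: 'X^i.
  rewrite (@eq_mmap _ _ _ _ polyC _ (fun i => 'X * (v i)%:P)) //.
    by rewrite (mmap_homog _ _ _ (pihomogP _ _ _)) mulrC -mul_polyC rmorph_mmap.
  by move=> j; rewrite polyC0 add0r -mul_polyC mulrC.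
rewrite (eq_bigr (fun i : 'I__ => (pihomog mdeg i f).@[v] * (d == i)%:R)); last first.
  by move=> i _; rewrite E coefZ coefXn.
have [lt|ge] := ltnP d (mmeasure mdeg f).
  rewrite (bigD1 (Ordinal lt)) //= eqxx mulr1 big1 ?addr0 // => i ne.
  by case: eqP => [e|]; rewrite ?mulr0 //; case/eqP: ne; apply/val_inj.
rewrite big1 => [|i _]; last by rewrite gtn_eqF ?mulr0 // (leq_trans (ltn_ord i)).
suff -> : pihomog mdeg d f = 0 by rewrite meval0.
rewrite pihomogE big_seq_cond big_pred0 // => m; apply/negP => /andP[ms /eqP md].
by have := msize_mdeg_lt ms; rewrite md ltnNge ge.
Qed.

End LineCoefficients.

Section Cubic.
Variables (k : closedFieldType) (F : {mpoly k[4]}).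
Hypothesis hF : smooth_cubic_surface F.

Lemma cubic_homog : F \is 3.-homog. Proof. by case: hF. Qed.

Lemma cubic_neq0 : F != 0.
Proof.
apply/eqP => F0; case: hF => _ /(_ (const_mx 1)) [].
- by apply/eqP => /matrixP/(_ ord0 ord0); rewrite !mxE => /eqP; rewrite oner_eq0.
- by rewrite F0 meval0.
- by move=> i; rewrite F0 mderiv0 meval0 eqxx.
Qed.

(* the rational root theorem, for the restriction of the cubic to a line *)
Lemma root_dvd_line (U W : {poly k}) (x : 'I_4 -> {poly k}) (e : 'I_4 -> k) :
  F.@[e] != 0 -> mmap polyC (fun i => W * x i + U * (e i)%:P) F = 0 -> W %| U.
Proof.
move=> Fe E.
have [|WU] := boolP ((W != 0) || (U != 0)); last first.
  by move: WU; rewrite negb_or !negbK => /andP[_ /eqP->]; rewrite dvdp0.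
move=> WU; have cop := coprimep_div_gcd WU.
set g := gcdp W U in cop; set W' := W %/ g in cop; set U' := U %/ g in cop.
have WE : W = g * W' by rewrite mulrC divpK ?dvdp_gcdl.
have UE : U = g * U' by rewrite mulrC divpK ?dvdp_gcdr.
have g0 : g != 0 by rewrite gcdp_eq0 negb_and.
have E' : mmap polyC (fun i => W' * x i + U' * (e i)%:P) F = 0.
  have := E; rewrite (@eq_mmap _ _ _ _ polyC _ (fun i => g * (W' * x i + U' * (e i)%:P))) //.
    rewrite (mmap_homog _ _ _ cubic_homog) => /eqP.
    by rewrite mulf_eq0 expf_eq0 /= (negbTE g0) => /eqP.
  by move=> i; rewrite {1}WE {1}UE; ring.
have [|c] := @mmap_congr _ _ _ polyC (fun i => W' * x i + U' * (e i)%:P)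
   (fun i => U' * (e i)%:P) F W'; first by move=> i; exists (x i); ring.
rewrite E' (mmap_homog _ _ _ cubic_homog).
have -> : mmap polyC (fun i => (e i)%:P) F = (F.@[e])%:P.
  by rewrite rmorph_mmap.
rewrite sub0r => E2.
have : W' %| U' ^+ 3.
  rewrite -(dvdpZr _ _ Fe) -mul_polyC mulrC -dvdpNr E2 dvdp_mulr //.
have : coprimep W' (U' ^+ 3) by apply: coprimep_expr.
move=> c3 d3; have /(coprimepP _ _)/(_ _ (dvdpp W') d3) W1 := c3.
by rewrite WE UE dvdp_mul2l // (eqp_dvdl _ W1) dvd1p.
Qed.

(* a linear form vanishing on a plane of the surface would make it singular
   where the residual conic meets that plane *)
Lemma cubic_no_linear_factor (l : {mpoly k[4]}) : l \is 1.-homog -> ~ divides l F.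
Proof.
move=> hl [Q0 E0]; have [Q FE hQ] := homog_dvd hl cubic_homog E0.
have {}hQ : Q \is 2.-homog by [].
pose A : 'cV[k]_4 := \col_i l@_U_(i).
have lA (v : 'rV[k]_4) : l.@[v 0] = (v *m A) 0 0.
  by rewrite meval_linear // mxE; apply: eq_bigr => i _; rewrite mxE mulrC.
pose K := row_base (kermx A).
have rK : (2 <= \rank (kermx A))%N.
  rewrite mxrank_ker; have := rank_leq_col A; case: (\rank A) => [|[|]] //.
pose B : 'M_(2, 4) := pid_mx 2 *m K.
have freeB : row_free B.
  rewrite /row_free /B mxrankMfree ?row_base_free // rank_pid_mx //.
have BA : B *m A = 0.
  apply/eqP; rewrite -sub_kermx; apply: submx_trans (submxMl _ _) _.
  by rewrite /K eq_row_base.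
suff [v [v0 lv Qv]] : exists v : 'rV[k]_4, [/\ v != 0, l.@[v 0] = 0 & Q.@[v 0] = 0].
  case: hF => _ /(_ v v0); rewrite FE mevalM lv mul0r => /(_ erefl)[i].
  by rewrite mderivM mevalD !mevalM lv Qv mulr0 mul0r addr0 eqxx.
have inB (u : 'rV[k]_2) : u != 0 -> u *m B != 0 /\ l.@[(u *m B) 0] = 0.
  move=> u0; split; last by rewrite lA -mulmxA BA mulmx0 mxE.
  by rewrite mulmx_free_eq0.
pose v0 := row 0 B; pose v1 := row 1 B.
pose p := line_poly (v0 0) (v1 0) Q.
have d01 (t : k) : delta_mx 0 0 + t *: delta_mx 0 1 != 0 :> 'rV[k]_2.
  by apply/eqP => /rowP/(_ 0); rewrite !mxE /= mulr0 addr0 => /eqP; rewrite oner_eq0.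
have [p0|/negP p1] := pselect (size p != 1).
  have [t] := closed_rootP _ p0; rewrite rootE horner_line => /eqP Qt.
  have [w0 lw] := inB _ (d01 t).
  exists ((delta_mx 0 0 + t *: delta_mx 0 1) *m B); split=> //.
  rewrite -[RHS]Qt; apply: meval_eq => i.
  by rewrite mulmxDl -scalemxAl -!rowE !mxE mulrC.
have d1 : delta_mx 0 1 != 0 :> 'rV[k]_2.
  by apply/eqP => /rowP/(_ 1); rewrite !mxE /= => /eqP; rewrite oner_eq0.
have [w0 lw] := inB _ d1.
exists (delta_mx 0 1 *m B); split=> //; rewrite -rowE -/v1.
rewrite -(line_coef_top (v0 0) _ hQ) -/p nth_default //.
by move: p1; rewrite negbK => /eqP->.
Qed.

(** A rational root u / w of the cubic F(x + T e) would be a polynomial, since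
    restricted to each line it is integral; its linear part l then satisfies
    F(x + l e) = 0, so that l divides F. *)
Lemma cubic_no_rational_root (e : 'I_4 -> k) (u w : {mpoly k[4]}) :
  F.@[e] != 0 -> w != 0 -> mmap (@mpolyC 4 k) (fun i => w * 'X_i + u * (e i)%:MP) F != 0.
Proof.
move=> Fe w0; apply/eqP => E.
have [r uE] : divides w u.
  apply: divides_of_lines => // v d.
  have := congr1 (line_poly v d) E; rewrite !line_polyE rmorph_mmap [RHS]rmorph0 /= => E'.
  apply: (@root_dvd_line _ _ (fun i => line_poly v d 'X_i) e Fe).
  apply: etrans E'; apply: eq_mmap => [c|i] /=; first by rewrite mmapC.
  by rewrite rmorphD !rmorphM /= !line_polyE mmapC.
have {E} E : mmap (@mpolyC 4 k) (fun i => 'X_i + r * (e i)%:MP) F = 0.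
  apply: (mulfI (expf_neq0 3 w0)); rewrite mulr0 -(mmap_homog _ _ _ cubic_homog) -[RHS]E.
  by apply: eq_mmap => // i; rewrite uE; ring.
pose l := pihomog mdeg 1 r.
have hl : l \is 1.-homog by apply: pihomogP.
suff root_l v : F.@[fun i => v i + l.@[v] * e i] = 0.
  apply: (cubic_no_linear_factor hl).
  have [|c] := @mmap_congr _ _ _ (@mpolyC 4 k) (fun i => 'X_i) (fun i => 'X_i + l * (e i)%:MP) F l.
    by move=> i; exists (- (e i)%:MP); ring.
  rewrite (_ : mmap _ (fun i => 'X_i) F = F); last first.
    by rewrite -[RHS]comp_mpoly_id; apply: eq_mmap => // i; rewrite tnth_mktuple.
  rewrite [X in _ - X](_ : _ = 0) ?subr0; first by exists c.
  apply: mpoly_fun0 => v; rewrite rmorph_mmap /= -[RHS](root_l v).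
  by apply: eq_mmap => [c'|i] /=; rewrite ?mevalC // mevalD mevalM mevalXU mevalC.
pose p := line_poly (fun=> 0) v r.
have pE : mmap polyC (fun i => 'X * (v i)%:P + p * (e i)%:P) F = 0.
  have := congr1 (line_poly (fun=> 0) v) E; rewrite !line_polyE rmorph_mmap [RHS]rmorph0 /= => E'.
  apply: etrans E'; apply: eq_mmap => [c|i] /=; first by rewrite mmapC.
  rewrite rmorphD rmorphM /= mmapC /p line_polyE; congr (_ + _ * _).
  rewrite mmapX mmap1U polyC0 add0r -mul_polyC mulrC //.
have /dvdpP[q pq] := root_dvd_line Fe pE.
have qE : mmap polyC (fun i => (v i)%:P + q * (e i)%:P) F = 0.
  apply: (mulfI (expf_neq0 3 (negbT (polyX_eq0 k)))).
  rewrite mulr0 -(mmap_homog _ _ _ cubic_homog) -[RHS]pE.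
  by apply: eq_mmap => // i; rewrite pq; ring.
have := congr1 (horner^~ 0) qE; rewrite horner0 -horner_evalE rmorph_mmap => <-.
apply: eq_mmap => [c|i] /=; first by rewrite horner_evalE hornerC.
rewrite horner_evalE hornerD hornerM !hornerC; congr (_ + _ * _).
have := congr1 (fun p : {poly k} => p`_1) pq; rewrite coefMX /= -horner_coef0 => <-.
by rewrite line_coef0.
Qed.

Lemma cubic_direction : exists e, F.@[e] != 0.
Proof. exact: mpoly_nonroot cubic_neq0. Qed.

Lemma divides_of_direction (e : 'I_4 -> k) (f : {mpoly k[4]}) : F.@[e] != 0 ->
  (forall v, line_poly v e F %| line_poly v e f) -> divides F f.
Proof.
by move=> Fe; apply: divides_of_shift (homog_msize_le cubic_homog) _;
  rewrite pihomog_dE ?cubic_homog.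
Qed.

(** The cubic is prime: over the function field it has no root in a direction
    not on the surface, hence is irreducible there, and it is monic. *)
Lemma cubic_prime (a b : {mpoly k[4]}) : divides F (a * b) -> divides F a \/ divides F b.
Proof.
move=> [c' ab]; have [e Fe] := cubic_direction.
have [c c0 cE] : exists2 c : k, c != 0 & c * F.@[e] = 1.
  by exists (F.@[e])^-1; rewrite ?invr_eq0 // mulVf.
have [szP mP] : size (c%:MP *: shift_poly e F) = 4 /\ c%:MP *: shift_poly e F \is monic.
  by apply: size_shift (homog_msize_le cubic_homog) _; rewrite pihomog_dE ?cubic_homog.
set P := _ *: _ in szP mP.
pose tf := map_poly (@tofrac {mpoly k[4]}).
have lcP : tofrac (lead_coef P) != 0 by rewrite (eqP mP) tofrac1 oner_neq0.
have irr : irreducible_poly (tf P).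
  apply: cubic_irreducible; first by rewrite (size_map_poly_id0 lcP) szP.
  move=> x; apply/negP; have [u [w [w0 xw]]] := frac_repr x.
  have wF : tofrac w != 0 by rewrite tofrac_eq0.
  have -> : x = tofrac u / tofrac w by rewrite -xw mulfK.
  rewrite rootE /tf map_polyZ hornerZ mulf_eq0 tofrac_eq0 mpolyC_eq0 (negbTE c0) /=.
  rewrite shift_polyE -horner_evalE !rmorph_mmap /= => /eqP E.
  have := @cubic_no_rational_root e u w Fe w0 => /eqP; apply.
  apply/eqP; rewrite -(tofrac_eq0 (mmap _ _ _)) rmorph_mmap; apply/eqP.
  apply: (mulfI (expf_neq0 3 (invr_neq0 wF))).
  rewrite mulr0 -(mmap_homog _ _ _ cubic_homog) -[RHS]E.
  apply: eq_mmap => [c''|i] /=; first by rewrite map_polyC /= horner_evalE hornerC.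
  rewrite horner_map_affine rmorphD !rmorphM /= mulrDr mulKf //; congr (_ + _).
  by rewrite [LHS]mulrCA [RHS]mulrCA; congr (_ * _); exact: mulrC.
have dvd_down f : tf P %| tf (shift_poly e f) -> divides F f.
  move=> dv; have B_eq := Pdiv.RingMonic.rdivp_eq mP (shift_poly e f).
  move: B_eq; set Q := Pdiv.CommonRing.rdivp _ _; set R := Pdiv.CommonRing.rmodp _ _ => B_eq.
  have R0 : tf R = 0.
    have dR : tf P %| tf R.
      have tfE : tf (shift_poly e f) = tf Q * tf P + tf R by rewrite {1}B_eq /tf rmorphD rmorphM.
      by move: dv; rewrite tfE dvdp_addr ?dvdp_mull.
    apply/eqP/negPn/negP => R0; have := dvdp_leq R0 dR.
    rewrite leqNgt (size_map_poly_id0 lcP) (leq_ltn_trans (size_poly _ _)) //.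
    by apply: Pdiv.Ring.ltn_rmodpN0; apply: monic_neq0.
  have {}R0 : R = 0.
    apply/polyP => i; have := congr1 (fun p : {poly _} => p`_i) R0.
    by rewrite coef_map !coef0 => /eqP; rewrite tofrac_eq0 => /eqP.
  exists (Q`_0 * c%:MP); apply: coef0_scaled_factor (shift_coef0 e f) (shift_coef0 e F).
  by rewrite [LHS]B_eq R0 addr0.
have dab : tf P %| tf (shift_poly e a) * tf (shift_poly e b).
  have PF : (F.@[e])%:MP *: P = shift_poly e F.
    by rewrite /P scalerA -rmorphM mulrC /= cE rmorph1 scale1r.
  have := map_dvd_scaled (@tofrac {mpoly k[4]}) P (shift_poly e c') (F.@[e])%:MP.
  by rewrite PF -shift_polyM -ab shift_polyM rmorphM.
have [da|nda] := boolP (tf P %| tf (shift_poly e a)); first by left; apply: dvd_down.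
right; apply: dvd_down; move: dab.
by rewrite Gauss_dvdpr // (irreducible_poly_coprime _ irr).
Qed.

Lemma cubic_primeX (a : {mpoly k[4]}) n : divides F (a ^+ n.+1) -> divides F a.
Proof.
elim: n => [|n IH]; first by rewrite expr1.
by rewrite exprS => /cubic_prime[].
Qed.

(** The Nullstellensatz for the cubic: along a line, a function vanishing at its
    three roots has its cube divisible by it. *)
Lemma cubic_vanish (f : {mpoly k[4]}) : (forall v, F.@[v] = 0 -> f.@[v] = 0) -> divides F f.
Proof.
move=> H; have [e Fe] := cubic_direction.
apply: (@cubic_primeX _ 2); apply: (divides_of_direction Fe) => v.
have [r] := closed_field_poly_normal (line_poly v e F).
set p := line_poly v e F => pE.
have sp : (size p <= 4)%N by apply: size_line_poly; apply: cubic_homog.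
have lc0 : lead_coef p != 0.
  rewrite lead_coef_eq0; apply: contraNneq Fe => p0.
  by rewrite -(line_coef_top v _ cubic_homog) -/p p0 coef0.
have sr : (size r <= 3)%N.
  by move: sp; rewrite pE size_scale // size_prod_XsubC.
rewrite pE dvdpZl // (_ : line_poly v e (f ^+ 3) = line_poly v e f ^+ 3); last first.
  by rewrite !line_polyE rmorphXn.
have root_r z : z \in r -> root (line_poly v e f) z.
  move=> zr; rewrite rootE horner_line; apply/eqP/H.
  have : root p z by rewrite pE rootZ // root_prod_XsubC.
  by rewrite rootE horner_line => /eqP.
have : \prod_(z <- r) ('X - z%:P) %| line_poly v e f ^+ size r.
  elim: (r) (root_r) => [|z s IH] Hs; first by rewrite big_nil dvd1p.
  rewrite big_cons exprS dvdp_mul // ?IH // ?dvdp_XsubCl ?Hs ?inE ?eqxx // => y ys.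
  by apply: Hs; rewrite inE ys orbT.
by move/dvdp_trans; apply; apply: dvdp_exp2l.
Qed.

(** ** The configurations of points on the affine cone over the surface *)

Definition on_cubic (I : Type) (v : I * 'I_4 -> k) : Prop :=
  forall i, F.@[fun j => v (i, j)] = 0.

Lemma cubic_irreducible_point (f g : ('I_4 -> k) -> k) : polyfun f -> polyfun g ->
  (exists2 v, F.@[v] = 0 & f v != 0) -> (exists2 v, F.@[v] = 0 & g v != 0) ->
  exists2 v, F.@[v] = 0 & f v * g v != 0.
Proof.
move=> /polyfun_mpoly[p pE] /polyfun_mpoly[q qE] [v Fv fv] [w Fw gw].
apply: contrapT => H.
have /cubic_vanish/cubic_prime[|] : forall v, F.@[v] = 0 -> (p * q).@[v] = 0.
- move=> u Fu; apply/eqP/negPn/negP => pq; apply: H; exists u => //.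
  by rewrite pE qE -mevalM.
- by move=> [c pc]; move: fv; rewrite pE pc mevalM Fv mul0r eqxx.
- by move=> [c pc]; move: gw; rewrite qE pc mevalM Fw mul0r eqxx.
Qed.

(** Products of the irreducible cone are irreducible: two tuples are merged into
    one, a coordinate point at a time. *)
Lemma on_cubic_irreducible (I : finType) : irreducible_set (@on_cubic I).
Proof.
move=> f g pf pg [v Xv fv] [w Xw gw].
have: exists v w, [/\ on_cubic v, on_cubic w, f v != 0, g w != 0
    & forall i, i \in enum I -> forall j, v (i, j) = w (i, j)].
  elim: (enum I) => [|i r [v' [w' [Xv' Xw' fv' gw' e]]]]; first by exists v, w.
  pose upd (u : I * 'I_4 -> k) (x : 'I_4 -> k) (ij : I * 'I_4) :=
    if ij.1 == i then x ij.2 else u ij.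
  have pu u h : polyfun h -> polyfun (fun x => h (upd u x)).
    move=> ph; apply: (polyfun_comp (g := fun ij x => upd u x ij) ph) => -[a b].
    by rewrite /upd /=; case: eqP => _; [exact: polyfun_var | exact: polyfun_const].
  have idu u : upd u (fun j => u (i, j)) = u.
    by apply/funext => -[a b]; rewrite /upd /=; case: eqP => // ->.
  have [| |x Fx] := cubic_irreducible_point (pu v' f pf) (pu w' g pg).
  - by exists (fun j => v' (i, j)); rewrite ?idu.
  - by exists (fun j => w' (i, j)); rewrite ?idu.
  rewrite mulf_eq0 => /norP[fx gx]; exists (upd v' x), (upd w' x); split=> //.
  - by move=> a; rewrite /upd /=; case: (a == i); [exact: Fx | exact: Xv'].
  - by move=> a; rewrite /upd /=; case: (a == i); [exact: Fx | exact: Xw'].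
  - move=> a; rewrite inE /upd /= => ar j; case: eqP ar => // ne /= ar; exact: e.
move=> [v' [w' [Xv' _ fv' gw' e]]]; exists v' => //.
rewrite mulf_neq0 // (_ : v' = w') //.
by apply/funext => -[i j]; apply: e; rewrite mem_enum.
Qed.

End Cubic.

(** * Koszul cohomology and the depth of complete intersections *)

Section GradedElements.
Variables (n : nat) (R : comNzRingType).
Local Notation S := {mpoly R[n]}.
Implicit Types (f g l : S) (J : S -> Prop) (t : int).

(** The shifts in the Koszul complex lead to negative degrees, hence integers. *)
Definition homz t f : bool := if t is Posz d then f \is d.-homog else f == 0.

Lemma homz0 t : homz t 0.
Proof. by case: t => d /=; rewrite ?dhomog0. Qed.

Lemma homzD t f g : homz t f -> homz t g -> homz t (f + g).
Proof. by case: t => d /=; [exact: dhomogD | move=> /eqP-> /eqP->; rewrite addr0]. Qed.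

Lemma homzN t f : homz t f -> homz t (- f).
Proof. by case: t => d /=; rewrite ?dhomogN // => /eqP->; rewrite oppr0. Qed.

Lemma homzM d t l f : l \is d.-homog -> homz t f -> homz (t + d%:Z) (l * f).
Proof.
move=> hl; case: t => e /=; first by move=> hf; rewrite addnC; apply: dhomogM.
by move/eqP->; rewrite mulr0 homz0.
Qed.

Definition projz t f : S := if t is Posz d then pihomog mdeg d f else 0.

Lemma projz_homz t f : homz t (projz t f).
Proof. by case: t => d /=; rewrite ?pihomogP. Qed.

Lemma projz_id t f : homz t f -> projz t f = f.
Proof. by case: t => d /=; [exact: pihomog_dE | move/eqP->]. Qed.

Lemma projzD t f g : projz t (f + g) = projz t f + projz t g.
Proof. by case: t => d /=; rewrite ?pihomogD ?addr0. Qed.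

Lemma projzM d t l f : l \is d.-homog -> projz (t + d%:Z) (l * f) = l * projz t f.
Proof.
move=> hl; case: t => e /=; first by rewrite addnC pihomogM.
rewrite mulr0; have -> : Negz e + d%:Z = if (e < d)%N then (d - e.+1)%:Z else Negz (e - d) by [].
by case: ltnP => //= lt; rewrite (pihomogM_small _ hl) // ltn_subrL ltn0Sn (leq_ltn_trans _ lt).
Qed.

End GradedElements.

Section Koszul.
Variables (k : closedFieldType) (n : nat).
Local Notation S := {mpoly k[n.+1]}.
Implicit Types (f g x r : S) (J : S -> Prop) (t : int) (xs : seq S).

Fixpoint kcochain m : zmodType := if m is m'.+1 then (kcochain m' * kcochain m')%type else S.

Fixpoint kscale m r : kcochain m -> kcochain m :=
  match m with
  | 0 => fun z : S => r * z
  | m'.+1 => fun z : kcochain m' * kcochain m' => (kscale r z.1, kscale r z.2)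
  end.

(** The Koszul cochain complex of x_1, ..., x_m, as the iterated cone of the
    multiplications by the x_i. *)
Fixpoint kdiff xs : kcochain (size xs) -> kcochain (size xs) :=
  match xs with
  | [::] => fun _ => 0
  | x :: xs' => fun z : kcochain (size xs') * kcochain (size xs') =>
      (kdiff z.1, kscale x z.1 - kdiff z.2)
  end.

Fixpoint kmod J m : kcochain m -> Prop :=
  match m with
  | 0 => fun z : S => J z
  | m'.+1 => fun z : kcochain m' * kcochain m' => kmod J z.1 /\ kmod J z.2
  end.

(** Cochains of cohomological degree i with coefficients of degree t. *)
Fixpoint khomog m (i : nat) t : kcochain m -> bool :=
  match m with
  | 0 => fun z : S => if i is 0 then homz t z else z == 0
  | m'.+1 => fun z : kcochain m' * kcochain m' =>
      khomog i t z.1 && (if i is i'.+1 then khomog i' t z.2 else z.2 == 0)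
  end.

Lemma kscaleD m r : {morph @kscale m r : z w / z + w}.
Proof.
elim: m => [|m IH] /=; first by move=> z w; rewrite mulrDr.
by case=> [a b] [c d] /=; rewrite !IH.
Qed.

Lemma kscale0 m r : @kscale m r 0 = 0.
Proof. by apply: (addrI (kscale r 0)); rewrite -kscaleD !addr0. Qed.

Lemma kscaleN m r : {morph @kscale m r : z / - z}.
Proof. by move=> z; apply/eqP; rewrite -addr_eq0 -kscaleD addNr kscale0. Qed.

Lemma kscaleB m r : {morph @kscale m r : z w / z - w}.
Proof. by move=> z w; rewrite kscaleD kscaleN. Qed.

Lemma kscaleC m r s (z : kcochain m) : kscale r (kscale s z) = kscale s (kscale r z).
Proof.
elim: m z => [|m IH] /=; first by move=> z; rewrite mulrCA.
by case=> a b /=; rewrite !IH.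
Qed.

Lemma kdiffD xs : {morph @kdiff xs : z w / z + w}.
Proof.
elim: xs => [|x xs IH] /=; first by move=> z w; rewrite addr0.
case=> [a b] [c d] /=; rewrite !IH kscaleD; congr (_, _).
by rewrite opprD addrACA.
Qed.

Lemma kdiff0 xs : @kdiff xs 0 = 0.
Proof. by apply: (addrI (kdiff 0)); rewrite -kdiffD !addr0. Qed.

Lemma kdiffN xs : {morph @kdiff xs : z / - z}.
Proof. by move=> z; apply/eqP; rewrite -addr_eq0 -kdiffD addNr kdiff0. Qed.

Lemma kdiffB xs : {morph @kdiff xs : z w / z - w}.
Proof. by move=> z w; rewrite kdiffD kdiffN. Qed.

Lemma kdiffZ xs r z : @kdiff xs (kscale r z) = kscale r (kdiff z).
Proof.
elim: xs z => [|x xs IH] /=; first by move=> z; rewrite mulr0.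
by case=> a b /=; rewrite !IH kscaleB kscaleC.
Qed.

Lemma kdiff_kdiff xs z : @kdiff xs (kdiff z) = 0.
Proof.
elim: xs z => [|x xs IH] //= [a b] /=.
by rewrite kdiffB kdiffZ !IH subr0 subrr.
Qed.

Section Ideal.
Variable J : S -> Prop.
Hypothesis idJ : is_ideal J.

Lemma ideal0 : J 0. Proof. by case: idJ. Qed.
Lemma idealD f g : J f -> J g -> J (f + g). Proof. by case: idJ => _ h _; apply: h. Qed.
Lemma idealMl f g : J g -> J (f * g). Proof. by case: idJ => _ _; apply. Qed.
Lemma idealN f : J f -> J (- f). Proof. by rewrite -mulN1r; apply: idealMl. Qed.
Lemma idealB f g : J f -> J g -> J (f - g).
Proof. by move=> Jf Jg; apply: idealD => //; apply: idealN. Qed.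

Lemma kmod0 m : kmod J (0 : kcochain m).
Proof. by elim: m => [|m IH] /=; first exact: ideal0. Qed.

Lemma kmodD m (z w : kcochain m) : kmod J z -> kmod J w -> kmod J (z + w).
Proof.
elim: m z w => [|m IH] /=; first exact: idealD.
by case=> [a b] [c d] /= [? ?] [? ?]; split; apply: IH.
Qed.

Lemma kmodZ m r (z : kcochain m) : kmod J z -> kmod J (kscale r z).
Proof.
elim: m z => [|m IH] /=; first exact: idealMl.
by case=> a b /= [? ?]; split; apply: IH.
Qed.

Lemma kmodN m (z : kcochain m) : kmod J z -> kmod J (- z).
Proof.
elim: m z => [|m IH] /=; first exact: idealN.
by case=> a b /= [? ?]; split; apply: IH.
Qed.

Lemma kmodB m (z w : kcochain m) : kmod J z -> kmod J w -> kmod J (z - w).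
Proof. by move=> hz hw; apply: kmodD => //; apply: kmodN. Qed.

Lemma kmod_kdiff xs (z : kcochain (size xs)) : kmod J z -> kmod J (kdiff z).
Proof.
elim: xs z => [|x xs IH] /=; first by move=> z _; exact: ideal0.
by case=> a b /= [? ?]; split; [exact: IH | apply: kmodB; [exact: kmodZ | exact: IH]].
Qed.

End Ideal.

Lemma khomog0 m i t : khomog i t (0 : kcochain m).
Proof. by elim: m i => [|m IH] [|i] //=; rewrite ?homz0 ?IH ?eqxx. Qed.

Lemma khomogD m i t (z w : kcochain m) : khomog i t z -> khomog i t w -> khomog i t (z + w).
Proof.
elim: m i z w => [|m IH] [|i] /=.
- exact: homzD.
- by move=> z w /eqP-> /eqP->; rewrite addr0.
- by case=> [a b] [c d] /= /andP[h1 /eqP->] /andP[h2 /eqP->]; rewrite IH //= addr0.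
- by case=> [a b] [c d] /= /andP[h1 h2] /andP[h3 h4]; rewrite !IH.
Qed.

Lemma khomogN m i t (z : kcochain m) : khomog i t z -> khomog i t (- z).
Proof.
elim: m i z => [|m IH] [|i] /=.
- exact: homzN.
- by move=> z /eqP->; rewrite oppr0.
- by case=> a b /= /andP[h1 /eqP->]; rewrite IH //= oppr0.
- by case=> a b /= /andP[h1 h2]; rewrite !IH.
Qed.

Lemma khomogB m i t (z w : kcochain m) : khomog i t z -> khomog i t w -> khomog i t (z - w).
Proof. by move=> h1 h2; apply: khomogD => //; apply: khomogN. Qed.

Lemma khomogZ m i t d r (z : kcochain m) : r \is d.-homog -> khomog i t z ->
  khomog i (t + d%:Z) (kscale r z).
Proof.
move=> hr; elim: m i z => [|m IH] [|i] /=.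
- by move=> z; exact: homzM.
- by move=> z /eqP->; rewrite mulr0.
- by case=> a b /= /andP[h1 /eqP->]; rewrite IH //= kscale0.
- by case=> a b /= /andP[h1 h2]; rewrite !IH.
Qed.

Lemma khomog_kdiff xs i t (z : kcochain (size xs)) : all (fun x => x \is 1.-homog) xs ->
  khomog i t z -> khomog i.+1 (t + 1) (kdiff z).
Proof.
elim: xs i z => [|x xs IH] i /=; first by move=> z _ _.
case=> a b /= /andP[hx hxs] /andP[h1 h2]; rewrite IH //=.
case: i h1 h2 => [|i] h1 h2; first by rewrite (eqP h2) kdiff0 subr0 (khomogZ hx).
by apply: khomogB; [exact: khomogZ | exact: IH].
Qed.

Lemma khomog_neg m i e (z : kcochain m) : khomog i (Negz e) z -> z = 0.
Proof.
elim: m i z => [|m IH] [|i] /=; try by move=> z /eqP.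
  by case=> a b /= /andP[/IH-> /eqP->].
by case=> a b /= /andP[/IH-> /IH->].
Qed.

Definition addI J r f : Prop := exists a b, J a /\ f = a + r * b.
Definition nonzerodiv J r : Prop := forall f, J (r * f) -> J f.

Definition kvanish xs J i t : Prop := forall z : kcochain (size xs),
  khomog i t z -> kmod J (kdiff z) ->
  if i is i'.+1 then exists2 y, khomog i' (t - 1) y & kmod J (z - kdiff y) else kmod J z.

Lemma kvanish_neg xs J i e : is_ideal J -> kvanish xs J i (Negz e).
Proof.
move=> idJ z /khomog_neg-> _; case: i => [|i]; first exact: kmod0.
by exists 0; [exact: khomog0 | rewrite kdiff0 subr0; exact: kmod0].
Qed.

Lemma addI_ideal J r : is_ideal J -> is_ideal (addI J r).
Proof.
move=> [J0 JD JM]; split.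
- by exists 0, 0; rewrite mulr0 addr0.
- move=> f g [a [b [Ja ->]]] [c [d [Jc ->]]]; exists (a + c), (b + d).
  by split; [exact: JD | rewrite mulrDr addrACA].
- move=> s f [a [b [Ja ->]]]; exists (s * a), (s * b); split; first exact: JM.
  by rewrite mulrDr mulrCA.
Qed.

Lemma addI_homog J d r : is_homogeneous J -> r \is d.-homog -> is_homogeneous (addI J r).
Proof.
move=> hJ hr f e [a [b [Ja ->]]]; exists (pihomog mdeg e a), (projz (e%:Z - d%:Z) b).
split; first exact: hJ.
rewrite pihomogD; congr (_ + _).
by have := projzM (e%:Z - d%:Z) b hr; rewrite subrK.
Qed.

Lemma kmod_lift m J d r i t (u : kcochain m) : is_ideal J -> is_homogeneous J -> r \is d.-homog ->
  khomog i t u -> kmod (addI J r) u ->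
  exists2 w, khomog i (t - d%:Z) w & kmod J (u - kscale r w).
Proof.
move=> idJ hJ hr; elim: m i u => [|m IH] [|i] /=.
- move=> u hu [a [b [Ja e]]]; exists (projz (t - d%:Z) b); first exact: projz_homz.
  have -> : r * projz (t - d%:Z) b = projz t (r * b) by rewrite -(projzM _ _ hr) subrK.
  have -> : u = projz t a + projz t (r * b) by rewrite -projzD -e projz_id.
  rewrite addrK; case: (t) => j /=; [exact: hJ | exact: ideal0].
- by move=> u /eqP-> _; exists 0; rewrite ?mulr0 ?subr0 //; exact: ideal0.
- case=> a b /= /andP[ha /eqP->] [/(IH _ _ ha)[w hw hJw] _].
  by exists (w, 0) => /=; rewrite ?hw ?eqxx // kscale0 subr0; split=> //; exact: kmod0.
- case=> a b /= /andP[ha hb] [/(IH _ _ ha)[w hw hJw] /(IH _ _ hb)[w' hw' hJw']].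
  by exists (w, w') => /=; rewrite ?hw ?hw'.
Qed.

Lemma kmod_nonzerodiv m J r (w : kcochain m) : nonzerodiv J r -> kmod J (kscale r w) -> kmod J w.
Proof.
move=> nz; elim: m w => [|m IH] /=; first by move=> w; exact: nz.
by case=> a b /= [/IH ? /IH ?].
Qed.

Lemma kmod_addI m J r (z w : kcochain m) : is_ideal J -> kmod J (z - kscale r w) -> kmod (addI J r) z.
Proof.
move=> idJ; elim: m z w => [|m IH] /=; last by case=> [a b] [c d] /= [/IH ? /IH ?].
by move=> z w h; exists (z - r * w), w; rewrite subrK.
Qed.

(** Dividing by a nonzerodivisor r lowers the depth by one: the long exact
    sequence of 0 -> S/J -> S/J -> S/(J + r) -> 0. *)
Lemma kvanish_quot xs J d r i t : is_ideal J -> is_homogeneous J -> r \is d.-homog ->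
  nonzerodiv J r -> all (fun x => x \is 1.-homog) xs ->
  kvanish xs J i t -> kvanish xs J i.+1 (t + 1 - d%:Z) -> kvanish xs (addI J r) i t.
Proof.
move=> idJ hJ hr nz hxs van1 van2 z hz dz.
have [w hw zw] := kmod_lift idJ hJ hr (khomog_kdiff hxs hz) dz.
have dw : kmod J (kdiff w).
  apply: (kmod_nonzerodiv nz); rewrite -kdiffZ -(subKr (kdiff z) (kscale r w)).
  by rewrite kdiffB kdiff_kdiff sub0r; apply/kmodN/kmod_kdiff.
have [y hy wy] := van2 w hw dw.
have hz' : khomog i t (z - kscale r y).
  by apply: khomogB => //; have := khomogZ hr hy; rewrite (_ : t + 1 - d%:Z - 1 + d%:Z = t) //; ring.
have dz' : kmod J (kdiff (z - kscale r y)).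
  rewrite kdiffB kdiffZ -[kdiff z](subrK (kscale r w)) -addrA -kscaleB.
  by apply: kmodD => //; apply: kmodZ.
have := van1 _ hz' dz'; case: (i) => [|i'] /=.
  by move=> h; apply: (kmod_addI idJ h).
case=> y' hy' h; exists y' => //; apply: (@kmod_addI _ _ _ _ y) => //.
by move: h; rewrite addrAC.
Qed.

(** A regular sequence has no Koszul cohomology below the top degree. *)
Lemma kvanish_cons x xs J J' i t : is_ideal J -> is_homogeneous J ->
  (forall f, J' f <-> addI J x f) -> x \is 1.-homog -> nonzerodiv J x ->
  all (fun x => x \is 1.-homog) xs ->
  (i <= size xs)%N -> (forall i' t', (i' < size xs)%N -> kvanish xs J' i' t') ->
  kvanish (x :: xs) J i t.
Proof.
move=> idJ hJ J'E hx nz hxs lti van.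
suff H (a b : kcochain (size xs)) :
    khomog i t a && (if i is i'.+1 then khomog i' t b else b == 0) ->
    kmod J (kdiff a) /\ kmod J (kscale x a - kdiff b) ->
    if i is i'.+1 then
      exists2 y : kcochain (size xs) * kcochain (size xs),
        khomog i' (t - 1) y.1 && (if i' is i''.+1 then khomog i'' (t - 1) y.2 else y.2 == 0)
        & kmod J (a - kdiff y.1) /\ kmod J (b - (kscale x y.1 - kdiff y.2))
    else kmod J a /\ kmod J b.
  by case: (i) H => [|i'] H [a b] /= h1 h2; apply: H.
have {}van i' t' : (i' < size xs)%N -> kvanish xs (addI J x) i' t'.
  by move=> lt; have := van i' t' lt; rewrite (_ : J' = addI J x) //;
    apply/funext => f; apply/propext.
case: i lti => [|i] lti /= /andP[ha hb] [da db].
  move: db; rewrite (eqP hb) kdiff0 subr0 => /(kmod_nonzerodiv nz) Ja.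
  by split=> //; exact: kmod0.
have dab : kmod (addI J x) (kdiff b).
  by rewrite -[kdiff b](subKr (kscale x a)); apply: (@kmod_addI _ _ _ _ a) => //;
    rewrite addrAC subrr sub0r; apply: kmodN.
have key w y : kmod J (b - kscale x w - kdiff y) -> kmod J (a - kdiff w).
  move=> h; apply: (kmod_nonzerodiv nz); rewrite kscaleB -kdiffZ.
  rewrite -[kscale x a](subrK (kdiff b)) -addrA -kdiffB; apply: kmodD => //.
  by have := kmod_kdiff idJ h; rewrite kdiffB kdiff_kdiff subr0.
have := van i t lti b hb dab; case: i lti hb ha => [|i] lti hb ha /=.
  move=> hB; have [w hw Jw] := kmod_lift idJ hJ hx hb hB.
  exists (w, 0) => /=; first by rewrite hw eqxx.
  rewrite kdiff0 subr0; split=> //; apply: (key w 0); by rewrite kdiff0 subr0.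
case=> y hy hB.
have hby : khomog i.+1 t (b - kdiff y).
  by apply: khomogB => //; have := khomog_kdiff hxs hy; rewrite subrK.
have [w hw Jw] := kmod_lift idJ hJ hx hby hB.
exists (w, - y) => /=; first by rewrite hw khomogN.
have Jw' : kmod J (b - kscale x w - kdiff y) by rewrite addrAC.
split; first exact: (key w y).
by rewrite kdiffN opprK opprD addrA.
Qed.

End Koszul.

Section Depth.
Variables (k : closedFieldType).
Local Notation S := {mpoly k[4]}.
Implicit Types (f g r : S) (J : S -> Prop).

Definition vanish_on (X : ('I_4 -> k) -> Prop) f : Prop := forall v, X v -> f.@[v] = 0.

Lemma vanish_on_ideal X : is_ideal (vanish_on X).
Proof.
split; first by move=> v _; rewrite meval0.
- by move=> f g hf hg v Xv; rewrite mevalD hf ?hg ?addr0.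
- by move=> f g hg v Xv; rewrite mevalM hg ?mulr0.
Qed.

Lemma vanish_on_homog (X : ('I_4 -> k) -> Prop) :
  (forall c v, X v -> X (fun i => v i * c)) -> is_homogeneous (vanish_on X).
Proof.
move=> cone f d hf v Xv; rewrite -line_coef0.
rewrite (_ : line_poly _ _ _ = 0) ?coef0 //; apply/eqP/negPn/negP => /poly_nonroot[t].
have E : f.@[fun i => 0 + v i * t] = f.@[fun i => v i * t].
  by apply: meval_eq => i; rewrite add0r.
by rewrite horner_line E hf ?eqxx //; exact: cone.
Qed.

(* the coordinate subspace x_0 = ... = x_(i-1) = 0 *)
Definition cut i (v : 'I_4 -> k) (j : 'I_4) : k := if (j < i)%N then 0 else v j.

Definition vanish_cut i f : Prop := forall v, f.@[cut i v] = 0.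

Lemma vanish_cutE i : vanish_cut i = vanish_on (fun v => exists w, v = cut i w).
Proof.
apply/funext => f; apply/propext; split; first by move=> h _ [w ->].
by move=> h v; apply: h; exists v.
Qed.

Lemma vanish_cut_ideal i : is_ideal (vanish_cut i).
Proof. by rewrite vanish_cutE; apply: vanish_on_ideal. Qed.

Lemma vanish_cut_homog i : is_homogeneous (vanish_cut i).
Proof.
rewrite vanish_cutE; apply: vanish_on_homog => c _ [w ->].
by exists (fun j => w j * c); apply/funext => j; rewrite /cut; case: ifP; rewrite ?mul0r.
Qed.

Lemma cut_poly i f : exists g, forall v, g.@[v] = f.@[cut i v].
Proof.
exists (mmap (@mpolyC 4 k) (fun j => if (j < i)%N then 0 else 'X_j) f) => v.
rewrite rmorph_mmap; apply: eq_mmap => j /=; first by rewrite mevalC.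
by rewrite /cut; case: ifP; rewrite ?meval0 ?mevalXU.
Qed.

Lemma vanish_cut_nonzerodiv (i : 'I_4) : nonzerodiv (vanish_cut i) 'X_i.
Proof.
move=> f h; have [g gE] := cut_poly i f; suff g0 : g = 0 by move=> v; rewrite -gE g0 meval0.
apply: (mulfI (_ : 'X_i != 0)); last first.
  rewrite mulr0; apply: mpoly_fun0 => v; rewrite mevalM gE mevalXU.
  by have := h v; rewrite mevalM mevalXU /cut ltnn.
by apply/eqP => /mpolyP/(_ U_(i)%MM); rewrite mcoeffX eqxx mcoeff0 => /eqP; rewrite oner_eq0.
Qed.

Lemma vanish_cutS (i : 'I_4) f : vanish_cut i.+1 f <-> addI (vanish_cut i) 'X_i f.
Proof.
split; last first.
  move=> [a [b [ha ->]]] v; rewrite mevalD mevalM mevalXU {2}/cut ltnS leqnn mul0r addr0.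
  rewrite -[RHS](ha (cut i.+1 v)); apply: meval_eq => j; rewrite /cut.
  by case: ltnP => // le; case: ifP => // /(leq_ltn_trans le); rewrite ltnNge leqnSn.
move=> h; pose u i (j : 'I_4) : S := if (j < i)%N then 0 else 'X_j.
pose g := mmap (@mpolyC 4 k) (u i) f; pose g' := mmap (@mpolyC 4 k) (u i.+1) f.
have gE i' v : (mmap (@mpolyC 4 k) (u i') f).@[v] = f.@[cut i' v].
  rewrite rmorph_mmap; apply: eq_mmap => j /=; first by rewrite mevalC.
  by rewrite /u /cut; case: ifP; rewrite ?meval0 ?mevalXU.
have g'0 : g' = 0 by apply: mpoly_fun0 => v; rewrite gE.
have [|c] := @mmap_congr _ _ _ (@mpolyC 4 k) (u i) (u i.+1) f 'X_i.
  move=> j; rewrite /u ltnS; case: ltngtP => [lt|gt|e]; rewrite ?subrr.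
  - by exists 0; rewrite mulr0.
  - by exists 0; rewrite mulr0.
  - by exists 1; rewrite mulr1 subr0; congr 'X_(_); apply/val_inj.
rewrite -/g -/g' g'0 subr0 => gc; exists (f - g), c; rewrite -gc subrK; split=> // v.
rewrite mevalB gE; apply/eqP; rewrite subr_eq0; apply/eqP; apply: meval_eq => j.
by rewrite /cut; case: ifP => // ->.
Qed.

Definition vars : seq S := [:: 'X_(inord 0); 'X_(inord 1); 'X_(inord 2); 'X_(inord 3)].

Lemma vars_homog : all (fun x => x \is 1.-homog) vars.
Proof. by rewrite /= !mpolyX_homog. Qed.

Lemma kvanish_vars i t : (i < 4)%N -> kvanish vars (fun f => f = 0) i t.
Proof.
have -> : (fun f : S => f = 0) = vanish_cut 0.
  by apply/funext => f; apply/propext; split=> [-> v|h]; [rewrite meval0 | apply: mpoly_fun0].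
have step j xs : (j < 4)%N -> all (fun x : S => x \is 1.-homog) xs ->
    (forall i t, (i < size xs)%N -> kvanish xs (vanish_cut j.+1) i t) ->
    forall i t, (i < (size xs).+1)%N -> kvanish ('X_(inord j) :: xs) (vanish_cut j) i t.
  move=> lt hxs H i' t' lti.
  have jE : nat_of_ord (inord j : 'I_4) = j by rewrite inordK.
  apply: (@kvanish_cons _ _ _ _ _ (vanish_cut j.+1)) => //.
  - exact: vanish_cut_ideal.
  - exact: vanish_cut_homog.
  - by move=> f; have := vanish_cutS (inord j) f; rewrite jE.
  - exact: mpolyX_homog.
  - by have := @vanish_cut_nonzerodiv (inord j); rewrite jE.
pose x j : S := 'X_(inord j).
have hx j : x j \is 1.-homog by apply: mpolyX_homog.
have van3 : forall i t, (i < 1)%N -> kvanish [:: x 3] (vanish_cut 3) i t.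
  by apply: (step 3 [::]).
have van2 : forall i t, (i < 2)%N -> kvanish [:: x 2; x 3] (vanish_cut 2) i t.
  by apply: (step 2 [:: x 3]); rewrite //= hx.
have van1 : forall i t, (i < 3)%N -> kvanish [:: x 1; x 2; x 3] (vanish_cut 1) i t.
  by apply: (step 1 [:: x 2; x 3]); rewrite //= !hx.
by apply: (step 0 [:: x 1; x 2; x 3]); rewrite //= !hx.
Qed.

Lemma kvanish_socle J d f : is_ideal J -> kvanish vars J 0 d%:Z -> f \is d.-homog ->
  (forall j, J ('X_j * f)) -> J f.
Proof.
move=> idJ van hf xf.
have := van ((((f, 0), 0), 0), 0); rewrite /= hf !eqxx /= => /(_ isT).
have J0 := ideal0 idJ.
case; last by case=> [[[]]].
by rewrite !mulr0 !subr0.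
Qed.

(** ** Regular sequences of length at most three *)

Fixpoint regular_chain J (rs : seq S) : Prop :=
  if rs is r :: rs' then nonzerodiv J r /\ regular_chain (addI J r) rs' else True.

Fixpoint addIs J (rs : seq S) : S -> Prop :=
  if rs is r :: rs' then addIs (addI J r) rs' else J.

(** With rs of degrees ds, cohomology in degree i is pushed up to cohomology of
    degree i + size rs, with t shifted by size rs - sum ds. *)
Lemma kvanish_chain J (rs : seq S) (ds : seq nat) i (t : int) : is_ideal J -> is_homogeneous J ->
  all2 (fun r d => r \is d.-homog) rs ds -> regular_chain J rs ->
  (forall i' t', (i' < i + size rs)%N -> kvanish vars J i' t') ->
  kvanish vars J (i + size rs) (t + (size rs)%:Z - (sumn ds)%:Z) ->
  kvanish vars (addIs J rs) i t.
Proof.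
elim: rs ds J i t => [|r rs IH] [|d ds] J i t idJ hJ //=.
  by rewrite addn0 subr0 addr0.
move=> /andP[hr hrs] [nz reg] van top.
have idJr := addI_ideal r idJ; have hJr := addI_homog hJ hr.
apply: IH hrs reg _ _ => //.
  move=> i' t' lt; apply: kvanish_quot hr nz vars_homog _ _ => //; apply: van.
    by rewrite addnS (leq_trans lt) // leqW // leqnn.
  by rewrite addnS ltnS.
apply: kvanish_quot hr nz vars_homog _ _ => //; first by apply: van; rewrite addnS ltnS leqnn.
rewrite addnS in top.
rewrite (_ : _ + 1 - d%:Z = t + (size rs).+1%:Z - (d + sumn ds)%N%:Z) //.
by rewrite PoszD intS; ring.
Qed.

Lemma chain_socle (rs : seq S) ds d f :
  all2 (fun r d => r \is d.-homog) rs ds -> regular_chain (fun f => f = 0) rs ->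
  (size rs < 4)%N || (size rs == 4%N) && (d + 4 < sumn ds)%N ->
  f \is d.-homog -> (forall j, addIs (fun f => f = 0) rs ('X_j * f)) ->
  addIs (fun f => f = 0) rs f.
Proof.
move=> hrs reg cond; have id0 : is_ideal (fun f : S => f = 0).
  by split=> [|f1 f2 -> ->|f1 f2 ->]; rewrite ?addr0 ?mulr0.
have h0 : is_homogeneous (fun f : S => f = 0) by move=> f1 e ->; rewrite pihomog0.
have idJ : is_ideal (addIs (fun f => f = 0) rs).
  elim: (rs) (fun f => f = 0) id0 {hrs reg cond} => [|r rs' IH] J idJ //=.
  by apply: IH; apply: addI_ideal.
apply: kvanish_socle => //; apply: (kvanish_chain id0 h0 hrs reg) => [i' t' lt|].
  by apply: kvanish_vars; case/orP: cond => [|/andP[/eqP<-]] // /ltnW/(leq_trans _)->.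
case/orP: cond => [lt|/andP[/eqP-> lt]]; first exact: kvanish_vars.
rewrite -PoszD -opprB subzn ?(ltnW lt) //.
move: lt; rewrite -subn_gt0; case: (_ - _)%N => // e _; rewrite -NegzE.
exact: kvanish_neg.
Qed.

End Depth.

(** * Hilbert functions and Gorenstein weights of complete intersections *)

Lemma homogM n (R : comNzRingType) d e m (f g : {mpoly R[n]}) :
  f \is d.-homog -> g \is e.-homog -> m = (d + e)%N -> f * g \is m.-homog.
Proof. by move=> hf hg ->; apply: dhomogM. Qed.

Section ClassicalSubspace.
Variables (k : fieldType) (vT : vectType k).
Implicit Types (P : vT -> Prop) (U : {vspace vT}).

Definition linear_pred P : Prop := P 0 /\ forall c x y, P x -> P y -> P (c *: x + y).

Lemma linear_predP P : linear_pred P -> exists U, forall x, (x \in U) <-> P x.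
Proof.
move=> [P0 PL].
have PL_sub U x : (forall z, z \in U -> P z) -> P x -> (forall z, z \in (U + <[x]>)%VS -> P z).
  move=> hU Px z /memv_addP[z1 /hU h1 [z2 /vlineP[c' ->] ->]].
  by rewrite addrC; apply: PL.
pose sub n := `[< exists2 U : {vspace vT}, \dim U = n & forall z, z \in U -> P z >].
have ex0 : exists n, sub n.
  by exists 0%N; apply/asboolP; exists 0%VS; rewrite ?dimv0 // => z; rewrite memv0 => /eqP->.
have bnd n : sub n -> (n <= \dim {:vT})%N.
  by move/asboolP => [U <- _]; apply: dimvS; apply: subvf.
case: (ex_maxnP ex0 bnd) => n /asboolP[U dU hU] max; exists U => x; split; first exact: hU.
move=> Px; have le : (\dim (U + <[x]>)%VS <= n)%N.
  by apply: max; apply/asboolP; exists (U + <[x]>)%VS => //; exact: (PL_sub U x hU Px).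
rewrite -dU in le; have : (U + <[x]>)%VS == U by rewrite eq_sym eqEdim addvSl.
by move/eqP => <-; apply: (subvP (addvSr U <[x]>)); apply: memv_line.
Qed.

Definition vspace_of P : {vspace vT} :=
  if pselect (exists U, forall x, (x \in U) <-> P x) is left h then projT1 (cid h) else 0%VS.

Lemma vspace_ofP P x : linear_pred P -> x \in vspace_of P <-> P x.
Proof.
move=> /linear_predP h; rewrite /vspace_of; case: pselect => // h'.
by case: (cid h').
Qed.

End ClassicalSubspace.

Section HilbertFunction.
Variables (k : closedFieldType).
Local Notation S := {mpoly k[4]}.
Implicit Types (f g r : S) (J : S -> Prop).

Definition additive_pred J : Prop :=
  J 0 /\ forall (c : k) f g, J f -> J g -> J (c *: f + g).

Lemma ideal_additive J : is_ideal J -> additive_pred J.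
Proof.
by move=> [J0 JD JM]; split=> // c f g Jf Jg; apply: JD => //; rewrite -mul_mpolyC; apply: JM.
Qed.

Definition homform d f (hf : f \is d.-homog) : dhomog 4 k d := DHomog hf.

Definition piece J d : {vspace dhomog 4 k d} := vspace_of (fun f : dhomog 4 k d => J f).

Lemma pieceP J d (x : dhomog 4 k d) : additive_pred J -> x \in piece J d <-> J x.
Proof.
move=> [J0 JL]; apply: vspace_ofP; split; first by rewrite linear0.
by move=> c u v Ju Jv; rewrite linearP; apply: JL.
Qed.

Definition dimS d := \dim {: dhomog 4 k d}.
Definition hilb J d := (dimS d - \dim (piece J d))%N.

Lemma dimS_E d : dimS d = 'C(d + 3, 3).
Proof. by rewrite /dimS dimvf -[RHS]bin_sub ?leq_addl // addnK. Qed.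

Lemma dim_piece_le J d : (\dim (piece J d) <= dimS d)%N.
Proof. by apply: dimvS; apply: subvf. Qed.

Lemma hilb_le J J' d : additive_pred J -> additive_pred J' ->
  (forall f, f \is d.-homog -> J f -> J' f) -> (hilb J' d <= hilb J d)%N.
Proof.
move=> aJ aJ' h; apply: leq_sub2l; apply: dimvS; apply/subvP => x /pieceP-/(_ aJ) Jx.
by apply/pieceP => //; apply: h => //; apply: valP.
Qed.

Lemma hilb_eq J J' d : additive_pred J -> additive_pred J' ->
  (forall f, f \is d.-homog -> J f -> J' f) -> (hilb J d <= hilb J' d)%N ->
  forall f, f \is d.-homog -> J' f -> J f.
Proof.
move=> aJ aJ' h le f hf J'f.
have sub : (piece J d <= piece J' d)%VS.
  by apply/subvP => x /pieceP-/(_ aJ) Jx; apply/pieceP => //; apply: h => //; apply: valP.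
have : piece J d == piece J' d.
  rewrite eqEdim sub /=; have := dim_piece_le J d; have := dim_piece_le J' d.
  by move: le; rewrite /hilb; lia.
move/eqP => e; have : homform hf \in piece J' d by apply/pieceP.
by rewrite -e => /pieceP-/(_ aJ).
Qed.

Lemma hilb0 J d : additive_pred J -> hilb J d = 0%N -> forall f, f \is d.-homog -> J f.
Proof.
move=> aJ h0 f hf; apply: (@hilb_eq J (fun _ => True) d) => //; by rewrite h0.
Qed.

Lemma hilb1 J d : additive_pred J -> hilb J d = 1%N ->
  exists w, [/\ w \is d.-homog, ~ J w & forall f, f \is d.-homog -> exists c : k, J (f - c *: w)].
Proof.
move=> aJ h1.
have [w wJ] : exists w : dhomog 4 k d, w \notin piece J d.
  apply: contrapT => H; have : (fullv <= piece J d)%VS.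
    by apply/subvP => x _; apply: contrapT => /negP h; apply: H; exists x.
  by move/dimvS; move: h1; rewrite /hilb /dimS; lia.
exists w; split; first exact: valP.
  by move/(pieceP _ aJ); apply/negP.
have full : (piece J d + <[w]>)%VS = fullv.
  apply/eqP; rewrite eqEdim subvf /= dimv_disjoint_sum; last first.
    apply/eqP; rewrite -subv0; apply/subvP => x; rewrite memv_cap => /andP[xJ /vlineP[c cx]].
    have [c0|c0] := eqVneq c 0; first by rewrite cx c0 scale0r mem0v.
    by case/negP: wJ; rewrite -[w]scale1r -(mulVf c0) -scalerA -cx memvZ.
  rewrite dim_vline; have -> : w != 0 by apply: contraNneq wJ => ->; rewrite mem0v.
  by have := dim_piece_le J d; move: h1; rewrite /hilb /dimS; lia.
move=> f hf; have : homform hf \in (piece J d + <[w]>)%VS by rewrite full memvf.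
case/memv_addP => y yJ [_ /vlineP[c ->] e]; exists c.
have /= -> : f = val y + c *: val w by rewrite -[f]/(val (homform hf)) e linearD linearZ.
by rewrite addrK; apply/(pieceP _ aJ).
Qed.

Lemma hilb_arith (A U b c K z X Y : nat) : (K <= Y)%N -> (A <= X)%N -> (U <= X)%N ->
  (z + b = Y -> z + c = K -> A + c = U + b -> X - A + (Y - K) = X - U)%N.
Proof. lia. Qed.

Section MulMap.
Variables (r : S) (e d : nat).
Hypothesis hr : r \is e.-homog.

Definition mulmap (f : dhomog 4 k d) : dhomog 4 k (e + d) := homform (dhomogM hr (valP f)).

Lemma mulmap_linear : linear mulmap.
Proof. by move=> c f g; apply/val_inj; rewrite [RHS]linearP /= mulrDr -scalerAr. Qed.

HB.instance Definition _ := GRing.isLinear.Build k _ _ _ mulmap mulmap_linear.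

Lemma hilb_addI J : is_ideal J -> is_homogeneous J ->
  (hilb (addI J r) (e + d) + hilb (fun f => J (r * f)%R) d = hilb J (e + d))%N.
Proof.
move=> idJ hJ; have aJ := ideal_additive idJ.
pose m := linfun mulmap; pose U := piece J (e + d).
have aC : additive_pred (fun f => J (r * f)).
  by split=> [|c f g Jf Jg]; [rewrite mulr0; case: idJ | rewrite mulrDr -scalerAr; case: aJ => _; apply].
set K := piece (fun f => J (r * f)) d.
have mE (f : dhomog 4 k d) : (m f : S) = r * (f : S) by rewrite lfunE.
have EK : (m @: K = U :&: limg m)%VS.
  apply/vspaceP => y; rewrite memv_cap; apply/memv_imgP/andP => [[x xK ->]|[yU /memv_imgP[x _ yx]]].
    split; last by rewrite memv_img ?memvf.
    by apply/(pieceP _ aJ); rewrite mE; apply/(pieceP _ aC).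
  by exists x => //; apply/(pieceP _ aC); rewrite -mE -yx; apply/(pieceP _ aJ).
have EA : piece (addI J r) (e + d) = (U + limg m)%VS.
  apply/vspaceP => y; apply/idP/idP => [/(pieceP _ (ideal_additive (addI_ideal r idJ)))|].
    move=> [a [b [Ja yE]]].
    have ha := pihomogP mdeg (e + d) a; have hb := pihomogP mdeg d b.
    apply/memv_addP; exists (homform ha); first by apply/(pieceP _ aJ); apply: hJ.
    exists (m (homform hb)); first by rewrite memv_img ?memvf.
    apply/val_inj; rewrite linearD /= mE /= -(pihomogM _ _ hr) -pihomogD -yE pihomog_dE //.
    exact: valP.
  case/memv_addP => a /(pieceP _ aJ) Ja [_ /memv_imgP[b _ ->] ->].
  apply/(pieceP _ (ideal_additive (addI_ideal r idJ))); exists (a : S), (b : S).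
  by rewrite linearD /= mE.
have kerK : (K :&: lker m = fullv :&: lker m)%VS.
  apply/vspaceP => x; rewrite !memv_cap memvf /=; case: (boolP (x \in lker m)); rewrite ?andbF ?andbT //.
  rewrite memv_ker => /eqP mx; apply/(pieceP _ aC); rewrite -mE mx linear0; by case: idJ.
have := dimv_sum_cap U (limg m); have := limg_ker_dim m K; have := limg_ker_dim m fullv.
rewrite kerK -EK -EA /hilb /dimS.
have := dim_piece_le J (e + d); have := dim_piece_le (addI J r) (e + d).
have := dim_piece_le (fun f => J (r * f)) d; rewrite /dimS -/K -/U.
exact: hilb_arith.
Qed.

End MulMap.

Lemma hilb_ext J J' d : additive_pred J -> additive_pred J' ->
  (forall f, f \is d.-homog -> J f <-> J' f) -> hilb J d = hilb J' d.
Proof.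
move=> aJ aJ' h; apply/eqP; rewrite eqn_leq !hilb_le // => f hf; by move/h; apply.
Qed.

Lemma colon_additive J r : is_ideal J -> additive_pred (fun f => J (r * f)).
Proof.
move=> idJ; have [J0 JL] := ideal_additive idJ.
by split=> [|c f g Jf Jg]; [rewrite mulr0 | rewrite mulrDr -scalerAr; apply: JL].
Qed.

Lemma hilb_nonzerodiv J r e d : is_ideal J -> is_homogeneous J -> r \is e.-homog ->
  nonzerodiv J r -> (hilb (addI J r) (e + d) + hilb J d = hilb J (e + d))%N.
Proof.
move=> idJ hJ hr nz; rewrite -(hilb_addI d hr idJ hJ); congr (_ + _)%N.
apply: hilb_ext; [exact: ideal_additive | exact: colon_additive |].
by move=> f _; split; [exact: idealMl | apply: nz].
Qed.

Lemma hilb_addI_ge J r e d : is_ideal J -> is_homogeneous J -> r \is e.-homog ->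
  (hilb J (e + d) <= hilb (addI J r) (e + d) + hilb J d)%N.
Proof.
move=> idJ hJ hr; rewrite -(hilb_addI d hr idJ hJ) leq_add2l.
apply: hilb_le; [exact: ideal_additive | exact: colon_additive |].
by move=> f _; exact: idealMl.
Qed.

Lemma nonzerodiv_hilb J r e d : is_ideal J -> is_homogeneous J -> r \is e.-homog ->
  (hilb (addI J r) (e + d) + hilb J d <= hilb J (e + d))%N ->
  forall f, f \is d.-homog -> J (r * f) -> J f.
Proof.
move=> idJ hJ hr; rewrite -(hilb_addI d hr idJ hJ) leq_add2l => le.
apply: (hilb_eq (ideal_additive idJ) (colon_additive r idJ)) => // f _; exact: idealMl.
Qed.

Lemma hilb_addI_low J r e d : is_ideal J -> is_homogeneous J -> r \is e.-homog -> (d < e)%N ->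
  hilb (addI J r) d = hilb J d.
Proof.
move=> idJ hJ hr lt; have idr := addI_ideal r idJ.
apply: hilb_ext; try exact: ideal_additive.
move=> f hf; split; last by move=> Jf; exists f, 0; rewrite mulr0 addr0.
move=> [a [b [Ja fE]]]; rewrite -(pihomog_dE hf) fE pihomogD (pihomogM_small _ hr) // addr0.
exact: hJ.
Qed.

Lemma form_linearP d (c : k) (f g : dhomog 4 k d) :
  (c *: f + g : dhomog 4 k d) = c *: (f : S) + (g : S) :> S.
Proof. exact: (linearP (@mpoly_of_dhomog 4 k d)). Qed.

End HilbertFunction.

(** ** Finite sets of points off a plane *)

Section Points.
Variables (k : closedFieldType).
Local Notation S := {mpoly k[4]}.
Local Notation pt := 'rV[k]_4.
Implicit Types (f g l : S) (J : S -> Prop) (M : seq pt).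

Definition vanishes M f : Prop := forall P, P \in M -> f.@[P 0] = 0.

Lemma vanishes_ideal M : is_ideal (vanishes M).
Proof.
split; first by move=> P _; rewrite meval0.
- by move=> f g hf hg P PM; rewrite mevalD hf ?hg ?addr0.
- by move=> f g hg P PM; rewrite mevalM hg ?mulr0.
Qed.

Definition normalized l M : Prop := l \is 1.-homog /\ forall P, P \in M -> l.@[P 0] = 1.

Lemma normalizedW l M M' : {subset M' <= M} -> normalized l M -> normalized l M'.
Proof. by move=> sub [hl lM]; split=> // P /sub/lM. Qed.

Lemma homogX l n : l \is 1.-homog -> l ^+ n \is n.-homog.
Proof.
by move=> hl; have := dhomogMn n hl; rewrite mul1n.
Qed.

(** Points off the plane l = 0 have representatives with l = 1, where multiplication by l changes
    the degree of a form but not its values. *)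
Lemma raise_degree l M f d n : normalized l M -> f \is d.-homog ->
  exists2 g, g \is (n + d).-homog & forall P, P \in M -> g.@[P 0] = f.@[P 0].
Proof.
move=> [hl lM] hf; exists (l ^+ n * f); first by apply: dhomogM => //; apply: homogX.
by move=> P /lM lP; rewrite mevalM rmorphXn /= lP expr1n mul1r.
Qed.

Lemma separate l M P : normalized l (P :: M) -> P \notin M ->
  exists2 f, f \is (size M).-homog & f.@[P 0] != 0 /\ vanishes M f.
Proof.
move=> [hl lM]; elim: M lM => [|Q M IH] lM.
  by exists 1; rewrite ?dhomog1 //; split; [rewrite meval1 oner_neq0 | move=> ?].
rewrite inE negb_or => /andP[PQ PM].
have [R|f hf [fP fM]] := IH _ PM.
  by rewrite inE => /orP[/eqP->|RM]; apply: lM; rewrite !inE ?eqxx // RM !orbT.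
have [j ne] : exists j, P 0 j != Q 0 j.
  apply: contrapT => H; case/eqP: PQ; apply/rowP => j.
  by apply/eqP/negPn/negP => ne; apply: H; exists j.
have lP : l.@[P 0] = 1 by apply: lM; rewrite inE eqxx.
have lQ : l.@[Q 0] = 1 by apply: lM; rewrite !inE eqxx orbT.
exists (('X_j - Q 0 j *: l) * f).
  apply: (homogM (d := 1)) hf _ => //; apply: rpredB; first exact: mpolyX_homog.
  exact: rpredZ.
have E R : (('X_j - Q 0 j *: l) * f).@[R 0] = (R 0 j - Q 0 j * l.@[R 0]) * f.@[R 0].
  by rewrite mevalM mevalB mevalZ mevalXU.
split; first by rewrite E lP mulr1 mulf_neq0 // subr_eq0.
move=> R; rewrite inE E => /orP[/eqP->|/fM->]; last by rewrite mulr0.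
by rewrite lQ mulr1 subrr mul0r.
Qed.

Lemma interpolate l M (u : pt -> k) d : uniq M -> normalized l M -> (size M <= d)%N ->
  exists2 f, f \is d.-homog & forall P, P \in M -> f.@[P 0] = u P.
Proof.
move=> uM nM le.
suff [f hf fE] : exists2 f, f \is (size M).-homog & forall P, P \in M -> f.@[P 0] = u P.
  have [g hg gE] := raise_degree (d - size M) nM hf.
  by exists g => [|P PM]; [rewrite subnK in hg | rewrite gE // fE].
elim: M uM nM {le} => [|P M IH] /=; first by exists 0; rewrite ?dhomog0.
move=> /andP[PM uM] nM.
have sub : {subset M <= P :: M} by move=> Q QM; rewrite inE QM orbT.
have [f hf fE] := IH uM (normalizedW sub nM).
have [g hg [gP gM]] := separate nM PM.
have [f' hf' f'E] := raise_degree 1 nM hf.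
have [g' hg' g'E] := raise_degree 1 nM hg.
exists (f' + ((u P - f'.@[P 0]) / g.@[P 0]) *: g').
  by apply: rpredD => //; apply: rpredZ.
have PP : P \in P :: M by rewrite inE eqxx.
move=> Q; rewrite inE mevalD mevalZ => /orP[/eqP->|QM].
  by rewrite g'E // divfK // addrC subrK.
by rewrite g'E ?sub // gM // mulr0 addr0 f'E ?sub // fE.
Qed.

Lemma hilb_points l M d : uniq M -> normalized l M -> (size M <= d)%N ->
  hilb (vanishes M) d = size M.
Proof.
move=> uM nM le; pose ev (f : dhomog 4 k d) : 'rV[k]_(size M) :=
  \row_i (f : S).@[(tnth (in_tuple M) i) 0].
have ev_lin : linear ev.
  by move=> c f g; apply/rowP => i; rewrite !mxE form_linearP mevalD mevalZ.
pose evL := GRing.isLinear.Build k _ _ _ ev ev_lin.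
pose evl : {linear dhomog 4 k d -> 'rV[k]_(size M)} := HB.pack ev evL.
pose m := linfun evl.
have kerE : lker m = piece (vanishes M) d.
  apply/vspaceP => f; apply/idP/idP.
    rewrite memv_ker lfunE /= => /eqP e; apply/(pieceP _ (ideal_additive (vanishes_ideal M))).
    move=> P /(tnthP (in_tuple M))[i ->]; by have /rowP/(_ i) := e; rewrite !mxE.
  move/(pieceP _ (ideal_additive (vanishes_ideal M))) => h.
  rewrite memv_ker lfunE /=; apply/eqP/rowP => i; rewrite !mxE h //; exact: mem_tnth.
have imE : limg m = fullv.
  apply/vspaceP => v; rewrite memvf; apply/memv_imgP.
  have [f hf fE] := interpolate (fun P => \sum_i (P == tnth (in_tuple M) i)%:R * v 0 i) uM nM le.
  exists (homform hf); first exact: memvf.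
  rewrite lfunE; apply/rowP => i; rewrite mxE fE ?mem_tnth // (bigD1 i) //= eqxx mul1r.
  rewrite big1 ?addr0 // => j ji; case: eqP => [e|]; last by rewrite mul0r.
  by case/eqP: ji; apply/val_inj/eqP; move: e => /eqP;
    rewrite !(tnth_nth 0) nth_uniq //= eq_sym.
have := limg_ker_dim m fullv; rewrite capfv kerE imE /hilb /dimS !dimvf.
have -> : dim 'rV[k]_(size M) = size M by rewrite /dim /= mul1n.
by move=> <-; rewrite addKn.
Qed.

End Points.

Definition hpoly d : nat := ('C(d + 3, 3) - 'C(d, 3))%N.

Lemma hpolyE d : (2 * hpoly d = 3 * d ^ 2 + 3 * d + 2)%N.
Proof.
have bin2' m : (2 * 'C(m.+1, 2) = m.+1 * m)%N by have := mul_bin_diag m.+1 1; rewrite bin1; lia.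
rewrite /hpoly addn3 !binS bin0.
case: d => [|d]; first by [].
have := bin2' d; have := bin2' d.+1; have := bin2' d.+2.
rewrite !binS !bin0 !bin1; lia.
Qed.

Lemma hpoly_diff a q d :
  (hpoly (a + (q + d)) + hpoly d = hpoly (a + d) + hpoly (q + d) + 3 * q * a)%N.
Proof.
have := hpolyE (a + (q + d)); have := hpolyE d; have := hpolyE (a + d); have := hpolyE (q + d).
by rewrite -!mulnn; lia.
Qed.

(* hpoly (-1) would be 1 by the quadratic formula, but no form has degree -1 *)
Lemma hpoly_diff1 a q : (hpoly (a.+1 + q) + 1 = hpoly a + hpoly q + 3 * q.+1 * a.+1)%N.
Proof.
have := hpolyE (a.+1 + q); have := hpolyE a; have := hpolyE q.
by rewrite -!mulnn; lia.
Qed.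

Section CompleteIntersection.
Variables (k : closedFieldType) (F : {mpoly k[4]}).
Hypothesis hF : smooth_cubic_surface F.
Local Notation S := {mpoly k[4]}.
Local Notation pt := 'rV[k]_4.
Implicit Types (f g l : S) (J : S -> Prop) (M : seq pt).

Definition zeroI : S -> Prop := fun f => f = 0.

Lemma zeroI_ideal : is_ideal zeroI.
Proof. by split=> [|f g -> ->|f g ->]; rewrite /zeroI ?addr0 ?mulr0. Qed.

Lemma zeroI_homog : is_homogeneous zeroI.
Proof. by move=> f d ->; exact: pihomog0. Qed.

Lemma zeroI_nonzerodiv f : f != 0 -> nonzerodiv zeroI f.
Proof. by move=> f0 g /eqP; rewrite mulf_eq0 (negbTE f0) => /eqP. Qed.

Definition idealF := addI zeroI F.

Lemma idealFE f : idealF f <-> divides F f.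
Proof.
split; first by move=> [a [b [-> ->]]]; exists b; rewrite add0r.
by move=> [b ->]; exists 0, b; rewrite add0r.
Qed.

Lemma idealF_ideal : is_ideal idealF. Proof. exact/addI_ideal/zeroI_ideal. Qed.
Lemma idealF_homog : is_homogeneous idealF.
Proof. exact: addI_homog zeroI_homog (cubic_homog hF). Qed.

Lemma hilb_idealF d : hilb idealF d = hpoly d.
Proof.
have hz e : hilb zeroI e = 'C(e + 3, 3).
  rewrite /hilb (_ : piece zeroI e = 0%VS) ?dimv0 ?subn0 ?dimS_E //.
  apply/vspaceP => f; rewrite memv0; apply/idP/eqP.
    by move/(pieceP _ (ideal_additive zeroI_ideal)) => f0; apply/val_inj; rewrite linear0.
  by move=> ->; rewrite mem0v.
have nz := zeroI_nonzerodiv (cubic_neq0 hF).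
have [lt|le] := ltnP d 3.
  rewrite (hilb_addI_low zeroI_ideal zeroI_homog (cubic_homog hF) lt) hz /hpoly.
  by rewrite ['C(d, 3)]bin_small ?subn0.
have := hilb_nonzerodiv (d - 3) zeroI_ideal zeroI_homog (cubic_homog hF) nz.
by rewrite -/idealF !hz subnKC // subnK // /hpoly => <-; rewrite addnK.
Qed.

Lemma idealF_nonzerodiv G : ~ divides F G -> nonzerodiv idealF G.
Proof.
move=> nG f /idealFE/(cubic_prime hF)[//|dv]; exact/idealFE.
Qed.

Section Curve.
Variables (G : S) (q : nat).
Hypotheses (hG : G \is q.-homog) (nG : ~ divides F G).

Definition idealC := addI idealF G.
Lemma idealC_ideal : is_ideal idealC. Proof. exact/addI_ideal/idealF_ideal. Qed.
Lemma idealC_homog : is_homogeneous idealC. Proof. exact: addI_homog idealF_homog hG. Qed.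

Lemma hilb_idealC_low d : (d < q)%N -> hilb idealC d = hpoly d.
Proof.
by move=> lt; rewrite (hilb_addI_low idealF_ideal idealF_homog hG lt) hilb_idealF.
Qed.

Lemma hilb_idealC d : (hilb idealC (q + d) + hpoly d = hpoly (q + d))%N.
Proof.
rewrite -!hilb_idealF; apply: hilb_nonzerodiv => //;
  [exact: idealF_ideal | exact: idealF_homog | exact: idealF_nonzerodiv].
Qed.

Lemma idealC_socle f d : f \is d.-homog -> (forall j, idealC ('X_j * f)) -> idealC f.
Proof.
move=> hf xf; apply: (@chain_socle _ [:: F; G] [:: 3; q]%N d) => //=.
  by rewrite (cubic_homog hF) hG.
by split; [exact: zeroI_nonzerodiv (cubic_neq0 hF) | split; [exact: idealF_nonzerodiv |]].
Qed.

Lemma addIE J r f : (exists2 g, J (f - r * g) & True) -> addI J r f.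
Proof. by move=> [g h _]; exists (f - r * g), g; rewrite subrK. Qed.

Section Surface.
Variables (A : S) (da : nat).
Hypothesis hA : A \is da.-homog.
Definition idealM := addI idealC A.

Lemma idealM_ideal : is_ideal idealM. Proof. exact/addI_ideal/idealC_ideal. Qed.
Lemma idealM_homog : is_homogeneous idealM. Proof. exact: addI_homog idealC_homog hA. Qed.

Lemma idealM_gen f : f = F \/ f = G \/ f = A -> idealM f.
Proof.
have subI J r g : is_ideal J -> J g -> addI J r g by move=> _ Jg; exists g, 0; rewrite mulr0 addr0.
have self J r : is_ideal J -> addI J r r.
  by move=> idJ; exists 0, 1; rewrite add0r mulr1; split=> //; case: idJ.
case=> [->|[->|->]].
- by apply/(subI _ _ _ idealC_ideal)/(subI _ _ _ idealF_ideal)/self/zeroI_ideal.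
- by apply/(subI _ _ _ idealC_ideal)/self/idealF_ideal.
- exact: self idealC_ideal.
Qed.

Lemma idealM_vanishes M : vanishes M F -> vanishes M G -> vanishes M A ->
  forall f, idealM f -> vanishes M f.
Proof.
move=> vF vG vA f [b [c [[b' [c' [[b'' [c'' [-> ->]]] ->]]] ->]]].
have idV := vanishes_ideal M.
have m r : vanishes M r -> forall x, vanishes M (r * x).
  by move=> vr x P /vr r0; rewrite mevalM r0 mul0r.
rewrite add0r; apply: (idealD idV); last exact: m.
by apply: (idealD idV); exact: m.
Qed.

Lemma hilb_idealM_ge d : (3 * q * da <= hilb idealM (da + (q + d)))%N.
Proof.
have := hilb_addI_ge (q + d) idealC_ideal idealC_homog hA.
have := hilb_idealC d; have := hilb_idealC (da + d).
rewrite -/idealM [(q + (da + d))%N]addnCA.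
have := hpoly_diff da q d; lia.
Qed.

(** A curve component in the surface A = 0 would make the Hilbert function grow
    beyond 3 q a. *)
Lemma idealC_nonzerodiv_of_hilb :
  (exists d0, forall d, (d0 <= d)%N -> (hilb idealM d <= 3 * q * da)%N) -> nonzerodiv idealC A.
Proof.
move=> [d0 H].
have high d f : (d0 + q <= d)%N -> f \is d.-homog -> idealC (A * f) -> idealC f.
  move=> le hf; apply: (nonzerodiv_hilb idealC_ideal idealC_homog hA) hf.
  have dE : d = (q + (d - q))%N by lia.
  have := H (da + d)%N; have := hilb_idealC (d - q); have := hilb_idealC (da + (d - q)).
  rewrite -/idealM [(q + (da + _))%N]addnCA -!dE.
  have := hpoly_diff da q (d - q); rewrite -dE; lia.
have step n : forall d f, (d0 + q <= d + n)%N -> f \is d.-homog -> idealC (A * f) -> idealC f.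
  elim: n => [|n IH] d f le hf Af; first by rewrite addn0 in le; apply: (high d).
  apply: (idealC_socle hf) => j; apply: (IH d.+1).
  - by rewrite addSnnS.
  - by apply: (homogM (d := 1) (mpolyX_homog k j) hf).
  - by rewrite mulrCA; apply: (idealMl idealC_ideal).
move=> f Af; rewrite (pihomog_partitionE (leqnn (mmeasure mdeg f))).
apply: (big_ind idealC) => [|x y|i _]; first exact: (ideal0 idealC_ideal).
  by move=> hx hy; apply: (idealD idealC_ideal).
apply: (step (d0 + q)%N i); [lia | exact: pihomogP |].
by rewrite -(pihomogM _ _ hA); apply: idealC_homog.
Qed.

Section Regular.
Hypothesis nA : nonzerodiv idealC A.

Lemma hilb_idealM d : hilb idealM (da + (q + d)) = (3 * q * da)%N.
Proof.
have := hilb_nonzerodiv (q + d) idealC_ideal idealC_homog hA nA.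
have := hilb_idealC d; have := hilb_idealC (da + d).
rewrite -/idealM [(q + (da + d))%N]addnCA.
have := hpoly_diff da q d; lia.
Qed.

Lemma hilb_idealM_socle : (0 < q)%N -> (0 < da)%N -> hilb idealM (da + q.-1) = (3 * q * da).-1.
Proof.
move=> q0 a0; have := hilb_nonzerodiv q.-1 idealC_ideal idealC_homog hA nA.
have lt : (q.-1 < q)%N by lia.
have := hilb_idealC_low lt; have := hilb_idealC da.-1.
rewrite -/idealM (_ : (q + da.-1 = da + q.-1)%N); last lia.
have := hpoly_diff1 da.-1 q.-1; rewrite !prednK //; lia.
Qed.

Lemma idealM_socle f d : f \is d.-homog -> (forall j, idealM ('X_j * f)) -> idealM f.
Proof.
move=> hf xf; apply: (@chain_socle _ [:: F; G; A] [:: 3; q; da]%N d) => //=.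
  by rewrite (cubic_homog hF) hG hA.
by split; [exact: zeroI_nonzerodiv (cubic_neq0 hF) | split; [exact: idealF_nonzerodiv |]].
Qed.

Section ReducedPoints.
Variables (l : S) (M : seq pt).
Hypotheses (q0 : (0 < q)%N) (a0 : (0 < da)%N) (uM : uniq M) (nM : normalized l M).
Hypotheses (vF : vanishes M F) (vG : vanishes M G) (vA : vanishes M A).

Lemma size_points_le : (size M <= 3 * q * da)%N.
Proof.
rewrite -(hilb_points uM nM (leq_addl (da + q) (size M))) -(hilb_idealM (size M)) addnA.
apply: hilb_le; [exact: ideal_additive idealM_ideal | exact: ideal_additive (vanishes_ideal M)|].
by move=> f _; exact: idealM_vanishes.
Qed.

Hypothesis sM : size M = (3 * q * da)%N.

Lemma vanishes_idealM f d : f \is d.-homog -> vanishes M f -> idealM f.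
Proof.
have high e g : (da + q + size M <= e)%N -> g \is e.-homog -> vanishes M g -> idealM g.
  move=> le; apply: hilb_eq.
  - exact: ideal_additive idealM_ideal.
  - exact: ideal_additive (vanishes_ideal M).
  - by move=> h _; exact: idealM_vanishes.
  - rewrite (hilb_points uM nM); last lia.
    by rewrite (_ : e = da + (q + (e - da - q)))%N ?hilb_idealM ?sM //; lia.
suff step n : forall e g, (da + q + size M <= e + n)%N -> g \is e.-homog -> vanishes M g -> idealM g.
  by apply: (step (da + q + size M)%N); exact: leq_addl.
elim: n => [|n IH] e g le hg vg; first by rewrite addn0 in le; apply: (high e).
apply: (idealM_socle hg) => j; apply: (IH e.+1).
- by rewrite addSnnS.
- by apply: (homogM (d := 1) (mpolyX_homog k j) hg).
- by apply: (idealMl (vanishes_ideal M)).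
Qed.

Let J := idealM.
Let Jl := addI J l.
Let s := (da + q)%N.

Let idJ : is_ideal J := idealM_ideal.
Let idJl : is_ideal Jl := addI_ideal l idJ.
Let hl : l \is 1.-homog := nM.1.

Lemma idealM_normal_nonzerodiv : nonzerodiv J l.
Proof.
move=> f lf; rewrite (pihomog_partitionE (leqnn (mmeasure mdeg f))).
apply: (big_ind J) => [|x y|i _]; [exact: (ideal0 idJ) | by move=> hx hy; apply: (idealD idJ) |].
apply: vanishes_idealM (pihomogP mdeg i f) _ => P PM.
have : J (l * pihomog mdeg i f) by rewrite -(pihomogM _ _ hl); apply: idealM_homog.
by move/(idealM_vanishes vF vG vA)/(_ P PM); rewrite mevalM nM.2 // mul1r.
Qed.

Lemma hilb_section d : (hilb Jl d.+1 + hilb J d = hilb J d.+1)%N.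
Proof. exact: (hilb_nonzerodiv d idJ idealM_homog hl idealM_normal_nonzerodiv). Qed.

(* forms modulo (J, l) are functions on M modulo those of one degree less *)
Lemma sectionP f d : f \is d.+1.-homog ->
  Jl f <-> exists2 g, g \is d.-homog & forall P, P \in M -> f.@[P 0] = g.@[P 0].
Proof.
move=> hf; split.
  move=> [b [c [Jb fE]]]; exists (pihomog mdeg d c); first exact: pihomogP.
  move=> P PM; rewrite -(pihomog_dE hf) fE pihomogD (pihomogM d c hl) mevalD mevalM nM.2 // mul1r.
  by rewrite (idealM_vanishes vF vG vA (idealM_homog _ Jb)) // add0r.
move=> [g hg E]; apply: addIE; exists g => //.
apply: (@vanishes_idealM _ d.+1).
  by apply: rpredB => //; apply: (homogM (d := 1) hl hg).
by move=> P PM; rewrite mevalB mevalM nM.2 // mul1r E // subrr.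
Qed.

Lemma section_high f d : (s < d)%N -> f \is d.-homog -> Jl f.
Proof.
move=> lt; apply: hilb0 (ideal_additive idJl) _ _.
have := hilb_section d.-1; rewrite prednK; last lia.
have -> : (d = da + (q + (d - da - q)))%N by rewrite /s in lt; lia.
have -> : ((da + (q + (d - da - q))).-1 = da + (q + (d - da - q).-1))%N by rewrite /s in lt; lia.
by rewrite /J !hilb_idealM; lia.
Qed.

Lemma functions_high (u : pt -> k) d : (s <= d)%N ->
  exists2 f, f \is d.-homog & forall P, P \in M -> f.@[P 0] = u P.
Proof.
suff H n : forall d, (s <= d)%N -> (size M <= d + n)%N ->
    exists2 f, f \is d.-homog & forall P, P \in M -> f.@[P 0] = u P.
  by move=> le; apply: (H (size M)) => //; exact: leq_addl.
elim: n => [|n IH] {}d le le'; first by apply: interpolate nM _; rewrite ?addn0 // in le' *.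
have [f hf fE] := IH d.+1 (leqW le) ltac:(by rewrite addSnnS).
have /(sectionP hf)[g hg gE] := section_high (d := d.+1) le hf.
by exists g => // P PM; rewrite -gE // fE.
Qed.

Lemma section_socle f d : (d < s)%N -> f \is d.-homog -> (forall j, Jl ('X_j * f)) -> Jl f.
Proof.
move=> lt hf xf; apply: (@chain_socle _ [:: F; G; A; l] [:: 3; q; da; 1]%N d) => //=.
- by rewrite (cubic_homog hF) hG hA hl.
- split; first exact: zeroI_nonzerodiv (cubic_neq0 hF).
  split; first exact: idealF_nonzerodiv.
  by split=> //; split=> //; exact: idealM_normal_nonzerodiv.
- by rewrite /s in lt; lia.
Qed.

Lemma section_reach n d f : (d + n = s)%N -> f \is d.-homog -> ~ Jl f ->
  exists2 g, g \is n.-homog & ~ Jl (f * g).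
Proof.
elim: n d f => [|n IH] d f e hf nf; first by exists 1; rewrite ?dhomog1 ?mulr1.
have [j nj] : exists j, ~ Jl ('X_j * f).
  apply: contrapT => H; apply: nf; apply: (section_socle _ hf); first lia.
  by move=> j; apply: contrapT => h; apply: H; exists j.
have [||g hg ng] := IH d.+1 ('X_j * f) _ _ nj; first lia.
  by apply: (homogM (d := 1) (mpolyX_homog k j) hf).
exists ('X_j * g); first by apply: (homogM (d := 1) (mpolyX_homog k j) hg).
by rewrite mulrCA mulrA.
Qed.

(** The socle of the Artinian quotient by a plane section is one-dimensional in
    degree s = q + a: the functional killing the forms of degree s - 1 on M
    induces a perfect duality. *)
Definition gorenstein_weights (X : seq pt) (sg : nat) (c : pt -> k) : Prop :=
  (forall f, f \is sg.-homog -> \sum_(P <- X) c P * f.@[P 0] = 0) /\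
  forall e (v : pt -> k),
    (forall j f, (j + e = sg)%N -> f \is j.-homog -> \sum_(P <- X) v P * f.@[P 0] = 0) ->
    exists2 g, g \is e.-homog & forall P, P \in X -> v P = c P * g.@[P 0].

Lemma ci_weights : exists c, gorenstein_weights M (q + da).-1 c.
Proof.
have s0 : (0 < s)%N by rewrite /s; lia.
have sE : s = s.-1.+1 by lia.
have h1 : hilb Jl s = 1%N.
  have e1 : hilb J s = (3 * q * da)%N by have := hilb_idealM 0; rewrite addn0.
  have e2 : hilb J s.-1 = (3 * q * da).-1.
    by rewrite -hilb_idealM_socle //; congr hilb; rewrite /s; lia.
  have := hilb_section s.-1; rewrite -sE e1 e2; have : (0 < 3 * q * da)%N; lia.
have [w [hw nw wP]] := hilb1 (ideal_additive idJl) h1.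
have eP P : exists e, e \is s.-homog /\ forall Q, Q \in M -> e.@[Q 0] = (Q == P)%:R.
  by have [f hf fE] := functions_high (fun Q => (Q == P)%:R) (leqnn s); exists f.
pose e P := projT1 (cid (eP P)).
have he P : e P \is s.-homog by rewrite /e; case: cid => f [].
have eE P Q : Q \in M -> (e P).@[Q 0] = (Q == P)%:R by move=> QM; rewrite /e; case: cid => f [_ h] /=; apply: h.
pose c P := projT1 (cid (wP _ (he P))).
have cE P : Jl (e P - c P *: w) by rewrite /c; case: cid.
have JlZ (x : k) f : Jl f -> Jl (x *: f) by rewrite -mul_mpolyC; apply: (idealMl idJl).
have subJ f : J f -> Jl f by move=> Jf; exists f, 0; rewrite mulr0 addr0.
have key f : f \is s.-homog -> Jl f <-> \sum_(P <- M) c P * f.@[P 0] = 0.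
  move=> hf; have : Jl (f - (\sum_(P <- M) c P * f.@[P 0]) *: w).
    have -> : f - (\sum_(P <- M) c P * f.@[P 0]) *: w =
        (f - \sum_(P <- M) f.@[P 0] *: e P) + \sum_(P <- M) f.@[P 0] *: (e P - c P *: w).
      rewrite scaler_suml -addrA; congr (_ + _); rewrite -sumrN -sumrN -big_split /=.
      apply: eq_bigr => P _; rewrite scalerBr addrA addNr sub0r scalerA; congr (- (_ *: _)).
      exact: mulrC.
    apply: (idealD idJl).
      apply: subJ; apply: (@vanishes_idealM _ s).
        by apply: rpredB => //; apply: rpred_sum => P _; rewrite rpredZ // he.
      move=> Q QM; rewrite mevalB (big_morph _ (mevalD _) (meval0 _)) (bigD1_seq Q) //= big1 => [|P ne].
        by rewrite mevalZ eE // eqxx mulr1 addr0 subrr.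
      by rewrite mevalZ eE // eq_sym (negbTE ne) mulr0.
    by apply: (big_ind Jl) => [|x y|P _]; [exact: (ideal0 idJl) | by move=> hx hy; apply: (idealD idJl) | exact: JlZ].
  set t := \sum_(P <- M) _ => h; split; last by move=> t0; move: h; rewrite t0 scale0r subr0.
  move=> Jf; apply: contrapT => /eqP t0; apply: nw.
  have := JlZ t^-1 _ (idealB idJl Jf h); rewrite opprB addrC subrK scalerA mulVf // scale1r.
  by [].
(* a function of degree exactly D pairs nontrivially with forms of degree s - D *)
have pair f D : f \is D.-homog -> (D <= s)%N -> ~ Jl f ->
    exists2 g, g \is (s - D).-homog & \sum_(P <- M) c P * (f.@[P 0] * g.@[P 0]) != 0.
  move=> hf le nf; have [g hg ng] := section_reach (subnKC le) hf nf.
  exists g => //; apply/eqP => h; apply: ng; apply/key.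
    by apply: (homogM hf hg); rewrite subnKC.
  by rewrite -[RHS]h; apply: eq_bigr => P _; rewrite mevalM.
have minimal (u : pt -> k) : exists D f, [/\ f \is D.-homog, forall P, P \in M -> f.@[P 0] = u P,
    (D <= s)%N & (forall D' g, g \is D'.-homog -> (forall P, P \in M -> g.@[P 0] = u P) -> (D <= D')%N)
    /\ (Jl f -> D = 0%N)].
  pose is_deg D := `[< exists2 f, f \is D.-homog & forall P, P \in M -> f.@[P 0] = u P >].
  have ex : exists D, is_deg D by exists s; apply/asboolP; exact: functions_high.
  case: (ex_minnP ex) => D /asboolP[f hf fE] min; exists D, f; split=> //.
    by apply: min; apply/asboolP; exact: functions_high.
  split; first by move=> D' g hg gE; apply: min; apply/asboolP; exists g.
  case: D hf min => // D hf min /(sectionP hf)[g hg gE].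
  suff /min : is_deg D by rewrite ltnn.
  by apply/asboolP; exists g => // P PM; rewrite -gE // fE.
have c_neq0 P : P \in M -> c P != 0.
  move=> PM; apply/eqP => c0; have [D [f [hf fE le [min fJ]]]] := minimal (fun Q => (Q == P)%:R).
  have eJ : Jl (e P) by have := cE P; rewrite c0 scale0r subr0.
  have nf : ~ Jl f.
    move=> Jf; have D0 := fJ Jf; have [b [b' [Jb fE']]] := Jf.
    have := fE P PM; rewrite eqxx -(pihomog_dE hf) fE' D0 pihomogD (pihomogM_small _ hl) // addr0.
    rewrite (idealM_vanishes vF vG vA (idealM_homog _ Jb)) // => /eqP; by rewrite eq_sym oner_eq0.
  have [g hg /eqP[]] := pair f D hf le nf.
  rewrite big_seq big1 // => Q QM; rewrite fE //; case: eqP => [->|]; last by rewrite !mul0r mulr0.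
  by rewrite c0 mul0r.
exists c; rewrite addnC -/s; split.
  move=> f hf; have hlf : l * f \is s.-homog by apply: (homogM (d := 1) hl hf).
  rewrite -[RHS](proj1 (key (l * f) hlf)); last by exists 0, f; rewrite add0r; split=> //; exact: (ideal0 idJ).
  by apply: eq_big_seq => P PM; rewrite mevalM nM.2 // mul1r.
move=> d v dv; have [D [f [hf fE le [min fJ]]]] := minimal (fun P => v P / c P).
suff leD : (D <= d)%N.
  have [g hg gE] := raise_degree (d - D) nM hf; rewrite subnK // in hg.
  by exists g => // P PM; rewrite gE // fE // mulrC divfK // c_neq0.
rewrite leqNgt; apply/negP => lt.
have nf : ~ Jl f by move/fJ; lia.
have [g hg /eqP[]] := pair f D hf le nf.
have [g' hg' g'E] := raise_degree (s.-1 - d - (s - D)) nM hg.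
have e1 : (s.-1 - d + d = s.-1)%N by rewrite subnK //; lia.
have e2 : (s.-1 - d - (s - D) + (s - D) = s.-1 - d)%N by rewrite subnK //; lia.
rewrite e2 in hg'; rewrite -[RHS](dv _ g' e1 hg').
by apply: eq_big_seq => P PM; rewrite g'E // fE // mulrA [c P * _]mulrC divfK // c_neq0.
Qed.

End ReducedPoints.
End Regular.
End Surface.
End Curve.
End CompleteIntersection.

(** * Deformation of reduced complete intersections *)

(** ** Simultaneous diagonalisation *)

Lemma not_uniq_perm (T : eqType) (r : seq T) : ~~ uniq r ->
  exists x r', perm_eq r [:: x, x & r'].
Proof.
elim: r => [|x s IH] //=; rewrite negb_and negbK => /orP[xs|/IH[y [r' sE]]].
  by exists x, (rem x s); rewrite perm_cons perm_to_rem.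
exists y, (x :: r'); rewrite -[[:: y, y & _]]/([:: y; y] ++ x :: r') -cat1s.
by rewrite perm_sym -(perm_catCA [:: x]) /= perm_cons perm_sym.
Qed.

Lemma row_diag_mul (R : pzRingType) m n (d : 'rV[R]_m) (A : 'M_(m, n)) s :
  row s (diag_mx d *m A) = d 0 s *: row s A.
Proof. by rewrite row_mul row_diag_mx -scalemxAl -rowE. Qed.

Section Diagonalisation.
Variables (k : closedFieldType) (n : nat).
Local Notation mx := 'M[k]_n.+1.

Definition separable_mx (L : mx) : Prop := \det (horner_mx L (char_poly L)^`()) != 0.

Lemma row_horner_mx (L : mx) (y : 'rV_n.+1) mu (p : {poly k}) : y *m L = mu *: y ->
  y *m horner_mx L p = p.[mu] *: y.
Proof.
move=> yL; elim/poly_ind: p => [|p c IH]; first by rewrite rmorph0 mulmx0 horner0 scale0r.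
rewrite rmorphD rmorphM /= horner_mx_X horner_mx_C hornerMXaddC mulmxDr mulmxA IH.
by rewrite -scalemxAl yL scalerA mul_mx_scalar -scalerDl.
Qed.

(** A matrix whose characteristic polynomial has simple roots has independent eigenvectors, which
    are also eigenvectors of everything commuting with it. *)
Lemma separable_diag (L : mx) : separable_mx L ->
  exists (Y : mx) (mu : 'I_n.+1 -> k), [/\ Y \in unitmx, injective mu,
    (forall s, row s Y *m L = mu s *: row s Y) & forall Z : mx, Z *m L = L *m Z ->
        exists nu : 'I_n.+1 -> k, forall s, row s Y *m Z = nu s *: row s Y].
Proof.
move=> sepL; have [r] := closed_field_poly_normal (char_poly L).
rewrite (monicP (char_poly_monic L)) scale1r => pE.
have sr : size r = n.+1 by have := size_char_poly L; rewrite pE size_prod_XsubC => -[].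
have eig mu : mu \in r -> exists2 y : 'rV_n.+1, y *m L = mu *: y & y != 0.
  move=> mur; apply/eigenvalueP; rewrite eigenvalue_root_char pE root_prod_XsubC //.
have ur : uniq r.
  apply: contrapT => /negP/not_uniq_perm[mu [r' rE]].
  have mur : mu \in r by rewrite (perm_mem rE) inE eqxx.
  have [y yL y0] := eig mu mur.
  have d0 : (char_poly L)^`().[mu] = 0.
    by rewrite pE (perm_big _ rE) !big_cons !derivM !derivXsubC !hornerE subrr; ring.
  have := row_horner_mx (char_poly L)^`() yL; rewrite d0 scale0r => yz.
  case/negP: sepL; rewrite -[_ == _]negbK -unitfE -[_ \is a _]/(_ \in unitmx).
  apply/negP => u; case/eqP: y0; by rewrite -(mulmxK u y) yz mul0mx.
pose mu (s : 'I_n.+1) := nth 0 r s.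
have mu_r s : mu s \in r by rewrite mem_nth ?sr.
have mu_inj : injective mu.
  move=> s t /eqP; rewrite nth_uniq ?sr // => /eqP/val_inj; exact.
pose y s := s2val (cid2 (eig _ (mu_r s))).
have yL s : y s *m L = mu s *: y s by exact: s2valP (cid2 (eig _ (mu_r s))).
have y0 s : y s != 0 by exact: s2valP' (cid2 (eig _ (mu_r s))).
pose Y : mx := \matrix_(s, t) y s 0 t.
have rowY s : row s Y = y s by apply/rowP => t; rewrite !mxE.
have YL : Y *m L = diag_mx (\row_s mu s) *m Y.
  by apply/row_matrixP => s; rewrite row_mul rowY yL row_diag_mul mxE rowY.
have uY : Y \in unitmx.
  rewrite -row_free_unit -kermx_eq0; apply/eqP/row_matrixP => i.
  set c := row i _; have cY : c *m Y = 0.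
    by apply/eqP; rewrite -sub_kermx row_sub.
  rewrite row0; apply/rowP => s; rewrite [RHS]mxE.
  pose p := \prod_(t | t != s) ('X - (mu t)%:P).
  have ps : p.[mu s] != 0.
    rewrite horner_prod; apply/prodf_neq0 => t ts; rewrite hornerXsubC subr_eq0.
    by apply: contra ts => /eqP/mu_inj->.
  have := congr1 (fun w => w *m horner_mx L p) cY; rewrite mul0mx.
  rewrite (mulmx_sum_row c Y) mulmx_suml (bigD1 s) //= big1 => [|t ts]; last first.
    rewrite -scalemxAl rowY (row_horner_mx _ (yL t)) horner_prod (bigD1 t) //=.
    by rewrite hornerXsubC subrr mul0r scale0r scaler0.
  rewrite addr0 -scalemxAl rowY (row_horner_mx _ (yL s)) scalerA => /eqP.
  by rewrite scaler_eq0 (negbTE (y0 s)) orbF mulf_eq0 (negbTE ps) orbF => /eqP.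
exists Y, mu; split=> // [s|Z ZL]; first by rewrite rowY.
pose W := Y *m Z *m invmx Y.
have WY : W *m Y = Y *m Z by rewrite /W mulmxKV.
have comm : W *m diag_mx (\row_s mu s) = diag_mx (\row_s mu s) *m W.
  rewrite -(mulmxK uY (W *m _)) -(mulmxA W) -YL mulmxA WY -(mulmxA Y) ZL mulmxA YL.
  by rewrite -mulmxA -WY mulmxA mulmxK.
exists (fun s => W s s) => s; rewrite -row_mul -WY row_mul mulmx_sum_row (bigD1 s) //=.
rewrite [X in _ + X]big1 ?addr0 => [|t ts]; rewrite mxE //.
have := congr1 (fun A : mx => A s t) comm; rewrite mul_mx_diag mul_diag_mx !mxE => /eqP.
rewrite mulrC -subr_eq0 -mulrBl mulf_eq0 subr_eq0 => /orP[/eqP/mu_inj e|/eqP->]; last by rewrite scale0r.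
by rewrite e eqxx in ts.
Qed.

Lemma separable_diag_mx (mu : 'I_n.+1 -> k) : injective mu -> separable_mx (diag_mx (\row_s mu s)).
Proof.
move=> mu_inj; rewrite /separable_mx -unitfE -[_ \is a _]/(_ \in unitmx).
set L := diag_mx _; set p := _^`().
have hd (p' : {poly k}) : horner_mx L p' = diag_mx (\row_s p'.[mu s]).
  apply/row_matrixP => s; rewrite rowE (row_horner_mx (mu := mu s)); last first.
    by rewrite -rowE row_diag_mx mxE.
  by rewrite row_diag_mx mxE.
rewrite hd unitmxE det_diag unitfE; apply/prodf_neq0 => s _; rewrite mxE /p.
rewrite char_poly_trig ?diag_mx_is_trig //.
rewrite (bigD1 s) //= derivM hornerD !hornerM derivXsubC hornerXsubC !mxE eqxx mulr1n subrr mul0r addr0.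
rewrite hornerC mul1r horner_prod; apply/prodf_neq0 => t ts; rewrite !mxE eqxx mulr1n hornerXsubC subr_eq0.
by apply: contra ts => /eqP/mu_inj->.
Qed.

(** The value of a polynomial at a tuple of commuting matrices. *)
Definition mx_meval m (X : 'I_m -> mx) (f : {mpoly k[m]}) : mx :=
  \sum_(u <- msupp f) f@_u *: \prod_(i < m) X i ^+ u i.

Lemma row_mx_meval m (X : 'I_m -> mx) (f : {mpoly k[m]}) (y : 'rV_n.+1) (Q : 'I_m -> k) :
  (forall i, y *m X i = Q i *: y) -> y *m mx_meval X f = f.@[Q] *: y.
Proof.
move=> yX; rewrite mulmx_sumr mevalE scaler_suml; apply: eq_bigr => u _.
rewrite -scalemxAr -scalerA; congr (_ *: _).
have yXn i j : y *m X i ^+ j = Q i ^+ j *: y.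
  elim: j => [|j IH]; first by rewrite mulmx1 scale1r.
  by rewrite exprS mulmxA yX -scalemxAl IH scalerA -exprS.
elim: (index_enum _) => [|i s IH]; first by rewrite !big_nil mulmx1 scale1r.
by rewrite !big_cons mulmxA yXn -scalemxAl IH scalerA.
Qed.

Lemma trace_mx_meval m (X : 'I_m -> mx) (f : {mpoly k[m]}) (Y : mx) (Q : 'I_n.+1 -> 'I_m -> k) :
  Y \in unitmx -> (forall s i, row s Y *m X i = Q s i *: row s Y) ->
  \tr (mx_meval X f) = \sum_s f.@[Q s].
Proof.
move=> uY YX; have YfE : Y *m mx_meval X f = diag_mx (\row_s f.@[Q s]) *m Y.
  by apply/row_matrixP => s; rewrite row_mul (row_mx_meval _ (YX s)) row_diag_mul mxE.
have -> : mx_meval X f = invmx Y *m (diag_mx (\row_s f.@[Q s]) *m Y) by rewrite -YfE mulKmx.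
rewrite mxtrace_mulC mulmxK // mxtrace_diag.
by apply: eq_bigr => s _; rewrite mxE.
Qed.

End Diagonalisation.

(** ** Polynomial families *)

Section PolynomialFamilies.
Variables (k : closedFieldType) (I : Type).
Implicit Types (th : I -> k).

(** Clearing the denominators that Cramer's rule introduces. *)
Lemma polyfun_frac J (f : (J -> k) -> k) (u : J -> (I -> k) -> k) (D : (I -> k) -> k) :
  polyfun f -> (forall j, polyfun (u j)) -> polyfun D ->
  exists p e, polyfun p /\ forall th, D th != 0 -> p th = D th ^+ e * f (fun j => u j th / D th).
Proof.
move=> pf pu pD; elim: pf => [c|j|f1 f2 _ [p1 [e1 [pp1 h1]]] _ [p2 [e2 [pp2 h2]]]
                            |f1 f2 _ [p1 [e1 [pp1 h1]]] _ [p2 [e2 [pp2 h2]]]].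
- by exists (fun=> c), 0%N; split=> [|th _]; [exact: polyfun_const | rewrite expr0 mul1r].
- by exists (u j), 1%N; split=> // th D0; rewrite expr1 mulrCA divff // mulr1.
- exists (fun th => D th ^+ e2 * p1 th + D th ^+ e1 * p2 th), (e1 + e2)%N; split.
    by apply: polyfun_add; apply: polyfun_mul => //; apply: polyfun_exp.
  by move=> th D0; rewrite h1 // h2 // exprD; ring.
- exists (fun th => p1 th * p2 th), (e1 + e2)%N; split; first exact: polyfun_mul.
  by move=> th D0; rewrite h1 // h2 // exprD; ring.
Qed.

Definition polymx m n (A : (I -> k) -> 'M[k]_(m, n)) : Prop := forall i j, polyfun (fun th => A th i j).

Lemma polymx_mul m n p (A : (I -> k) -> 'M[k]_(m, n)) (B : (I -> k) -> 'M[k]_(n, p)) :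
  polymx A -> polymx B -> polymx (fun th => A th *m B th).
Proof.
move=> pA pB i j; apply: (@polyfun_ext _ _ (fun th => \sum_h A th i h * B th h j)).
  by move=> th; rewrite mxE.
by apply: polyfun_sum => h; apply: polyfun_mul.
Qed.

Lemma polymx_det n (A : (I -> k) -> 'M[k]_n) : polymx A -> polyfun (fun th => \det (A th)).
Proof.
move=> pA; apply: (@polyfun_ext _ _ (fun th => \det (\matrix_(i, j) A th i j))).
  by move=> th; congr (\det _); apply/matrixP => i j; rewrite mxE.
exact: polyfun_det.
Qed.

Lemma polymx_adj n (A : (I -> k) -> 'M[k]_n) : polymx A -> polymx (fun th => \adj (A th)).
Proof.
move=> pA i j.
apply: (@polyfun_ext _ _ (fun th => (-1) ^+ (j + i) * \det (row' j (col' i (A th))))).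
  by move=> th; rewrite mxE.
apply: polyfun_mul; first exact: polyfun_const.
apply: polymx_det => i' j'; apply: (@polyfun_ext _ _ (fun th => A th (lift j i') (lift i j'))) => //.
by move=> th; rewrite !mxE.
Qed.

Lemma polymx_scale m n (c : (I -> k) -> k) (A : (I -> k) -> 'M[k]_(m, n)) : polyfun c ->
  polymx A -> polymx (fun th => c th *: A th).
Proof.
move=> pc pA i j; apply: (@polyfun_ext _ _ (fun th => c th * A th i j)); first by move=> th; rewrite mxE.
exact: polyfun_mul.
Qed.

Lemma polymx_sum m n T (r : seq T) (A : T -> (I -> k) -> 'M[k]_(m, n)) :
  (forall t, polymx (A t)) -> polymx (fun th => \sum_(t <- r) A t th).
Proof.
move=> pA i j; apply: (@polyfun_ext _ _ (fun th => \sum_(t <- r) A t th i j)).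
  by move=> th; rewrite summxE.
by apply: polyfun_sum => t; apply: pA.
Qed.

Lemma polymx_const m n (A : 'M[k]_(m, n)) : polymx (fun=> A).
Proof. by move=> i j; exact: polyfun_const. Qed.

Lemma polymx_exp n (A : (I -> k) -> 'M[k]_n.+1) e : polymx A -> polymx (fun th => A th ^+ e).
Proof.
move=> pA; elim: e => [|e IH]; first exact: polymx_const.
have -> : (fun th => A th ^+ e.+1) = fun th => A th *m A th ^+ e.
  by apply/funext => th; rewrite exprS.
exact: polymx_mul.
Qed.

Lemma polymx_prod n T (r : seq T) (A : T -> (I -> k) -> 'M[k]_n.+1) :
  (forall t, polymx (A t)) -> polymx (fun th => \prod_(t <- r) A t th).
Proof.
move=> pA; elim: r => [|t r IH].
  have -> : (fun th => \prod_(t <- [::]) A t th) = fun=> 1 by apply/funext => th; rewrite big_nil.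
  exact: polymx_const.
have -> : (fun th => \prod_(t <- t :: r) A t th) = fun th => A t th *m \prod_(t <- r) A t th.
  by apply/funext => th; rewrite big_cons.
exact: polymx_mul.
Qed.

Definition polypoly (p : (I -> k) -> {poly k}) : Prop := forall i, polyfun (fun th => (p th)`_i).

Lemma polypoly_mul p q : polypoly p -> polypoly q -> polypoly (fun th => p th * q th).
Proof.
move=> pp pq i; apply: (@polyfun_ext _ _ (fun th => \sum_(j < i.+1) (p th)`_j * (q th)`_(i - j))).
  by move=> th; rewrite coefM.
by apply: polyfun_sum => j; apply: polyfun_mul.
Qed.

Lemma polypoly_char n (A : (I -> k) -> 'M[k]_n) : polymx A -> polypoly (fun th => char_poly (A th)).
Proof.
move=> pA i; apply: (@polyfun_ext _ _ (fun th => \sum_(s : 'S_n) (-1) ^+ s *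
    (\prod_i (char_poly_mx (A th)) i (s i))`_i)).
  move=> th; rewrite /char_poly /determinant coef_sum; apply: eq_bigr => s _.
  by rewrite -[in RHS](rmorph_sign (@polyC k)) coefCM.
apply: polyfun_sum => s; apply: polyfun_mul; first exact: polyfun_const.
suff : polypoly (fun th => \prod_i (char_poly_mx (A th)) i (s i)) by apply.
elim: (index_enum _) => [|j r IH].
  have -> : (fun th => \prod_(j <- [::]) char_poly_mx (A th) j (s j)) = fun=> 1.
    by apply/funext => th; rewrite big_nil.
  by move=> i'; exact: polyfun_const.
have -> : (fun th => \prod_(j <- j :: r) char_poly_mx (A th) j (s j)) =
    fun th => char_poly_mx (A th) j (s j) * \prod_(j <- r) char_poly_mx (A th) j (s j).
  by apply/funext => th; rewrite big_cons.
apply: polypoly_mul IH => e; apply: (@polyfun_ext _ _ (fun th => ('X *+ (j == s j))`_e - (A th j (s j) *+ (e == 0)%N))).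
  by move=> th; rewrite !mxE coefB coefC; case: (e == 0)%N.
apply: polyfun_sub; first exact: polyfun_const.
by case: (e == 0)%N; [exact: pA | exact: polyfun_const].
Qed.

Lemma polyfun_separable n (A : (I -> k) -> 'M[k]_n.+1) : polymx A ->
  polyfun (fun th => \det (horner_mx (A th) (char_poly (A th))^`())).
Proof.
move=> pA; apply: polymx_det.
have -> : (fun th => horner_mx (A th) (char_poly (A th))^`()) =
    fun th => \sum_(i <- iota 0 n.+1) ((char_poly (A th))`_i.+1 *+ i.+1) *: A th ^+ i.
  apply/funext => th; set p := (char_poly (A th))^`().
  have sp : (size p <= n.+1)%N by rewrite (leq_trans (size_poly _ _)) // size_char_poly.
  have {1}-> : p = \poly_(i < n.+1) p`_i.
    apply/polyP => i; rewrite coef_poly; case: ltnP => // le; by rewrite nth_default // (leq_trans sp).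
  rewrite poly_def rmorph_sum /= -(big_mkord xpredT (fun i => horner_mx (A th) (p`_i *: 'X^i))).
  rewrite /index_iota subn0; apply: eq_bigr => i _.
  by rewrite linearZ /= rmorphXn /= horner_mx_X coef_deriv.
apply: polymx_sum => i; apply: polymx_scale; last exact: polymx_exp.
apply: (@polyfun_ext _ _ (fun th => (char_poly (A th))`_i.+1 * i.+1%:R)).
  by move=> th; rewrite mulr_natr.
by apply: polyfun_mul; [exact: polypoly_char | exact: polyfun_const].
Qed.

Lemma polymx_meval n m (X : 'I_m -> (I -> k) -> 'M[k]_n.+1) (f : {mpoly k[m]}) :
  (forall i, polymx (X i)) -> polymx (fun th => mx_meval (fun i => X i th) f).
Proof.
move=> pX; apply: polymx_sum => u; apply: polymx_scale; first exact: polyfun_const.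
by apply: polymx_prod => i; apply: polymx_exp.
Qed.

Lemma polyfun_trace n (A : (I -> k) -> 'M[k]_n) : polymx A -> polyfun (fun th => \tr (A th)).
Proof. by move=> pA; apply: polyfun_sum => i; apply: pA. Qed.

End PolynomialFamilies.

Section HomogDecomposition.
Variables (k : closedFieldType) (n : nat).
Implicit Types (f : {mpoly k[n]}).

Lemma homog_decomp f e : f \is e.+1.-homog ->
  exists g : 'I_n -> {mpoly k[n]}, (forall j, g j \is e.-homog) /\ f = \sum_j 'X_j * g j.
Proof.
move=> /dhomogP hf; rewrite (mpolyE f); rewrite big_seq.
pose R (f : {mpoly k[n]}) := exists g : 'I_n -> {mpoly k[n]}, (forall j, g j \is e.-homog) /\ f = \sum_j 'X_j * g j.
apply: (big_ind R) => [|f1 f2 [g1 [h1 ->]] [g2 [h2 ->]]|m /hf md].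
- by exists (fun=> 0); split=> [j|]; rewrite ?dhomog0 // big1 // => j _; rewrite mulr0.
- exists (fun j => g1 j + g2 j); split=> [j|]; first by rewrite rpredD.
  by rewrite -big_split; apply: eq_bigr => j _; rewrite mulrDr.
have [i mi] : exists i, (0 < m i)%N.
  apply: contrapT => H; have m0 : m = 0%MM.
    by apply/mnmP => i; rewrite mnm0E; apply/eqP; rewrite -leqn0 leqNgt; apply/negP => h; apply: H; exists i.
  by move: md; rewrite /= m0 mdeg0.
have le : (U_(i) <= m)%MM by rewrite lep1mP -lt0n.
have dm : mdeg (m - U_(i))%MM = e.
  by have := congr1 mdeg (submK le); rewrite mdegD mdeg1 md addn1 => -[].
exists (fun j => if j == i then f@_m *: 'X_[m - U_(i)] else 0); split=> [j|].
  by case: eqP => _; rewrite ?dhomog0 // rpredZ // dhomogX /= dm.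
rewrite (bigD1 i) //= eqxx big1 ?addr0 => [|j /negbTE->]; last by rewrite mulr0.
by rewrite -scalerAr -mpolyXD addmC submK.
Qed.

Lemma homog0_const f : f \is 0.-homog -> f = (f@_0)%:MP.
Proof. by move/homog_msize_le/msize1_polyC. Qed.

End HomogDecomposition.

Lemma arith1 (u n x y z : nat) : (u <= n.+1)%N -> (n.+1 <= x - y)%N -> (x + z = y + u)%N -> z = 0%N.
Proof. lia. Qed.
Lemma arith3 (u n x y z : nat) : (u <= n)%N -> (x + z = y + u)%N -> (x - y <= n)%N.
Proof. lia. Qed.
Lemma arith2 (u n x y z : nat) : (u <= n.+1)%N -> (n.+1 <= x - y)%N -> (x + z = y + u)%N -> u = n.+1.
Proof. lia. Qed.

Lemma exchange_coef (R : comPzRingType) (V : lmodType R) (I T U : finType) (c : I -> T -> R)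
    (X : I -> U -> T -> R) (v : U -> V) :
  \sum_u (\sum_j \sum_t c j t * X j u t) *: v u = \sum_j \sum_t c j t *: \sum_u X j u t *: v u.
Proof.
under eq_bigr => u _ do rewrite scaler_suml.
rewrite exchange_big; apply: eq_bigr => j _.
under eq_bigr => u _ do rewrite scaler_suml.
rewrite exchange_big; apply: eq_bigr => t _; rewrite scaler_sumr.
by apply: eq_bigr => u _; rewrite scalerA.
Qed.

Section Multiplication.
Variables (k : closedFieldType).
Local Notation S := {mpoly k[4]}.
Variables (l : S) (J : S -> Prop) (n d : nat) (b : 'I_n.+1 -> S) (X : 'I_4 -> 'M[k]_n.+1).
Hypotheses (hl : l \is 1.-homog) (idJ : is_ideal J) (hb : forall s, b s \is d.-homog).

(** Multiplication by f in the algebra of functions on the scheme defined by J, in the basis b_s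
    of forms of one high degree; the power of l restores the degree. *)
Definition represents e (f : S) (C : 'M[k]_n.+1) : Prop :=
  forall s, J (f * b s - \sum_t C t s *: (l ^+ e * b t)).

Hypotheses (hX : forall j, represents 1 'X_j (X j))
  (span : forall f, f \is d.+1.-homog -> exists c : 'I_n.+1 -> k, J (f - \sum_t c t *: (l * b t))).

Let JZ (c : k) f : J f -> J (c *: f).
Proof. by rewrite -mul_mpolyC; apply: (idealMl idJ). Qed.

Let Jsum (T : finType) (f : T -> S) : (forall t, J (f t)) -> J (\sum_t f t).
Proof. by move=> h; apply: (big_ind J) => // [|x y]; [exact: (ideal0 idJ) | exact: (@idealD _ _ _ idJ x y)]. Qed.

Let Jtrans f g h : J (f - g) -> J (g - h) -> J (f - h).
Proof. by move=> h1 h2; have := idealD idJ h1 h2; rewrite addrA subrK. Qed.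

Lemma represents_mul e e' f g C D : represents e f C -> represents e' g D ->
  represents (e + e') (f * g) (C *m D).
Proof.
move=> hf hg s; apply: (@Jtrans _ (\sum_t D t s *: (l ^+ e' * (f * b t)))).
  have -> : f * g * b s - \sum_t D t s *: (l ^+ e' * (f * b t)) =
            f * (g * b s - \sum_t D t s *: (l ^+ e' * b t)).
    rewrite mulrBr mulrA mulr_sumr; congr (_ - _); apply: eq_bigr => t _.
    by rewrite -scalerAr mulrCA.
  exact: (idealMl idJ).
have -> : \sum_t D t s *: (l ^+ e' * (f * b t)) - \sum_t (C *m D) t s *: (l ^+ (e + e') * b t) =
   \sum_t D t s *: (l ^+ e' * (f * b t - \sum_u C u t *: (l ^+ e * b u))).
  under [in RHS]eq_bigr => t _ do rewrite mulrBr scalerBr.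
  rewrite sumrB; congr (_ - _).
  under [in RHS]eq_bigr => t _ do rewrite mulr_sumr scaler_sumr.
  rewrite exchange_big /=; apply: eq_bigr => u _; rewrite mxE scaler_suml.
  apply: eq_bigr => t _; rewrite -scalerAr scalerA mulrA -exprD addnC; congr (_ *: _).
  exact: mulrC.
by apply: Jsum => t; apply: JZ; apply: (idealMl idJ).
Qed.

Lemma represents_sum e (T : finType) (f : T -> S) (C : T -> 'M[k]_n.+1) :
  (forall t, represents e (f t) (C t)) -> represents e (\sum_t f t) (\sum_t C t).
Proof.
move=> h s; have := Jsum (fun t => h t s); congr J; rewrite sumrB mulr_suml; congr (_ - _).
rewrite exchange_big /=; apply: eq_bigr => u _; rewrite summxE scaler_suml.
by [].
Qed.

Lemma represents_const c : represents 0 c%:MP c%:M.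
Proof.
move=> s; rewrite (bigD1 s) //= big1 => [|t ts]; last by rewrite mxE (negbTE ts) scale0r.
rewrite mxE eqxx mulr1n addr0 expr0 mul1r mul_mpolyC subrr; exact: (ideal0 idJ).
Qed.

Lemma represents_l : represents 1 l 1%:M.
Proof.
move=> s; rewrite (bigD1 s) //= big1 => [|t ts]; last by rewrite mxE (negbTE ts) scale0r.
by rewrite mxE eqxx addr0 expr1 scale1r subrr; exact: (ideal0 idJ).
Qed.

Lemma represents_ex e f : f \is e.-homog -> exists2 C, represents e f C
  & forall y (Q : 'I_4 -> k), (forall j, y *m X j = Q j *: y) -> y *m C = f.@[Q] *: (y : 'rV_n.+1).
Proof.
elim: e f => [|e IH] f hf.
  rewrite (homog0_const hf); exists (f@_0)%:M; first exact: represents_const.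
  by move=> y Q _; rewrite mul_mx_scalar mevalC.
have [g [hg ->]] := homog_decomp hf.
pose D j := s2val (cid2 (IH _ (hg j))).
have hD j : represents e (g j) (D j) := s2valP (cid2 (IH _ (hg j))).
have eD j := s2valP' (cid2 (IH _ (hg j))) : forall y Q, _ -> y *m D j = _.
exists (\sum_j X j *m D j).
  by rewrite -add1n; apply: represents_sum => j; apply: represents_mul.
move=> y Q yX; rewrite mulmx_sumr (big_morph _ (mevalD _) (meval0 _)) scaler_suml.
by apply: eq_bigr => j _; rewrite mulmxA yX -scalemxAl (eD j y Q yX) scalerA mevalM mevalXU.
Qed.

Lemma span_high e f : f \is (e + d).+1.-homog ->
  exists c : 'I_n.+1 -> k, J (f - \sum_t c t *: (l ^+ e.+1 * b t)).
Proof.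
elim: e f => [|e IH] f hf; first by have [c] := span hf; exists c; rewrite expr1.
have [g [hg ->]] := homog_decomp hf.
pose c j := projT1 (cid (IH _ (hg j))); have cP j : J (_ - _) := projT2 (cid (IH _ (hg j))).
pose w (u : 'I_n.+1) : k := \sum_j \sum_t c j t * X j u t.
exists w; have hXe j : represents e.+2 ('X_j * l ^+ e.+1) (X j).
  rewrite -[X j]mulmx1 -add1n; apply: represents_mul => //.
  elim: e.+1 => [|m IHm]; first by rewrite expr0 -mpolyC1; exact: represents_const.
  by rewrite exprS -[1%:M]mulmx1 -add1n; apply: represents_mul => //; exact: represents_l.
pose v (u : 'I_n.+1) : S := l ^+ e.+2 * b u.
have E := exchange_coef c (fun j u t => X j u t) v.
have H : J (\sum_j \sum_t c j t *: ('X_j * l ^+ e.+1 * b t) - \sum_u w u *: v u).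
  have K : J (\sum_j \sum_t c j t *: ('X_j * l ^+ e.+1 * b t) -
      \sum_j \sum_t c j t *: \sum_u X j u t *: v u).
    rewrite -sumrB; apply: Jsum => j; rewrite -sumrB; apply: Jsum => t; rewrite -scalerBr.
    by apply: JZ; apply: hXe.
  by have := K; congr (J (_ - _)); exact: (esym E).
apply: Jtrans H; rewrite -sumrB; apply: Jsum => j; have := idealMl idJ 'X_j (cP j); congr J.
rewrite mulrBr mulr_sumr; congr (_ - _); apply: eq_bigr => t _.
by rewrite -scalerAr mulrA.
Qed.

Let lb_homog e t : l ^+ e.+1 * b t \is (e + d).+1.-homog.
Proof. by apply: (homogM (homogX e.+1 hl) (hb t)). Qed.

Let lb e : n.+1.-tuple (dhomog 4 k (e + d).+1) := [tuple homform (lb_homog e t) | t < n.+1].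

Let lb_sum e (c : 'I_n.+1 -> k) :
  (\sum_t c t *: (lb e)`_t : dhomog 4 k (e + d).+1) = \sum_t c t *: (l ^+ e.+1 * b t) :> S.
Proof.
rewrite (linear_sum (@mpoly_of_dhomog 4 k _)); apply: eq_bigr => t _.
by rewrite linearZ -tnth_nth tnth_mktuple.
Qed.

Let lb_span e : (piece J (e + d).+1 + <<lb e>> = fullv)%VS.
Proof.
have aJ := ideal_additive idJ; apply/eqP; rewrite eqEsubv subvf; apply/subvP => f _.
have [c cP] := span_high (valP f); apply/memv_addP.
exists (f - \sum_t c t *: (lb e)`_t).
  apply/(pieceP _ aJ); move: cP; congr J.
  apply: etrans (esym (linearB (@mpoly_of_dhomog 4 k _) f _)).
  by congr (_ - _); exact: (esym (lb_sum e c)).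
exists (\sum_t c t *: (lb e)`_t); last by rewrite subrK.
by apply: memv_suml => t _; rewrite memvZ // memv_span // mem_nth // size_tuple.
Qed.

Lemma hilb_span_high e : (hilb J (e + d).+1 <= n.+1)%N.
Proof.
have := dimv_sum_cap (piece J (e + d).+1) <<lb e>>; rewrite lb_span.
have := dim_span (lb e); rewrite size_tuple; rewrite /hilb /dimS.
move=> h1 h2; exact: (arith3 h1 h2).
Qed.

Hypothesis hN : forall e, (n.+1 <= hilb J (e + d).+1)%N.

Lemma basis_free e (c : 'I_n.+1 -> k) : J (\sum_t c t *: (l ^+ e.+1 * b t)) -> forall t, c t = 0.
Proof.
have aJ := ideal_additive idJ.
have dc := dimv_sum_cap (piece J (e + d).+1) <<lb e>>; rewrite lb_span in dc.
have ds := dim_span (lb e); rewrite size_tuple in ds.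
have h := hN e; rewrite /hilb /dimS in h.
have e1 : \dim (piece J (e + d).+1 :&: <<lb e>>) = 0%N.
  by apply: (arith1 ds h dc).
have e2 : \dim <<lb e>> = n.+1 by apply: (arith2 ds h dc).
have fr : free (lb e) by rewrite /free e2 size_tuple.
move: fr => /freeP/(_ c) fr Jc; apply: fr.
apply/eqP; rewrite -memv0; have /eqP <- : (piece J (e + d).+1 :&: <<lb e>> == 0)%VS by rewrite -dimv_eq0 e1.
rewrite memv_cap; apply/andP; split; last first.
  by apply: memv_suml => t _; rewrite memvZ // memv_span // mem_nth // size_tuple.
by apply/(pieceP _ aJ); move: Jc; congr J; exact: (esym (lb_sum e c)).
Qed.

Lemma represents_unique e f C D : represents e.+1 f C -> represents e.+1 f D -> C = D.
Proof.
move=> hC hD; apply/matrixP => t s; apply/eqP; rewrite -subr_eq0; apply/eqP; move: t.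
apply: (@basis_free e (fun t => C t s - D t s)).
have := idealB idJ (hD s) (hC s); congr J; rewrite opprB addrC addrA subrK.
by rewrite -sumrB; apply: eq_bigr => t _; rewrite scalerBl.
Qed.

Lemma X_comm i j : X i *m X j = X j *m X i.
Proof.
have h1 : represents 2 ('X_i * 'X_j) (X i *m X j) := represents_mul (hX i) (hX j).
have h2 : represents 2 ('X_i * 'X_j) (X j *m X i) by rewrite mulrC; exact: (represents_mul (hX j) (hX i)).
exact: represents_unique h1 h2.
Qed.

(** Joint eigenvalues of the multiplications by the coordinates are points of the scheme. *)
Lemma joint_eigen_vanish e f (y : 'rV[k]_n.+1) (Q : 'I_4 -> k) : f \is e.+1.-homog -> J f -> y != 0 ->
  (forall j, y *m X j = Q j *: y) -> f.@[Q] = 0.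
Proof.
move=> hf Jf y0 yX; have [C hC] := represents_ex hf.
have -> : C = 0.
  apply: represents_unique hC _ => s; rewrite big1 ?subr0 => [|t _]; last by rewrite mxE scale0r.
  by rewrite mulrC; apply: (idealMl idJ).
by move/(_ y Q yX)/esym/eqP; rewrite mulmx0 scaler_eq0 (negbTE y0) orbF => /eqP.
Qed.

Lemma joint_eigen_normal (y : 'rV[k]_n.+1) (Q : 'I_4 -> k) : y != 0 -> (forall j, y *m X j = Q j *: y) -> l.@[Q] = 1.
Proof.
move=> y0 yX; have [C hC] := represents_ex hl.
have -> : C = 1%:M by apply: represents_unique hC represents_l.
move/(_ y Q yX)/esym/eqP; rewrite mulmx1 -subr_eq0 -{2}[y]scale1r -scalerBl scaler_eq0 (negbTE y0) orbF.
by rewrite subr_eq0 => /eqP.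
Qed.

End Multiplication.

Section PolynomialForms.
Variables (k : closedFieldType) (I : Type).
Local Notation S := {mpoly k[4]}.
Implicit Types (th : I -> k) (f g : (I -> k) -> S).

Definition polyform f : Prop := exists s : seq (((I -> k) -> k) * S),
  (forall x, List.In x s -> polyfun x.1) /\ forall th, f th = \sum_(x <- s) x.1 th *: x.2.

Lemma polyform_const (g : S) : polyform (fun=> g).
Proof.
exists [:: ((fun=> 1), g)]; split=> [x [<-|[]]|th]; first exact: polyfun_const.
by rewrite big_seq1 scale1r.
Qed.

Lemma polyform_add f g : polyform f -> polyform g -> polyform (fun th => f th + g th).
Proof.
move=> [s [hs sE]] [t [ht tE]]; exists (s ++ t); split=> [x|th]; last by rewrite big_cat sE tE.
by move=> H; case: (List.in_app_or _ _ _ H) => [/hs|/ht].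
Qed.

Lemma polyform_scale c f : polyfun c -> polyform f -> polyform (fun th => c th *: f th).
Proof.
move=> pc [s [hs sE]]; exists [seq ((fun th => c th * x.1 th), x.2) | x <- s]; split=> [x|th].
  move=> H; have [y [<- /hs py]] := proj1 (List.in_map_iff _ _ _) H; exact: polyfun_mul.
by rewrite sE big_map scaler_sumr; apply: eq_bigr => x _; rewrite scalerA.
Qed.

Lemma polyform_mulr f (g : S) : polyform f -> polyform (fun th => f th * g).
Proof.
move=> [s [hs sE]]; exists [seq (x.1, x.2 * g) | x <- s]; split=> [x|th].
  by move=> H; have [y [<- /hs]] := proj1 (List.in_map_iff _ _ _) H.
by rewrite sE big_map mulr_suml; apply: eq_bigr => x _; rewrite scalerAl.
Qed.

Lemma polyform_sum T (r : seq T) (f : T -> (I -> k) -> S) :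
  (forall t, polyform (f t)) -> polyform (fun th => \sum_(t <- r) f t th).
Proof.
move=> pf; elim: r => [|t r IH].
  have -> : (fun th => \sum_(t <- [::]) f t th) = fun=> 0 by apply/funext => th; rewrite big_nil.
  exact: polyform_const.
have -> : (fun th => \sum_(t <- t :: r) f t th) = fun th => f t th + \sum_(t <- r) f t th.
  by apply/funext => th; rewrite big_cons.
exact: polyform_add.
Qed.

Lemma polyform_linear f (phi : S -> k) : polyform f ->
  (forall (c : k) (g h : S), phi (c *: g + h) = c * phi g + phi h) -> polyfun (fun th => phi (f th)).
Proof.
move=> [s [hs sE]] lin.
have phi0 : phi 0 = 0.
  by have := lin (-1) 0 0; rewrite scaler0 addr0 mulN1r addNr.
apply: (@polyfun_ext _ _ (fun th => \sum_(x <- s) x.1 th * phi x.2)).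
  move=> th; rewrite sE; elim: (s) => [|x r IH]; first by rewrite !big_nil phi0.
  by rewrite !big_cons lin IH.
elim: s hs {sE} => [|x r IH] hs.
  by apply: (@polyfun_ext _ _ (fun=> 0)) => [th|]; [rewrite big_nil | exact: polyfun_const].
apply: (@polyfun_ext _ _ (fun th => x.1 th * phi x.2 + \sum_(y <- r) y.1 th * phi y.2)).
  by move=> th; rewrite big_cons.
apply: polyfun_add; last by apply: IH => y yr; apply: hs; right.
by apply: polyfun_mul; [apply: hs; left | exact: polyfun_const].
Qed.

Lemma polyform_meval f (v : 'I_4 -> k) : polyform f -> polyfun (fun th => (f th).@[v]).
Proof. by move=> pf; apply: (polyform_linear pf) => c g h; rewrite mevalD mevalZ. Qed.

End PolynomialForms.

Section Separation.
Variables (k : closedFieldType).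
Local Notation S := {mpoly k[4]}.
Local Notation pt := 'rV[k]_4.

(** Polynomial functions of r points as sums of products of functions of one
    point: this is what makes their symmetrised sums traces. *)
Lemma polyfun_products r (h : ('I_r * 'I_4 -> k) -> k) : polyfun h ->
  exists s : seq (k * ('I_r -> S)), forall v, h v =
    \sum_(x <- s) x.1 * \prod_j (x.2 j).@[fun i => v (j, i)].
Proof.
elim=> [c|[j i]|f1 f2 _ [s1 e1] _ [s2 e2]|f1 f2 _ [s1 e1] _ [s2 e2]].
- exists [:: (c, fun=> 1)] => v; rewrite big_seq1 /= big1 ?mulr1 // => j _; exact: meval1.
- exists [:: (1, fun j' => if j' == j then 'X_i else 1)] => v; rewrite big_seq1 /= mul1r (bigD1 j) //=.
  by rewrite eqxx mevalXU big1 ?mulr1 // => j' /negbTE->; exact: meval1.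
- by exists (s1 ++ s2) => v; rewrite big_cat e1 e2.
- exists [seq (x.1 * y.1, fun j => x.2 j * y.2 j) | x <- s1, y <- s2] => v.
  rewrite big_allpairs_dep e1 e2 mulr_suml; apply: eq_bigr => x _; rewrite mulr_sumr.
  apply: eq_bigr => y _ /=; rewrite mulrACA -big_split; congr (_ * _).
  by apply: eq_bigr => j _; rewrite mevalM.
Qed.

Lemma separating_form n (P : 'I_n -> pt) : injective P ->
  exists lam : 'I_4 -> k, injective (fun s => \sum_j lam j * P s 0 j).
Proof.
move=> injP; pose f : S := \prod_(s | true) \prod_(t | t != s) \sum_j (P s 0 j - P t 0 j) *: 'X_j.
have /mpoly_nonroot[lam fl] : f != 0.
  apply/prodf_neq0 => s _; apply/prodf_neq0 => t ts; apply/eqP => e.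
  case/eqP: ts; apply: injP; apply/rowP => j; apply/esym/eqP; rewrite -subr_eq0; apply/eqP.
  have := congr1 (mcoeff U_(j)) e; rewrite mcoeff0 linear_sum (bigD1 j) //= big1 => [|i ij].
    by rewrite addr0 mcoeffZ mcoeffX eqxx mulr1.
  by rewrite mcoeffZ mcoeffX eq_mnm1 (negbTE ij) mulr0.
exists lam => s t e; apply/eqP/negPn/negP => st; case/eqP: fl.
rewrite /f (big_morph _ (mevalM lam) (meval1 lam)) (bigD1 s) //=.
rewrite (big_morph _ (mevalM lam) (meval1 lam)) (bigD1 t) 1?eq_sym //=.
rewrite (big_morph _ (mevalD lam) (meval0 lam)) [X in X * _ * _](_ : _ = 0) ?mul0r //.
rewrite (eq_bigr (fun j => lam j * P s 0 j - lam j * P t 0 j)) ?sumrB ?e ?subrr // => j _.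
by rewrite mevalZ mevalXU mulrBl ![lam j * _]mulrC.
Qed.

End Separation.

Lemma arith4 (x m y : nat) : (m <= x)%N -> (x - m = y)%N -> (m + y <= x)%N.
Proof. lia. Qed.

Section ReducedCI.
Variables (k : closedFieldType) (F : {mpoly k[4]}).
Hypothesis hF : smooth_cubic_surface F.
Local Notation S := {mpoly k[4]}.
Local Notation pt := 'rV[k]_4.

Definition reduced_ci (l : S) (q p : nat) (G A : S) (M : seq pt) : Prop :=
  [/\ G \is q.-homog, A \is p.-homog, ~ divides F G & nonzerodiv (idealC F G) A] /\
  [/\ uniq M, normalized l M, size M = (3 * q * p)%N & forall P, P \in M -> [/\ F.@[P 0] = 0, G.@[P 0] = 0 & A.@[P 0] = 0]].

Lemma reduced_ci_vanishes l q p G A M f d : (0 < q)%N -> (0 < p)%N -> reduced_ci l q p G A M ->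
  f \is d.-homog -> vanishes M f -> idealM F G A f.
Proof.
move=> q0 p0 [[hG hA nG nA] [uM nM sM vM]].
by apply: (vanishes_idealM hF hG nG hA nA q0 p0 uM nM _ _ _ sM) => P /vM[].
Qed.

Lemma reduced_ci_weights l q p G A M : (0 < q)%N -> (0 < p)%N -> reduced_ci l q p G A M ->
  exists c, gorenstein_weights M (q + p).-1 c.
Proof.
move=> q0 p0 [[hG hA nG nA] [uM nM sM vM]].
by apply: (ci_weights hF hG nG hA nA q0 p0 uM nM _ _ _ sM) => P /vM[].
Qed.

Lemma idealM_decomp G A q p e f : G \is q.-homog -> A \is p.-homog -> f \is e.-homog ->
  idealM F G A f -> exists b c d, f = F * b + G * c + A * d /\
    forall G' A', G' \is q.-homog -> A' \is p.-homog -> F * b + G' * c + A' * d \is e.-homog.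
Proof.
move=> hG hA hf [f1 [d [[f2 [c [[f3 [b [-> ->]]] ->]]] fE]]].
pose prj q (x : S) := projz (e%:Z - q%:Z) x.
have hprj q' r x : r \is q'.-homog -> r * prj q' x \is e.-homog.
  by move=> hr; have := homzM hr (projz_homz (e%:Z - q'%:Z) x); rewrite subrK.
have eprj q' r x : r \is q'.-homog -> pihomog mdeg e (r * x) = r * prj q' x.
  by move=> hr; have := projzM (e%:Z - q'%:Z) x hr; rewrite subrK.
exists (prj 3%N b), (prj q c), (prj p d); split.
  rewrite -(pihomog_dE hf) fE add0r !pihomogD.
  by rewrite (eprj _ _ _ (cubic_homog hF)) (eprj _ _ _ hG) (eprj _ _ _ hA).
by move=> G' A' hG' hA'; rewrite !rpredD // hprj // (cubic_homog hF).
Qed.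

Section Openness.
Variables (I : Type) (l : S) (q p : nat) (G A : (I -> k) -> S) (th0 : I -> k) (M0 : seq pt).
Hypotheses (q0 : (0 < q)%N) (p0 : (0 < p)%N) (pG : polyform G) (pA : polyform A).
Hypotheses (hG : forall th, G th \is q.-homog) (hA : forall th, A th \is p.-homog).
Hypothesis ci0 : reduced_ci l q p (G th0) (A th0) M0.

Let J th := idealM F (G th) (A th).
Let idJ th : is_ideal (J th). Proof. exact: idealM_ideal. Qed.
Let aJ th := ideal_additive (idJ th).
Let hl : l \is 1.-homog. Proof. by case: ci0 => _ [_ []]. Qed.

Let n := (3 * q * p).-1.
Let nE : (3 * q * p = n.+1)%N. Proof. by rewrite prednK // !muln_gt0 q0 p0. Qed.
Let sum_le : (p + q <= n.+1)%N. Proof. by rewrite -nE; case: (q) q0 (p) p0 => // q' _ [|p'] // _; lia. Qed.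
Let sM : size M0 = n.+1. Proof. by case: ci0 => _ [_ _ -> _]. Qed.
Let P (s : 'I_n.+1) := nth 0 M0 s.
Let PM s : P s \in M0. Proof. by rewrite mem_nth // sM. Qed.
Let PMP Q : Q \in M0 -> exists s, Q = P s.
Proof.
move=> QM; have lt : (index Q M0 < n.+1)%N by rewrite -sM index_mem.
by exists (Ordinal lt); rewrite /P nth_index.
Qed.
Let P_inj : injective P.
Proof.
move=> s t /eqP; rewrite nth_uniq ?sM //; last by case: ci0 => _ [].
by move/eqP/val_inj.
Qed.

Let vanJ f : J th0 f -> vanishes M0 f.
Proof.
by case: ci0 => _ [_ _ _ h]; apply: idealM_vanishes => Q /h[].
Qed.

Let exb s : exists2 b : S, b \is n.+1.-homog & forall t, b.@[(P t) 0] = (t == s)%:R.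
Proof.
case: ci0 => _ [uM nM _ _].
have [b hb bE] := interpolate (fun Q => (Q == P s)%:R) uM nM (leqnn _).
rewrite sM in hb; exists b => // t; rewrite bE //; congr (_%:R); congr nat_of_bool.
by apply/eqP/eqP => [/P_inj|->].
Qed.

Let b s := s2val (cid2 (exb s)).
Let hb s : b s \is n.+1.-homog := s2valP (cid2 (exb s)).
Let bE s t : (b s).@[(P t) 0] = (t == s)%:R := s2valP' (cid2 (exb s)) t.

Let lb_homog t : l * b t \is n.+2.-homog.
Proof. by apply: (homogM (d := 1) hl (hb t)). Qed.

Let l1 Q : Q \in M0 -> l.@[Q 0] = 1. Proof. by case: ci0 => _ [_ [_ h] _ _] /h. Qed.

Let n1 := \dim (piece (J th0) n.+2).
Let ys : n1.-tuple _ := vbasis (piece (J th0) n.+2).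

Let ys_decomp (i : 'I_n1) : exists x : S * S * S, (ys`_i : S) = F * x.1.1 + G th0 * x.1.2 + A th0 * x.2 /\
    forall G' A', G' \is q.-homog -> A' \is p.-homog -> F * x.1.1 + G' * x.1.2 + A' * x.2 \is n.+2.-homog.
Proof.
have : ys`_i \in piece (J th0) n.+2 by rewrite vbasis_mem // mem_nth // size_tuple.
move/(pieceP _ (aJ th0))/(idealM_decomp (hG th0) (hA th0) (valP _)) => [x [y [z [e h]]]].
by exists (x, y, z).
Qed.

Let yx i := projT1 (cid (ys_decomp i)).
Let y i th : S := F * (yx i).1.1 + G th * (yx i).1.2 + A th * (yx i).2.
Let y_homog i th : y i th \is n.+2.-homog.
Proof. by rewrite /y /yx; case: cid => x [_ h] /=; apply: h. Qed.
Let y0 i : homform (y_homog i th0) = ys`_i.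
Proof. by apply/val_inj; have [e _] := projT2 (cid (ys_decomp i)); exact: esym e. Qed.
Let yJ i th : J th (y i th).
Proof.
have gen f : f = F \/ f = G th \/ f = A th -> J th f by apply: idealM_gen.
have mr f x : J th f -> J th (f * x) by rewrite mulrC; apply: (idealMl (idJ th)).
rewrite /y; apply: (idealD (idJ th)); first apply: (idealD (idJ th)).
- by apply: mr; apply: gen; left.
- by apply: mr; apply: gen; right; left.
- by apply: mr; apply: gen; right; right.
Qed.
Let y_poly i : polyform (y i).
Proof.
apply: polyform_add; last exact: polyform_mulr.
by apply: polyform_add; [exact: polyform_const | exact: polyform_mulr].
Qed.

(* a family of bases of the forms of degree n + 2: the first n1 elements in the
   ideal, the others independent of the parameters *)
Let Y (i : 'I_(n1 + n.+1)) th : dhomog 4 k n.+2 :=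
  match split i with inl j => homform (y_homog j th) | inr t => homform (lb_homog t) end.

Let Xb := [tuple Y i th0 | i < n1 + n.+1].

Let Xb_span : <<Xb>>%VS = fullv.
Proof.
apply/eqP; rewrite eqEsubv subvf; apply/subvP => f _.
have inX i : Y i th0 \in <<Xb>>%VS.
  by apply: memv_span; apply/tnthP; exists i; rewrite tnth_mktuple.
have lbX t : homform (lb_homog t) \in <<Xb>>%VS.
  by have := inX (rshift n1 t); rewrite /Y (unsplitK (inr _ t)).
pose g := \sum_t (f : S).@[(P t) 0] *: homform (lb_homog t).
rewrite -[f](subrK g); apply: memvD; last by apply: memv_suml => t _; apply: memvZ.
have : f - g \in piece (J th0) n.+2.
  apply/(pieceP _ (aJ th0)); apply: (reduced_ci_vanishes q0 p0 ci0 (valP (f - g))).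
  move=> _ /PMP[t ->].
  have -> : val (f - g) = (f : S) - \sum_t (f : S).@[(P t) 0] *: (l * b t).
    apply: etrans (linearB (@mpoly_of_dhomog 4 k _) f g) _; congr (_ - _).
    rewrite (linear_sum (@mpoly_of_dhomog 4 k _)); apply: eq_bigr => u _; by rewrite linearZ.
  rewrite mevalB (big_morph _ (mevalD _) (meval0 _)) (bigD1 t) //= big1 => [|u ut].
    by rewrite mevalZ mevalM l1 // bE eqxx !mulr1 addr0 subrr.
  by rewrite mevalZ mevalM bE eq_sym (negbTE ut) !mulr0.
rewrite -(span_basis (vbasisP (piece (J th0) n.+2))); apply: subvP; apply/span_subvP => z.
move=> /(tnthP ys)[i ->]; rewrite (tnth_nth 0) -y0.
by have := inX (lshift n.+1 i); rewrite /Y (unsplitK (inl _ i)).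
Qed.

Let hilb0E : hilb (J th0) n.+2 = n.+1.
Proof.
case: ci0 => -[_ _ nFG nA] _; rewrite -[RHS]nE /J.
have -> : (n.+2 = p + (q + (n.+2 - p - q)))%N by have := sum_le; lia.
exact: (hilb_idealM hF (hG th0) nFG (hA th0) nA).
Qed.

Let Xb_basis : basis_of fullv Xb.
Proof.
rewrite basisEdim Xb_span subvv size_tuple /=.
exact: (arith4 (dim_piece_le (J th0) n.+2) hilb0E).
Qed.

Let crd (f : dhomog 4 k n.+2) : 'rV[k]_(n1 + n.+1) := \row_i coord Xb i f.
Let crdE f : f = \sum_i crd f 0 i *: Y i th0.
Proof.
rewrite {1}(coord_basis Xb_basis (memvf f)); apply: eq_bigr => i _.
by rewrite mxE -tnth_nth tnth_mktuple.
Qed.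

Let B th : 'M[k]_(n1 + n.+1) := \matrix_i crd (Y i th).
Let B0 : B th0 = 1%:M.
Proof.
apply/matrixP => i j; rewrite !mxE.
have -> : Y i th0 = Xb`_i by rewrite -tnth_nth tnth_mktuple.
rewrite coord_free; first by [].
exact: (vector.basis_free Xb_basis).
Qed.

Let B_poly : polymx B.
Proof.
move=> i j; apply: (@polyfun_ext _ _ (fun th => coord Xb j (Y i th))).
  by move=> th; rewrite !mxE.
rewrite /Y; case: (split i) => t; last exact: polyfun_const.
pose phi (f : S) := coord Xb j (homform (pihomogP mdeg n.+2 f)).
apply: (@polyfun_ext _ _ (fun th => phi (y t th))).
  move=> th; rewrite /phi; congr (coord _ _ _); apply/val_inj; exact: pihomog_dE.
apply: (polyform_linear (y_poly t)) => c g h; rewrite /phi -linearP /=; congr (coord _ _ _).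
by apply/val_inj; rewrite /= linearP.
Qed.

Let expand th (f : dhomog 4 k n.+2) : B th \in unitmx -> f = \sum_i (crd f *m invmx (B th)) 0 i *: Y i th.
Proof.
move=> uB; set c := _ *m _.
have -> : \sum_i c 0 i *: Y i th = \sum_j (c *m B th) 0 j *: Y j th0.
  rewrite (eq_bigr (fun i => \sum_j (c 0 i * B th i j) *: Y j th0)); last first.
    move=> i _; rewrite {1}(crdE (Y i th)) scaler_sumr; apply: eq_bigr => j _.
    by rewrite scalerA [B th i j]mxE.
  rewrite exchange_big; apply: eq_bigr => j _; by rewrite -scaler_suml mxE.
by rewrite mulmxKV // -crdE.
Qed.

Let expandJ th (f : dhomog 4 k n.+2) : B th \in unitmx -> J th ((f : S) - \sum_t (crd f *m invmx (B th)) 0 (rshift n1 t) *: (l * b t)).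
Proof.
move=> uB; set c := _ *m _; have -> : (f : S) = \sum_j c 0 (lshift n.+1 j) *: y j th + \sum_t c 0 (rshift n1 t) *: (l * b t).
  rewrite {1}(expand f uB) -/c (linear_sum (@mpoly_of_dhomog 4 k _)) big_split_ord; congr (_ + _).
    by apply: eq_bigr => j _; rewrite linearZ /Y (unsplitK (inl _ j)).
  by apply: eq_bigr => t _; rewrite linearZ /Y (unsplitK (inr _ t)).
rewrite addrK; apply: (big_ind (J th)) => [|x z|j _]; first exact: (ideal0 (idJ th)).
  by move=> hx hz; apply: (idealD (idJ th)).
by rewrite -mul_mpolyC; apply: (idealMl (idJ th)).
Qed.

Let xb_homog j s : 'X_j * b s \is n.+2.-homog.
Proof. by apply: (homogM (d := 1) (mpolyX_homog k j) (hb s)). Qed.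

Let U j th : 'M[k]_n.+1 := \matrix_(t, s) (crd (homform (xb_homog j s)) *m \adj (B th)) 0 (rshift n1 t).
Let X j th : 'M[k]_n.+1 := (\det (B th))^-1 *: U j th.

Let XE j th t s : B th \in unitmx -> X j th t s = (crd (homform (xb_homog j s)) *m invmx (B th)) 0 (rshift n1 t).
Proof. by move=> uB; rewrite /invmx uB -scalemxAr [RHS]mxE /X mxE; congr (_ * _); rewrite /U mxE. Qed.

Let X_rep j th : B th \in unitmx -> represents l (J th) b 1 'X_j (X j th).
Proof.
move=> uB s; have := expandJ (homform (xb_homog j s)) uB; congr (J th (_ - _)).
by apply: eq_bigr => t _; rewrite XE.
Qed.

Let X_span th f : B th \in unitmx -> f \is n.+2.-homog ->
  exists c : 'I_n.+1 -> k, J th (f - \sum_t c t *: (l * b t)).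
Proof.
move=> uB hf; exists (fun t => (crd (homform hf) *m invmx (B th)) 0 (rshift n1 t)).
exact: (expandJ (homform hf) uB).
Qed.

Let U_poly j : polymx (U j).
Proof.
move=> t s; apply: (@polyfun_ext _ _ (fun th => (crd (homform (xb_homog j s)) *m \adj (B th)) 0 (rshift n1 t))).
  by move=> th; rewrite [RHS]mxE.
by apply: polymx_mul; [exact: polymx_const | exact: polymx_adj].
Qed.

Let X0 j : X j th0 = diag_mx (\row_s P s 0 j).
Proof.
have uB : B th0 \in unitmx by rewrite B0 unitmx1.
apply/matrixP => t s; have := vanJ (X_rep j uB s) (PM t).
rewrite mevalB mevalM mevalXU bE (big_morph _ (mevalD _) (meval0 _)) (bigD1 t) //= big1 => [|u ut].
  rewrite mevalZ mevalM expr1 l1 // bE eqxx !mulr1 addr0 => /eqP; rewrite subr_eq0 => /eqP <-.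
  by rewrite !mxE mulr_natr.
by rewrite mevalZ mevalM bE eq_sym (negbTE ut) !mulr0.
Qed.

(** Reducedness is open, and the points of a reduced complete intersection move algebraically.  The
    multiplication matrices depend polynomially on th; where they are jointly diagonalisable they
    yield 3 q p points.  A polynomial in r of these points, summed over all choices of r points, is
    a polynomial in traces, hence remains nonzero near th0. *)
Lemma reduced_ci_open r (R : 'I_r -> pt) (h : ('I_r * 'I_4 -> k) -> k) :
  (forall j, R j \in M0) -> polyfun h -> h (fun ji => R ji.1 0 ji.2) != 0 ->
  exists D, [/\ polyfun D, D th0 != 0 & forall th, D th != 0 -> exists M, reduced_ci l q p (G th) (A th) M /\
     exists2 Q : 'I_r -> pt, (forall j, Q j \in M) & h (fun ji => Q ji.1 0 ji.2) != 0].
Proof.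
move=> RM ph hR; have [lam lam_inj] := separating_form P_inj.
have [ss hE] := polyfun_products ph.
have R_idx j : exists s, R j = P s by apply: PMP.
pose ix j := projT1 (cid (R_idx j)); have ixE j : R j = P (ix j) := projT2 (cid (R_idx j)).
pose var := ('I_4 * ('I_n.+1 * 'I_n.+1))%type.
pose mx (v : var -> k) j : 'M[k]_n.+1 := \matrix_(t, s) v (j, (t, s)).
pose lmx v := \sum_j lam j *: mx v j.
pose sep v := \det (horner_mx (lmx v) (char_poly (lmx v))^`()).
pose tra v := \sum_(x <- ss) x.1 * \prod_j \tr (mx_meval (mx v) (x.2 j * b (ix j))).
have pmx j : polymx (fun v => mx v j).
  move=> t s; apply: (@polyfun_ext _ _ (fun v => v (j, (t, s)))); first by move=> v; rewrite mxE.
  exact: polyfun_var.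
have psep : polyfun sep.
  apply: polyfun_separable; apply: polymx_sum => j; apply: polymx_scale => //; exact: polyfun_const.
have ptra : polyfun tra.
  apply: polyfun_sum => x; apply: polyfun_mul; first exact: polyfun_const.
  by apply: polyfun_prod => j; apply: polyfun_trace; apply: polymx_meval.
pose u (x : var) th := U x.1 th x.2.1 x.2.2.
have pu x : polyfun (u x) by exact: U_poly.
have pD1 : polyfun (fun th => \det (B th)) by apply: polymx_det.
have [f1 [e1 [pf1 f1E]]] := polyfun_frac psep pu pD1.
have [f2 [e2 [pf2 f2E]]] := polyfun_frac ptra pu pD1.
have mxX th : mx (fun x => u x th / \det (B th)) = X ^~ th.
  by apply/funext => j; apply/matrixP => t s; rewrite [LHS]mxE [RHS]mxE mulrC.
have [v0 Fv0 Gv0] : exists2 v, F.@[v] = 0 & (G th0).@[v] != 0.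
  apply: contrapT => H; case: ci0 => -[_ _ nFG _] _; apply: nFG; apply: (cubic_vanish hF) => v Fv.
  by apply/eqP/negPn/negP => Gv; apply: H; exists v.
exists (fun th => \det (B th) * (G th).@[v0] * (f1 th * f2 th)); split.
- by apply: polyfun_mul; apply: polyfun_mul => //; apply: polyform_meval.
- have d1 : \det (B th0) = 1 by rewrite B0 det1.
  have d0 : \det (B th0) != 0 by rewrite d1 oner_neq0.
  rewrite mulf_neq0 //; first by rewrite mulf_neq0.
  rewrite f1E // f2E // d1 !expr1n !mul1r; rewrite mulf_neq0 //.
    rewrite /sep /lmx; move: (mxX th0); rewrite d1 => ->.
    rewrite (_ : \sum_j _ = diag_mx (\row_s \sum_j lam j * P s 0 j)); last first.
      apply/matrixP => s t; rewrite summxE !mxE; case: (eqVneq s t) => [->|ne].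
        by rewrite mulr1n; apply: eq_bigr => j _; rewrite mxE X0 !mxE eqxx mulr1n.
      by rewrite mulr0n big1 // => j _; rewrite mxE X0 !mxE (negbTE ne) mulr0n mulr0.
    exact: separable_diag_mx.
  move: hR; rewrite hE /tra; move: (mxX th0); rewrite d1 => ->; congr (_ != 0).
  apply: eq_bigr => x _; congr (_ * _); apply: eq_bigr => j _.
  rewrite (@trace_mx_meval _ _ _ _ _ 1%:M (fun s i => P s 0 i)) ?unitmx1 //; last first.
    by move=> s i; rewrite X0 -row_mul mul1mx row_diag_mx mxE rowE mulmx1.
  rewrite (bigD1 (ix j)) //= big1 => [|s ne]; last by rewrite mevalM bE (negbTE ne) mulr0.
  by rewrite mevalM bE eqxx mulr1 addr0 ixE.
move=> th; rewrite !mulf_eq0 !negb_or => /andP[/andP[d0 Gv] /andP[f1n f2n]].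
have uB : B th \in unitmx by rewrite unitmxE unitfE.
have rep j := X_rep j uB; have spn := fun f hf => X_span (f := f) uB hf.
have nFG : ~ divides F (G th).
  by move=> [c Gc]; move: Gv; rewrite Gc mevalM Fv0 mul0r eqxx.
have le e : (hilb (J th) (e + n.+1).+1 <= n.+1)%N.
  by apply: (hilb_span_high hl (idJ th) hb rep spn).
have nA : nonzerodiv (idealC F (G th)) (A th).
  apply: (idealC_nonzerodiv_of_hilb hF (hG th) nFG (hA th)).
  by exists n.+2 => d led; have := le (d - n.+2)%N; rewrite -addnS subnK // nE.
have ge e : (n.+1 <= hilb (J th) (e + n.+1).+1)%N.
  have eE : (e + n.+1).+1 = (p + (q + ((e + n.+1).+1 - p - q)))%N.
    by move: sum_le; clear; lia.
  by rewrite eE; apply: leq_trans (hilb_idealM_ge hF (hG th) nFG (hA th) _); rewrite nE.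
have comm := X_comm hl (idJ th) hb rep spn ge.
pose L := \sum_j lam j *: X j th.
have sepL : separable_mx L.
  move: f1n; rewrite f1E // mulf_eq0 negb_or => /andP[_]; by rewrite /sep /lmx mxX.
have [YY [mu [uY mu_inj muL YX]]] := separable_diag sepL.
have commL j : X j th *m L = L *m X j th.
  rewrite mulmx_sumr mulmx_suml; apply: eq_bigr => i _; by rewrite -scalemxAr -scalemxAl comm.
pose nu j := projT1 (cid (YX _ (commL j))).
have nuE j s : row s YY *m X j th = nu j s *: row s YY := projT2 (cid (YX _ (commL j))) s.
pose Q s : pt := \row_j nu j s.
have Qrow s j : row s YY *m X j th = Q s 0 j *: row s YY by rewrite nuE mxE.
have Y0 s : row s YY != 0.
  apply/eqP => r0; have := congr1 (row s) (mulmxV uY); rewrite row_mul r0 mul0mx => /rowP/(_ s).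
  by rewrite !mxE eqxx => /esym/eqP; rewrite oner_eq0.
have Q_inj : injective Q.
  move=> s t e; apply: mu_inj; suff H s' : mu s' = \sum_j lam j * Q s' 0 j by rewrite !H e.
  have := muL s'; rewrite mulmx_sumr => /esym/eqP.
  rewrite (eq_bigr (fun j => (lam j * Q s' 0 j) *: row s' YY)); last first.
    by move=> j _; rewrite -scalemxAr Qrow scalerA.
  by rewrite -scaler_suml -subr_eq0 -scalerBl scaler_eq0 (negbTE (Y0 s')) orbF subr_eq0 => /eqP.
exists [seq Q s | s <- enum 'I_n.+1]; split.
  split; split=> //.
  - by rewrite map_inj_uniq ?enum_uniq.
  - split=> // _ /mapP[s _ ->].
    exact: (joint_eigen_normal hl (idJ th) hb rep spn ge (Y0 s) (Qrow s)).
  - by rewrite size_map size_enum_ord nE.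
  - move=> _ /mapP[s _ ->].
    have van f e : f \is e.+1.-homog -> J th f -> f.@[(Q s) 0] = 0.
      by move=> hf Jf; apply: (joint_eigen_vanish hl (idJ th) hb rep spn ge hf Jf (Y0 s) (Qrow s)).
    split.
    + by apply: (van F 2%N (cubic_homog hF)); apply: idealM_gen; left.
    + by apply: (van _ q.-1); [rewrite prednK | apply: idealM_gen; right; left].
    + by apply: (van _ p.-1); [rewrite prednK | apply: idealM_gen; right; right].
have : \sum_(f : {ffun 'I_r -> 'I_n.+1}) (\prod_j (b (ix j)).@[(Q (f j)) 0]) * h (fun ji => Q (f ji.1) 0 ji.2) != 0.
  move: f2n; rewrite f2E // mulf_eq0 negb_or => /andP[_]; rewrite /tra mxX; congr (_ != 0).
  under [RHS]eq_bigr => f _ do rewrite hE mulr_sumr.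
  rewrite exchange_big /=; apply: eq_bigr => x _.
  under eq_bigr => j _ do rewrite (trace_mx_meval _ uY Qrow).
  rewrite bigA_distr_bigA mulr_sumr; apply: eq_bigr => f _; rewrite mulrCA -big_split; congr (_ * _).
  by apply: eq_bigr => j _ /=; rewrite mevalM mulrC.
move=> sum0; have [f hf] : exists f : {ffun 'I_r -> 'I_n.+1}, h (fun ji => Q (f ji.1) 0 ji.2) != 0.
  apply: contrapT => H; case/eqP: sum0; apply: big1 => f _.
  by have [->|hf] := eqVneq (h (fun ji => Q (f ji.1) 0 ji.2)) 0; [rewrite mulr0 | case: H; exists f].
exists (fun j => Q (f j)) => // j; apply: map_f; exact: mem_enum.
Qed.

End Openness.
End ReducedCI.

(** * Two links moving a point set *)

Lemma homzZ n (R : comNzRingType) t (c : R) (f : {mpoly R[n]}) : homz t f -> homz t (c *: f).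
Proof. by case: t => d /=; [exact: rpredZ | move/eqP->; rewrite scaler0]. Qed.

Lemma arith5 (a b c d q m : nat) : (a + b = 3 * q * m -> c + d = 3 * q * 1 ->
  3 * q * m.+1 <= a + c + (b + d))%N.
Proof. lia. Qed.

Section Near.
Variables (k : closedFieldType) (F : {mpoly k[4]}).
Hypothesis hF : smooth_cubic_surface F.
Local Notation S := {mpoly k[4]}.
Local Notation pt := 'rV[k]_4.
Implicit Types (l G A B f g h : S) (M X Y Z : seq pt).

(** A degree above [sg] puts no condition on a functional, so point masses are multiples of c. *)
Lemma weights_neq0 X sg c P : gorenstein_weights X sg c -> P \in X -> c P != 0.
Proof.
move=> [_ h] PX; have [|g _ /(_ P PX)] := h sg.+1 (fun Q => (Q == P)%:R).
  by move=> j f e; exfalso; move: e; lia.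
by rewrite eqxx => e; apply: contraTneq isT => c0; move/eqP: e; rewrite c0 mul0r oner_eq0.
Qed.

Lemma reduced_ci_mem l q p G A M (P : pt) : reduced_ci F l q p G A M ->
  F.@[P 0] = 0 -> G.@[P 0] = 0 -> A.@[P 0] = 0 -> l.@[P 0] = 1 -> P \in M.
Proof.
move=> [[hG hA nG nA] [uM [hl nM] sM vM]] FP GP AP lP; apply: contrapT => /negP PM.
have := @size_points_le _ _ hF _ _ hG nG _ _ hA nA l (P :: M).
rewrite /= PM uM sM ltnn => H; suff: false by [].
apply: H => //.
- by split=> // Q; rewrite inE => /orP[/eqP->|/nM].
- by move=> Q; rewrite inE => /orP[/eqP->|/vM[]].
- by move=> Q; rewrite inE => /orP[/eqP->|/vM[]].
- by move=> Q; rewrite inE => /orP[/eqP->|/vM[]].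
Qed.

Lemma reduced_ci_perm l q p G A M M' : perm_eq M M' -> reduced_ci F l q p G A M ->
  reduced_ci F l q p G A M'.
Proof.
move=> pM [h [uM [hl nM] sM vM]]; split=> //; split.
- by rewrite -(perm_uniq pM).
- by split=> // P; rewrite -(perm_mem pM); apply: nM.
- by rewrite -(perm_size pM).
- by move=> P; rewrite -(perm_mem pM); apply: vM.
Qed.

Lemma idealC_split l G q f d : G \is q.-homog -> l \is 1.-homog -> f \is d.-homog ->
  idealM F G l f -> exists2 g, homz (d%:Z - 1) g &
    forall v, F.@[v] = 0 -> G.@[v] = 0 -> f.@[v] = l.@[v] * g.@[v].
Proof.
move=> hG hl hf [x [g [Cx fE]]]; exists (projz (d%:Z - 1) g); first exact: projz_homz.
move=> v Fv Gv; have e : l * projz (d%:Z - 1) g = pihomog mdeg d (l * g).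
  by have := projzM (d%:Z - 1) g hl; rewrite subrK.
rewrite -mevalM e -(pihomog_dE hf) fE pihomogD mevalD [X in X + _](_ : _ = 0) ?add0r //.
have [a [b [[a' [b' [-> ->]]] ->]]] := @idealC_homog _ _ hF _ _ hG _ d Cx.
by rewrite add0r mevalD !mevalM Fv Gv !mul0r addr0.
Qed.

Section Core.
Variables (l : S) (q m : nat) (G A B lf : S) (Z' Z'' Y1 Y Zt : seq pt) (t : k).
Hypotheses (q0 : (0 < q)%N) (m0 : (0 < m)%N) (mY : (m + size Y = q.+1)%N)
  (sY : (0 < size Y <= 2)%N).
Hypotheses (ciL : reduced_ci F l q 1 G lf (Y1 ++ Y)) (hA : A \is m.-homog)
  (hB : B \is m.+1.-homog) (BY1 : vanishes Y1 B) (BY : forall P, P \in Y -> B.@[P 0] != 0).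
Hypotheses (t0 : t != 0) (ciM : reduced_ci F l q m.+1 G (A * lf + t *: B) (Z' ++ Y1 ++ Zt)).

Let hl : l \is 1.-homog. Proof. by case: ciL => _ [_ []]. Qed.
Let nY : normalized l Y.
Proof. by case: ciL => _ [_ + _ _]; apply: normalizedW => P PY; rewrite mem_cat PY orbT. Qed.
Let uY : uniq Y. Proof. by case: ciL => _ []; rewrite cat_uniq => /and3P[]. Qed.

Let sepY P d : P \in Y -> (size Y <= d.+1)%N ->
  exists2 g, g \is d.-homog & forall Q, Q \in Y -> g.@[Q 0] = (Q == P)%:R.
Proof.
move=> PY le; have [| |g hg [gP gY]] := @separate _ l (rem P Y) P.
- split=> // Q; rewrite inE => /orP[/eqP->|/mem_rem]; exact: nY.2.
- by rewrite mem_rem_uniqF.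
rewrite size_rem // in hg; have [g' hg' g'E] := raise_degree (d - (size Y).-1) nY hg.
exists ((g.@[P 0])^-1 *: g'); first by rewrite rpredZ //; rewrite subnK // in hg'; move: le; lia.
move=> Q QY; rewrite mevalZ g'E //; case: eqP => [->|/eqP QP]; first by rewrite mulVf.
have QR : Q \in rem P Y by rewrite mem_rem_uniq // inE QP.
by rewrite (gY Q QR) mulr0.
Qed.

Let cancel_on_Y f d : f \is d.-homog -> vanishes Y1 f ->
  exists2 h, homz (d%:Z - m.+1%:Z) h & forall P, P \in Y -> f.@[P 0] = B.@[P 0] * h.@[P 0].
Proof.
move=> hf fY1; have [cL wcL] := reduced_ci_weights hF q0 (isT : (0 < 1)%N) ciL.
have cL0 P : P \in Y -> cL P != 0.
  by move=> PY; apply: (weights_neq0 wcL); rewrite mem_cat PY orbT.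
case: wcL => wL _; rewrite addn1 /= in wL.
have rel f' g d' : f' \is d'.-homog -> vanishes Y1 f' -> (d' <= q)%N -> g \is (q - d').-homog ->
    \sum_(P <- Y) cL P * (f'.@[P 0] * g.@[P 0]) = 0.
  move=> hf' v' le hg; have hfg : f' * g \is q.-homog by apply: (homogM hf' hg); rewrite subnKC.
  rewrite -[RHS](wL _ hfg) big_cat /= [X in _ = X + _]big_seq [X in _ = X + _]big1 ?add0r => [|P PY].
    by apply: eq_bigr => P _; rewrite mevalM.
  by rewrite mevalM v' // mul0r mulr0.
have vanish : (d <= q)%N -> (size Y <= (q - d).+1)%N -> vanishes Y f.
  move=> le le' P PY; have [g hg gE] := sepY PY le'.
  have := rel f g d hf fY1 le hg; rewrite (bigD1_seq P) //= big_seq_cond big1 => [|Q /andP[QY QP]].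
    rewrite addr0 gE // eqxx mulr1 => /eqP; rewrite mulf_eq0 (negbTE (cL0 _ PY)) => /eqP //.
  by rewrite gE // (negbTE QP) !mulr0.
have [le|lt] := leqP d q; last first.
  have dE : (d%:Z - m.+1%:Z = (d - m.+1)%N%:Z) by rewrite subzn //; move: mY sY lt; lia.
  have le' : (size Y <= (d - m.+1).+1)%N by move: mY sY lt; clear; lia.
  pose gs P := if pselect (P \in Y) is left h then s2val (cid2 (sepY h le')) else 0.
  exists (\sum_(P <- Y) (f.@[P 0] / B.@[P 0]) *: gs P).
    rewrite dE /= big_seq; apply: rpred_sum => P PY; rewrite rpredZ // /gs.
    by case: pselect => // h; exact: s2valP (cid2 (sepY h le')).
  move=> P PY; rewrite (big_morph _ (mevalD _) (meval0 _)) (bigD1_seq P) //=.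
  have gsE Q : Q \in Y -> (gs Q).@[P 0] = (P == Q)%:R.
    by move=> QY; rewrite /gs; case: pselect => // h; exact: (s2valP' (cid2 (sepY h le')) P PY).
  rewrite big_seq_cond big1 => [|Q /andP[QY QP]]; last first.
    by rewrite mevalZ gsE // eq_sym (negbTE QP) mulr0.
  by rewrite mevalZ gsE // eqxx mulr1 addr0 mulrC divfK // BY.
have [le'|lt'] := leqP (size Y) (q - d).+1.
  by exists 0 => [|P PY]; rewrite ?homz0 // meval0 mulr0 vanish.
have dq : d = q by move: sY lt' le; clear; lia.
have s2 : size Y = 2 by move: sY lt'; rewrite dq subnn; clear; lia.
have mq : m.+1 = q by move: mY; rewrite s2; lia.
case YE : Y s2 => [|y1 [|y2 []]] // _.
have y1Y : y1 \in Y by rewrite YE inE eqxx.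
have y2Y : y2 \in Y by rewrite YE !inE eqxx orbT.
have one : (1 : S) \is (q - q).-homog by rewrite subnn dhomog1.
rewrite dq in hf; have hB' : B \is q.-homog by rewrite -mq.
have rf := rel f 1 q hf fY1 (leqnn _) one; have rB := rel B 1 q hB' BY1 (leqnn _) one.
move: rf rB; rewrite YE !big_cons !big_nil !meval1 !mulr1 !addr0 => rf rB.
exists (f.@[y1 0] / B.@[y1 0])%:MP; first by rewrite dq mq subrr -[_%:MP]mulr1 mul_mpolyC homzZ //= dhomog1.
move=> P; rewrite !inE mevalC => /orP[/eqP->|/eqP->].
  by rewrite mulrC divfK // BY.
apply: (mulfI (cL0 _ y2Y)); rewrite !mulrA.
have -> : cL y2 * B.@[y2 0] = - (cL y1 * B.@[y1 0]) by apply/eqP; rewrite -addr_eq0 addrC rB.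
have -> : cL y2 * f.@[y2 0] = - (cL y1 * f.@[y1 0]) by apply/eqP; rewrite -addr_eq0 addrC rf.
by field; apply: BY.
Qed.

Let onM P : P \in Z' ++ Zt -> [/\ F.@[P 0] = 0, G.@[P 0] = 0 & B.@[P 0] = - t^-1 * (A.@[P 0] * lf.@[P 0])].
Proof.
move=> PX; case: ciM => _ [_ _ _ vM]; have [|-> ->] := vM P.
  by move: PX; rewrite !mem_cat => /orP[->|->]; rewrite ?orbT.
rewrite mevalD mevalM mevalZ => /eqP; rewrite addr_eq0 => /eqP ->; split=> //.
by rewrite mulrNN mulKf.
Qed.

Let divide_lf f d : f \is d.-homog -> vanishes Y1 f ->
  exists2 g, homz (d%:Z - 1) g & forall P, P \in Z' ++ Zt -> f.@[P 0] = lf.@[P 0] * g.@[P 0].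
Proof.
move=> hf fY1; have [h hh hE] := cancel_on_Y hf fY1.
have hBh : B * h \is d.-homog by have := homzM hB hh; rewrite subrK.
case: (ciL) => -[hG hlf _ _] [_ _ _ vL].
have [||g hg gE] := @idealC_split lf G q (f - B * h) d hG hlf.
- by rewrite rpredB.
- apply: (reduced_ci_vanishes hF q0 (isT : (0 < 1)%N) ciL (rpredB hf hBh)).
  move=> P; rewrite mem_cat mevalB mevalM => /orP[PY|PY]; last by rewrite hE // subrr.
  by rewrite fY1 // BY1 // mul0r subrr.
exists (g - t^-1 *: (A * h)).
  apply: homzD => //; apply: homzN; apply: homzZ.
  by have := homzM hA hh; rewrite (_ : d%:Z - m.+1%:Z + m%:Z = d%:Z - 1) // intS; ring.
move=> P PX; have [Fv Gv BP] := onM PX.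
have := gE _ Fv Gv; rewrite mevalB mevalM BP => /eqP; rewrite subr_eq => /eqP ->.
by rewrite mevalB mevalZ mevalM; ring.
Qed.

(** Removing from a complete intersection the part Y1 in the plane lf = 0: a form of degree d vanishing
    on Y1 agrees on the remaining points with lf times a form of degree d - 1, so the weights
    multiplied by lf are dual weights in one degree less. *)
Lemma moved_weights : exists c, gorenstein_weights (Z' ++ Zt) (q + m).-1 c.
Proof.
have [c wc] := reduced_ci_weights hF q0 (isT : (0 < m.+1)%N) ciM.
have c0 P := weights_neq0 (P := P) wc; case: wc => w1 w2.
case: (ciL) => -[_ hlf _ _] [_ _ _ vL]; case: (ciM) => _ [uM _ _ _].
have sE : (q + m.+1).-1 = (q + m).-1.+1 by move: q0; clear; lia.
exists (fun P => c P * lf.@[P 0]); split.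
  move=> f hf; have h : lf * f \is (q + m.+1).-1.-homog by apply: (homogM (d := 1) hlf hf).
  rewrite -[RHS](w1 _ h) !big_cat /= [X in _ = _ + (X + _)]big_seq [X in _ = _ + (X + _)]big1 => [|P PY].
    by rewrite add0r; congr (_ + _); apply: eq_bigr => P _; rewrite mevalM mulrA.
  by have [|_ _ lP] := vL P; rewrite ?mem_cat ?PY // mevalM lP mul0r mulr0.
move=> e v hv; pose v' P := if P \in Y1 then 0 else v P.
have notY1 P : P \in Z' ++ Zt -> P \notin Y1.
  move: uM; rewrite uniq_catC -catA cat_uniq => /and3P[_ /hasPn H _] PX; apply: H.
  by move: PX; rewrite !mem_cat orbC.
have [|g hg gE] := w2 e.+1 v'.
  move=> j f je hf; rewrite -[RHS](hv j f _ hf); last by move: je sE; clear; lia.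
  have e1 X : {subset X <= Z' ++ Zt} -> \sum_(P <- X) v' P * f.@[P 0] = \sum_(P <- X) v P * f.@[P 0].
    by move=> sub; apply: eq_big_seq => P /sub/notY1; rewrite /v' => /negbTE->.
  have s1 : {subset Z' <= Z' ++ Zt} by move=> P PX; rewrite mem_cat PX.
  have s2 : {subset Zt <= Z' ++ Zt} by move=> P PX; rewrite mem_cat PX orbT.
  rewrite !big_cat /= (e1 _ s1) (e1 _ s2).
  rewrite [X in _ + (X + _)]big_seq [X in _ + (X + _)]big1 ?add0r // => P PY.
  by rewrite /v' PY mul0r.
have gY1 : vanishes Y1 g.
  move=> P PY; have PM : P \in Z' ++ Y1 ++ Zt by rewrite !mem_cat PY orbT.
  have := gE P PM; rewrite /v' PY => /esym/eqP; rewrite mulf_eq0 (negbTE (c0 P PM)) => /eqP //.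
have [g' hg' g'E] := divide_lf hg gY1.
rewrite -[e.+1]addn1 PoszD addrK in hg'; exists g' => // P PX.
have PM : P \in Z' ++ Y1 ++ Zt by move: PX; rewrite !mem_cat => /orP[->|->]; rewrite ?orbT.
by rewrite -mulrA -g'E // -gE // /v' (negbTE (notY1 P PX)).
Qed.

End Core.

Definition differ (P Q : pt) : 'I_4 := odflt 0 [pick i | P 0 i != Q 0 i].

Lemma differP (P Q : pt) : P != Q -> P 0 (differ P Q) != Q 0 (differ P Q).
Proof.
move=> PQ; rewrite /differ; case: pickP => // H; case/eqP: PQ; apply/rowP => i.
by apply/eqP/negPn; rewrite H.
Qed.

(** The relation w, divided by the weights of the complete intersection, is the form B of the pencil
    A lf + t B; for general t its moving points satisfy h. *)
Lemma near (l : S) q m (G A lf : S) (Z' Z'' Y1 Y : seq pt) (w : pt -> k) :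
  (0 < q)%N -> (0 < m)%N -> (m + size Y = q.+1)%N -> (0 < size Y <= 2)%N ->
  size (Z' ++ Z'') = (3 * q * m)%N -> reduced_ci F l q 1 G lf (Y1 ++ Y) ->
  A \is m.-homog -> vanishes Z' A ->
  reduced_ci F l q m.+1 G (A * lf) ((Z' ++ Z'') ++ (Y1 ++ Y)) ->
  (forall f, f \is q.-1.-homog -> \sum_(P <- Z'' ++ Y) w P * f.@[P 0] = 0) ->
  (forall P, P \in Y -> w P != 0) ->
  forall r (h : ('I_r * 'I_4 -> k) -> k), r = size (Z'' ++ Y) -> polyfun h ->
    h (fun ji => nth 0 (Z'' ++ Y) ji.1 0 ji.2) != 0 ->
  exists Q : 'I_r -> pt, [/\ h (fun ji => Q ji.1 0 ji.2) != 0,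
    uniq (Z' ++ [seq Q j | j <- enum 'I_r]),
    normalized l (Z' ++ [seq Q j | j <- enum 'I_r]),
    vanishes (Z' ++ [seq Q j | j <- enum 'I_r]) F
    & exists c, gorenstein_weights (Z' ++ [seq Q j | j <- enum 'I_r]) (q + m).-1 c].
Proof.
move=> q0 m0 mY sY sX ciL hA AZ' ci0 wrel wY r h rE ph hR.
set R := Z'' ++ Y in rE hR wrel.
case: (ci0) => -[hG _ _ _] [uM nM sM vM]; case: (ciL) => -[_ hlf _ _] [_ _ sL vL].
have pM0 : perm_eq ((Z' ++ Z'') ++ Y1 ++ Y) ((Z' ++ Y1) ++ R).
  by apply/seq.permP => x; rewrite /R !count_cat; lia.
have uM' : uniq ((Z' ++ Y1) ++ R) by rewrite -(perm_uniq pM0).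
have disj P : P \in R -> P \notin Z' ++ Y1.
  by move: uM'; rewrite cat_uniq => /and3P[_ /hasPn H _] /H.
have uR : uniq R by move: uM'; rewrite cat_uniq => /and3P[].
have [c0 wc] := reduced_ci_weights hF q0 (isT : (0 < m.+1)%N) ci0.
have c0n P := weights_neq0 (P := P) wc; case: wc => _ w2.
have [|B hB BE] := w2 m.+1 (fun P => if P \in Z' ++ Y1 then 0 else w P).
  move=> j f je hf; have jq : j = q.-1 by move: je; clear; lia.
  rewrite jq in hf; rewrite (perm_big _ pM0) big_cat /= -[RHS](wrel f hf).
  rewrite [X in X + _]big_seq [X in X + _]big1 ?add0r => [|P ->]; last by rewrite mul0r.
  by apply: eq_big_seq => P /disj/negbTE->.
have inM P : P \in Z' ++ Y1 -> P \in (Z' ++ Z'') ++ Y1 ++ Y.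
  by move=> PZ; rewrite (perm_mem pM0) mem_cat PZ.
have B0 : vanishes (Z' ++ Y1) B.
  move=> P PZ; have := BE P (inM P PZ); rewrite PZ => /esym/eqP.
  by rewrite mulf_eq0 (negbTE (c0n P (inM P PZ))) => /eqP.
have BY P : P \in Y -> B.@[P 0] != 0.
  move=> PY; have PR : P \in R by rewrite mem_cat PY orbT.
  have PM : P \in (Z' ++ Z'') ++ Y1 ++ Y by rewrite !mem_cat PY !orbT.
  apply: contra (wY P PY) => /eqP BP; have := BE P PM.
  by rewrite (negbTE (disj P PR)) BP mulr0 => ->.
pose At (th : unit -> k) := A * lf + th tt *: B.
have pAt : polyform At.
  by apply: polyform_add; [exact: polyform_const | apply: polyform_scale; [exact: polyfun_var | exact: polyform_const]].
have hAl : A * lf \is m.+1.-homog by apply: (homogM hA hlf); rewrite addn1.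
have hAt th : At th \is m.+1.-homog by rewrite rpredD // rpredZ.
have ci0' : reduced_ci F l q m.+1 G (At (fun=> 0)) ((Z' ++ Z'') ++ Y1 ++ Y).
  by rewrite /At scale0r addr0.
pose RR (j : 'I_r) := nth 0 R j.
have RR_mem j : RR j \in R by rewrite mem_nth // -rE.
have RR_inj : injective RR by move=> i j /eqP; rewrite nth_uniq -?rE // => /eqP/val_inj.
pose h' (v : 'I_r * 'I_4 -> k) := h v * ((\prod_j \prod_(P <- Z' ++ Y1) (v (j, differ (RR j) P) - P 0 (differ (RR j) P)))
   * \prod_j \prod_(j' | j' != j) (v (j, differ (RR j) (RR j')) - v (j', differ (RR j) (RR j')))).
have ph' : polyfun h'.
  apply: polyfun_mul => //; apply: polyfun_mul.
    apply: polyfun_prod => j; apply: polyfun_prod => P; apply: polyfun_sub; [exact: polyfun_var | exact: polyfun_const].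
  by apply: polyfun_prod => j; apply: polyfun_prod => j'; apply: polyfun_sub; exact: polyfun_var.
have h'R : h' (fun ji => RR ji.1 0 ji.2) != 0.
  rewrite mulf_neq0 // mulf_neq0 //=.
    apply/prodf_neq0 => j _; rewrite prodf_seq_neq0; apply/allP => P PZ /=; rewrite subr_eq0.
    by apply: differP; apply: contraNneq (disj _ (RR_mem j)) => ->.
  apply/prodf_neq0 => j _; apply/prodf_neq0 => j' jj; rewrite subr_eq0.
  by apply: differP; apply: contra jj => /eqP/RR_inj->.
have RM j : RR j \in (Z' ++ Z'') ++ Y1 ++ Y by rewrite (perm_mem pM0) mem_cat RR_mem orbT.
have [D [pD D0 DE]] := reduced_ci_open hF q0 (isT : (0 < m.+1)%N) (polyform_const _ G) pAt
  (fun _ => hG) hAt ci0' RM ph' h'R.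
have [t tn Dt] : exists2 t, t \notin [:: 0] & D (fun=> ('X : {poly k}).[t]) != 0.
  by apply: (@polyfun_curve_nonroot _ _ D (fun=> 'X) 0) => //; rewrite hornerX.
rewrite inE in tn; rewrite hornerX in Dt.
have [M [ciM [Q QM hQ]]] := DE _ Dt.
move: hQ; rewrite /h' !mulf_eq0 !negb_or => /and3P[hQ /prodf_neq0 hZ /prodf_neq0 hI].
have Q_inj : injective Q.
  move=> i j e; apply/eqP/negPn/negP => ij.
  have /prodf_neq0/(_ j) := hI i isT; rewrite eq_sym ij => /(_ isT) /=.
  by rewrite e subrr eqxx.
set Zt := [seq Q j | j <- enum 'I_r].
have uZt : uniq Zt by rewrite map_inj_uniq ?enum_uniq.
have sZt : size Zt = r by rewrite size_map size_enum_ord.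
have QZ j : Q j \notin Z' ++ Y1.
  apply/negP => QZ; have := hZ j isT; rewrite prodf_seq_neq0 => /allP/(_ _ QZ) /=.
  by rewrite subrr eqxx.
have ZM : {subset Z' ++ Y1 <= M}.
  move=> P PZ; have [FP GP _] := vM P (inM P PZ).
  apply: (reduced_ci_mem ciM) => //; last exact: (nM.2 P (inM P PZ)).
  rewrite /At mevalD mevalM mevalZ B0 // mulr0 addr0.
  move: PZ; rewrite mem_cat => /orP[/AZ'->|PY]; first by rewrite mul0r.
  by have [|_ _ ->] := vL P; rewrite ?mulr0 // mem_cat PY.
have uAll : uniq ((Z' ++ Y1) ++ Zt).
  rewrite cat_uniq uZt andbT; move: uM'; rewrite cat_uniq => /and3P[-> _ _] /=.
  by apply/hasPn => _ /mapP[j _ ->]; exact: QZ.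
have pM : perm_eq M (Z' ++ Y1 ++ Zt).
  rewrite catA perm_sym; apply: uniq_perm => //; first by case: ciM => _ [].
  have sub : {subset (Z' ++ Y1) ++ Zt <= M}.
    by move=> P; rewrite mem_cat => /orP[/ZM//|/mapP[j _ ->]].
  apply: (uniq_min_size uAll sub _).2.
  case: ciM => _ [_ _ -> _]; rewrite !size_cat sZt rE !size_cat.
  by move: sX sL; rewrite !size_cat; exact: arith5.
have ciM' := reduced_ci_perm pM ciM.
have subX : {subset Z' ++ Zt <= Z' ++ Y1 ++ Zt}.
  by move=> P; rewrite !mem_cat => /orP[->|->]; rewrite ?orbT.
case: (ciM') => _ [uM'' nM'' _ vM'']; exists Q; split=> //.
- rewrite -/Zt; move: uAll; rewrite uniq_catC catA cat_uniq => /and3P[+ _ _].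
  by rewrite uniq_catC.
- exact: normalizedW subX nM''.
- by move=> P /subX/vM''[].
have vB : vanishes Y1 B by move=> P PY; apply: B0; rewrite mem_cat PY orbT.
exact: (moved_weights q0 m0 mY sY ciL hA hB vB BY tn ciM').
Qed.

End Near.

(** * Points imposing independent conditions *)

Lemma arith6 (x m y : nat) : (m + y <= x)%N -> (y <= x - m)%N.
Proof. lia. Qed.

Lemma tnth_eq (I : eqType) (T : seq I) (s t : 'I_(size T)) : uniq T ->
  (tnth (in_tuple T) s == tnth (in_tuple T) t) = (s == t).
Proof.
by move=> uT; have x0 := tnth (in_tuple T) s; rewrite !(tnth_nth x0) nth_uniq.
Qed.

Section Independence.
Variables (k : closedFieldType) (F : {mpoly k[4]}).
Hypothesis hF : smooth_cubic_surface F.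
Local Notation S := {mpoly k[4]}.
Local Notation pt := 'rV[k]_4.
Implicit Types (T X Y Z : seq pt) (f g l : S).

Definition indep d T : Prop := exists b : pt -> S, (forall P, P \in T -> b P \is d.-homog) /\
  forall P Q, P \in T -> Q \in T -> (b P).@[Q 0] = (Q == P)%:R.

Lemma indep_sub d T T' : {subset T' <= T} -> indep d T -> indep d T'.
Proof.
by move=> sub [b [hb bE]]; exists b; split=> [P /sub/hb//|P Q /sub PT /sub QT]; apply: bE.
Qed.

Lemma indep_raise l d d' T : normalized l T -> (d <= d')%N -> indep d T -> indep d' T.
Proof.
move=> [hl nT] le [b [hb bE]]; exists (fun P => l ^+ (d' - d) * b P); split=> [P PT|P Q PT QT].
  by apply: (homogM (homogX _ hl) (hb P PT)); rewrite subnK.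
by rewrite mevalM rmorphXn /= nT // expr1n mul1r bE.
Qed.

Lemma indep_add d T g (P : pt) : indep d T -> g \is d.-homog -> vanishes T g -> g.@[P 0] != 0 ->
  indep d (P :: T).
Proof.
move=> [b [hb bE]] hg gT gP; have PT : P \notin T by apply: contra gP => /gT->.
exists (fun Q => if Q == P then (g.@[P 0])^-1 *: g else b Q - ((b Q).@[P 0] / g.@[P 0]) *: g).
split=> [Q|Q R]; rewrite !inE; first by case: eqP => [_ _|_ /= /hb h]; rewrite ?rpredB ?rpredZ.
case: eqP => [->|/eqP QP] /= => [_|QT] /orP[/eqP->|RT].
- by rewrite mevalZ mulVf // eqxx.
- rewrite mevalZ (gT R RT) mulr0; case: eqP => // RP; by rewrite RP (negbTE PT) in RT.
- by rewrite mevalB mevalZ divfK // subrr eq_sym (negbTE QP).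
- by rewrite mevalB mevalZ (gT R RT) mulr0 subr0 bE.
Qed.

(** Forms that vanish on Z and separate Y extend independence from Z to Z and Y. *)
Lemma indep_cat d Z Y (b : pt -> S) : indep d Z -> (forall P, P \in Y -> b P \is d.-homog) ->
  (forall P, P \in Y -> vanishes Z (b P)) ->
  (forall P Q, P \in Y -> Q \in Y -> (b P).@[Q 0] = (Q == P)%:R) -> indep d (Z ++ Y).
Proof.
move=> iZ; elim: Y => [|P Y IH] hb bZ bE; first by rewrite cats0.
have sub : {subset Y <= P :: Y} by move=> Q QY; rewrite inE QY orbT.
have {IH} iZY : indep d (Z ++ Y).
  by apply: IH => [Q /sub/hb//|Q /sub/bZ//|Q R /sub QY /sub RY]; apply: bE.
have PP : P \in P :: Y by rewrite inE eqxx.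
have [PY|PY] := boolP (P \in Y).
  by apply: indep_sub iZY => Q; rewrite !mem_cat inE => /or3P[->|/eqP->|->]; rewrite ?PY ?orbT.
suff : indep d (P :: Z ++ Y) by apply: indep_sub => Q; rewrite !inE !mem_cat inE orbCA.
apply: (indep_add iZY (hb P PP)); last by rewrite bE // eqxx oner_neq0.
move=> Q; rewrite mem_cat => /orP[QZ|QY]; first exact: bZ.
rewrite (bE P Q PP (sub _ QY)); case: eqP => // e; by rewrite -e QY in PY.
Qed.

Lemma hilb_indep_le d Z : indep d Z -> (hilb (vanishes Z) d <= size Z)%N.
Proof.
move=> [b [hb bE]]; have aJ := ideal_additive (vanishes_ideal Z).
pose bb P : dhomog 4 k d := homform (pihomogP mdeg d (b P)).
have full : (piece (vanishes Z) d + <<[seq bb P | P <- undup Z]>> = fullv)%VS.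
  apply/eqP; rewrite eqEsubv subvf; apply/subvP => f _.
  pose g := \sum_(P <- undup Z) (f : S).@[P 0] *: bb P.
  apply/memv_addP; exists (f - g); last exists g; last by rewrite subrK.
    apply/(pieceP _ aJ); have -> : (f - g : dhomog 4 k d) = (f : S) - \sum_(P <- undup Z) (f : S).@[P 0] *: b P :> S.
      rewrite (linearB (@mpoly_of_dhomog 4 k d)); congr (_ - _).
      rewrite (linear_sum (@mpoly_of_dhomog 4 k d)); apply: eq_big_seq => P; rewrite mem_undup => PZ.
      by rewrite linearZ /=; congr (_ *: _); rewrite pihomog_dE // hb.
    move=> Q QZ; rewrite mevalB (big_morph _ (mevalD _) (meval0 _)) (bigD1_seq Q) ?mem_undup ?undup_uniq //=.
    rewrite big_seq_cond big1 => [|P /andP[PZ PQ]]; last first.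
      by rewrite mem_undup in PZ; rewrite mevalZ bE // eq_sym (negbTE PQ) mulr0.
    by rewrite mevalZ bE // eqxx mulr1 addr0 subrr.
  rewrite /g big_seq; apply: memv_suml => P PZ; apply: memvZ; apply: memv_span; exact: map_f.
have := dimv_sum_cap (piece (vanishes Z) d) <<[seq bb P | P <- undup Z]>>; rewrite full.
have := dim_span [seq bb P | P <- undup Z]; rewrite size_map => h1 h2.
apply: leq_trans (size_undup Z); exact: (arith3 h1 h2).
Qed.

Lemma indep_size d T J : uniq T -> indep d T -> additive_pred J ->
  (forall f, f \is d.-homog -> J f -> vanishes T f) -> (size T <= hilb J d)%N.
Proof.
move=> uT [b [hb bE]] aJ JT.
pose bb P : dhomog 4 k d := homform (pihomogP mdeg d (b P)).
pose X := [tuple of [seq bb P | P <- in_tuple T]].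
have comb (c : 'I_(size T) -> k) : (\sum_i c i *: X`_i : dhomog 4 k d) = \sum_i c i *: b (tnth (in_tuple T) i) :> S.
  rewrite (linear_sum (@mpoly_of_dhomog 4 k d)); apply: eq_bigr => i _.
  rewrite linearZ -tnth_nth tnth_map /=; congr (_ *: _); rewrite pihomog_dE // hb //; exact: mem_tnth.
have ev (c : 'I_(size T) -> k) j : (\sum_i c i *: b (tnth (in_tuple T) i)).@[(tnth (in_tuple T) j) 0] = c j.
  rewrite (big_morph _ (mevalD _) (meval0 _)) (bigD1 j) //= big1 => [|i ij].
    by rewrite mevalZ bE ?mem_tnth // eqxx mulr1 addr0.
  rewrite mevalZ bE ?mem_tnth //; case: eqP => [e|]; last by rewrite mulr0.
  by case/eqP: ij; apply/eqP; rewrite -(tnth_eq _ _ uT) e.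
have JX (c : 'I_(size T) -> k) : J (\sum_i c i *: X`_i : dhomog 4 k d) -> forall i, c i = 0.
  move=> Jc i; rewrite -(ev c i) -comb; apply: JT Jc _ _; last exact: mem_tnth.
  exact: (valP (\sum_i c i *: X`_i : dhomog 4 k d)).
have frX : free X.
  by apply/freeP => c c0; apply: JX; rewrite c0 linear0; case: aJ.
have dX : \dim <<X>> = size T by move: frX; rewrite /free => /eqP ->; rewrite size_tuple.
have cap0 : (piece J d :&: <<X>> = 0)%VS.
  apply/eqP; rewrite -subv0; apply/subvP => f; rewrite memv_cap => /andP[fJ fX].
  have fE := coord_span fX; have := fJ; rewrite {1}fE => /(pieceP _ aJ)/JX c0.
  by rewrite fE big1 ?mem0v // => i _; rewrite c0 scale0r.
have := dimvS (subvf (piece J d + <<X>>)%VS); rewrite dimv_disjoint_sum // dX => le.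
exact: (arith6 le).
Qed.

Lemma indep_extend d X T n : uniq T -> {subset T <= X} -> indep d T ->
  (size T <= n <= hilb (vanishes X) d)%N ->
  exists Z, [/\ uniq (Z ++ T), {subset Z ++ T <= X}, indep d (Z ++ T) & size (Z ++ T) = n].
Proof.
move=> uT TX iT /andP[le1 le2]; elim: n le1 le2 => [|n IH] le1 le2.
  by exists [::]; split=> //; apply/eqP; rewrite -leqn0.
have [e|lt] := eqVneq (size T) n.+1; first by exists [::]; split.
have le1' : (size T <= n)%N by move: le1; rewrite leq_eqVlt (negbTE lt).
have [Z [uZ ZX iZ sZ]] := IH le1' (ltnW le2).
have [P [PX [g [hg gZ gP]]]] : exists P, P \in X /\ exists g, [/\ g \is d.-homog, vanishes (Z ++ T) g & g.@[P 0] != 0].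
  apply: contrapT => H; have := hilb_indep_le iZ; rewrite sZ leqNgt; apply/negP/negPn.
  apply: leq_trans le2 _; apply: hilb_le; try exact: ideal_additive (vanishes_ideal _).
  move=> g hg gZ P PX; apply/eqP/negPn/negP => gP; apply: H; exists P; split=> //.
  by exists g.
exists (P :: Z); split=> /=.
- rewrite uZ andbT; apply/negP => PZ; by rewrite gZ ?eqxx in gP.
- by move=> Q; rewrite inE => /orP[/eqP->//|/ZX].
- exact: indep_add hg gZ gP.
- by rewrite sZ.
Qed.

Lemma indep_full d T : uniq T -> vanishes T F -> indep d T -> size T = hpoly d ->
  forall g, g \is d.-homog -> vanishes T g -> divides F g.
Proof.
move=> uT TF iT sT g hg gT; apply/idealFE.
apply: (hilb_eq (J := idealF F) (J' := vanishes T) _ _ _ _ hg gT).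
- exact: ideal_additive (idealF_ideal F).
- exact: ideal_additive (vanishes_ideal T).
- by move=> f _ /idealFE[c ->] P PT; rewrite mevalM TF // mul0r.
- rewrite (hilb_idealF hF) -sT; apply: indep_size => //; exact: ideal_additive (vanishes_ideal T).
Qed.

End Independence.

(** ** Families through moving points *)

Section MovingPoints.
Variables (k : closedFieldType) (F : {mpoly k[4]}).
Hypothesis hF : smooth_cubic_surface F.
Local Notation S := {mpoly k[4]}.
Local Notation pt := 'rV[k]_4.
Variables (I : finType).
Local Notation conf := (I * 'I_4 -> k).
Implicit Types (v : conf) (T : seq I).

Definition pnt v (j : I) : 'I_4 -> k := fun i => v (j, i).

Lemma polyform_mul J (f g : (J -> k) -> S) : polyform f -> polyform g ->
  polyform (fun th => f th * g th).
Proof.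
move=> [s [hs sE]] pg; have -> : (fun th => f th * g th) = fun th => \sum_(x <- s) (x.1 th *: (x.2 * g th)).
  by apply/funext => th; rewrite sE mulr_suml; apply: eq_bigr => x _; rewrite scalerAl.
elim: s hs {sE} => [|x s IH] hs.
  have -> : (fun th => \sum_(x <- [::]) (x.1 th *: (x.2 * g th))) = fun=> 0 by apply/funext => th; rewrite big_nil.
  exact: polyform_const.
have -> : (fun th => \sum_(x <- x :: s) (x.1 th *: (x.2 * g th))) =
    fun th => x.1 th *: (x.2 * g th) + \sum_(x <- s) (x.1 th *: (x.2 * g th)).
  by apply/funext => th; rewrite big_cons.
apply: polyform_add; last by apply: IH => y ys; apply: hs; right.
apply: polyform_scale; first by apply: hs; left.
have -> : (fun th => x.2 * g th) = fun th => g th * x.2 by apply/funext => th; rewrite mulrC.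
exact: polyform_mulr.
Qed.

Lemma polyform_meval2 J (f : (J -> k) -> S) (u : 'I_4 -> (J -> k) -> k) :
  polyform f -> (forall i, polyfun (u i)) -> polyfun (fun th => (f th).@[fun i => u i th]).
Proof.
move=> [s [hs sE]] pu.
have -> : (fun th => (f th).@[fun i => u i th]) = fun th => \sum_(x <- s) x.1 th * x.2.@[fun i => u i th].
  apply/funext => th; rewrite sE (big_morph _ (mevalD _) (meval0 _)).
  by apply: eq_bigr => x _; rewrite mevalZ.
elim: s hs {sE} => [|x s IH] hs.
  by apply: (@polyfun_ext _ _ (fun=> 0)) => [th|]; [rewrite big_nil | exact: polyfun_const].
apply: (@polyfun_ext _ _ (fun th => x.1 th * x.2.@[fun i => u i th] + \sum_(x <- s) x.1 th * x.2.@[fun i => u i th])).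
  by move=> th; rewrite big_cons.
apply: polyfun_add; last by apply: IH => y ys; apply: hs; right.
by apply: polyfun_mul; [apply: hs; left | apply: polyfun_meval].
Qed.

(** For forms dual to the points at v0 this is the identity at v0, hence invertible nearby. *)
Definition evmx T (b : I -> S) v : 'M[k]_(size T) :=
  \matrix_(s, t) (b (tnth (in_tuple T) t)).@[pnt v (tnth (in_tuple T) s)].

Lemma evmx_poly T b : polymx (evmx T b).
Proof.
move=> s t; apply: (@polyfun_ext _ _ (fun v => (b (tnth (in_tuple T) t)).@[pnt v (tnth (in_tuple T) s)])).
  by move=> v; rewrite mxE.
by apply: polyfun_meval => i; exact: polyfun_var.
Qed.

Definition dual_at T d (b : I -> S) v : Prop := (forall j, j \in T -> b j \is d.-homog) /\
  forall i j, i \in T -> j \in T -> (b j).@[pnt v i] = (i == j)%:R.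

Lemma evmx_dual T d b v : uniq T -> dual_at T d b v -> evmx T b v = 1%:M.
Proof.
move=> uT [_ bE]; apply/matrixP => s t; by rewrite !mxE bE ?mem_tnth // (tnth_eq _ _ uT).
Qed.

(** Cramer's rule moves a form vanishing at the points v0 to one vanishing at v. *)
Lemma moving_form T d (b : I -> S) v0 (G0 : S) : uniq T -> dual_at T d b v0 -> G0 \is d.-homog ->
  (forall j, j \in T -> G0.@[pnt v0 j] = 0) ->
  exists G : conf -> S, [/\ polyform G, forall v, G v \is d.-homog, G v0 = G0
    & forall v j, j \in T -> (G v).@[pnt v j] = 0].
Proof.
move=> uT dual hG0 G00; pose x s := tnth (in_tuple T) s.
pose g v : 'cV[k]_(size T) := \col_s G0.@[pnt v (x s)].
exists (fun v => \det (evmx T b v) *: G0 - \sum_t (\adj (evmx T b v) *m g v) t 0 *: b (x t)).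
have pg : polymx g.
  move=> s t; apply: (@polyfun_ext _ _ (fun v => G0.@[pnt v (x s)])); first by move=> v; rewrite mxE.
  by apply: polyfun_meval => i; exact: polyfun_var.
split.
- have -> : (fun v => \det (evmx T b v) *: G0 - \sum_t (\adj (evmx T b v) *m g v) t 0 *: b (x t)) =
     fun v => \det (evmx T b v) *: G0 + \sum_t (- (\adj (evmx T b v) *m g v) t 0) *: b (x t).
    by apply/funext => v; rewrite -sumrN; congr (_ + _); apply: eq_bigr => t _; rewrite scaleNr.
  apply: polyform_add.
    by apply: polyform_scale; [apply: polymx_det; exact: evmx_poly | exact: polyform_const].
  apply: polyform_sum => t; apply: polyform_scale; last exact: polyform_const.
  by apply: polyfun_opp; apply: polymx_mul => //; apply: polymx_adj; exact: evmx_poly.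
- move=> v; rewrite rpredB ?rpredZ // rpred_sum // => t _; rewrite rpredZ //.
  by case: dual => hb _; apply: hb; exact: mem_tnth.
- rewrite (evmx_dual uT dual) det1 scale1r big1 ?subr0 // => t _.
  rewrite mxE big1 ?scale0r // => s _; rewrite [g v0 _ _]mxE G00 ?mulr0 //; exact: mem_tnth.
move=> v j /(tnthP (in_tuple T))[s ->]; rewrite mevalB mevalZ (big_morph _ (mevalD _) (meval0 _)).
have -> : \sum_t ((\adj (evmx T b v) *m g v) t 0 *: b (x t)).@[pnt v (x s)] =
          (evmx T b v *m (\adj (evmx T b v) *m g v)) s 0.
  by rewrite [RHS]mxE; apply: eq_bigr => t _; rewrite mevalZ mulrC [evmx T b v s t]mxE.
by rewrite mulmxA mul_mx_adj mul_scalar_mx !mxE subrr.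
Qed.

(** If the points T impose as many conditions as possible, the value at any
    further point of the surface is determined by the values on T. *)
Lemma moving_relation T d (b : I -> S) v0 v (y : 'I_4 -> k) : uniq T -> dual_at T d b v0 ->
  size T = hpoly d -> on_cubic F v0 -> on_cubic F v -> F.@[y] = 0 -> \det (evmx T b v) != 0 ->
  exists w : I -> k, (forall j, j \notin T -> w j = 0) /\
    forall g, g \is d.-homog -> g.@[y] = \sum_j w j * g.@[pnt v j].
Proof.
move=> uT dual sT v0F vF yF; rewrite -unitfE -[_ \is a _]/(_ \in unitmx) => uE.
pose x s := tnth (in_tuple T) s; pose pr j : pt := \row_i v0 (j, i).
have prE (f : S) j : f.@[(pr j) 0] = f.@[pnt v0 j] by apply: meval_eq => i; rewrite mxE.
have pr_inj : {in T &, injective pr}.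
  move=> i j iT jT e; have := dual.2 i j iT jT; have := dual.2 j j jT jT.
  by rewrite -!prE e eqxx => ->; case: eqP => // _ /eqP; rewrite oner_eq0.
have expand g : g \is d.-homog -> exists c : 'I_(size T) -> k, forall z, F.@[z] = 0 ->
    g.@[z] = \sum_t c t * (b (x t)).@[z].
  move=> hg; exists (fun t => g.@[pnt v0 (x t)]) => z zF.
  pose g' := g - \sum_t g.@[pnt v0 (x t)] *: b (x t).
  suff [c cE] : divides F g'.
    have := congr1 (fun f : S => f.@[z]) cE; rewrite mevalM zF mul0r mevalB => /eqP.
    rewrite subr_eq0 => /eqP ->; rewrite (big_morph _ (mevalD _) (meval0 _)).
    by apply: eq_bigr => t _; rewrite mevalZ.
  have hb t : b (x t) \is d.-homog by apply: dual.1; exact: mem_tnth.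
  apply: (@indep_full _ _ hF d [seq pr j | j <- T]).
  - by rewrite map_inj_in_uniq.
  - by move=> _ /mapP[j _ ->]; rewrite prE; apply: v0F.
  - exists (fun P => \sum_t (P == pr (x t))%:R *: b (x t)); split=> [P _|].
      by rewrite rpred_sum // => t _; rewrite rpredZ ?hb.
    move=> _ _ /mapP[i /(tnthP (in_tuple T))[s ->] ->] /mapP[j jT ->].
    have sT' : tnth (in_tuple T) s \in T by exact: mem_tnth.
    rewrite (big_morph _ (mevalD _) (meval0 _)) (bigD1 s) //= big1 => [|t ts].
      rewrite eqxx mevalZ mul1r addr0 prE dual.2 //; congr (nat_of_bool _)%:R.
      by apply/eqP/eqP => [->//|/pr_inj]; apply.
    case: eqP => [e|]; last by rewrite scale0r meval0.
    by case/eqP: ts; apply/eqP; rewrite -(tnth_eq _ _ uT) (pr_inj _ _ sT' (mem_tnth t (in_tuple T)) e).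
  - by rewrite size_map.
  - by rewrite rpredB // rpred_sum // => t _; rewrite rpredZ ?hb.
  - move=> _ /mapP[j /(tnthP (in_tuple T))[s ->] ->]; rewrite prE mevalB.
    rewrite (big_morph _ (mevalD _) (meval0 _)) (bigD1 s) //= big1 => [|t ts].
      by rewrite mevalZ dual.2 ?mem_tnth // eqxx mulr1 addr0 subrr.
    rewrite mevalZ dual.2 ?mem_tnth //; case: eqP => [e|]; last by rewrite mulr0.
    by case/eqP: ts; apply/eqP; rewrite -(tnth_eq _ _ uT) e.
pose E := evmx T b v; pose by_ : 'rV[k]_(size T) := \row_t (b (x t)).@[y].
pose w := by_ *m invmx E.
exists (fun j => \sum_s (j == x s)%:R * w 0 s); split=> [j jT|g hg].
  rewrite big1 // => s _; case: eqP => [e|]; last by rewrite mul0r.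
  by rewrite e mem_tnth in jT.
have [c cE] := expand g hg; pose cc : 'cV[k]_(size T) := \col_t c t.
have -> : g.@[y] = (by_ *m cc) 0 0.
  by rewrite cE // mxE; apply: eq_bigr => t _; rewrite !mxE mulrC.
have -> : by_ *m cc = w *m (E *m cc) by rewrite mulmxA /w mulmxKV.
rewrite mxE (eq_bigr (fun s => \sum_j (j == x s)%:R * w 0 s * g.@[pnt v j])); last first.
  move=> s _; rewrite (bigD1 (x s)) //= big1 => [|j jx]; last by rewrite (negbTE jx) !mul0r.
  rewrite eqxx mul1r addr0 cE; last exact: vF.
  apply/esym.
  by congr (_ * _); rewrite [RHS]mxE; apply: eq_bigr => t _; rewrite !mxE mulrC.
by rewrite exchange_big; apply: eq_bigr => j _; rewrite mulr_suml.
Qed.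

End MovingPoints.

Lemma perm_complement (T : eqType) (s t : seq T) : uniq s -> uniq t -> {subset t <= s} ->
  perm_eq s ([seq x <- s | x \notin t] ++ t).
Proof.
move=> us ut ts; apply: uniq_perm => // [|x].
  rewrite cat_uniq filter_uniq // ut andbT; apply/hasPn => x xt.
  by rewrite mem_filter xt.
rewrite mem_cat mem_filter; case: (boolP (x \in t)) => [/ts->|_]; rewrite ?orbT ?orbF //.
Qed.

Lemma arith7 (a b q m : nat) : (a <= 3 * q * m -> b <= 3 * q * 1 -> a + b = 3 * q * m.+1 ->
  a = 3 * q * m /\ b = 3 * q * 1)%N.
Proof. lia. Qed.

Lemma sum_split_enum (V : nmodType) (T : Type) n e (P : 'I_(n + e) -> T) (f : T -> V) :
  \sum_(Q <- [seq P (lshift e i) | i <- enum 'I_n] ++ [seq P (rshift n i) | i <- enum 'I_e]) f Q =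
  \sum_j f (P j).
Proof. by rewrite big_cat !big_map big_split_ord -!big_enum. Qed.

Section NearGeneric.
Variables (k : closedFieldType) (F : {mpoly k[4]}).
Hypothesis hF : smooth_cubic_surface F.
Local Notation S := {mpoly k[4]}.
Local Notation pt := 'rV[k]_4.
Implicit Types (l f g : S).

Definition linkable l (sg : nat) (Z Q : seq pt) : Prop :=
  [/\ uniq (Z ++ Q), normalized l (Z ++ Q), vanishes (Z ++ Q) F
    & exists c, gorenstein_weights (Z ++ Q) sg c].

Definition nrm l (I : finType) (v : I * 'I_4 -> k) (j : I) : pt :=
  (l.@[pnt v j])^-1 *: \row_i v (j, i).

Lemma nrm_meval l (I : finType) (v : I * 'I_4 -> k) j f d : f \is d.-homog ->
  f.@[(nrm l v j) 0] = (l.@[pnt v j])^-1 ^+ d * f.@[pnt v j].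
Proof.
move=> hf; rewrite -(meval_homog _ _ hf); apply: meval_eq => i.
by rewrite !mxE.
Qed.

Variables (l : S) (q m e n : nat).

(** The n first points of v can be linked to some Z that is linked to sets of n + e points as close
    to v as one likes; closeness is tested by polynomials h. *)
Definition nearable (v : 'I_(n + e) * 'I_4 -> k) : Prop :=
  (forall j, l.@[pnt v j] != 0) /\
  exists Z, [/\ size Z = (3 * q * m - n)%N,
    linkable l (q + m).-1 Z [seq nrm l v (lshift e i) | i <- enum 'I_n]
  & forall h, polyfun h -> h (fun ji => nrm l v ji.1 0 ji.2) != 0 ->
      exists2 Q : 'I_(n + e) -> pt, h (fun ji => Q ji.1 0 ji.2) != 0 &
        linkable l (q + m).-1 Z [seq Q j | j <- enum 'I_(n + e)]].

Lemma nth_split_enum (P : 'I_(n + e) -> pt) (j : 'I_(n + e)) :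
  nth 0 ([seq P (lshift e i) | i <- enum 'I_n] ++ [seq P (rshift n i) | i <- enum 'I_e]) j = P j.
Proof.
rewrite nth_cat size_map size_enum_ord -[j]splitK; case: (split j) => i /=.
  by rewrite ltn_ord (nth_map i) ?size_enum_ord ?ltn_ord // nth_ord_enum.
by rewrite ltnNge leq_addr addKn (nth_map i) ?size_enum_ord ?ltn_ord // nth_ord_enum.
Qed.

(** A general combination of the relations involves every point that one of them involves. *)
Lemma combine_relations (om : 'I_e -> 'I_(n + e) -> k) : (forall y, om y (rshift n y) != 0) ->
  exists s : 'I_e -> k, forall y, \sum_z s z * om z (rshift n y) != 0.
Proof.
move=> om0; pose f : {mpoly k[e]} := \prod_y \sum_z om z (rshift n y) *: 'X_z.
have /mpoly_nonroot[s fs] : f != 0.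
  apply/prodf_neq0 => y _; apply/eqP => E; case/eqP: (om0 y).
  have := congr1 (mcoeff U_(y)) E; rewrite mcoeff0 linear_sum (bigD1 y) //= big1 => [|z zy].
    by rewrite addr0 mcoeffZ mcoeffX eqxx mulr1.
  by rewrite mcoeffZ mcoeffX eq_mnm1 (negbTE zy) mulr0.
exists s => y; move: fs; rewrite /f (big_morph _ (mevalM s) (meval1 s)) => /prodf_neq0/(_ y isT).
rewrite (big_morph _ (mevalD s) (meval0 s)); congr (_ != 0); apply: eq_bigr => z _.
by rewrite mevalZ mevalXU mulrC.
Qed.

(** One configuration v0 with independent conditions spreads to an open set of configurations: forms
    follow the points by Cramer's rule, the complete intersection stays reduced, and each of the
    further points y keeps a relation with the points T y. *)
Theorem near_generic (G0 A0 lf0 : S) (v0 : 'I_(n + e) * 'I_4 -> k) (M0 : seq pt)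
    (bG bA bL : 'I_(n + e) -> S) (T : 'I_e -> seq 'I_(n + e)) (bR : 'I_e -> 'I_(n + e) -> S) :
  (0 < q)%N -> (0 < m)%N -> (m + e = q.+1)%N -> (0 < e <= 2)%N ->
  on_cubic F v0 -> (forall j, l.@[pnt v0 j] = 1) -> (forall i j, pnt v0 i = pnt v0 j -> i = j) ->
  reduced_ci F l q m.+1 G0 (A0 * lf0) M0 -> A0 \is m.-homog -> lf0 \is 1.-homog ->
  dual_at (enum 'I_(n + e)) q bG v0 -> dual_at [seq lshift e i | i <- enum 'I_n] m bA v0 ->
  dual_at [seq rshift n i | i <- enum 'I_e] 1 bL v0 ->
  (forall j, G0.@[pnt v0 j] = 0) -> (forall i, A0.@[pnt v0 (lshift e i)] = 0) ->
  (forall i, lf0.@[pnt v0 (rshift n i)] = 0) -> (forall i, A0.@[pnt v0 (rshift n i)] != 0) ->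
  (forall y, [/\ uniq (T y), rshift n y \notin T y, size (T y) = hpoly q.-1 & dual_at (T y) q.-1 (bR y) v0]) ->
  generically (@on_cubic k F 'I_(n + e)) nearable.
Proof.
move=> q0 m0 me e12 v0F v0l v0inj ci0 hA0 hlf0 dG dA dL G00 A00 lf00 A0Y hT.
have hG0 : G0 \is q.-homog by case: ci0 => -[].
have hl : l \is 1.-homog by case: ci0 => _ [_ []].
have [G [pG hG Gv0 Gv]] := moving_form (enum_uniq _) dG hG0 (fun j _ => G00 j).
have uL : uniq [seq lshift e i | i <- enum 'I_n] by rewrite map_inj_uniq ?enum_uniq //; exact: lshift_inj.
have uR : uniq [seq rshift n i | i <- enum 'I_e] by rewrite map_inj_uniq ?enum_uniq //; exact: rshift_inj.
have [|A [pA hA Av0 Av]] := moving_form uL dA hA0; first by move=> _ /mapP[i _ ->].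
have [|lf [plf hlf lfv0 lfv]] := moving_form uR dL hlf0; first by move=> _ /mapP[i _ ->].
have pAlf : polyform (fun v => A v * lf v) by exact: polyform_mul.
have hAlf v : A v * lf v \is m.+1.-homog by apply: (homogM (hA v) (hlf v)); rewrite addn1.
have ci0' : reduced_ci F l q m.+1 (G v0) (A v0 * lf v0) M0 by rewrite Gv0 Av0 lfv0.
have [||D1 [pD1 D10 D1E]] := reduced_ci_open hF q0 (isT : (0 < m.+1)%N) pG pAlf hG hAlf ci0' (r := 0) (R := fun _ => 0) (h := fun=> 1) _ (polyfun_const _ 1).
- by case.
- exact: oner_neq0.
pose row v (j : 'I_(n + e)) : pt := \row_i v (j, i).
pose df i j := differ (row v0 i) (row v0 j).
pose Dl (v : 'I_(n + e) * 'I_4 -> k) := \prod_j l.@[pnt v j].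
pose DA (v : 'I_(n + e) * 'I_4 -> k) := \prod_y (A v).@[pnt v (rshift n y)].
pose Dd (v : 'I_(n + e) * 'I_4 -> k) := \prod_i \prod_(j | j != i) (v (i, df i j) * l.@[pnt v j] - v (j, df i j) * l.@[pnt v i]).
pose DR (v : 'I_(n + e) * 'I_4 -> k) := \prod_y \det (evmx (T y) (bR y) v).
have pl j : polyfun (fun v : 'I_(n + e) * 'I_4 -> k => l.@[pnt v j]).
  by apply: polyfun_meval => i; exact: polyfun_var.
exists (fun v => D1 v * (Dl v * DA v) * (Dd v * DR v)); split.
- apply: polyfun_mul; apply: polyfun_mul => //; first apply: polyfun_mul.
  + by apply: polyfun_prod => j; exact: pl.
  + by apply: polyfun_prod => y; apply: polyform_meval2 => // i; exact: polyfun_var.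
  + apply: polyfun_prod => i; apply: polyfun_prod => j; apply: polyfun_sub;
      by apply: polyfun_mul; [exact: polyfun_var | exact: pl].
  + by apply: polyfun_prod => y; apply: polymx_det; exact: evmx_poly.
- exists v0 => //; rewrite !mulf_eq0 (negbTE D10) /= !negb_or -andbA; apply/and4P; split.
  + by apply/prodf_neq0 => j _; rewrite v0l oner_neq0.
  + by apply/prodf_neq0 => y _; rewrite Av0.
  + apply/prodf_neq0 => i _; apply/prodf_neq0 => j ji; rewrite !v0l !mulr1 subr_eq0.
    have := @differP _ (row v0 i) (row v0 j); rewrite !mxE; apply.
    apply: contra ji => /eqP/rowP E; apply/eqP/v0inj/funext => a.
    by have := E a; rewrite !mxE.
  + apply/prodf_neq0 => y _; have [uT _ _ dT] := hT y.
    by rewrite (evmx_dual uT dT) det1 oner_neq0.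
move=> v vF; rewrite !mulf_eq0 !negb_or -!andbA.
case/and5P => d1 /prodf_neq0 dl /prodf_neq0 dAv /prodf_neq0 dd /prodf_neq0 dR.
have [M [ciM _]] := D1E v d1.
have lv j : l.@[pnt v j] != 0 by exact: dl.
pose P j := nrm l v j.
have PE f d j : f \is d.-homog -> f.@[(P j) 0] = (l.@[pnt v j])^-1 ^+ d * f.@[pnt v j].
  exact: nrm_meval.
have P0 f d j : f \is d.-homog -> f.@[pnt v j] = 0 -> f.@[(P j) 0] = 0.
  by move=> hf fv; rewrite (PE _ _ _ hf) fv mulr0.
have Pl j : l.@[(P j) 0] = 1 by rewrite (PE _ _ _ hl) expr1 mulVf.
have P_inj : injective P.
  move=> i j Eij; apply/eqP/negPn/negP => ij; have /prodf_neq0/(_ j) := dd i isT.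
  rewrite eq_sym ij => /(_ isT); rewrite subr_eq0 => /eqP; apply.
  have /rowP/(_ (df i j)) := Eij; rewrite !mxE => E2.
  by rewrite -[v (i, _)](mulVKf (lv i)) E2; field; exact: lv.
have lfP i : (lf v).@[(P (rshift n i)) 0] = 0.
  by apply: (P0 _ _ _ (hlf v)); apply: lfv; rewrite map_f // mem_enum.
have AP i : (A v).@[(P (lshift e i)) 0] = 0.
  by apply: (P0 _ _ _ (hA v)); apply: Av; rewrite map_f // mem_enum.
have GP j : (G v).@[(P j) 0] = 0 by apply: (P0 _ _ _ (hG v)); apply: Gv; rewrite mem_enum.
have FP j : F.@[(P j) 0] = 0 by apply: (P0 _ _ _ (cubic_homog hF)); exact: vF.
have PM j : P j \in M.
  apply: (reduced_ci_mem hF ciM) => //; rewrite mevalM -[j]splitK.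
  by case: (split j) => i /=; rewrite ?AP ?lfP ?mul0r ?mulr0.
case: (ciM) => -[_ _ nG nAl] [uM nM sM vM].
have idC := idealC_ideal F (G v).
have nA : nonzerodiv (idealC F (G v)) (A v).
  by move=> f h; apply: nAl; rewrite [A v * _]mulrC -mulrA; apply: (idealMl idC).
have nlf : nonzerodiv (idealC F (G v)) (lf v).
  by move=> f h; apply: nAl; rewrite -mulrA; apply: (idealMl idC).
pose X := [seq Q : pt <- M | (A v).@[Q 0] == 0]; pose L := [seq Q : pt <- M | (A v).@[Q 0] != 0].
have pXL : perm_eq (X ++ L) M by rewrite perm_filterC.
have sX' : {subset X <= M} by move=> Q; rewrite mem_filter => /andP[].
have sL' : {subset L <= M} by move=> Q; rewrite mem_filter => /andP[].
have vX : forall Q, Q \in X -> [/\ F.@[Q 0] = 0, (G v).@[Q 0] = 0 & (A v).@[Q 0] = 0].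
  by move=> Q; rewrite mem_filter => /andP[/eqP AQ /vM[]].
have vL : forall Q, Q \in L -> [/\ F.@[Q 0] = 0, (G v).@[Q 0] = 0 & (lf v).@[Q 0] = 0].
  move=> Q; rewrite mem_filter => /andP[AQ /vM[FQ GQ]]; rewrite mevalM => /eqP.
  by rewrite mulf_eq0 (negbTE AQ) => /eqP.
have uX : uniq X by rewrite filter_uniq.
have uL' : uniq L by rewrite filter_uniq.
have leX : (size X <= 3 * q * m)%N.
  by apply: (size_points_le hF (hG v) nG (hA v) nA uX (normalizedW sX' nM)) => Q /vX[].
have leL : (size L <= 3 * q * 1)%N.
  by apply: (size_points_le hF (hG v) nG (hlf v) nlf uL' (normalizedW sL' nM)) => Q /vL[].
have := perm_size pXL; rewrite size_cat sM => /(arith7 leX leL)[sX sL].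
have ciX : reduced_ci F l q m (G v) (A v) X.
  by split=> //; split=> //; exact: normalizedW nM.
have ciL : reduced_ci F l q 1 (G v) (lf v) L.
  by split=> //; split=> //; exact: normalizedW nM.
pose Z2 := [seq P (lshift e i) | i <- enum 'I_n]; pose Y := [seq P (rshift n i) | i <- enum 'I_e].
have uZ2 : uniq Z2 by rewrite map_inj_uniq ?enum_uniq // => i j /P_inj/lshift_inj.
have uY : uniq Y by rewrite map_inj_uniq ?enum_uniq // => i j /P_inj/rshift_inj.
have Z2X : {subset Z2 <= X} by move=> _ /mapP[i _ ->]; rewrite mem_filter AP eqxx PM.
have YL : {subset Y <= L}.
  move=> _ /mapP[i _ ->]; rewrite mem_filter PM andbT (PE _ _ _ (hA v)).
  by rewrite mulf_neq0 ?expf_neq0 ?invr_eq0 //; exact: dAv.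
pose Z1 := [seq Q <- X | Q \notin Z2]; pose Y1 := [seq Q <- L | Q \notin Y].
have pX : perm_eq X (Z1 ++ Z2) by exact: perm_complement.
have pL : perm_eq L (Y1 ++ Y) by exact: perm_complement.
have ciX' := reduced_ci_perm pX ciX; have ciL' := reduced_ci_perm pL ciL.
have ciM' : reduced_ci F l q m.+1 (G v) (A v * lf v) ((Z1 ++ Z2) ++ (Y1 ++ Y)).
  apply: reduced_ci_perm ciM; rewrite perm_sym; apply: perm_trans pXL.
  by rewrite perm_sym; apply: perm_cat.
have sZ2 : size Z2 = n by rewrite size_map size_enum_ord.
have sY : size Y = e by rewrite size_map size_enum_ord.
have rel y : exists w : 'I_(n + e) -> k, w (rshift n y) = -1 /\
    forall g, g \is q.-1.-homog -> \sum_j w j * g.@[pnt v j] = 0.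
  have [uT yT sT dT] := hT y.
  have [w [w0 wE]] := moving_relation hF uT dT sT v0F vF (vF (rshift n y)) (dR y isT).
  exists (fun j => w j - (j == rshift n y)%:R); split; first by rewrite w0 // eqxx sub0r.
  move=> g hg; rewrite (eq_bigr (fun j => w j * g.@[pnt v j] - (j == rshift n y)%:R * g.@[pnt v j])); last first.
    by move=> j _; rewrite mulrBl.
  rewrite sumrB -wE // (bigD1 (rshift n y)) //= big1 => [|j jy]; last by rewrite (negbTE jy) mul0r.
  by rewrite eqxx mul1r addr0 subrr.
pose om y := projT1 (cid (rel y)).
have omE y := projT2 (cid (rel y)).
have [|s sE] := @combine_relations om.
  by move=> y; rewrite /om (omE y).1 oppr_eq0 oner_neq0.
pose W j := (\sum_y s y * om y j) * l.@[pnt v j] ^+ q.-1.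
pose w Q := \sum_j (Q == P j)%:R * W j.
have wP j : w (P j) = W j.
  rewrite /w (bigD1 j) //= big1 => [|i ij]; first by rewrite eqxx mul1r addr0.
  by rewrite (inj_eq P_inj) eq_sym (negbTE ij) mul0r.
have wrel f : f \is q.-1.-homog -> \sum_(Q <- Z2 ++ Y) w Q * f.@[Q 0] = 0.
  move=> hf; rewrite sum_split_enum.
  rewrite (eq_bigr (fun j => \sum_y s y * (om y j * f.@[pnt v j]))); last first.
    move=> j _; rewrite wP (PE _ _ _ hf) /W exprVn -mulrA mulVKf ?expf_neq0 // mulr_suml.
    by apply: eq_bigr => y _; rewrite mulrA.
  by rewrite exchange_big big1 // => y _; rewrite -mulr_sumr (omE y).2 // mulr0.
have wY Q : Q \in Y -> w Q != 0.
  by move=> /mapP[y _ ->]; rewrite wP mulf_neq0 ?expf_neq0.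
split=> //; exists Z1; split.
- by have := perm_size pX; rewrite size_cat sZ2 sX => ->; rewrite addnK.
- case: (ciX') => _ [u1 n1 _ v1]; split=> //; first by move=> Q /v1[].
  exact: (reduced_ci_weights hF q0 m0 ciX').
move=> h ph hP; have sZ : size (Z1 ++ Z2) = (3 * q * m)%N by rewrite -(perm_size pX).
have sr : (n + e = size (Z2 ++ Y))%N by rewrite size_cat sZ2 sY.
have me' : (m + size Y = q.+1)%N by rewrite sY.
have e12' : (0 < size Y <= 2)%N by rewrite sY.
have AZ1 : vanishes Z1 (A v) by move=> Q; rewrite mem_filter => /andP[_ /vX[]].
have hP' : h (fun ji => nth 0 (Z2 ++ Y) ji.1 0 ji.2) != 0.
  move: hP; congr (h _ != 0); apply/funext => -[j i] /=; congr ((_ : pt) 0 i).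
  exact/esym/nth_split_enum.
have [Q [hQ uQ nQ vQ cQ]] := near hF q0 m0 me' e12' sZ ciL' (hA v) AZ1 ciM' wrel wY sr ph hP'.
by exists Q.
Qed.

End NearGeneric.

(** * A grid of lines *)

Section Grid.
Variables (k : closedFieldType) (F : {mpoly k[4]}).
Hypothesis hF : smooth_cubic_surface F.
Local Notation S := {mpoly k[4]}.
Local Notation pt := 'rV[k]_4.
Local Notation vec := ('I_4 -> k).
Implicit Types (f g l : S).

Lemma idealCE G f : idealC F G f <-> exists a b, f = F * a + G * b.
Proof.
split; first by move=> [x [b [[x' [a [-> ->]]] ->]]]; exists a, b; rewrite add0r.
by move=> [a [b ->]]; exists (F * a), b; split=> //; exists 0, a; rewrite add0r.
Qed.

Lemma nonzerodiv_mul J (x y : S) : nonzerodiv J x -> nonzerodiv J y -> nonzerodiv J (x * y).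
Proof. by move=> hx hy f; rewrite -mulrA => /hx/hy. Qed.

Lemma nonzerodiv_prod J T (r : seq T) (x : T -> S) : (forall t, List.In t r -> nonzerodiv J (x t)) ->
  nonzerodiv J (\prod_(t <- r) x t).
Proof.
elim: r => [|t r IH] H; first by rewrite big_nil => f; rewrite mul1r.
rewrite big_cons; apply: nonzerodiv_mul; first by apply: H; left.
by apply: IH => s sr; apply: H; right.
Qed.

Lemma nonzerodiv_curve_mul (mu G la : S) : ~ divides F mu -> nonzerodiv (idealC F mu) la ->
  nonzerodiv (idealC F G) la -> nonzerodiv (idealC F (mu * G)) la.
Proof.
move=> nF nmu nG f /idealCE[a [b E]].
have /nmu/idealCE[a' [f' fE]] : idealC F mu (la * f) by apply/idealCE; exists a, (G * b); rewrite E mulrA.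
have : idealF F (mu * (la * f' - G * b)).
  apply/idealFE; exists (a - la * a'); have := E; rewrite fE => E'.
  have -> : mu * (la * f' - G * b) = la * (F * a' + mu * f') - mu * G * b - la * F * a' by ring.
  by rewrite E'; ring.
move/(idealF_nonzerodiv hF nF)/idealFE => [d dE].
have /nG/idealCE[a2 [b2 f'E]] : idealC F G (la * f').
  by apply/idealCE; exists d, b; rewrite -dE; ring.
by apply/idealCE; exists (a' + mu * a2), b2; rewrite fE f'E; ring.
Qed.

Lemma nonzerodiv_curve_prod (r : seq k) (mu : k -> S) (la : S) :
  (forall a, a \in r -> ~ divides F (mu a) /\ nonzerodiv (idealC F (mu a)) la) ->
  nonzerodiv (idealC F (\prod_(a <- r) mu a)) la.
Proof.
elim: r => [|a r IH] H.
  by rewrite big_nil => f _; apply/idealCE; exists 0, f; rewrite mulr0 mul1r add0r.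
rewrite big_cons; have [h1 h2] := H a (mem_head _ _); apply: nonzerodiv_curve_mul => //.
by apply: IH => b br; apply: H; rewrite inE br orbT.
Qed.

Lemma not_divides_linear f : f \is 1.-homog -> f != 0 -> ~ divides F f.
Proof.
move=> hf f0 [c fE]; have [c' fE' hc'] := homog_dvd (cubic_homog hF) hf fE.
by move: hc' => /= /eqP c0; case/eqP: f0; rewrite fE' c0 mulr0.
Qed.

Lemma homog_at0 f d : f \is d.+1.-homog -> f.@[fun=> 0] = 0.
Proof.
by move=> hf; have := meval_homog 0 (fun=> 1) hf; rewrite exprS !mul0r.
Qed.

Lemma not_divides_prod T (r : seq T) (x : T -> S) : (forall t, List.In t r -> ~ divides F (x t)) ->
  ~ divides F (\prod_(t <- r) x t).
Proof.
elim: r => [|t r IH] H.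
  rewrite big_nil => -[c e]; have := congr1 (fun f : S => f.@[fun=> 0]) e.
  by rewrite meval1 mevalM (homog_at0 (cubic_homog hF)) mul0r => /eqP; rewrite oner_eq0.
rewrite big_cons => /(cubic_prime hF)[]; first by apply: H; left.
by apply: IH => s sr; apply: H; right.
Qed.

Lemma meval_lin2 f (a b : vec) (s t : k) : f \is 1.-homog ->
  f.@[fun i => a i * s + b i * t] = f.@[a] * s + f.@[b] * t.
Proof.
move=> hf; rewrite meval_linearD // [X in X + _](_ : _ = f.@[a] * s) //.
have := meval_homog s a hf; rewrite expr1 mulrC => <-; apply: meval_eq => i; exact: mulrC.
Qed.

Variables (x : 'I_4 -> S) (e : 'I_4 -> vec).
Hypotheses (hx : forall s, x s \is 1.-homog) (xe : forall s t, (x s).@[e t] = (s == t)%:R)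
  (dec : forall v i, v i = \sum_s (x s).@[v] * e s i).

Let o0 : 'I_4 := inord 0. Let o1 : 'I_4 := inord 1. Let o2 : 'I_4 := inord 2. Let o3 : 'I_4 := inord 3.
Let neq i j : (i < 4)%N -> (j < 4)%N -> (inord i == inord j :> 'I_4) = (i == j).
Proof. by move=> hi hj; rewrite -val_eqE /= !inordK. Qed.

Let sum4 (f : 'I_4 -> k) : \sum_s f s = f o0 + f o1 + f o2 + f o3.
Proof.
rewrite !big_ord_recl big_ord0 addr0 !addrA; do ?congr (_ + _); congr (f _); apply/val_inj => /=;
  by rewrite inordK.
Qed.

Definition mu (al : k) : S := x o2 - al *: x o0.
Definition la (be : k) : S := x o3 - be *: x o1.
Definition va (al : k) : vec := fun i => e o0 i + al * e o2 i.
Definition vb (be : k) : vec := fun i => e o1 i + be * e o3 i.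

Lemma mu_homog al : mu al \is 1.-homog. Proof. by rewrite rpredB ?rpredZ ?hx. Qed.
Lemma la_homog be : la be \is 1.-homog. Proof. by rewrite rpredB ?rpredZ ?hx. Qed.

Let xv s (c : 'I_4 -> k) (v : vec) : (forall i, v i = \sum_t c t * e t i) -> (x s).@[v] = c s.
Proof.
move=> vE; rewrite meval_linear //.
rewrite (eq_bigr (fun i => \sum_t c t * ((x s)@_U_(i) * e t i))); last first.
  by move=> i _; rewrite vE mulr_sumr; apply: eq_bigr => t _; rewrite mulrCA.
rewrite exchange_big (bigD1 s) //= [X in _ + X]big1 => [|t ts].
  by rewrite addr0 -mulr_sumr -meval_linear // xe eqxx mulr1.
by rewrite -mulr_sumr -meval_linear // xe eq_sym (negbTE ts) mulr0.
Qed.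

Lemma line_decomp al be v i :
  v i - (mu al).@[v] * e o2 i - (la be).@[v] * e o3 i = va al i * (x o0).@[v] + vb be i * (x o1).@[v].
Proof. by rewrite {1}(dec v i) sum4 /mu /la /va /vb !mevalB !mevalZ; ring. Qed.

Let h2 al (i : 'I_4) : S := 'X_i - mu al * (e o2 i)%:MP.
Let h3 al be (i : 'I_4) : S := h2 al i - la be * (e o3 i)%:MP.
Let mmap_id f : mmap (@mpolyC 4 k) (fun i => 'X_i) f = f.
Proof. by rewrite -[RHS]comp_mpoly_id; apply: eq_mmap => // i; rewrite tnth_mktuple. Qed.
Let h2_eval al f v : (mmap (@mpolyC 4 k) (h2 al) f).@[v] = f.@[fun i => v i - (mu al).@[v] * e o2 i].
Proof. by rewrite rmorph_mmap; apply: eq_mmap => [c|i] /=; rewrite ?mevalC // mevalB mevalM mevalXU mevalC. Qed.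
Let h3_eval al be f v : (mmap (@mpolyC 4 k) (h3 al be) f).@[v] =
  f.@[fun i => v i - (mu al).@[v] * e o2 i - (la be).@[v] * e o3 i].
Proof. by rewrite rmorph_mmap; apply: eq_mmap => [c|i] /=; rewrite ?mevalC // /h3 mevalB mevalM mevalC /h2 mevalB mevalM mevalXU mevalC. Qed.
Let h2_congr al f : exists c, f - mmap (@mpolyC 4 k) (h2 al) f = mu al * c.
Proof.
rewrite -{1}(mmap_id f); apply: mmap_congr => i; exists (e o2 i)%:MP; by rewrite /h2; ring.
Qed.

Lemma vanish_line al be f : (forall s t, f.@[fun i => va al i * s + vb be i * t] = 0) ->
  exists c c', f = mu al * c + la be * c'.
Proof.
move=> H; have [c cE] := h2_congr al f.
have [|c' c'E] := @mmap_congr _ _ _ (@mpolyC 4 k) (h2 al) (h3 al be) f (la be).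
  by move=> i; exists (e o3 i)%:MP; rewrite /h3; ring.
exists c, c'; rewrite -cE -c'E (_ : mmap _ (h3 al be) f = 0) ?subr0 ?subrK //.
apply: mpoly_fun0 => v; rewrite h3_eval -[RHS](H (x o0).@[v] (x o1).@[v]).
by apply: meval_eq => i; exact: line_decomp.
Qed.

Lemma mu_la_nonzerodiv al be : F.@[va al] != 0 -> nonzerodiv (idealC F (mu al)) (la be).
Proof.
move=> Fa f /idealCE[a [b E]].
have mu2 v : (mu al).@[fun i => v i - (mu al).@[v] * e o2 i] = 0.
  have := @meval_lin2 (mu al) v (e o2) 1 (- (mu al).@[v]) (mu_homog al).
  have -> : (mu al).@[e o2] = 1 by rewrite mevalB mevalZ !xe !neq //= mulr0 subr0.
  by rewrite mulr1 mul1r subrr => <-; apply: meval_eq => i; rewrite mulr1 mulrN mulrC.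
have la2 v : (la be).@[fun i => v i - (mu al).@[v] * e o2 i] = (la be).@[v].
  have := @meval_lin2 (la be) v (e o2) 1 (- (mu al).@[v]) (la_homog be).
  have -> : (la be).@[e o2] = 0 by rewrite mevalB mevalZ !xe !neq //= mulr0 subr0.
  by rewrite mulr1 mul0r addr0 => <-; apply: meval_eq => i; rewrite mulr1 mulrN mulrC.
have line0 s t : (mu al).@[fun i => va al i * s + vb be i * t] = 0 /\ (la be).@[fun i => va al i * s + vb be i * t] = 0.
  pose c (u : 'I_4) := if u == o0 then s else if u == o1 then t else if u == o2 then al * s else be * t.
  have E' i : va al i * s + vb be i * t = \sum_u c u * e u i.
    by rewrite sum4 /c !neq //= /va /vb; ring.
  by rewrite !mevalB !mevalZ !(xv _ E') /c !neq //= !subrr.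
pose phi f := mmap (@mpolyC 2 k) (fun i => (va al i)%:MP * 'X_0 + (vb be i)%:MP * 'X_1) f.
have phiE f' w : (phi f').@[w] = f'.@[fun i => va al i * w 0 + vb be i * w 1].
  rewrite /phi rmorph_mmap; apply: eq_mmap => [c|i] /=; rewrite ?mevalC //.
  by rewrite mevalD !mevalM !mevalC !mevalXU.
have a0 : phi a = 0.
  have F0 : phi F != 0.
    apply: contraNneq Fa => F0; have := phiE F (fun i => (i == 0)%:R); rewrite F0 meval0 => ->.
    by apply/eqP; apply: meval_eq => i; rewrite eqxx /= mulr1 mulr0 addr0.
  apply: (mulfI F0); rewrite mulr0; apply: mpoly_fun0 => w; rewrite mevalM !phiE -mevalM.
  have [m0 l0] := line0 (w 0) (w 1).
  have := congr1 (fun g : S => g.@[fun i => va al i * w 0 + vb be i * w 1]) E.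
  by rewrite mevalD !mevalM m0 l0 !mul0r addr0 => <-.
have [|c [c' aE]] := @vanish_line al be a.
  move=> s t; have := phiE a (fun i => if i == 0 then s else t); rewrite a0 meval0 => ->.
  by apply: meval_eq.
have E2 : la be * (f - F * c') = mu al * (b + F * c).
  by rewrite mulrBr E aE; ring.
have [d dE] := h2_congr al (f - F * c').
have z0 : mmap (@mpolyC 4 k) (h2 al) (f - F * c') = 0.
  have l0 : la be != 0.
    apply/eqP => l0; have := congr1 (fun g : S => g.@[e o3]) l0.
    by rewrite mevalB mevalZ !xe !neq //= mulr0 subr0 meval0 => /eqP; rewrite oner_eq0.
  apply: (mulfI l0); rewrite mulr0; apply: mpoly_fun0 => v; rewrite mevalM h2_eval -la2 -mevalM E2.
  by rewrite mevalM mu2 mul0r.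
apply/idealCE; exists c', d; move: dE; rewrite z0 subr0 => <-; ring.
Qed.

Lemma mu_not_divides al : ~ divides F (mu al).
Proof.
apply: not_divides_linear; first exact: mu_homog.
apply/eqP => m0; have := congr1 (fun g : S => g.@[e o2]) m0.
by rewrite mevalB mevalZ !xe !neq //= mulr0 subr0 meval0 => /eqP; rewrite oner_eq0.
Qed.

Section Lists.
Variables (l : S) (M : k -> k -> seq pt) (als bes : seq k).
Hypotheses (ua : uniq als) (ub : uniq bes).
Hypothesis hM : forall al be, al \in als -> be \in bes ->
  [/\ F.@[va al] != 0, F.@[vb be] != 0 & reduced_ci F l 1 1 (mu al) (la be) (M al be)].

Definition grid als bes : seq pt := flatten [seq flatten [seq M al be | be <- bes] | al <- als].

Lemma gridP P : reflect (exists al be, [/\ al \in als, be \in bes & P \in M al be]) (P \in grid als bes).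
Proof.
apply: (iffP flatten_mapP) => [[al aa /flatten_mapP[be bb PM]]|[al [be [aa bb PM]]]].
  by exists al, be.
by exists al => //; apply/flatten_mapP; exists be.
Qed.

Lemma grid_coord al be P : al \in als -> be \in bes -> P \in M al be ->
  [/\ (x o2).@[P 0] = al * (x o0).@[P 0], (x o3).@[P 0] = be * (x o1).@[P 0],
      (x o0).@[P 0] != 0 & (x o1).@[P 0] != 0].
Proof.
move=> aa bb PM; have [Fa Fb [_ [_ [hl nM] _ vM]]] := hM aa bb.
have [FP mP lP] := vM P PM.
have E2 : (x o2).@[P 0] = al * (x o0).@[P 0] by move: mP; rewrite mevalB mevalZ => /eqP; rewrite subr_eq0 => /eqP.
have E3 : (x o3).@[P 0] = be * (x o1).@[P 0] by move: lP; rewrite mevalB mevalZ => /eqP; rewrite subr_eq0 => /eqP.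
have PE i : P 0 i = va al i * (x o0).@[P 0] + vb be i * (x o1).@[P 0].
  by rewrite -line_decomp mP lP !mul0r !subr0.
have lin0 : P 0 <> fun=> 0.
  by move=> P0; have := nM P PM; rewrite P0 (homog_at0 hl) => /eqP; rewrite eq_sym oner_eq0.
have scal (w : vec) (c : k) : F.@[w] != 0 -> (forall i, P 0 i = c * w i) -> c = 0.
  move=> Fw Pw; have := FP; rewrite (_ : F.@[P 0] = F.@[fun i => c * w i]); last by apply: meval_eq.
  rewrite (meval_homog _ _ (cubic_homog hF)) => /eqP.
  by rewrite mulf_eq0 (negbTE Fw) orbF expf_eq0 /= => /eqP.
split=> //; apply/eqP => z; apply: lin0; apply/funext => i; rewrite PE z mulr0 ?add0r ?addr0.
  by rewrite (_ : (x o1).@[P 0] = 0) ?mulr0 //; apply: (scal _ _ Fb) => j; rewrite PE z mulr0 add0r mulrC.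
by rewrite (_ : (x o0).@[P 0] = 0) ?mulr0 //; apply: (scal _ _ Fa) => j; rewrite PE z mulr0 addr0 mulrC.
Qed.

Lemma size_flatten_const (T : eqType) T' (r : seq T) (f : T -> seq T') c :
  (forall t, t \in r -> size (f t) = c) -> size (flatten [seq f t | t <- r]) = (size r * c)%N.
Proof.
elim: r => [|t r IH] //= H; rewrite size_cat mulSn H ?mem_head // IH // => u ur.
by apply: H; rewrite inE ur orbT.
Qed.

Lemma grid_size : size (grid als bes) = (3 * size als * size bes)%N.
Proof.
rewrite /grid (@size_flatten_const _ _ _ _ (size bes * 3)%N) => [|al aa]; first by rewrite mulnA mulnC mulnA.
by apply: size_flatten_const => be bb; have [_ _ [_ [_ _ -> _]]] := hM aa bb.
Qed.

Lemma flatten_uniq (T T' : eqType) (r : seq T) (f : T -> seq T') : uniq r ->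
  (forall t, t \in r -> uniq (f t)) ->
  (forall t u y, t \in r -> u \in r -> y \in f t -> y \in f u -> t = u) -> uniq (flatten [seq f t | t <- r]).
Proof.
elim: r => [|t r IH] //= /andP[tr ur] uf inj.
rewrite cat_uniq uf ?mem_head // IH //= => [|u ur'|u w y ur' wr]; last 2 first.
- by apply: uf; rewrite inE ur' orbT.
- by apply: inj; rewrite inE ?ur' ?wr orbT.
rewrite andbT; apply/hasPn => y /flatten_mapP[u ur' yu]; apply/negP => yt.
by move: tr; rewrite (inj t u y) ?mem_head ?ur' // inE ur' orbT.
Qed.

Lemma grid_uniq : uniq (grid als bes).
Proof.
apply: flatten_uniq => // [al aa|al al' P aa aa'].
  apply: flatten_uniq => // [be bb|be be' P bb bb' h h'].
    by have [_ _ [_ []]] := hM aa bb.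
  have [_ e1 _ n1] := grid_coord aa bb h; have [_ e2 _ _] := grid_coord aa bb' h'.
  by apply: (mulIf n1); rewrite -e1 -e2.
move=> /flatten_mapP[be bb h] /flatten_mapP[be' bb' h'].
have [e1 _ n1 _] := grid_coord aa bb h; have [e2 _ _ _] := grid_coord aa' bb' h'.
by apply: (mulIf n1); rewrite -e1 -e2.
Qed.

Lemma prod_homog (r : seq k) (f : k -> S) : (forall a, f a \is 1.-homog) ->
  \prod_(a <- r) f a \is (size r).-homog.
Proof.
move=> hf; elim: r => [|a r IH]; first by rewrite big_nil dhomog1.
by rewrite big_cons; apply: (homogM (d := 1) (hf a) IH).
Qed.

Lemma prod_vanish (r : seq k) (f : k -> S) a v : a \in r -> (f a).@[v] = 0 -> (\prod_(b <- r) f b).@[v] = 0.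
Proof.
by move=> ar fa; rewrite (big_morph _ (mevalM v) (meval1 v)) (big_rem a) //= fa mul0r.
Qed.

Lemma In_mem (T : eqType) (a : T) r : List.In a r -> a \in r.
Proof. by elim: r => //= b r IH [->|/IH ar]; rewrite inE ?eqxx // ar orbT. Qed.

(** Products of planes through skew lines cut the surface in the intersections with the grid lines;
    three points on each line give the Bezout number. *)
Lemma grid_ci : l \is 1.-homog -> reduced_ci F l (size als) (size bes)
  (\prod_(a <- als) mu a) (\prod_(b <- bes) la b) (grid als bes).
Proof.
move=> hl; split; split.
- by apply: prod_homog; exact: mu_homog.
- by apply: prod_homog; exact: la_homog.
- by apply: not_divides_prod => a _; exact: mu_not_divides.
- apply: nonzerodiv_prod => b /In_mem bb; apply: nonzerodiv_curve_prod => a aa.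
  by split; [exact: mu_not_divides | have [Fa _ _] := hM aa bb; exact: mu_la_nonzerodiv].
- exact: grid_uniq.
- split=> // P /gridP[al [be [aa bb PM]]]; by have [_ _ [_ [_ [_ nM] _ _]]] := hM aa bb; apply: nM.
- exact: grid_size.
- move=> P /gridP[al [be [aa bb PM]]]; have [_ _ [_ [_ _ _ vM]]] := hM aa bb.
  by have [-> mP lP] := vM P PM; rewrite (prod_vanish aa mP) (prod_vanish bb lP).
Qed.

End Lists.
End Grid.

(** * A line meeting the surface in three points *)

Section TrisecantLine.
Variables (k : closedFieldType).
Local Notation S := {mpoly k[4]}.
Local Notation vec := ('I_4 -> k).
Implicit Types (f g : S) (v w : vec).

Lemma line_polyC v w c : line_poly v w c%:MP = c%:P.
Proof. by rewrite line_polyE mmapC. Qed.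

Lemma line_polyD v w f g : line_poly v w (f + g) = line_poly v w f + line_poly v w g.
Proof. by rewrite !line_polyE rmorphD. Qed.

Lemma line_coef00 v w f : (line_poly v w f)`_0 = f.@[v].
Proof.
by rewrite -horner_coef0 horner_line; apply: meval_eq => i; rewrite mulr0 addr0.
Qed.

Lemma coef1M (p q : {poly k}) : (p * q)`_1 = p`_0 * q`_1 + p`_1 * q`_0.
Proof. by rewrite coefM big_ord_recl big_ord_recl big_ord0 addr0. Qed.

(** Taylor's formula to first order. *)
Lemma line_coef1 v w f : (line_poly v w f)`_1 = \sum_i w i * (f^`M(i)).@[v].
Proof.
pose R f := (line_poly v w f)`_1 = \sum_i w i * (f^`M(i)).@[v].
have RD f1 f2 : R f1 -> R f2 -> R (f1 + f2).
  rewrite /R line_polyD coefD => -> ->; rewrite -big_split; apply: eq_bigr => i _.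
  by rewrite mderivD mevalD mulrDr.
have RM f1 f2 : R f1 -> R f2 -> R (f1 * f2).
  rewrite /R line_polyM coef1M !line_coef00 => -> ->.
  rewrite [RHS](eq_bigr (fun i => f1.@[v] * (w i * (f2^`M(i)).@[v]) + w i * (f1^`M(i)).@[v] * f2.@[v])).
    by rewrite big_split /= -mulr_sumr -mulr_suml.
  by move=> i _; rewrite mderivM mevalD !mevalM /=; ring.
have RC c : R c%:MP.
  by rewrite /R line_polyC coefC big1 // => i _; rewrite mderivC meval0 mulr0.
have RX j : R 'X_j.
  rewrite /R line_polyE mmapX mmap1U coefD coefC coefZ coefX /= add0r mulr1 (bigD1 j) //=.
  rewrite mderivX mnm1E eqxx scale1r (_ : (U_(j) - U_(j))%MM = 0%MM) ?mpolyX0 ?meval1; last by apply/mnmP => i'; rewrite mnmBE subnn mnm0E.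
    rewrite ?mulr1 big1 ?addr0 // => i ij.
  by rewrite mderivX mnm1E eq_sym (negbTE ij) scale0r meval0 mulr0.
change (R f); rewrite (mpolyE f); apply: (big_ind R) => [|f1 f2|m _]; first by rewrite -mpolyC0.
  exact: RD.
have RM' := RM; rewrite -mul_mpolyC; apply: RM => //; rewrite mpolyXE_id; apply: (big_ind R) => [|f1 f2|i _].
- by rewrite -mpolyC1.
- exact: RM'.
- by elim: (m i) => [|j IH]; rewrite ?expr0 -?mpolyC1 // exprS; apply: RM'.
Qed.

Lemma distinct_poly (p : {poly k}) t0 : (forall t, t != t0 -> p.[t] = 0) -> p = 0.
Proof.
move=> H; apply/eqP/negPn/negP => p0.
have [t] : exists t, (p * ('X - t0%:P)).[t] != 0.
  by apply: poly_nonroot; rewrite mulf_neq0 // polyXsubC_eq0.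
rewrite hornerM hornerXsubC mulf_eq0 subr_eq0 negb_or => /andP[pt tt].
by rewrite H ?eqxx in pt.
Qed.

End TrisecantLine.

Section Example.
Variables (k : closedFieldType) (F : {mpoly k[4]}).
Hypothesis hF : smooth_cubic_surface F.
Local Notation S := {mpoly k[4]}.
Local Notation pt := 'rV[k]_4.
Local Notation vec := ('I_4 -> k).
Implicit Types (f g l : S).

Definition comb (v w : vec) (s t : k) : vec := fun i => v i * s + w i * t.

(** For general points v and w of the surface neither tangent plane contains the other point, which
    makes both outer coefficients of the binary cubic on their line nonzero. *)
Lemma trisecant : exists (v w : vec) (c1 c2 : k), [/\ c1 != 0, c2 != 0 &
  forall s t, F.@[comb v w s t] = s * t * (c1 * s + c2 * t)].
Proof.
pose dF (v w : vec) := \sum_i w i * (F^`M(i)).@[v].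
have smooth v : v <> (fun=> 0) -> F.@[v] = 0 -> exists i, (F^`M(i)).@[v] != 0.
  move=> v0 Fv; case: hF => _ /(_ (\row_i v i)) [||i Fi].
  - by apply/eqP => /rowP E; apply: v0; apply/funext => i; have := E i; rewrite !mxE.
  - by rewrite -[RHS]Fv; apply: meval_eq => i; rewrite mxE.
  - by exists i; apply: contra Fi => /eqP <-; apply/eqP/meval_eq => j; rewrite mxE.
have [e Fe] := cubic_direction hF.
have root u : exists t, F.@[fun i => u i + e i * t] = 0.
  have [|t] := closed_rootP (line_poly u e F) _.
    apply/eqP => s1; case/eqP: Fe; rewrite -(line_coef_top u e (cubic_homog hF)).
    by rewrite nth_default // s1.
  by rewrite rootE horner_line => /eqP; exists t.
have [v [v0 Fv]] : exists v, v <> (fun=> 0) /\ F.@[v] = 0.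
  have [t0 F0] := root (fun i => (i == 0)%:R); have [t1 F1] := root (fun i => (i == 1)%:R).
  apply: contrapT => H.
  have E0 : (fun i : 'I_4 => (i == 0)%:R + e i * t0) = fun=> 0 by apply: contrapT => h; apply: H; eexists; split; [exact: h | exact: F0].
  have E1 : (fun i : 'I_4 => (i == 1)%:R + e i * t1) = fun=> 0 by apply: contrapT => h; apply: H; eexists; split; [exact: h | exact: F1].
  have := congr1 (fun z : vec => z 0) E0; have := congr1 (fun z : vec => z 1) E0; have := congr1 (fun z : vec => z 1) E1.
  rewrite /= add0r => e1 /eqP; rewrite mulf_eq0 => /orP[/eqP e0|/eqP->].
    by move: e1; rewrite e0 mul0r addr0 => /eqP; rewrite oner_eq0.
  by rewrite mulr0 addr0 => /eqP; rewrite oner_eq0.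
have [i Fi] := smooth v v0 Fv.
have [w Fw dw] : exists2 w, F.@[w] = 0 & dF v w != 0.
  pose lf : S := \sum_i (F^`M(i)).@[v] *: 'X_i.
  have lfE u : lf.@[u] = dF v u.
    rewrite (big_morph _ (mevalD u) (meval0 u)); apply: eq_bigr => j _.
    by rewrite mevalZ mevalXU mulrC.
  apply: contrapT => H; apply: (@not_divides_linear _ _ hF lf).
  - by rewrite rpred_sum // => j _; rewrite rpredZ // mpolyX_homog.
  - apply: contraNneq Fi => l0; have := lfE (fun j => (j == i)%:R); rewrite l0 meval0 => ->.
    by rewrite /dF (bigD1 i) //= eqxx mul1r big1 ?addr0 // => j /negbTE->; rewrite mul0r.
  - apply: (cubic_vanish hF) => u Fu; rewrite lfE; apply/eqP/negPn/negP => du; apply: H.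
    by exists u.
pose pr (u : bool * 'I_4 -> k) b : vec := fun i => u (b, i).
have pdF b : polyfun (fun u => dF (pr u b) (pr u (~~ b))).
  apply: polyfun_sum => j; apply: polyfun_mul; first exact: polyfun_var.
  by apply: polyfun_meval => i'; exact: polyfun_var.
have ex b : exists2 u, on_cubic F u & dF (pr u b) (pr u (~~ b)) != 0.
  exists (fun x => if x.1 == b then v x.2 else w x.2) => [b'|].
    by rewrite /=; case: (b' == b).
  by rewrite /pr /= eqxx; case: (b) dw.
have [u uF] := @on_cubic_irreducible _ _ hF _ _ _ (pdF true) (pdF false) (ex true) (ex false).
rewrite mulf_eq0 negb_or => /andP[]; rewrite /=; move: (uF true) (uF false).
rewrite -/(pr u true) -/(pr u false); move: (pr u true) (pr u false) => V W FV FW dVW dWV.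
pose p := line_poly V W F; pose c1 := p`_1; pose c2 := p`_2.
have pE t : F.@[fun i => V i + W i * t] = t * (c1 + c2 * t).
  rewrite -horner_line (horner_coef_wide _ (size_line_poly V W (cubic_homog hF))) !big_ord_recr big_ord0 /=.
  rewrite line_coef00 FV (line_coef_top V W (cubic_homog hF)) FW -/p -/c1 -/c2; ring.
have FE s t : F.@[comb V W s t] = s * t * (c1 * s + c2 * t).
  have [->|s0] := eqVneq s 0.
    rewrite mul0r mul0r; have := meval_homog t W (cubic_homog hF); rewrite FW mulr0 => E0.
    rewrite -[RHS]E0; by apply: meval_eq => j; rewrite /comb mulr0 add0r mulrC.
  have := meval_homog s (fun i => V i + W i * (t / s)) (cubic_homog hF); rewrite pE.
  rewrite (_ : F.@[fun i => s * _] = F.@[comb V W s t]) => [->|]; first by field.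
  by apply: meval_eq => j; rewrite /comb; field.
exists V, W, c1, c2; split=> //.
- by rewrite /c1 /p line_coef1.
- pose q := line_poly W V F; suff -> : c2 = q`_1 by rewrite line_coef1.
  have -> : q = c1 *: 'X^2 + c2 *: 'X.
    apply/eqP; rewrite -subr_eq0; apply/eqP; apply: (@distinct_poly _ _ 0) => t _.
    rewrite hornerD hornerN hornerD !hornerZ hornerXn hornerX horner_line.
    have -> : F.@[fun i => W i + V i * t] = F.@[comb V W t 1].
      by apply: meval_eq => j; rewrite /comb mulr1 addrC.
    by rewrite FE; ring.
  by rewrite coefD !coefZ coefXn coefX /= mulr0 add0r mulr1.
Qed.

Lemma choose_nonroots (p : {poly k}) n : p != 0 ->
  exists s, [/\ uniq s, size s = n & forall a, a \in s -> p.[a] != 0].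
Proof.
move=> p0; elim: n => [|n [s [us ss sp]]]; first by exists [::].
have [a] : exists a, (p * \prod_(z <- s) ('X - z%:P)).[a] != 0.
  by apply: poly_nonroot; rewrite mulf_neq0 // monic_neq0 // monic_prod_XsubC.
rewrite hornerM mulf_eq0 negb_or => /andP[pa sa]; exists (a :: s); split=> /=.
- by rewrite us andbT; apply: contra sa => ain; rewrite -rootE root_prod_XsubC.
- by rewrite ss.
- by move=> b; rewrite inE => /orP[/eqP->|/sp].
Qed.

Lemma comb_meval f (v w : vec) s t : f \is 1.-homog -> f.@[comb v w s t] = f.@[v] * s + f.@[w] * t.
Proof. exact: meval_lin2. Qed.

(** The three points of one trisecant line stay distinct on nearby lines, and so on all lines of a
    grid with general coordinates. *)
Theorem grids : exists2 l, l \is 1.-homog & forall q m, exists (G A lf : S) (M X L : seq pt),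
  [/\ reduced_ci F l q m.+1 G (A * lf) M, reduced_ci F l q m G A X, reduced_ci F l q 1 G lf L
    & forall P, P \in L -> A.@[P 0] != 0].
Proof.
have [v [w [c1 [c2 [c10 c20 FE]]]]] := trisecant.
pose pp : {poly k} := 'X * (c1%:P + c2 *: 'X).
have ppE t : pp.[t] = F.@[comb v w 1 t].
  by rewrite FE /pp hornerM hornerX hornerD hornerC hornerZ hornerX mulr1 mul1r.
have pp0 : pp != 0.
  rewrite mulf_neq0 ?polyX_eq0 //; apply/eqP => E; have := congr1 (fun p : {poly k} => p`_0) E.
  by rewrite coefD coefC coefZ coefX mulr0 addr0 coef0 => /eqP; rewrite (negbTE c10).
have [kk [ukk skk kkP]] := choose_nonroots 2 pp0.
case: kk ukk skk kkP => [|k1 [|k2 []]] // ukk _ kkP.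
have k12 : k1 != k2 by move: ukk; rewrite /= inE andbT.
have F1 : F.@[comb v w 1 k1] != 0 by rewrite -ppE; apply: kkP; rewrite inE eqxx.
have F2 : F.@[comb v w 1 k2] != 0 by rewrite -ppE; apply: kkP; rewrite !inE eqxx orbT.
have combD s t s' t' z : (fun i => comb v w s t i + z * comb v w s' t' i) = comb v w (s + z * s') (t + z * t').
  by apply/funext => i; rewrite /comb; ring.
have ind s t : comb v w s t = (fun=> 0) -> s = 0 /\ t = 0.
  move=> st0; have shift z : F.@[comb v w (1 + z * s) (k1 + z * t)] != 0.
    rewrite -combD (_ : (fun i => _) = comb v w 1 k1) //.
    by apply/funext => i; rewrite st0 mulr0 addr0.
  have t0 : t = 0.
    apply/eqP/negPn/negP => tn; have := shift (- k1 / t); rewrite divfK // subrr FE.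
    by rewrite mulr0 mul0r eqxx.
  split=> //; apply/eqP/negPn/negP => sn; have := shift (- 1 / s); rewrite divfK // subrr FE.
  by rewrite !mul0r eqxx.
pose Bm : 'M[k]_(2, 4) := \matrix_(r, i) comb v w 1 (if r == 0 then k1 else k2) i.
have rB : \rank Bm = 2.
  apply/eqP; rewrite -[_ == _]/(row_free Bm) -kermx_eq0; apply/eqP/row_matrixP => r.
  have yB : row r (kermx Bm) *m Bm = 0 by apply/eqP; rewrite -sub_kermx row_sub.
  move: (row r (kermx Bm)) yB => y yB.
  have : comb v w (y 0 0 + y 0 1) (y 0 0 * k1 + y 0 1 * k2) = fun=> 0.
    apply/funext => i; have := congr1 (fun A : 'rV_4 => A 0 i) yB.
    rewrite [X in X = _ -> _]mxE [X in _ = X -> _]mxE big_ord_recl big_ord_recl big_ord0 addr0 [X in _ * X + _ = _ -> _]mxE [X in _ + _ * X = _ -> _]mxE /= => E0; rewrite -[RHS]E0 /comb /=.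
    rewrite (_ : lift 0 0 = 1 :> 'I_2); last exact/val_inj.
    by ring.
  move/ind => [/eqP e1 /eqP e2]; rewrite addr_eq0 in e1; rewrite (eqP e1) in e2.
  have y1 : y 0 1 = 0.
    move: e2; rewrite mulNr addrC -mulrBr mulf_eq0 subr_eq0 [k2 == _]eq_sym (negbTE k12) orbF => /eqP //.
  rewrite row0; apply/rowP => i; rewrite [RHS]mxE.
  case: (unliftP 0 i) => [j ->|->]; last by rewrite (eqP e1) y1 oppr0.
  by rewrite (ord1 j) (_ : lift 0 0 = 1 :> 'I_2) //; exact/val_inj.
have [g ug gE] : exists2 g : 'M[k]_4, g \in unitmx & (pid_mx 2 : 'M_(2, 4)) *m g = Bm.
  pose U : 'M[k]_(2, 4) := pid_mx 2; pose f : 'M[k]_4 := (pid_mx 2 : 'M_(4, 2)) *m Bm.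
  have Uf : U *m f = Bm by rewrite mulmxA mul_pid_mx /= minnn pid_mx_1 mul1mx.
  have [|g ug Ug] := @complete_unitmx _ _ _ U f; first by rewrite Uf rB rank_pid_mx.
  by exists g; rewrite // -Ug.
pose e (s i : 'I_4) := g s i.
pose x (s : 'I_4) : S := \sum_j (invmx g) j s *: 'X_j.
have hx s : x s \is 1.-homog by rewrite rpred_sum // => j _; rewrite rpredZ // mpolyX_homog.
have xE s u : (x s).@[u] = \sum_j u j * (invmx g) j s.
  rewrite (big_morph _ (mevalD u) (meval0 u)); apply: eq_bigr => j _.
  by rewrite mevalZ mevalXU mulrC.
have xe s t : (x s).@[e t] = (s == t)%:R.
  by have := congr1 (fun A : 'M_4 => A t s) (mulmxV ug); rewrite !mxE xE eq_sym.
have dec u i : u i = \sum_s (x s).@[u] * e s i.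
  have := congr1 (fun A : 'rV_4 => A 0 i) (mulmxKV ug (\row_j u j)); rewrite !mxE => {1}<-.
  by apply: eq_bigr => s _; congr (_ * _); rewrite mxE xE; apply: eq_bigr => j _; rewrite mxE.
have pidE (r : 'I_2) i : e (inord r) i = Bm r i.
  rewrite -gE [RHS]mxE (bigD1 (inord r)) //= big1 => [|j jr].
    by rewrite addr0 mxE inordK ?eqxx ?ltn_ord ?mul1r // (ltn_trans (ltn_ord r)).
  rewrite mxE; suff /negbTE-> : (r : nat) != j by rewrite mul0r.
  by apply: contra jr => /eqP->; rewrite inord_val.
have e0E : e (inord 0) = comb v w 1 k1.
  by apply/funext => i; rewrite (pidE 0) mxE.
have e1E : e (inord 1) = comb v w 1 k2.
  by apply/funext => i; rewrite (pidE 1) mxE.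
have xvw s : s != inord 0 -> s != inord 1 -> (x s).@[v] = 0 /\ (x s).@[w] = 0.
  move=> s0 s1; have := xe s (inord 0); have := xe s (inord 1).
  rewrite (negbTE s0) (negbTE s1) e0E e1E !comb_meval // !mulr1 => h2 h1.
  have w0 : (x s).@[w] = 0.
    apply/eqP; have : (x s).@[w] * (k1 - k2) = 0.
      by rewrite mulrBr -[_ * k1](addKr (x s).@[v]) -[_ * k2](addKr (x s).@[v]) h1 h2 subrr.
    by move/eqP; rewrite mulf_eq0 subr_eq0 (negbTE k12) orbF.
  by split=> //; move: h1; rewrite w0 mul0r addr0.
pose R (j : 'I_3) : vec := if j == 0 then comb v w 1 0 else if j == 1 then comb v w 0 1 else comb v w c2 (- c1).
pose lin (u : vec) : S := \sum_i u i *: 'X_i.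
have linE u z : (lin u).@[z] = \sum_i u i * z i.
  by rewrite (big_morph _ (mevalD z) (meval0 z)); apply: eq_bigr => i _; rewrite mevalZ mevalXU.
have Rn j : R j <> fun=> 0.
  by rewrite /R; case: ifP => _; last case: ifP => _; move/ind => [/eqP E1 /eqP E2];
     move: E1 E2; rewrite ?oner_eq0 ?oppr_eq0 ?(negbTE c20) ?(negbTE c10).
have /mpoly_nonroot[lv lvP] : \prod_j lin (R j) != 0.
  apply/prodf_neq0 => j _; apply/eqP => l0; apply: (Rn j); apply/funext => i.
  have := linE (R j) (fun i' => (i' == i)%:R); rewrite l0 meval0 (bigD1 i) //= eqxx mulr1 big1 ?addr0 //.
  by move=> i' /negbTE->; rewrite mulr0.
pose l := lin lv; have hl : l \is 1.-homog by rewrite rpred_sum // => j _; rewrite rpredZ // mpolyX_homog.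
have lR j : l.@[R j] != 0.
  move: lvP; rewrite (big_morph _ (mevalM lv) (meval1 lv)) => /prodf_neq0/(_ j isT).
  by rewrite !linE; congr (_ != 0); apply: eq_bigr => i _; rewrite mulrC.
have FR j : F.@[R j] = 0.
  by rewrite /R; case: ifP => _; last case: ifP => _; rewrite FE; ring.
have xR s j : s != inord 0 -> s != inord 1 -> (x s).@[R j] = 0.
  move=> s0 s1; have [E1 E2] := xvw s s0 s1.
  by rewrite /R; case: ifP => _; last case: ifP => _; rewrite comb_meval // E1 E2 !mul0r addr0.
pose Rt (j : 'I_3) : pt := (l.@[R j])^-1 *: \row_i R j i.
have RtE f d j : f \is d.-homog -> f.@[(Rt j) 0] = (l.@[R j])^-1 ^+ d * f.@[R j].
  by move=> hf; rewrite -(meval_homog _ _ hf); apply: meval_eq => i; rewrite !mxE.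
have Rt_inj : injective Rt.
  have key s t s' t' z z' : z != 0 -> (forall i, z * comb v w s t i = z' * comb v w s' t' i) ->
      z * s = z' * s' /\ z * t = z' * t'.
    move=> z0 H; have /ind[/eqP E1 /eqP E2] : comb v w (z * s - z' * s') (z * t - z' * t') = fun=> 0.
      apply/funext => i; have := H i; rewrite /comb => /eqP; rewrite -subr_eq0 => /eqP <-; ring.
    by split; apply/eqP; rewrite -subr_eq0.
  move=> i j /rowP E; have Ei t : (l.@[R i])^-1 * R i t = (l.@[R j])^-1 * R j t by have := E t; rewrite !mxE.
  have n1 : (l.@[R i])^-1 != 0 by rewrite invr_eq0.
  have n2 : (l.@[R j])^-1 != 0 by rewrite invr_eq0.
  move: Ei n1 n2; rewrite /R; move: (_^-1) (_^-1) => z z' Ei n1 n2; move: Ei.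
  have o2 (u : 'I_3) : u != 0 -> u != 1 -> u = 2%:R by case: u => [[|[|[|]]]] //= ? _ _; apply/val_inj.
  have [i0|i0] := eqVneq i 0; [|have [i1|i1] := eqVneq i 1]; (have [j0|j0] := eqVneq j 0; [|have [j1|j1] := eqVneq j 1]);
   move/(key _ _ _ _ _ _ n1) => [/eqP E1 /eqP E2]; move: E1 E2; rewrite ?mulr1 ?mulr0 ?(negbTE n1) ?[0 == _]eq_sym ?mulrN ?oppr_eq0 ?mulf_eq0 ?(negbTE n1) ?(negbTE n2) ?(negbTE c10) ?(negbTE c20) //; subst => //.
  by rewrite (o2 i) // (o2 j).
pose M0 := [seq Rt j | j <- enum 'I_3].
have va0 : va e 0 = e (inord 0) by apply/funext => i; rewrite /va mul0r addr0.
have vb0 : vb e 0 = e (inord 1) by apply/funext => i; rewrite /vb mul0r addr0.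
have ne i j : (i < 4)%N -> (j < 4)%N -> i != j -> inord i != inord j :> 'I_4.
  by move=> hi hj; rewrite -val_eqE /= !inordK.
have ci0 : reduced_ci F l 1 1 (mu x 0) (la x 0) M0.
  have Fva : F.@[va e 0] != 0 by rewrite va0 e0E.
  split; split.
  - exact: mu_homog.
  - exact: la_homog.
  - exact: (mu_not_divides hF hx xe).
  - exact: (mu_la_nonzerodiv hx xe dec (be := 0) Fva).
  - by rewrite map_inj_uniq ?enum_uniq.
  - by split=> // _ /mapP[j _ ->]; rewrite (RtE _ _ _ hl) expr1 mulVf.
  - by rewrite size_map size_enum_ord.
  - move=> _ /mapP[j _ ->]; rewrite (RtE _ _ _ (cubic_homog hF)) (RtE _ _ _ (mu_homog hx 0)) (RtE _ _ _ (la_homog hx 0)).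
    by rewrite FR /mu /la !mevalB !mevalZ !mul0r !subr0 !xR ?mulr0 ?ne.
pose G (th : bool -> k) := mu x (th true); pose A (th : bool -> k) := la x (th false).
have pG : polyform G.
  have -> : G = fun th => x (inord 2) + (- th true) *: x (inord 0) by apply/funext => th; rewrite scaleNr.
  by apply: polyform_add; [|apply: polyform_scale; [apply: polyfun_opp; exact: polyfun_var|]]; exact: polyform_const.
have pA : polyform A.
  have -> : A = fun th => x (inord 3) + (- th false) *: x (inord 1) by apply/funext => th; rewrite scaleNr.
  by apply: polyform_add; [|apply: polyform_scale; [apply: polyfun_opp; exact: polyfun_var|]]; exact: polyform_const.
have ci0' : reduced_ci F l 1 1 (G (fun=> 0)) (A (fun=> 0)) M0 by [].
have [||D1 [pD1 D10 D1E]] := reduced_ci_open hF (isT : (0 < 1)%N) (isT : (0 < 1)%N) pG pA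
  (fun th => mu_homog hx _) (fun th => la_homog hx _) ci0' (r := 0) (R := fun _ => 0) (h := fun=> 1) _ (polyfun_const _ 1).
- by case.
- exact: oner_neq0.
pose D th := D1 th * (F.@[va e (th true)] * F.@[vb e (th false)]).
have pD : polyfun D.
  apply: polyfun_mul => //; apply: polyfun_mul; apply: polyfun_meval => i; apply: polyfun_add; try exact: polyfun_const;
    by apply: polyfun_mul; [exact: polyfun_var | exact: polyfun_const].
have D0 : D (fun=> 0) != 0 by rewrite !mulf_neq0 // ?va0 ?vb0 ?e0E ?e1E.
exists l => // q m.
have [pa paE] := polyfun_curve (fun b : bool => if b then 'X else 0) pD.
have thE al be : (fun b : bool => (if b then 'X else be%:P : {poly k}).[al]) = fun b => if b then al else be.
  by apply/funext => -[]; rewrite ?hornerX ?hornerC.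
have [als [ua sa alsP]] : exists s, [/\ uniq s, size s = q & forall a, a \in s -> D (fun b => if b then a else 0) != 0].
  have [|s [us ss sP]] := choose_nonroots q (p := pa).
    apply: contraNneq D0 => pa0; have := paE 0; rewrite pa0 horner0.
    have -> : (fun b : bool => (if b then 'X else 0 : {poly k}).[0]) = fun=> 0.
      by apply/funext => -[]; rewrite ?hornerX ?horner0.
    by move=> ->.
  exists s; split=> // a /sP; rewrite -paE; congr (D _ != 0); apply/funext => -[]; by rewrite ?hornerX ?horner0.
have pbE' al := polyfun_curve (fun b : bool => if b then al%:P else 'X) pD.
pose pb al := projT1 (cid (pbE' al)).
have pbE al t : D (fun b => if b then al else t) = (pb al).[t].
  rewrite -(projT2 (cid (pbE' al)) t); congr D; apply/funext => -[]; by rewrite ?hornerX ?hornerC.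
have [|bes [ub sb besP]] := choose_nonroots m.+1 (p := \prod_(a <- als) pb a).
  rewrite prodf_seq_neq0; apply/allP => a aa /=; apply: contraNneq (alsP a aa) => p0.
  by rewrite pbE p0 horner0.
have DE al be : al \in als -> be \in bes -> D (fun b => if b then al else be) != 0.
  move=> aa /besP; rewrite horner_prod prodf_seq_neq0 => /allP/(_ al aa) /=; by rewrite pbE.
pose M al be := if pselect (exists M, reduced_ci F l 1 1 (mu x al) (la x be) M) is left h then projT1 (cid h) else [::].
have hM al be : al \in als -> be \in bes -> [/\ F.@[va e al] != 0, F.@[vb e be] != 0 & reduced_ci F l 1 1 (mu x al) (la x be) (M al be)].
  move=> aa bb; have := DE al be aa bb; rewrite /D !mulf_eq0 !negb_or => /and3P[d1 fa fb]; split=> //.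
  rewrite /M; case: pselect => [h|[]]; first exact: projT2 (cid h).
  by have [M1 [cM _]] := D1E _ d1; exists M1.
case: bes ub sb hM {besP DE} => // bm bes /= /andP[bmn ub] [sb] hM.
have sub (bes' : seq k) : {subset bes' <= bm :: bes} -> forall al be, al \in als -> be \in bes' ->
  [/\ F.@[va e al] != 0, F.@[vb e be] != 0 & reduced_ci F l 1 1 (mu x al) (la x be) (M al be)].
  by move=> s al be aa /s; apply: hM.
have ciA := grid_ci hF hx xe dec ua (_ : uniq (bm :: bes)) hM hl.
have s1 : {subset bes <= bm :: bes} by move=> b; rewrite inE orbC => ->.
have s2 : {subset [:: bm] <= bm :: bes} by move=> b; rewrite !inE => ->.
exists (\prod_(a <- als) mu x a), (\prod_(b <- bes) la x b), (la x bm).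
exists (grid M als (bm :: bes)), (grid M als bes), (grid M als [:: bm]); split.
- have := ciA; rewrite /= bmn ub => /(_ isT); by rewrite sa sb big_cons mulrC.
- by have := grid_ci hF hx xe dec ua ub (sub _ s1) hl; rewrite sa sb.
- by have := grid_ci hF hx xe dec ua (isT : uniq [:: bm]) (sub _ s2) hl; rewrite sa big_seq1.
move=> P /gridP[al [be [aa]]]; rewrite inE => /eqP-> PM.
have [_ E3 _ n1] := grid_coord hF dec hM aa (mem_head bm bes) PM.
rewrite (big_morph _ (mevalM _) (meval1 _)) prodf_seq_neq0; apply/allP => b bb /=.
rewrite mevalB mevalZ E3 -mulrBl mulf_neq0 // subr_eq0; apply: contraNneq bmn => ->; exact: bb.
Qed.

End Example.

(** * General sets of points are nearable *)

Section NearableGeneric.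
Variables (k : closedFieldType) (F : {mpoly k[4]}).
Hypothesis hF : smooth_cubic_surface F.
Local Notation S := {mpoly k[4]}.
Local Notation pt := 'rV[k]_4.
Implicit Types (f g l : S).

Lemma indep_dual (I : finType) d (T : seq pt) (Tj : seq I) v (P : I -> pt) : injective P ->
  (forall j, pnt v j = P j 0) -> indep d T -> (forall j, j \in Tj -> P j \in T) ->
  exists b, dual_at Tj d b v.
Proof.
move=> inj vP [b [hb bE]] TjT; exists (fun j => b (P j)); split=> [j /TjT/hb//|i j /TjT iT /TjT jT].
by rewrite vP bE // (inj_eq inj).
Qed.

Lemma indep_few l (Y : seq pt) : uniq Y -> normalized l Y -> indep (size Y).-1 Y.
Proof.
move=> uY nY.
have ex P : P \in Y -> exists2 f : S, f \is (size Y).-1.-homog & forall Q, Q \in Y -> f.@[Q 0] = (Q == P)%:R.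
  move=> PY; have pm := perm_to_rem PY.
  have [|/=|f hf [fP f0]] := @separate _ l (rem P Y) P.
  - by apply: normalizedW nY => Q; rewrite inE => /orP[/eqP->|/mem_rem].
  - by rewrite mem_rem_uniq // inE eqxx.
  exists ((f.@[P 0])^-1 *: f) => [|Q QY]; first by rewrite rpredZ // -(size_rem PY).
  rewrite mevalZ; have [->|QP] := eqVneq Q P; first by rewrite mulVf.
  have Qr : Q \in rem P Y by rewrite (mem_rem_uniq _ uY) inE QP.
  by rewrite (f0 Q Qr) mulr0.
pose b P := if pselect (P \in Y) is left h then projT1 (cid2 (ex P h)) else 0.
have bP P : P \in Y -> b P \is (size Y).-1.-homog /\ forall Q, Q \in Y -> (b P).@[Q 0] = (Q == P)%:R.
  by move=> PY; rewrite /b; case: pselect => // h; case: (cid2 (ex P h)).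
by exists b; split=> [P /bP[]//|P Q /bP[_ H] /H].
Qed.

(** The forms dual to Z'' and Y in degree q are those of Z'' together with A times the forms dual to Y
    in degree e - 1, and m + e - 1 = q. *)
Lemma nearable_of_points l q m e n (G A lf : S) (M X L Z Y : seq pt) (ty : pt -> seq pt) :
  (0 < q)%N -> (0 < m)%N -> (m + e = q.+1)%N -> (0 < e <= 2)%N ->
  reduced_ci F l q m.+1 G (A * lf) M -> reduced_ci F l q m G A X -> reduced_ci F l q 1 G lf L ->
  (forall P, P \in L -> A.@[P 0] != 0) ->
  uniq Z -> {subset Z <= X} -> size Z = n -> indep m Z ->
  uniq Y -> {subset Y <= L} -> size Y = e ->
  (forall y, y \in Y -> [/\ uniq (ty y), y \notin ty y, {subset ty y <= Z ++ Y},
     size (ty y) = hpoly q.-1 & indep q.-1 (ty y)]) ->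
  generically (@on_cubic k F 'I_(n + e)) (@nearable _ F l q m e n).
Proof.
move=> q0 m0 me e12 cM cX cL AL uZ ZX sZ iZ uY YL sY tyP.
have [[hG hA _ _] [_ [hl lX] _ vX]] := cX; have [[_ hlf _ _] [_ [_ lL] _ vL]] := cL.
have uW : uniq (Z ++ Y).
  rewrite cat_uniq uZ uY andbT; apply/hasPn => P /YL/AL; apply: contra => /ZX/vX[_ _ ->]; exact: eqxx.
have iY : indep e.-1 Y by rewrite -sY; apply: (@indep_few l) => //; split=> // P /YL/lL.
have iW : indep q (Z ++ Y).
  have [b [hb bE]] := iY; apply: (@indep_cat _ _ _ _ (fun P => (A.@[P 0])^-1 *: (A * b P))).
  - apply: (indep_raise (l := l)) iZ; last by lia.
    by split=> // P /ZX/lX.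
  - by move=> P /hb hP; rewrite rpredZ //; apply: (homogM hA hP); lia.
  - by move=> P _ Q /ZX/vX[_ _ AQ]; rewrite mevalZ mevalM AQ mul0r mulr0.
  - move=> P Q PY QY; rewrite mevalZ mevalM bE //; have [->|] := eqVneq Q P; last by rewrite !mulr0.
    by rewrite mulr1 mulVf // AL // YL.
pose v0 (ji : 'I_(n + e) * 'I_4) := (nth 0 (Z ++ Y) ji.1) 0 ji.2.
have sW : size (Z ++ Y) = (n + e)%N by rewrite size_cat sZ sY.
pose W (j : 'I_(n + e)) : pt := nth 0 (Z ++ Y) j.
have pE j : pnt v0 j = W j 0 by [].
have pW j : W j \in Z ++ Y by rewrite mem_nth // sW.
have pL i : W (lshift e i) \in Z by rewrite /W nth_cat /= sZ ltn_ord mem_nth // sZ.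
have pRE i : W (rshift n i) = nth 0 Y i by rewrite /W nth_cat /= sZ ltnNge leq_addr addKn.
have pR i : W (rshift n i) \in Y by rewrite pRE mem_nth // sY.
have inj : injective W.
  move=> i j; rewrite /W => /eqP; rewrite nth_uniq ?sW // => /eqP E; exact: val_inj.
have WF P : P \in Z ++ Y -> [/\ F.@[P 0] = 0, G.@[P 0] = 0 & l.@[P 0] = 1].
  rewrite mem_cat => /orP[/ZX h|/YL h]; first by have [? ? _] := vX P h; split=> //; exact: lX.
  by have [? ? _] := vL P h; split=> //; exact: lL.
have [bG dG] := indep_dual inj pE iW (fun j (_ : j \in enum 'I_(n + e)) => pW j).
have [|bA dA] := @indep_dual _ _ _ [seq lshift e i | i <- enum 'I_n] _ _ inj pE iZ.
  by move=> _ /mapP[i _ ->].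
have iY1 : indep 1 Y.
  apply: (indep_raise (l := l)) iY; last by lia.
  by split=> // P /YL/lL.
have [|bL dL] := @indep_dual _ _ _ [seq rshift n i | i <- enum 'I_e] _ _ inj pE iY1.
  by move=> _ /mapP[i _ ->].
pose T (y : 'I_e) := [seq j <- enum 'I_(n + e) | W j \in ty (nth 0 Y y)].
have hT y : exists b, [/\ uniq (T y), rshift n y \notin T y, size (T y) = hpoly q.-1 & dual_at (T y) q.-1 b v0].
  have [|u1 u2 u3 u4 u5] := tyP (nth 0 Y y); first by rewrite mem_nth // sY.
  have [|b bE] := @indep_dual _ _ _ (T y) _ _ inj pE u5; first by move=> j; rewrite mem_filter => /andP[].
  have uT : uniq (T y) by rewrite filter_uniq // enum_uniq.
  exists b; split=> //; first by rewrite mem_filter pRE (negbTE u2).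
  rewrite -u4 -(size_map W); apply/perm_size/uniq_perm => //.
    by rewrite map_inj_uniq.
  move=> P; apply/mapP/idP => [[j]|Pt]; first by rewrite mem_filter => /andP[h _] ->.
  have PW := u3 P Pt; have lt : (index P (Z ++ Y) < n + e)%N by rewrite -sW index_mem.
  have PE : P = W (Ordinal lt) by rewrite /W nth_index.
  by exists (Ordinal lt) => //; rewrite mem_filter -PE Pt mem_enum.
pose bR y := projT1 (cid (hT y)).
apply: (near_generic hF (G0 := G) (A0 := A) (lf0 := lf) (v0 := v0) (M0 := M) (bG := bG) (bA := bA)
  (bL := bL) (T := T) (bR := bR)) => //.
- by move=> j; have [FP _ _] := WF _ (pW j).
- by move=> j; case: (WF _ (pW j)).
- move=> i j; rewrite !pE => E; apply: inj; apply/rowP => s; exact: (congr1 (@^~ s) E).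
- by move=> j; case: (WF _ (pW j)).
- by move=> i; case: (vX _ (ZX _ (pL i))).
- by move=> i; case: (vL _ (YL _ (pR i))).
- by move=> i; apply/AL/YL/pR.
- by move=> y; exact: projT2 (cid (hT y)).
Qed.

Lemma hilb_reduced_ci l q m G A X d : (0 < q)%N -> (0 < m)%N -> reduced_ci F l q m G A X ->
  hilb (vanishes X) d = hilb (idealM F G A) d.
Proof.
move=> q0 m0 cX; have [[hG hA _ _] [_ _ _ vX]] := cX.
apply: hilb_ext; first exact: ideal_additive (vanishes_ideal X).
  exact: ideal_additive (idealM_ideal F G A).
move=> f hf; split; first exact: (reduced_ci_vanishes hF q0 m0 cX hf).
by move=> h; apply: (idealM_vanishes _ _ _ h) => P /vX[].
Qed.

(** The bounds on n say that X contains n points independent in degree m, and that points of X (for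
    e = 1) or the other point of Y with points of X (for e = 2) span the conditions in degree q - 1. *)
Theorem nearable_generic : exists2 l, l \is 1.-homog & forall q m e n,
  (0 < q)%N -> (0 < m)%N -> (m + e = q.+1)%N ->
  (e = 1%N /\ (hpoly q.-1 <= n)%N /\ (n + 2 <= hpoly q)%N) \/ (e = 2 /\ n.+1 = hpoly q.-1) ->
  generically (@on_cubic k F 'I_(n + e)) (@nearable _ F l q m e n).
Proof.
have [l hl H] := grids hF; exists l => // q m e n q0 m0 me cases.
have [G [A [lf [M [X [L [cM cX cL AL]]]]]]] := H q m.
have [[hG hA nG nA] [uX [_ lX] _ vX]] := cX; have [_ [uL nL sL vL]] := cL.
have nX : normalized l X by split.
have e12 : (0 < e <= 2)%N by case: cases => [[-> _]|[-> _]].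
pose Y := take e L.
have sY : size Y = e by rewrite size_takel // sL; lia.
have YL : {subset Y <= L} by exact: mem_take.
have uY : uniq Y by rewrite take_uniq.
have idC := idealC_ideal F G; have hC := idealC_homog hF hG.
have h1 : hilb (idealM F G A) m = (hilb (idealC F G) m - 1)%N.
  have := hilb_nonzerodiv 0 idC hC hA nA; rewrite addn0 (hilb_idealC_low hF hG q0) /idealM => <-.
  by rewrite (_ : hpoly 0 = 1%N) // addnK.
have inil d : indep d ([::] : seq pt) by exists (fun=> 0); split.
case: cases => [[e1 [le1 le2]]|[e2 nE]].
- have mq : m = q by lia.
  have [|T [uT TX iT sT]] := @indep_extend _ q.-1 X [::] (hpoly q.-1) isT (fun P (h : P \in [::]) => False_ind _ (notF h)) (inil _).
  - rewrite /= (hilb_reduced_ci _ q0 m0 cX) /idealM mq in h1 *.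
    rewrite (hilb_addI_low idC hC (e := m) hA); last by lia.
    by rewrite (hilb_idealC_low hF hG) ?leqnn //; lia.
  rewrite !cats0 in uT TX iT sT.
  have le : (q.-1 <= m)%N by lia.
  have [|Z [uZ ZX iZ sZ]] := @indep_extend _ m X T n uT TX (indep_raise (normalizedW TX nX) le iT).
    rewrite sT le1 /= (hilb_reduced_ci _ q0 m0 cX) h1 mq; have := hilb_idealC hF hG nG 0.
    by rewrite addn0 (_ : hpoly 0 = 1%N) //; lia.
  apply: (nearable_of_points (ty := fun=> T) q0 m0 me e12 cM cX cL AL uZ ZX sZ iZ uY YL sY) => y yY.
  split=> //; last by move=> P PT; rewrite !mem_cat PT orbT.
  by apply: contraL (AL y (YL y yY)) => /TX/vX[_ _ ->]; rewrite eqxx.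
have mq : m = q.-1 by lia.
have [|Z [uZ ZX iZ sZ]] := @indep_extend _ m X [::] n isT (fun P (h : P \in [::]) => False_ind _ (notF h)) (inil _).
- by rewrite /= (hilb_reduced_ci _ q0 m0 cX) h1 mq (hilb_idealC_low hF hG); lia.
rewrite !cats0 in uZ ZX iZ sZ.
apply: (nearable_of_points (ty := fun y => rem y Y ++ Z) q0 m0 me e12 cM cX cL AL uZ ZX sZ iZ uY YL sY) => y yY.
have AZ : vanishes Z A by move=> P /ZX/vX[].
have YZ z : z \in Y -> z \notin Z by move=> /YL/AL; apply: contra => /AZ ->.
have [y' E] : exists y', rem y Y = [:: y'].
  have := size_rem yY; rewrite sY e2; by case: (rem y Y) => [|y' []] //; exists y'.
have y'Y : y' \in Y by apply: (mem_rem (x := y)); rewrite E mem_head.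
rewrite E /= ; split.
- by rewrite /= uZ andbT YZ.
- rewrite inE negb_or YZ // andbT; have : y \notin rem y Y by rewrite mem_rem_uniq // inE eqxx.
  by rewrite E inE.
- by move=> P; rewrite inE mem_cat => /orP[/eqP->|->//]; rewrite y'Y orbT.
- by rewrite /= sZ.
- by rewrite -mq; apply: (indep_add iZ hA AZ); apply/AL/YL.
Qed.

End NearableGeneric.

(** * Subrings of total rings of fractions, and Baer's criterion *)

Record subring (Q : comNzRingType) := Subring {
  in_subring :> Q -> Prop;
  subring1 : in_subring 1;
  subringB : forall x y, in_subring x -> in_subring y -> in_subring (x - y);
  subringM : forall x y, in_subring x -> in_subring y -> in_subring (x * y) }.

Section SubringType.
Local Open Scope quotient_scope.
Variables (Q : comNzRingType) (B : subring Q).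

Lemma subring0 : B 0. Proof. by rewrite -(subrr 1); apply: subringB; exact: subring1. Qed.
Lemma subringN x : B x -> B (- x).
Proof. by move=> Bx; rewrite -sub0r; apply: subringB => //; exact: subring0. Qed.
Lemma subringD x y : B x -> B y -> B (x + y).
Proof. by move=> Bx By; rewrite -[y]opprK; apply: subringB => //; exact: subringN. Qed.
Lemma subring_sum (I : Type) (r : seq I) (P : pred I) (f : I -> Q) :
  (forall i, P i -> B (f i)) -> B (\sum_(i <- r | P i) f i).
Proof. by move=> h; apply: big_ind => //; [exact: subring0 | exact: subringD]. Qed.

Definition subring_pred : Q -> bool := fun x => `[< B x >].

Fact subring_pred_closed : subring_closed subring_pred.
Proof.
split; first exact/asboolP/subring1.
  by move=> x y /asboolP Bx /asboolP By; exact/asboolP/subringB.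
by move=> x y /asboolP Bx /asboolP By; exact/asboolP/subringM.
Qed.
HB.instance Definition _ := GRing.isSubringClosed.Build Q subring_pred subring_pred_closed.

Record subr : Type := Subr { subr_val : Q; subr_valP : subring_pred subr_val }.
HB.instance Definition _ := [isSub for subr_val].
HB.instance Definition _ := [Choice of subr by <:].
HB.instance Definition _ := [SubChoice_isSubComNzRing of subr by <:].

Lemma subrP (x : subr) : B (val x). Proof. exact/asboolP/(valP x). Qed.
Definition mksubr x (Bx : B x) : subr := Subr (introT (asboolP _) Bx).

(** K as a module over the subring; the dummy dependence on B distinguishes the module structures. *)
Definition overring : Type := let _ := B in Q.
HB.instance Definition _ := GRing.Zmodule.on overring.
Definition overring_scale (a : subr) (x : overring) : overring := val a * x.
Fact overring_scaleA a b v : overring_scale a (overring_scale b v) = overring_scale (a * b) v.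
Proof. exact: mulrA. Qed.
Fact overring_scale1 : left_id 1 overring_scale. Proof. exact: mul1r. Qed.
Fact overring_scaleDr : right_distributive overring_scale +%R. Proof. by move=> a x y; exact: mulrDr. Qed.
Fact overring_scaleDl v : {morph overring_scale^~ v : a b / a + b}. Proof. by move=> a b; exact: mulrDl. Qed.
HB.instance Definition _ := GRing.Zmodule_isLmodule.Build subr overring
  overring_scaleA overring_scale1 overring_scaleDr overring_scaleDl.

Definition overpred : overring -> bool := subring_pred.
Fact overpred_closed : zmod_closed overpred.
Proof. by split; [exact/asboolP/subring0 | move=> x y /asboolP ? /asboolP ?; exact/asboolP/subringB]. Qed.
Definition overclosed : zmodClosed overring :=
  HB.pack overpred (GRing.isZmodClosed.Build overring overpred overpred_closed).

Definition coring : Type := @Quotient.quot overring overclosed.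
HB.instance Definition _ := GRing.Zmodule.on coring.
Definition topi (x : overring) : coring := \pi_(@Quotient.quot overring overclosed) x.
Definition torepr (x : coring) : overring := repr (x : @Quotient.quot overring overclosed).

Lemma topiD x y : topi (x + y) = topi x + topi y.
Proof. by rewrite /topi; exact: (Quotient.pi_add _ x y). Qed.
Lemma topi_eq x y : topi x = topi y <-> B (x - y).
Proof.
rewrite /topi; split; first by move/eqP; rewrite -Quotient.idealrBE => /asboolP.
by move=> h; apply/eqP; rewrite -Quotient.idealrBE; exact/asboolP.
Qed.
Lemma toreprK x : topi (torepr x) = x. Proof. exact: reprK. Qed.

Definition coring_scale (a : subr) (x : coring) : coring := topi (a *: torepr x).
Lemma coring_scaleE a x : coring_scale a (topi x) = topi (a *: x).
Proof.
apply/topi_eq; rewrite -scalerBr; apply: subringM; first exact: subrP.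
by apply/topi_eq; rewrite toreprK.
Qed.
Fact coring_scaleA a b v : coring_scale a (coring_scale b v) = coring_scale (a * b) v.
Proof. by rewrite -[v]toreprK !coring_scaleE scalerA. Qed.
Fact coring_scale1 : left_id 1 coring_scale.
Proof. by move=> v; rewrite -[v]toreprK coring_scaleE scale1r. Qed.
Fact coring_scaleDr : right_distributive coring_scale +%R.
Proof. by move=> a x y; rewrite -[x]toreprK -[y]toreprK -topiD !coring_scaleE scalerDr topiD. Qed.
Fact coring_scaleDl v : {morph coring_scale^~ v : a b / a + b}.
Proof. by move=> a b; rewrite -[v]toreprK !coring_scaleE scalerDl topiD. Qed.
HB.instance Definition _ := GRing.Zmodule_isLmodule.Build subr coring
  coring_scaleA coring_scale1 coring_scaleDr coring_scaleDl.

Lemma topiZ (a : subr) x : topi (a *: x) = a *: topi x.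
Proof. by rewrite -coring_scaleE. Qed.

End SubringType.

Section Baer.
Variables (A : comNzRingType) (E : lmodType A).
Local Open Scope classical_set_scope.

Definition baer : Prop := forall (I : A -> Prop) (f : A -> E), is_ideal I ->
  (forall x y, I x -> I y -> f (x + y) = f x + f y) ->
  (forall a x, I x -> f (a * x) = a *: f x) -> exists e, forall x, I x -> f x = x *: e.

(** A maximal partial extension, viewed as a functional submodule of N x E, is total. *)
Lemma baer_injective : baer -> injective_module E.
Proof.
move=> HB M N i f inj.
pose good (G : set (N * E)) := [/\ forall x, G (i x, f x),
  forall a u v, G u -> G v -> G (a *: u.1 + v.1, a *: u.2 + v.2) & forall e, G (0, e) -> e = 0].
pose P (G : set (N * E)) := G = set0 \/ good G.
have [G [PG maxG]] : exists G, P G /\ forall G', G `<` G' -> ~ P G'.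
  apply: Zorn_bigcup => C CP tot.
  have [[G0 [CG0 gG0]]|none] := pselect (exists G0, C G0 /\ good G0); last first.
    left; rewrite -subset0 => u [G CG Gu]; case: (CP _ CG) => [E0|gG]; first by rewrite E0 in Gu.
    by case: none; exists G.
  right; split.
  - by move=> x; exists G0 => //; case: gG0.
  - move=> a u v [G1 C1 G1u] [G2 C2 G2v].
    have [G3 [C3 G3u G3v]] : exists G3, [/\ C G3, G3 u & G3 v].
      by case: (tot _ _ C1 C2) => s; [exists G2 | exists G1]; split=> //; exact: s.
    exists G3 => //; case: (CP _ C3) => [E0|[_ lin _]]; first by rewrite E0 in G3u.
    exact: lin.
  - move=> e [G1 C1 G1e]; case: (CP _ C1) => [E0|[_ _ z]]; first by rewrite E0 in G1e.
    exact: z.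
pose base : set (N * E) := [set u | exists x, u = (i x, f x)].
have gbase : good base.
  split; first by move=> x; exists x.
  - by move=> a _ _ [x ->] [y ->]; exists (a *: x + y); rewrite /= !linearP.
  - move=> e [x [x0 ->]]; suff -> : x = 0 by rewrite linear0.
    by apply: inj; rewrite linear0.
have {PG} gG : good G.
  case: PG => // G0; case: (maxG base); last by right.
  rewrite G0; split; first by move=> u [].
  by move=> /(_ (i 0, f 0)); apply; exists 0.
have [Gb Glin G0] := gG.
have G00 : G (0, 0) by have := Gb 0; rewrite !linear0.
have GD u v : G u -> G v -> G (u.1 + v.1, u.2 + v.2) by move=> hu /(Glin 1 _ _ hu); rewrite !scale1r.
have GZ a u : G u -> G (a *: u.1, a *: u.2) by move=> /(Glin a)/(_ G00); rewrite !addr0.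
have Guniq x e e' : G (x, e) -> G (x, e') -> e = e'.
  move=> h h'; apply/eqP; rewrite -subr_eq0; apply/eqP/G0.
  by have := Glin (-1) _ _ h' h; rewrite /= !scaleN1r addNr addrC.
have total y : exists e, G (y, e).
  apply: contrapT => ny.
  pose I a := exists e, G (a *: y, e).
  pose fI a := if pselect (I a) is left h then projT1 (cid h) else 0.
  have fIP a : I a -> G (a *: y, fI a) by move=> h; rewrite /fI; case: pselect => // h'; case: (cid h').
  have idI : is_ideal I.
    split; first by exists 0; rewrite scale0r.
    - by move=> a b [e1 h1] [e2 h2]; exists (e1 + e2); rewrite scalerDl; exact: (GD _ _ h1 h2).
    - by move=> a b [e h]; exists (a *: e); rewrite -scalerA; exact: (GZ _ _ h).
  have fIG a e : G (a *: y, e) -> fI a = e by move=> h; apply: (Guniq (a *: y)); [apply: fIP; exists e | exact: h].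
  have [||ka kaP] := HB I fI idI.
  - by move=> a b /fIP h1 /fIP h2; apply: fIG; rewrite scalerDl; exact: (GD _ _ h1 h2).
  - by move=> a b /fIP h; apply: fIG; rewrite -scalerA; exact: (GZ _ _ h).
  pose G' : set (N * E) := [set u | exists v a, G v /\ u = (v.1 + a *: y, v.2 + a *: ka)].
  case: (maxG G').
    split; first by move=> u Gu; exists u, 0; rewrite !scale0r !addr0; case: (u) Gu.
    move=> s; apply: ny; exists ka; apply: s; exists (0, 0), 1; split=> //=.
    by rewrite !scale1r !add0r.
  right; split.
  - by move=> x; exists (i x, f x), 0; rewrite !scale0r !addr0.
  - move=> a _ _ [v [b [Gv ->]]] [v' [b' [Gv' ->]]]; exists (a *: v.1 + v'.1, a *: v.2 + v'.2), (a * b + b').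
    by split; [exact: Glin | congr (_, _); rewrite /= !scalerDr !scalerDl !scalerA addrACA].
  - move=> e [v [a [Gv [v1 ->]]]].
    have Ga : G (a *: y, - v.2).
      have -> : a *: y = - v.1 by apply/eqP; rewrite -addr_eq0 addrC -v1.
      by have := GZ (-1) _ Gv; rewrite !scaleN1r.
    by rewrite -(kaP a) ?(fIG _ _ Ga) ?subrr //; exists (- v.2).
pose g y := projT1 (cid (total y)).
have gP y : G (y, g y) by exact: (projT2 (cid (total y))).
have glin : linear g.
  by move=> a x y; apply: (Guniq (a *: x + y)); [exact: gP | exact: (Glin a _ _ (gP x) (gP y))].
pose gL : {linear N -> E} := HB.pack g (GRing.isLinear.Build A N E _ g glin).
by exists gL => x; apply: (Guniq (i x)); [exact: gP | exact: Gb].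
Qed.

End Baer.

Section InjectiveDimension.
Variables (Q : comNzRingType) (B : subring Q).
Local Notation A := (subr B).

Definition frac_ideal (I : Q -> Prop) : Prop := [/\ forall x, I x -> B x, I 0,
  forall x y, I x -> I y -> I (x + y) & forall a x, B a -> I x -> I (a * x)].

(** Every ideal becomes, after adding a complement that it annihilates, one containing a unit of K. *)
Definition regular_complement : Prop := forall I, frac_ideal I ->
  exists u v w, [/\ I u, B v, (forall x, I x -> x * v = 0) & (u + v) * w = 1].

(** The part of Baer's criterion for K / A that concerns ideals containing a unit of K: a map given
    modulo A that kills the unit u is a multiplication. *)
Definition cosyzygy_extension : Prop := forall I u w (f : Q -> Q), frac_ideal I -> I u -> u * w = 1 ->
  (forall x y, I x -> I y -> B (f (x + y) - f x - f y)) ->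
  (forall a x, B a -> I x -> B (f (a * x) - a * f x)) -> B (f u) ->
  exists ka, forall x, I x -> B (f x - x * ka).

Definition image_ideal (I : A -> Prop) (x : Q) : Prop := exists2 a : A, I a & x = val a.

Lemma image_idealP I : is_ideal I -> frac_ideal (image_ideal I).
Proof.
move=> [I0 ID IM]; split.
- by move=> _ [a _ ->]; exact: subrP.
- by exists 0.
- by move=> _ _ [a Ia ->] [b Ib ->]; exists (a + b) => //; exact: ID.
- by move=> c _ Bc [a Ia ->]; exists (mksubr Bc * a) => //; exact: IM.
Qed.

Hypotheses (H1 : regular_complement) (H2 : cosyzygy_extension).

(** With t = u + v a unit and v killing I, t f(x) = f(u x) = x f(u). *)
Lemma overring_baer : @baer A (overring B).
Proof.
move=> I f idI fD fM; have [u [v [w [[u' Iu uE] Bv uv uw]]]] := H1 (image_idealP idI).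
have [I0 ID IM] := idI.
exists (f u' * w : Q) => x Ix; rewrite -[LHS]mul1r -uw.
have xv : val x * v = 0 by apply: uv; exists x.
pose t := u' + mksubr Bv.
have tE : val t = u + v by rewrite uE.
have tx : t * x = x * u'.
  by apply: val_inj; rewrite /= mulrDl mulrC [v * _]mulrC xv addr0.
have key : val t * (f x : Q) = val x * (f u' : Q).
  by rewrite -[LHS](fM t x Ix) tx (fM x u' Iu).
by rewrite -tE mulrAC key -mulrA.
Qed.

(** Extend f by zero to the ideal I + v A, and subtract the multiplication that agrees with it at the
    unit u + v. *)
Lemma coring_baer : @baer A (coring B).
Proof.
move=> I f idI fD fM; have [u [v [w [[u' Iu uE] Bv uv uw]]]] := H1 (image_idealP idI).
have [I0 ID IM] := idI; have [J0 J1 J2 J3] := image_idealP idI.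
pose F x : Q := if pselect (B x) is left h then torepr (f (mksubr h)) else 0.
have FE (a : A) : @topi Q B (F (val a)) = f a.
  rewrite /F; case: pselect => [h|[]]; last exact: subrP.
  by rewrite toreprK; congr f; apply: val_inj.
have FD x y : image_ideal I x -> image_ideal I y -> B (F (x + y) - F x - F y).
  move=> [a Ia ->] [b Ib ->]; rewrite -addrA -opprD; apply/topi_eq.
  by rewrite topiD (FE (a + b)) !FE fD.
have FM c x : B c -> image_ideal I x -> B (F (c * x) - c * F x).
  move=> Bc [a Ia ->]; apply/topi_eq.
  by rewrite (FE (mksubr Bc * a)) fM // -FE -topiZ.
have Iu0 : image_ideal I u by exists u'.
pose k0 := F u * w.
pose J y := exists x a, [/\ image_ideal I x, B a & y = x + a * v].
have uv0 : u * v = 0 by exact: uv.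
have uniqJ x a x' a' : image_ideal I x -> image_ideal I x' -> x + a * v = x' + a' * v -> x = x'.
  have aux x1 a1 : image_ideal I x1 -> x1 * (u + v) = (x1 + a1 * v) * u.
    by move=> /uv h; rewrite mulrDr h addr0 mulrDl -mulrA [v * u]mulrC uv0 mulr0 addr0.
  by move=> /(aux x a) h /(aux x' a') h' e; rewrite -[x]mulr1 -[x']mulr1 -uw !mulrA h h' e.
pose part y := if pselect (exists x a, [/\ image_ideal I x, B a & y = x + a * v]) is left h
   then projT1 (cid h) else 0.
have partE x a : image_ideal I x -> B a -> part (x + a * v) = x.
  move=> Ix Ba; rewrite /part; case: pselect => [h|[]]; last by exists x, a.
  by case: (cid h) => x' [a' [Ix' Ba' e]] /=; symmetry; apply: uniqJ e.
pose G y := F (part y) - y * k0.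
have GE x a : image_ideal I x -> B a -> G (x + a * v) = F x - (x + a * v) * k0.
  by move=> Ix Ba; rewrite /G partE.
have idJ : frac_ideal J.
  split.
  - by move=> _ [x [a [/J0 Bx Ba ->]]]; apply: subringD => //; exact: subringM.
  - by exists 0, 0; split=> //; [exact: subring0 | rewrite mul0r addr0].
  - move=> _ _ [x [a [Ix Ba ->]]] [y [b [Iy Bb ->]]]; exists (x + y), (a + b).
    by split; [exact: J2 | exact: subringD | rewrite mulrDl addrACA].
  - move=> c _ Bc [x [a [Ix Ba ->]]]; exists (c * x), (c * a).
    by split; [exact: J3 | exact: subringM | rewrite mulrDr mulrA].
have Ju : J (u + v) by exists u, 1; split=> //; [exact: subring1 | rewrite mul1r].
have [|||ka kaP] := H2 (f := G) idJ Ju uw.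
- move=> _ _ [x [a [Ix Ba ->]]] [y [b [Iy Bb ->]]].
  rewrite (_ : x + a * v + (y + b * v) = x + y + (a + b) * v); last by rewrite mulrDl addrACA.
  rewrite !GE //; [|exact: J2|exact: subringD].
  have := FD x y Ix Iy; congr (B _); ring.
- move=> c _ Bc [x [a [Ix Ba ->]]]; rewrite mulrDr mulrA !GE //; [|exact: J3|exact: subringM].
  by have := FM c x Bc Ix; congr (B _); ring.
- rewrite -[v in G (_ + v)]mul1r GE //; last exact: subring1.
  by rewrite mul1r /k0 mulrCA uw mulr1 subrr; exact: subring0.
exists (@topi Q B (k0 + ka)) => x Ix; rewrite -topiZ -FE; apply/topi_eq.
have h : J (val x) by exists (val x), 0; split; [exists x | exact: subring0 | rewrite mul0r addr0].
have := kaP _ h; rewrite -{1}[val x]addr0 -(mul0r v) GE; [|by exists x|exact: subring0].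
by congr (B _); rewrite -[_ *: _]/(val x * _) mul0r addr0 mulrDr opprD addrA.
Qed.

Definition resolution (n : nat) : lmodType A :=
  match n with 0 => overring B | 1 => coring B | _ => 'rV[A]_0 end.

Fact topi_linear : linear (@topi Q B : overring B -> coring B).
Proof. by move=> a x y; rewrite topiD topiZ. Qed.

Fact inclusion_linear : linear (fun x : A^o => val x : overring B).
Proof. by []. Qed.

Definition inclusion : {linear A^o -> overring B} :=
  HB.pack (fun x : A^o => val x : overring B)
    (GRing.isLinear.Build A A^o (overring B) _ _ inclusion_linear).

Definition differential (i : nat) : {linear resolution i -> resolution i.+1} :=
  match i with
  | 0 => HB.pack (@topi Q B : overring B -> coring B)
           (GRing.isLinear.Build A (overring B) (coring B) _ _ topi_linear)
  | 1 => (\0 : {linear coring B -> 'rV[A]_0})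
  | _ => (\0 : {linear 'rV[A]_0 -> 'rV[A]_0})
  end.

Theorem subring_injective_dimension : finite_injective_dimension (A^o : lmodType A).
Proof.
exists 1%N, resolution, inclusion, differential; split.
- case=> [|[|i]]; first exact: baer_injective overring_baer.
    exact: baer_injective coring_baer.
  move=> M N h f _; exists (\0 : {linear N -> 'rV[A]_0}) => x.
  by apply/rowP => -[].
- by move=> x y; exact: val_inj.
- have t0 : @topi Q B 0 = 0.
    by apply: (@addIr _ (@topi Q B 0)); rewrite add0r -topiD addr0.
  move=> x; split=> [E|[y ->]]; last by rewrite -[RHS]t0; apply/topi_eq; rewrite subr0; exact: subrP.
  have Bx : B x by rewrite -[x]subr0; apply/topi_eq; rewrite t0.
  by exists (mksubr Bx).
- case=> [|i] x; last first.
    by split=> _; [exists 0|]; case: i x => [|i] x; apply/rowP => -[].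
  split=> _; last exact/rowP => -[].
  by exists (torepr x); rewrite /= toreprK.
- by case=> [|[|i]] // _ x; apply/rowP => -[].
Qed.

End InjectiveDimension.

(** * Localizations inside a ring of fractions *)

Section Localization.
Variables (R Q : comNzRingType) (psi : {rmorphism R -> Q}) (P : R -> Prop).
Hypothesis primeP : is_prime P.
Hypothesis psi_unit : forall s, ~ P s -> exists w, psi s * w = 1.
Hypothesis psi_ker : forall r, psi r = 0 -> exists2 s, ~ P s & s * r = 0.

(** The localization at P realised inside Q, where the elements outside P become units. *)
Definition local_pred (x : Q) : Prop := exists r s, ~ P s /\ x * psi s = psi r.

Fact prime_mul s t : ~ P s -> ~ P t -> ~ P (s * t).
Proof. by case: primeP => _ _ h Ps Pt /h[]. Qed.

Fact local_pred1 : local_pred 1.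
Proof. by case: primeP => _ P1 _; exists 1, 1; rewrite mul1r. Qed.
Fact local_predB x y : local_pred x -> local_pred y -> local_pred (x - y).
Proof.
move=> [r [s [Ps e]]] [r' [s' [Ps' e']]]; exists (r * s' - r' * s), (s * s').
split; first exact: prime_mul.
by rewrite rmorphB !rmorphM /= -e -e'; ring.
Qed.
Fact local_predM x y : local_pred x -> local_pred y -> local_pred (x * y).
Proof.
move=> [r [s [Ps e]]] [r' [s' [Ps' e']]]; exists (r * r'), (s * s'); split; first exact: prime_mul.
by rewrite !rmorphM /= -e -e'; ring.
Qed.
Definition local_ring : subring Q := Subring local_pred1 local_predB local_predM.

Lemma local_mem r : local_ring (psi r).
Proof. by case: primeP => _ P1 _; exists r, 1; rewrite rmorph1 mulr1. Qed.

Lemma local_inv s w : ~ P s -> psi s * w = 1 -> local_ring w.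
Proof. by move=> Ps e; exists 1, s; rewrite rmorph1 mulrC. Qed.

Definition to_local (r : R) : subr local_ring := mksubr (local_mem r).
Fact to_local_zmod : zmod_morphism to_local.
Proof. by move=> x y; apply: val_inj; rewrite /= rmorphB. Qed.
Fact to_local_monoid : monoid_morphism to_local.
Proof. by split; [|move=> x y]; apply: val_inj; rewrite /= ?rmorph1 ?rmorphM. Qed.
Definition localization : {rmorphism R -> subr local_ring} :=
  HB.pack to_local (GRing.isZmodMorphism.Build R (subr local_ring) to_local to_local_zmod)
    (GRing.isMonoidMorphism.Build R (subr local_ring) to_local to_local_monoid).

Lemma localizationP : is_localization P localization.
Proof.
split.
- move=> s Ps; have [w e] := psi_unit Ps; exists (mksubr (local_inv Ps e)).
  by apply: val_inj; rewrite /= mulrC.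
- move=> x; have [r [s [Ps e]]] := subrP x; exists r, s; split=> //; exact: val_inj.
- move=> r; split=> [/(congr1 val)/= /psi_ker//|[s Ps sr]].
  apply: val_inj; have [w e] := psi_unit Ps.
  by rewrite /= -[LHS]mul1r -e mulrAC -rmorphM sr rmorph0 mul0r.
Qed.

End Localization.

(** * The coordinate ring of a finite set of points *)

Section Functional.
Variables (k : fieldType) (J : finType).

(** A linear functional on a subspace of a finite-dimensional space extends. *)
Lemma extend_functional (G : (J -> k) -> k -> Prop) :
  G (fun=> 0) 0 -> (forall c u v x y, G u x -> G v y -> G (fun j => c * u j + v j) (c * x + y)) ->
  (forall x, G (fun=> 0) x -> x = 0) -> exists nu : J -> k, forall u x, G u x -> x = \sum_j nu j * u j.
Proof.
move=> G0 GL Gu; pose r := #|J|.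
pose GG (z : 'rV[k]_(r + 1)) := G (fun j => z 0 (lshift 1 (enum_rank j))) (z 0 (rshift r 0)).
have [|U UP] := @linear_predP _ _ GG.
  split; first by rewrite /GG; have := G0; congr G; [apply/funext => j|]; rewrite mxE.
  move=> c x y hx hy; rewrite /GG; have := GL c _ _ _ _ hx hy.
  by congr G; [apply/funext => j|]; rewrite !mxE.
pose B : 'M[k]_(\dim U, r + 1) := \matrix_i (vbasis U)`_i.
pose e : 'rV[k]_(r + 1) := delta_mx 0 (rshift r 0).
have eB : ~~ (e <= B)%MS.
  apply/negP => /submxP[D eD]; have : e \in U.
    rewrite eD mulmx_sum_row memv_suml // => i _; rewrite memvZ // rowK.
    by rewrite vbasis_mem // mem_nth // size_tuple.
  move/UP => h; suff /Gu/eqP : G (fun=> 0) 1 by rewrite oner_eq0.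
  move: h; rewrite /GG; congr G; last by rewrite mxE !eqxx.
  by apply/funext => j; rewrite mxE eq_lrshift andbF.
have BC : B *m cokermx B = 0 by exact: mulmx_coker.
have UC x : x \in U -> x *m cokermx B = 0.
  move=> xU; rewrite (coord_vbasis xU) mulmx_suml big1 // => i _.
  rewrite -scalemxAl (_ : (vbasis U)`_i = row i B); last by rewrite rowK.
  by rewrite -row_mul BC row0 scaler0.
have [j ej] : exists j, (e *m cokermx B) 0 j != 0.
  apply/existsP; apply: contraR eB => /existsPn h; rewrite submxE; apply/eqP/rowP => j.
  by have /negPn/eqP -> := h j; rewrite mxE.
pose C := cokermx B; have C1 : (e *m C) 0 j = C (rshift r 0) j by rewrite -rowE mxE.
rewrite -/C C1 in ej.
exists (fun i => - (C (rshift r 0) j)^-1 * C (lshift 1 (enum_rank i)) j) => u x Gux.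
pose z : 'rV[k]_(r + 1) := row_mx (\row_i u (enum_val i)) (\row_i x).
have /UP/UC/rowP/(_ j) : GG z.
  rewrite /GG; have := Gux; congr G; last by rewrite row_mxEr mxE.
  by apply/funext => i; rewrite row_mxEl mxE enum_rankK.
rewrite [LHS]mxE [RHS]mxE big_split_ord /= big_ord1 row_mxEr [(\row__ _) _ _]mxE => E.
have -> : \sum_i (- (C (rshift r 0) j)^-1 * C (lshift 1 (enum_rank i)) j) * u i =
    - (C (rshift r 0) j)^-1 * \sum_(i < r) z 0 (lshift 1 i) * C (lshift 1 i) j.
  rewrite mulr_sumr (reindex_onto (@enum_rank J) (@enum_val _ _)) /=; last by move=> i _; exact: enum_valK.
  apply: eq_big => [i|i _]; first by rewrite enum_rankK eqxx.
  by rewrite row_mxEl [(\row__ _) _ _]mxE enum_rankK; ring.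
rewrite -/C in E; move/eqP: E; rewrite addr_eq0 => /eqP->.
by rewrite mulrN mulNr opprK mulrCA mulVf ?mulr1.
Qed.

End Functional.

Section FreeModule.
Variables (k : fieldType) (n : nat).
Local Notation V := {ffun 'I_n -> {poly k}}.

(** Submodules of a free module of finite rank over k[t] are finitely generated: eliminate the
    coordinates one after the other. *)
Lemma submodule_generators (W : V -> Prop) : W 0 -> (forall x y, W x -> W y -> W (x + y)) ->
  (forall (p : {poly k}) x, W x -> W [ffun i => p * x i]) ->
  exists2 s : seq V, (forall x, x \in s -> W x) &
    forall x, W x -> exists c : nat -> {poly k}, forall i, x i = \sum_(j < size s) c j * s`_j i.
Proof.
have main m : (m <= n)%N -> forall W' : V -> Prop, W' 0 -> (forall x y, W' x -> W' y -> W' (x + y)) ->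
    (forall (p : {poly k}) x, W' x -> W' [ffun i => p * x i]) ->
    (forall x, W' x -> forall i : 'I_n, (m <= i)%N -> x i = 0) ->
    exists2 s : seq V, (forall x, x \in s -> W' x) &
      forall x, W' x -> exists c : nat -> {poly k}, forall i, x i = \sum_(j < size s) c j * s`_j i.
  elim: m => [|m IH] lt W' W0 WD WM high.
    exists [::] => // x /high h; exists (fun=> 0) => i; by rewrite big_ord0 h.
  pose im : 'I_n := Ordinal lt.
  have [||||s sW sE] := IH (ltnW lt) (fun x => W' x /\ x im = 0).
  - by split=> //; rewrite ffunE.
  - by move=> x y [hx ex] [hy ey]; split; [exact: WD | rewrite ffunE ex ey addr0].
  - by move=> p x [hx ex]; split; [exact: WM | rewrite ffunE ex mulr0].
  - move=> x [hx ex] i; rewrite leq_eqVlt => /orP[/eqP e|]; last exact: high.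
    by rewrite -ex; congr (x _); apply: val_inj.
  have [[x0 [W0x x00]]|none] := pselect (exists x, W' x /\ x im != 0); last first.
    exists s => [x /sW[]//|x Wx]; apply: sE; split=> //; apply/eqP/negPn/negP => h.
    by apply: none; exists x.
  pose pr d := `[< exists x, [/\ W' x, x im != 0 & size (x im) = d] >].
  have ex : exists d, pr d by exists (size (x0 im)); apply/asboolP; exists x0.
  have [d /asboolP[w [Ww w0 wd]] dmin] := ex_minnP ex.
  exists (w :: s) => [x|x Wx]; first by rewrite inE => /orP[/eqP->//|/sW[]].
  pose p := x im %/ w im; pose y := x + [ffun i => - p * w i].
  have Wy : W' y by apply: WD => //; exact: WM.
  have y0 : y im = 0.
    have ym : y im = x im %% w im.
      by rewrite !ffunE mulNr {1}(divp_eq (x im) (w im)) addrAC subrr add0r.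
    apply/eqP/negPn/negP => h; have /dmin : pr (size (y im)) by apply/asboolP; exists y.
    by rewrite ym -wd leqNgt ltn_modp w0.
  have [c cE] := sE y (conj Wy y0).
  exists (fun j => if j is j'.+1 then c j' else p) => i.
  rewrite big_ord_recl /= -cE !ffunE /=; ring.
move=> W0 WD WM; apply: (main n (leqnn n)) => // x _ i; by rewrite leqNgt ltn_ord.
Qed.

End FreeModule.

Section ProductOfFields.
Variables (k : fieldType) (N : nat).
Local Notation K := {fraction {poly k}}.

Definition prodfrac : Type := {ffun 'I_N.+1 -> K}.
HB.instance Definition _ := GRing.Zmodule.on prodfrac.
Definition prodfrac1 : prodfrac := [ffun=> 1].
Definition prodfrac_mul (x y : prodfrac) : prodfrac := [ffun i => x i * y i].
Fact prodfrac_mulA : associative prodfrac_mul.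
Proof. by move=> x y z; apply/ffunP => i; rewrite !ffunE mulrA. Qed.
Fact prodfrac_mulC : commutative prodfrac_mul.
Proof. by move=> x y; apply/ffunP => i; rewrite !ffunE mulrC. Qed.
Fact prodfrac_mul1 : left_id prodfrac1 prodfrac_mul.
Proof. by move=> x; apply/ffunP => i; rewrite !ffunE mul1r. Qed.
Fact prodfrac_mulD : left_distributive prodfrac_mul +%R.
Proof. by move=> x y z; apply/ffunP => i; rewrite !ffunE mulrDl. Qed.
Fact prodfrac_nz : prodfrac1 != 0.
Proof. by apply/eqP => /ffunP/(_ ord0)/eqP; rewrite !ffunE oner_eq0. Qed.
HB.instance Definition _ := GRing.Zmodule_isComNzRing.Build prodfrac
  prodfrac_mulA prodfrac_mulC prodfrac_mul1 prodfrac_mulD prodfrac_nz.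

Lemma prodfracM (x y : prodfrac) i : (x * y) i = x i * y i. Proof. by rewrite ffunE. Qed.
Lemma prodfracD (x y : prodfrac) i : (x + y) i = x i + y i. Proof. by rewrite ffunE. Qed.
Lemma prodfrac_zero i : (0 : prodfrac) i = 0. Proof. by rewrite ffunE. Qed.
Lemma prodfrac_one i : (1 : prodfrac) i = 1. Proof. by rewrite ffunE. Qed.

Lemma prodfrac_inv (x : prodfrac) : (forall i, x i != 0) -> exists w, x * w = 1.
Proof.
move=> h; exists [ffun i => (x i)^-1]; apply/ffunP => i.
by rewrite prodfracM ffunE mulfV // prodfrac_one.
Qed.

Lemma prodfrac_complement (J : 'I_N.+1 -> bool) (a0 : K) (x : 'I_N.+1 -> K) (u v : prodfrac) :
  a0 != 0 -> (forall j, J j -> x j != 0) -> (forall j, u j = if J j then a0 * x j else 0) ->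
  (forall j, v j = if J j then 0 else a0) -> exists w, (u + v) * w = 1.
Proof.
move=> a00 x0 uE vE; apply: prodfrac_inv => j; rewrite prodfracD uE vE.
case: ifP => [/x0 h|_]; last by rewrite add0r.
by rewrite addr0; exact: mulf_neq0 a00 h.
Qed.

End ProductOfFields.

(** * Dual weights make the coordinate ring Gorenstein *)

Section PointsRing.
Variables (k : closedFieldType) (N : nat) (pp : 'I_N.+1 -> 'rV[k]_4) (l : {mpoly k[4]}).
Hypotheses (hl : l \is 1.-homog) (lpp : forall i, l.@[pp i 0] = 1) (inj : injective pp).
Local Notation S := {mpoly k[4]}.
Local Notation Q := (prodfrac k N).
Local Notation tofrac := (@FracField.tofrac {poly k}).
Implicit Types (f g h : S).

(** The restriction of f to the line through 0 and the i-th point; its coefficients are the values of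
    the homogeneous components. *)
Definition along i f : {poly k} := mmap polyC (fun j => (0 : k)%:P + pp i 0 j *: 'X) f.

Lemma alongE i f : along i f = line_poly (fun=> 0) (pp i 0) f.
Proof. by rewrite line_polyE. Qed.
Lemma alongD i f g : along i (f + g) = along i f + along i g. Proof. exact: rmorphD. Qed.
Lemma alongB i f g : along i (f - g) = along i f - along i g. Proof. exact: rmorphB. Qed.
Lemma alongM i f g : along i (f * g) = along i f * along i g. Proof. exact: rmorphM. Qed.
Lemma alongX i f n : along i (f ^+ n) = along i f ^+ n. Proof. exact: rmorphXn. Qed.
Lemma along1 i : along i 1 = 1. Proof. exact: rmorph1. Qed.
Lemma alongC i c : along i c%:MP = c%:P. Proof. by rewrite /along mmapC. Qed.
Lemma along_sum i (I : Type) (r : seq I) (P : pred I) (f : I -> S) :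
  along i (\sum_(j <- r | P j) f j) = \sum_(j <- r | P j) along i (f j).
Proof. exact: rmorph_sum. Qed.

Lemma along_coef i f d : (along i f)`_d = (pihomog mdeg d f).@[pp i 0].
Proof. by rewrite alongE line_coef0. Qed.

Lemma along_homog i f d : f \is d.-homog -> along i f = f.@[pp i 0] *: 'X^d.
Proof.
move=> hf; apply/polyP => e; rewrite along_coef coefZ coefXn; have [->|ne] := eqVneq e d.
  by rewrite pihomog_dE // mulr1.
by rewrite (pihomog_ne0 _ hf) ?meval0 ?mulr0 // eq_sym.
Qed.

Lemma along_l i : along i l = 'X. Proof. by rewrite (along_homog i hl) lpp scale1r expr1. Qed.

Definition in_l (p : {poly k}) : S := (map_poly (@mpolyC 4 k) p).[l].

Lemma along_in_l i p : along i (in_l p) = p.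
Proof.
rewrite /in_l /along -horner_map /= -[mmap _ _ l]/(along i l) along_l -map_poly_comp.
rewrite (eq_map_poly (g := polyC)) => [|c]; last exact: (alongC i c).
exact: comp_polyXr.
Qed.

Definition cst f : k := (pihomog mdeg 0 f)@_0.

Lemma along_cst i f : (along i f)`_0 = cst f.
Proof. by rewrite along_coef (homog0_const (pihomogP mdeg 0 f)) mevalC. Qed.

Lemma bump_form i : exists2 f, f \is N.-homog & forall j, f.@[pp j 0] = (j == i)%:R.
Proof.
pose Y := [seq pp j | j <- enum 'I_N.+1].
have memY j : pp j \in Y by apply: map_f; rewrite mem_enum.
have [||b [hb bE]] := @indep_few k l Y; first by rewrite map_inj_uniq ?enum_uniq.
  by split=> // _ /mapP[j _ ->].
exists (b (pp i)); last by move=> j; rewrite bE // (inj_eq inj).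
by have := hb _ (memY i); rewrite size_map size_enum_ord.
Qed.

Definition bump i : S := s2val (cid2 (bump_form i)).
Lemma along_bump i j : along j (bump i) = (j == i)%:R *: 'X^N.
Proof.
by rewrite /bump; case: (cid2 _) => f hf fE /=; rewrite (along_homog j hf) fE.
Qed.

(** Forms of degree N separate N + 1 points, so everything divisible by the N-th power of the parameter
    comes from a polynomial. *)
Lemma lift_multiple (w : 'I_N.+1 -> {poly k}) : exists f, forall i, along i f = 'X^N * w i.
Proof.
exists (\sum_i bump i * in_l (w i)) => j; rewrite along_sum (bigD1 j) //= big1 ?addr0 => [|i ij].
  by rewrite alongM along_bump along_in_l eqxx scale1r.
by rewrite alongM along_bump eq_sym (negbTE ij) scale0r mul0r.
Qed.

Definition evl f : Q := [ffun i => tofrac (along i f)].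
Lemma evlE f i : evl f i = tofrac (along i f). Proof. exact: ffunE. Qed.
Lemma evlB f g : evl (f - g) = evl f - evl g.
Proof. by apply/ffunP => i; rewrite !ffunE alongB rmorphB. Qed.
Lemma evlD f g : evl (f + g) = evl f + evl g.
Proof. by apply/ffunP => i; rewrite !ffunE alongD rmorphD. Qed.
Lemma evlM f g : evl (f * g) = evl f * evl g.
Proof. by apply/ffunP => i; rewrite !ffunE alongM rmorphM. Qed.
Lemma evl1 : evl 1 = 1.
Proof. by apply/ffunP => i; rewrite !ffunE along1 rmorph1. Qed.
Lemma evl0 : evl 0 = 0.
Proof. by have := evlB 0 0; rewrite !subrr. Qed.
Lemma evl_eq f g : (forall i, along i f = along i g) -> evl f = evl g.
Proof. by move=> h; apply/ffunP => i; rewrite !ffunE h. Qed.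
Lemma evl_inj f g i : evl f = evl g -> along i f = along i g.
Proof. by move/ffunP/(_ i); rewrite !ffunE => /eqP; rewrite tofrac_eq => /eqP. Qed.
Lemma evl_unit f : (forall i, along i f != 0) -> exists w, evl f * w = 1.
Proof. by move=> h; apply: prodfrac_inv => i; rewrite evlE tofrac_eq0. Qed.

Definition points_subring : subring Q.
Proof.
exists (fun x => exists f, x = evl f).
- by exists 1; rewrite evl1.
- by move=> _ _ [f ->] [g ->]; exists (f - g); rewrite evlB.
- by move=> _ _ [f ->] [g ->]; exists (f * g); rewrite evlM.
Defined.

Definition points_ring := subr points_subring.
Definition to_points f : points_ring := mksubr (ex_intro (fun g => evl f = evl g) f erefl : points_subring (evl f)).
Fact to_points_zmod : zmod_morphism to_points.
Proof. by move=> f g; apply: val_inj; rewrite /= evlB. Qed.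
Fact to_points_monoid : monoid_morphism to_points.
Proof. by split; [|move=> f g]; apply: val_inj; rewrite /= ?evl1 ?evlM. Qed.
Definition qpts : {rmorphism S -> points_ring} :=
  HB.pack to_points (GRing.isZmodMorphism.Build S points_ring to_points to_points_zmod)
    (GRing.isMonoidMorphism.Build S points_ring to_points to_points_monoid).
Lemma qptsE f : val (qpts f) = evl f. Proof. by []. Qed.
Lemma qpts_surj y : exists f, qpts f = y.
Proof. by have [f e] := subrP y; exists f; apply: val_inj; rewrite qptsE e. Qed.
Lemma qpts_eq0 f : qpts f = 0 <-> forall i, along i f = 0.
Proof.
split=> [/(congr1 val) e i|h].
  have e' : evl f = evl 0 by rewrite evl0; exact: e.
  by rewrite (evl_inj i e') /along rmorph0.
by apply: val_inj; rewrite qptsE -[RHS]evl0; apply: evl_eq => i; rewrite h /along rmorph0.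
Qed.

Lemma points_ring_noetherian : noetherian points_ring.
Proof.
move=> J [J0 JD JM].
pose W (x : {ffun 'I_N.+1 -> {poly k}}) := exists2 f, J (qpts f) & forall i, x i = along i f.
have [|||s sW sE] := @submodule_generators _ _ W.
- by exists 0; [rewrite rmorph0 | move=> i; rewrite ffunE /along rmorph0].
- by move=> x y [f Jf fE] [g Jg gE]; exists (f + g);
    [rewrite rmorphD; exact: JD | move=> i; rewrite ffunE fE gE alongD].
- by move=> p x [f Jf fE]; exists (in_l p * f);
    [rewrite rmorphM; exact: JM | move=> i; rewrite ffunE fE alongM along_in_l].
pose F x : S := if pselect (W x) is left h then s2val (cid2 h) else 0.
have FW x : W x -> J (qpts (F x)) /\ forall i, along i (F x) = x i.
  by move=> h; rewrite /F; case: pselect => // h'; case: (cid2 h') => f Jf fE /=; split.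
exists [seq qpts (F x) | x <- s] => y.
have nthE j : (j < size s)%N -> [seq qpts (F x) | x <- s]`_j = qpts (F s`_j).
  by move=> lt; rewrite (nth_map 0).
split=> [Jy|[c ->]].
  have [f fy] := qpts_surj y; rewrite -fy in Jy *.
  have [c cE] := sE [ffun i => along i f] (ex_intro2 _ _ f Jy (fun i => ffunE _ i)).
  exists (fun j => qpts (in_l (c j))).
  have -> : \sum_(j < size [seq qpts (F x) | x <- s]) qpts (in_l (c j)) * [seq qpts (F x) | x <- s]`_j
      = qpts (\sum_(j < size s) in_l (c j) * F s`_j).
    rewrite -(big_mkord xpredT (fun j => qpts (in_l (c j)) * [seq qpts (F x) | x <- s]`_j)) size_map.
    rewrite big_mkord rmorph_sum; apply: eq_bigr => j _; by rewrite nthE // rmorphM.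
  apply/eqP; rewrite -subr_eq0 -rmorphB; apply/eqP/qpts_eq0 => i.
  rewrite alongB along_sum; have := cE i; rewrite ffunE => ->; apply/eqP; rewrite subr_eq0; apply/eqP.
  by apply: eq_bigr => j _; rewrite alongM along_in_l (FW _ (sW _ (mem_nth 0 (ltn_ord j)))).2.
have Jsum (I : finType) (F0 : I -> points_ring) : (forall i, J (F0 i)) -> J (\sum_i F0 i).
  by move=> h; apply: (big_ind J).
apply: Jsum => j; apply: JM; have lt : (j < size s)%N by rewrite -(size_map (fun x => qpts (F x))).
by rewrite nthE //; apply: (FW _ (sW _ (mem_nth 0 lt))).1.
Qed.

(** ** Primes away from the vertex *)

Section AwayFromVertex.
Variables (P : points_ring -> Prop) (primeP : is_prime P) (i : 'I_N.+1).
Hypothesis Pbump : ~ P (qpts (bump i)).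
Local Notation K := {fraction {poly k}}.

Definition component (r : points_ring) : K := (val r : Q) i.
Fact component_zmod : zmod_morphism component.
Proof. by move=> x y; rewrite /component /= !ffunE. Qed.
Fact component_monoid : monoid_morphism component.
Proof. by split; [|move=> x y]; rewrite /component /= ?prodfracM ?prodfrac_one. Qed.
Definition componentM : {rmorphism points_ring -> K} :=
  HB.pack component (GRing.isZmodMorphism.Build points_ring K component component_zmod)
    (GRing.isMonoidMorphism.Build points_ring K component component_monoid).

Lemma component_q f : componentM (qpts f) = tofrac (along i f).
Proof. exact: evlE. Qed.

Lemma component_ker r : componentM r = 0 -> exists2 s, ~ P s & s * r = 0.
Proof.
have [f <-] := qpts_surj r; rewrite component_q => /eqP; rewrite tofrac_eq0 => /eqP f0.
exists (qpts (bump i)) => //; rewrite -rmorphM; apply/qpts_eq0 => j.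
by rewrite alongM along_bump; case: eqP => [->|_]; rewrite ?f0 ?mulr0 // scale0r mul0r.
Qed.

Lemma component_unit s : ~ P s -> exists w, componentM s * w = 1.
Proof.
move=> Ps; exists (componentM s)^-1; rewrite mulfV //; apply/eqP => /component_ker[t Pt ts].
have [[P0 _ _] _ h] := primeP; have : P (t * s) by rewrite ts.
by case/h.
Qed.

(** There the local ring is a localization of k[t] in k(t): all its ideals are principal, generated by a
    polynomial of least degree. *)
Lemma away_from_vertex : exists (A : comNzRingType) (phi : {rmorphism points_ring -> A}),
  is_localization P phi /\ finite_injective_dimension (A^o : lmodType A).
Proof.
pose B := local_ring componentM primeP.
exists (subr B), (localization componentM primeP); split.
  exact: (localizationP primeP component_unit component_ker).
have Bpoly p : B (tofrac p) by rewrite -(along_in_l i p) -component_q; exact: local_mem.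
apply: subring_injective_dimension.
  move=> I [IB I0 _ _]; have [[x [Ix x0]]|none] := pselect (exists x, I x /\ x != 0).
    exists x, 0, x^-1; split=> //; [exact: subring0 | by move=> y _; rewrite mulr0 | by rewrite addr0 mulfV].
  exists 0, 1, 1; split=> //; [exact: subring1 | move=> x Ix | by rewrite add0r mulr1].
  by rewrite mulr1; apply/eqP/negPn/negP => x0; apply: none; exists x.
move=> I u w f [IB I0 ID IM] Iu uw fD fM _.
have clear x : B x -> exists s t, [/\ B s, t * s = 1, B t & exists p, s * x = tofrac p].
  move=> [r [s [Ps e]]]; have [t st] := component_unit Ps.
  exists (componentM s), t; split; [exact: local_mem | by rewrite mulrC | exact: local_inv st |].
  by have [g gr] := qpts_surj r; exists (along i g); rewrite mulrC e -gr component_q.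
pose pr d := `[< exists p, [/\ I (tofrac p), p != 0 & size p = d] >].
have ex : exists d, pr d.
  have [s [t [Bs ts Bt [p e]]]] := clear u (IB u Iu); exists (size p); apply/asboolP; exists p.
  split=> //; first by rewrite -e; exact: IM.
  rewrite -tofrac_eq0 -e mulf_neq0 //; apply/eqP => z; move/eqP: ts => /eqP.
    by rewrite z mulr0 => /esym/eqP; rewrite oner_eq0.
  by move: uw; rewrite z mul0r => /esym/eqP; rewrite oner_eq0.
have [d /asboolP[g [Ig g0 gd]] dmin] := ex_minnP ex.
have g0' : tofrac g != 0 by rewrite tofrac_eq0.
have multiple p : I (tofrac p) -> p = (p %/ g) * g.
  move=> Ip; have [r0|r0] := eqVneq (p %% g) 0; first by rewrite {1}(divp_eq p g) r0 addr0.
  have /dmin : pr (size (p %% g)).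
    apply/asboolP; exists (p %% g); split=> //.
    have -> : p %% g = p + (- (p %/ g)) * g by rewrite {2}(divp_eq p g) mulNr addrAC subrr add0r.
    by rewrite rmorphD rmorphM; apply: ID => //; apply: IM => //; exact: Bpoly.
  by rewrite -gd leqNgt ltn_modp g0.
exists (f (tofrac g) / tofrac g) => x Ix.
have [s [t [Bs ts Bt [p e]]]] := clear x (IB x Ix).
have Ip : I (tofrac p) by rewrite -e; exact: IM.
have E1 : B (f (tofrac p) - tofrac p * (f (tofrac g) / tofrac g)).
  have := fM (tofrac (p %/ g)) (tofrac g) (Bpoly _) Ig; rewrite -rmorphM -multiple //.
  congr (B (_ - _)); rewrite [in RHS](multiple p Ip) rmorphM /= -mulrA; congr (_ * _).
  by rewrite mulrCA mulfV // mulr1.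
have E2 : B (s * (f x - x * (f (tofrac g) / tofrac g))).
  have := subringB E1 (fM s x Bs Ix); rewrite e; congr (B _); rewrite -e; ring.
by have := subringM Bt E2; rewrite mulrA ts mul1r.
Qed.

End AwayFromVertex.

(** ** The vertex *)

Section Weights.
Variables (sg : nat) (cc : 'I_N.+1 -> k).
Hypothesis W1 : forall f, f \is sg.-homog -> \sum_i cc i * f.@[pp i 0] = 0.
Hypothesis W2 : forall e (u : 'I_N.+1 -> k),
  (forall j f, (j + e = sg)%N -> f \is j.-homog -> \sum_i u i * f.@[pp i 0] = 0) ->
  exists2 g, g \is e.-homog & forall i, u i = cc i * g.@[pp i 0].
Hypothesis cc0 : forall i, cc i != 0.

(** No nonzero functional on the values at the points kills the forms of a degree above [sg]:
    such a functional would be a multiple of the dual weights in every coordinate direction. *)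
Lemma high_degree_nondegenerate j0 u : (sg < j0)%N ->
  (forall g, g \is j0.-homog -> \sum_i u i * g.@[pp i 0] = 0) -> forall i, u i = 0.
Proof.
move=> lt h0.
have h1 g : g \is sg.+1.-homog -> \sum_i u i * g.@[pp i 0] = 0.
  move=> hg; have hlg : l ^+ (j0 - sg.+1) * g \is j0.-homog.
    by apply: (homogM (homogX _ hl) hg); rewrite subnK.
  by rewrite -[RHS](h0 _ hlg); apply: eq_bigr => i _; rewrite mevalM rmorphXn /= lpp expr1n mul1r.
have hS (s : 'I_4) f : f \is sg.-homog -> \sum_i (u i * pp i 0 s) * f.@[pp i 0] = 0.
  move=> hf; have hx : 'X_s * f \is sg.+1.-homog.
    by apply: (homogM (d := 1) _ hf) => //; rewrite mpolyX_homog // mdeg1.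
  by rewrite -[RHS](h1 _ hx); apply: eq_bigr => i _; rewrite mevalM mevalXU mulrA.
have const v : (forall f, f \is sg.-homog -> \sum_i v i * f.@[pp i 0] = 0) ->
    exists ga, forall i, v i = cc i * ga.
  move=> h; have [|g hg gE] := W2 (e := 0) (u := v).
    by move=> j f; rewrite addn0 => -> /h.
  by exists g@_0 => i; rewrite gE [in LHS](homog0_const hg) mevalC.
have [|ga gaE] := const u.
  move=> f hf; have hlf : l * f \is sg.+1.-homog by apply: (homogM hl hf).
  by rewrite -[RHS](h1 _ hlf); apply: eq_bigr => i _; rewrite mevalM lpp mul1r.
have [g0|g0] := eqVneq ga 0; first by move=> i; rewrite gaE g0 mulr0.
have same i j : pp i = pp j.
  apply/rowP => s; have [b bE] := const _ (hS s).
  have aux i' : ga * pp i' 0 s = b.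
    by apply: (mulfI (cc0 i')); rewrite mulrA -gaE bE.
  by apply: (mulfI g0); rewrite !aux.
have := W1 (homogX sg hl); rewrite (bigD1 ord0) //= big1 => [|i i0].
  by rewrite addr0 rmorphXn /= lpp expr1n mulr1 => /eqP; rewrite (negbTE (cc0 _)).
by case/eqP: i0; apply: inj; exact: same.
Qed.

(** The functional given by the weights on the coefficients of degree sg + n; it factors through the
    quotient by the n-th power of the parameter, where it is nondegenerate. *)
Definition lam n f : k := \sum_i cc i * (along i f)`_(sg + n).

Lemma lamB n f g : lam n (f - g) = lam n f - lam n g.
Proof.
by rewrite -sumrB; apply: eq_bigr => i _; rewrite alongB coefB mulrBr.
Qed.

Lemma lam_shift n f h : (forall i, along i f = 'X^n * along i h) -> lam n f = 0.
Proof.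
move=> e; rewrite -[RHS](W1 (pihomogP mdeg sg h)); apply: eq_bigr => i _.
by rewrite e coefXnM ltnNge leq_addl addnK along_coef.
Qed.

Lemma lam_homog n f j g : g \is j.-homog -> (j <= sg + n)%N ->
  lam n (f * g) = \sum_i cc i * (along i f)`_(sg + n - j) * g.@[pp i 0].
Proof.
move=> hg le; apply: eq_bigr => i _; rewrite alongM (along_homog i hg) -scalerAr coefZ.
by rewrite mulrC [_ * 'X^_]mulrC coefXnM ltnNge le /=; ring.
Qed.

Lemma lam_nondegenerate n f : (forall g, lam n (f * g) = 0) ->
  exists h, forall i, along i f = 'X^n * along i h.
Proof.
move=> h0.
have low e i : (e < n)%N -> (along i f)`_e = 0.
  move=> lt; apply: (mulfI (cc0 i)); rewrite mulr0.
  apply: (@high_degree_nondegenerate (sg + n - e) (fun i => cc i * (along i f)`_e)); first by lia.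
  move=> g hg; rewrite -[RHS](h0 g) (@lam_homog n f _ g hg); last by lia.
  by rewrite (_ : sg + n - (sg + n - e) = e)%N //; lia.
have high e : exists2 g, g \is e.-homog & forall i, (along i f)`_(n + e) = g.@[pp i 0].
  have [|g hg gE] := W2 (e := e) (u := fun i => cc i * (along i f)`_(n + e)).
    move=> j g je hg; rewrite -[RHS](h0 g) (@lam_homog n f _ g hg); last by lia.
    by rewrite (_ : sg + n - j = n + e)%N //; lia.
  by exists g => // i; apply: (mulfI (cc0 i)).
pose gg e := s2val (cid2 (high e)).
have ggh e : gg e \is e.-homog by rewrite /gg; case: (cid2 _).
have ggE e i : (along i f)`_(n + e) = (gg e).@[pp i 0] by rewrite /gg; case: (cid2 _).
pose m := \max_i size (along i f).
exists (\sum_(e < m) gg e) => i; rewrite along_sum.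
have -> : \sum_(e < m) along i (gg e) = \poly_(e < m) (along i f)`_(n + e).
  by rewrite poly_def; apply: eq_bigr => e _; rewrite (along_homog i (ggh e)) ggE.
apply/polyP => t; rewrite coefXnM; case: ltnP => [/low->//|le].
rewrite coef_poly subnKC //; case: ltnP => // le'; rewrite nth_default //.
have si : (size (along i f) <= m)%N by rewrite /m (bigD1 i) //= leq_maxl.
by apply: leq_trans si (leq_trans le' (leq_subr _ _)).
Qed.

Section Vertex.
Variables (P : points_ring -> Prop) (primeP : is_prime P).
Hypothesis Pl : P (qpts l).

(** A form g of positive degree d satisfies the equation of degree N + 1 whose factors are g - g(P) l^d,
    so a prime containing l contains g. *)
Lemma vertex_prime f : P (qpts f) <-> cst f = 0.
Proof.
have [[P0 PD PM] P1 Pp] := primeP.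
have PDN x y : P (x - y) -> P y -> P x by move=> h h'; rewrite -[x](subrK y); exact: PD.
have PlX d c : (0 < d)%N -> P (qpts (c%:MP * l ^+ d)).
  case: d => // d _; rewrite exprSr mulrA rmorphM; exact: PM.
have homP d g : (0 < d)%N -> g \is d.-homog -> P (qpts g).
  move=> d0 hg; have z : P (\prod_(i <- enum 'I_N.+1) qpts (g - (g.@[pp i 0])%:MP * l ^+ d)).
    rewrite -rmorph_prod (_ : qpts _ = 0) //; apply/qpts_eq0 => i.
    rewrite /along rmorph_prod big_enum (bigD1 i) //= -[mmap _ _ _]/(along i _).
    by rewrite alongB alongM alongC alongX along_l (along_homog i hg) mul_polyC subrr mul0r.
  elim: (enum _) z => [|i s IH]; rewrite ?big_nil // big_cons => /Pp[|/IH//].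
  by rewrite rmorphB => /PDN; apply; exact: PlX.
have tail g : P (qpts (g - (cst g)%:MP)).
  rewrite [X in X - _](pihomog_partitionE (leqnn (mmeasure mdeg g))).
  case: (mmeasure _ _) (pihomog_partitionE (leqnn (mmeasure mdeg g))) => [|m] gE.
    rewrite big_ord0 in gE *; rewrite gE /cst pihomog0 mcoeff0 mpolyC0 subrr rmorph0; exact: P0.
  have -> : \sum_(d < m.+1) pihomog mdeg d g - (cst g)%:MP = \sum_(i < m) pihomog mdeg i.+1 g.
    rewrite big_ord_recl [pihomog mdeg ord0 g](homog0_const (pihomogP mdeg 0 g)) -/(cst g).
    by rewrite addrC addKr.
  rewrite (_ : qpts _ = \sum_(i < m) qpts (pihomog mdeg i.+1 g)); last exact: rmorph_sum.
  by apply: (big_ind P) => // i _; apply: (homP i.+1) => //; exact: pihomogP.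
split=> [Pf|f0]; last by have := tail f; rewrite f0 mpolyC0 subr0.
apply/eqP/negPn/negP => c0; case: P1.
have Pc : P (qpts (cst f)%:MP).
  have -> : (cst f)%:MP = f - (f - (cst f)%:MP) by rewrite subKr.
  by rewrite rmorphB -[_ - _]addrC -mulN1r; apply: PD => //; apply: PM; exact: tail.
have -> : 1 = qpts ((cst f)^-1)%:MP * qpts (cst f)%:MP.
  by rewrite -rmorphM -mpolyCM mulVf // mpolyC1 rmorph1.
exact: PM.
Qed.

Definition inclusionM : {rmorphism points_ring -> Q} := (val : points_ring -> Q).

Lemma along_cst_neq0 f i : cst f != 0 -> along i f != 0.
Proof. by apply: contraNneq => e; rewrite -(along_cst i) e coef0. Qed.

Lemma vertex_unit s : ~ P s -> exists w, inclusionM s * w = 1.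
Proof.
have [f <-] := qpts_surj s; rewrite vertex_prime => /eqP f0.
by apply: evl_unit => i; exact: along_cst_neq0.
Qed.

Lemma vertex_ker r : inclusionM r = 0 -> exists2 s, ~ P s & s * r = 0.
Proof.
by case: primeP => _ P1 _ e; exists 1 => //; rewrite mul1r; apply: val_inj.
Qed.

Let B := local_ring inclusionM primeP.
Let T : Q := evl l.

Lemma vertex_mem f : B (evl f). Proof. by rewrite -qptsE; exact: (local_mem inclusionM primeP (qpts f)). Qed.

Lemma vertex_inv s : cst s != 0 -> exists2 w, B w & evl s * w = 1.
Proof.
move=> s0; have Ps : ~ P (qpts s) by move/vertex_prime/eqP; rewrite (negbTE s0).
by have [w e] := vertex_unit Ps; exists w => //; exact: (local_inv primeP Ps e).
Qed.

Lemma vertex_frac x : B x -> exists f s, cst s != 0 /\ x * evl s = evl f.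
Proof.
move=> [r [s [Ps e]]]; have [f fr] := qpts_surj r; have [g gs] := qpts_surj s.
exists f, g; rewrite -gs -fr in Ps e; split; last exact: e.
by apply/eqP => /vertex_prime.
Qed.

Lemma evl_lX n f h : (forall i, along i f = 'X^n * along i h) -> evl f = T ^+ n * evl h.
Proof.
move=> e; have -> : T ^+ n = evl (l ^+ n).
  by elim: n {e} => [|n IH]; rewrite ?expr0 ?evl1 // !exprS evlM IH.
by rewrite -evlM; apply: evl_eq => i; rewrite e alongM alongX along_l.
Qed.

Lemma evl_lX_inv n f h : evl f = T ^+ n * evl h -> forall i, along i f = 'X^n * along i h.
Proof.
move=> e i; have -> : 'X^n * along i h = along i (l ^+ n * h) by rewrite alongM alongX along_l.
apply: evl_inj; rewrite e; symmetry; apply: evl_lX => j; by rewrite alongM alongX along_l.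
Qed.

(** Modulo a power of the parameter, the local ring and the graded ring agree. *)
Lemma vertex_inverse_mod n s : cst s != 0 -> exists w z, evl s * evl w = 1 - T ^+ n * evl z.
Proof.
move=> s0; pose nu := 1 - ((cst s)^-1)%:MP * s.
have nu0 i : exists p, along i nu = 'X * p.
  exists (\poly_(j < size (along i nu)) (along i nu)`_j.+1).
  apply/polyP => [[|t]]; rewrite coefXM /=.
    by rewrite /nu alongB along1 alongM alongC coefB coef1 coefCM along_cst mulVf // subrr.
  by rewrite coef_poly; case: ltnP => // le; rewrite nth_default // (leq_trans le).
pose p i := projT1 (cid (nu0 i)); have pE i : along i nu = 'X * p i by exact: (projT2 (cid (nu0 i))).
have [z zE] := lift_multiple (fun i => p i ^+ (n + N)).
exists (((cst s)^-1)%:MP * \sum_(j < n + N) nu ^+ j), z.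
have -> : T ^+ n * evl z = evl (nu ^+ (n + N)).
  symmetry; apply: evl_lX => i; rewrite alongX pE exprMn zE exprD; ring.
rewrite -evl1 -evlB -evlM; congr evl.
have -> : 1 - nu ^+ (n + N) = 1 ^+ (n + N) - nu ^+ (n + N) by rewrite expr1n.
rewrite subrXX mulrCA mulrA; congr (_ * _); first by rewrite /nu; ring.
by apply: eq_bigr => j _; rewrite expr1n mul1r.
Qed.

Lemma vertex_decomp n x : B x -> exists g b, B b /\ x = evl g + T ^+ n * b.
Proof.
move=> Bx; have [f [s [s0 e]]] := vertex_frac Bx; have [w [z wz]] := vertex_inverse_mod n s0.
exists (f * w), (x * evl z); split; first by apply: subringM => //; exact: vertex_mem.
rewrite evlM -e -mulrA wz; ring.
Qed.

Lemma vertex_divide n f b : B b -> evl f = T ^+ n * b -> exists h, forall i, along i f = 'X^n * along i h.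
Proof.
move=> Bb e; have [g [s [s0 e']]] := vertex_frac Bb; have [w [z wz]] := vertex_inverse_mod n s0.
exists (g * w + f * z); apply: evl_lX_inv; rewrite evlD !evlM -e'.
transitivity (evl f * (evl s * evl w) + evl f * (T ^+ n * evl z)); first by rewrite wz; ring.
by rewrite {1}e; ring.
Qed.

Lemma vertex_unit_multiple u w : B u -> u * w = 1 -> exists n c, B c /\ T ^+ n = c * u.
Proof.
move=> Bu uw; have [r [s [s0 e]]] := vertex_frac Bu.
have r0 i : along i r != 0.
  rewrite -tofrac_eq0 -evlE -e prodfracM mulf_neq0 //.
    apply/eqP => z; have := congr1 (fun x : Q => x i) uw.
    by rewrite prodfracM z mul0r prodfrac_one => /esym/eqP; rewrite oner_eq0.
  by rewrite evlE tofrac_eq0 along_cst_neq0.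
have fac i : exists aw : nat * {poly k}, along i r = 'X^(aw.1) * aw.2 /\ aw.2`_0 != 0.
  have [m [q]] := multiplicity_XsubC (along i r) 0; rewrite r0 /= => rq E; exists (m, q).
  split; first by rewrite E subr0 mulrC.
  by move: rq; rewrite rootE horner_coef0.
pose aw i := projT1 (cid (fac i)).
have awE i : along i r = 'X^((aw i).1) * (aw i).2 by exact: (projT2 (cid (fac i))).1.
have aw0 i : (aw i).2`_0 != 0 by exact: (projT2 (cid (fac i))).2.
pose m := (\sum_i (aw i).1)%N.
have [y yE] := lift_multiple (fun i => 'X^(m - (aw i).1) * \prod_(j | j != i) (aw j).2).
pose s' := in_l (\prod_j (aw j).2).
have [|w' Bw' sw'] := @vertex_inv s'.
  rewrite -(along_cst ord0) along_in_l -horner_coef0 horner_prod; apply/prodf_neq0 => j _.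
  by rewrite horner_coef0.
exists (N + m)%N, (evl y * evl s * w'); split.
  by do 2?[apply: subringM => //]; exact: vertex_mem.
have -> : evl y * evl s * w' * u = evl (y * r) * w' by rewrite evlM -e; ring.
have -> : evl (y * r) = T ^+ (N + m) * evl s'.
  apply: evl_lX => i; rewrite alongM yE awE along_in_l [in RHS](bigD1 i) //= !exprD.
  have le : ((aw i).1 <= m)%N by rewrite /m (bigD1 i) //= leq_addr.
  have regroup (x1 x2 x3 x4 x5 : {poly k}) : x1 * (x2 * x3) * (x4 * x5) = x1 * (x2 * x4) * (x5 * x3).
    by ring.
  by rewrite regroup -exprD subnK.
by rewrite -mulrA sw' mulr1.
Qed.

Lemma vertex_complement : regular_complement B.
Proof.
move=> I [IB I0 ID IM].
pose J i := `[< exists2 x, I x & x i != 0 >].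
have ex i : exists x, I x /\ (J i -> x i != 0).
  have [|none] := pselect (exists2 x, I x & x i != 0); first by move=> [x]; exists x.
  by exists 0; split=> // /asboolP.
pose X i := projT1 (cid (ex i)).
have XI i : I (X i) by exact: (projT2 (cid (ex i))).1.
have XJ i : J i -> X i i != 0 by exact: (projT2 (cid (ex i))).2.
have bumpE i j : evl (bump i) j = (j == i)%:R * tofrac 'X^N.
  rewrite evlE along_bump; case: eqP => _; rewrite ?scale1r ?mul1r // scale0r mul0r rmorph0 //.
pose u : Q := \sum_(i | J i) evl (bump i) * X i; pose v : Q := \sum_(i | ~~ J i) evl (bump i).
have uE j : u j = if J j then tofrac 'X^N * X j j else 0.
  rewrite /u sum_ffunE big_mkcond (bigD1 j) //= big1 ?addr0 => [|i ij].
    by case: (J j); rewrite ?prodfracM ?bumpE ?eqxx ?mul1r.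
  by case: (J i); rewrite // prodfracM bumpE eq_sym (negbTE ij) !mul0r.
have vE j : v j = if J j then 0 else tofrac 'X^N.
  rewrite /v sum_ffunE big_mkcond (bigD1 j) //= big1 ?addr0 => [|i ij].
    by case: (J j); rewrite /= ?bumpE ?eqxx ?mul1r.
  by case: (J i); rewrite //= bumpE eq_sym (negbTE ij) mul0r.
have XN0 : tofrac ('X^N : {poly k}) != 0 by rewrite tofrac_eq0 expf_neq0 // polyX_eq0.
have Iu : I u by apply: (big_ind I) => // i _; apply: IM => //; exact: vertex_mem.
have Bv : B v by apply: subring_sum => i _; exact: vertex_mem.
move: u v uE vE Iu Bv => u v uE vE Iu Bv.
have [w uvw] := prodfrac_complement (J := J) (x := fun j => X j j) XN0 XJ uE vE.
exists u, v, w; split=> // x Ix; apply/ffunP => j; rewrite prodfracM vE prodfrac_zero.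
case: ifP => [_|/asboolP none]; first by rewrite mulr0.
suff -> : x j = 0 by rewrite mul0r.
by apply/eqP/negPn/negP => h; apply: none; exists x.
Qed.

(** On an ideal I containing the n-th power T^n of the parameter and killed by it, f = phi / T^n with
    phi from I to A / T^n.  The functional lam o phi on I extends to all of A / T^n, where it is
    lam (b _) for some b by duality; nondegeneracy then gives phi = b. *)
Lemma vertex_cosyzygy : cosyzygy_extension B.
Proof.
move=> I u w f [IB I0 ID IM] Iu uw fD fM Bfu.
have [n [c [Bc TE]]] := vertex_unit_multiple (IB u Iu) uw.
have In : I (T ^+ n) by rewrite TE; exact: IM.
have BT : B (f (T ^+ n)).
  have := subringD (fM c u Bc Iu) (subringM Bc Bfu); by rewrite subrK -TE.
have TlE : T ^+ n = evl (l ^+ n).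
  by rewrite (@evl_lX n _ 1) ?evl1 ?mulr1 // => i; rewrite alongX along_l along1 mulr1.
have [T' TT'] : exists T', T ^+ n * T' = 1.
  by rewrite TlE; apply: evl_unit => i; rewrite alongX along_l expf_neq0 // polyX_eq0.
have fT x : B x -> B (f (x * T ^+ n)).
  by move=> Bx; have := subringD (fM x _ Bx In) (subringM Bx BT); rewrite subrK.
have Tx x : I x -> B (T ^+ n * f x).
  move=> Ix; have := subringB (fT x (IB x Ix)) (fM (T ^+ n) x (IB _ In) Ix).
  by rewrite mulrC opprB addrCA subrr addr0.
pose Rel x a := I (evl x) /\ B (f (evl x) - evl a * T').
have RelE x : I (evl x) -> exists a, Rel x a.
  move=> Ix; have [g [b [Bb e]]] := vertex_decomp n (Tx _ Ix); exists g; split=> //.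
  suff -> : f (evl x) - evl g * T' = b by [].
  by rewrite -[f _]mul1r -TT' mulrAC e mulrDl addrAC subrr add0r mulrAC TT' mul1r.
have RelL g x a y b : Rel x a -> Rel y b -> Rel (g * x + y) (g * a + b).
  move=> [Ix hx] [Iy hy]; rewrite /Rel !evlD !evlM; have Igx := IM _ _ (vertex_mem g) Ix.
  split; first exact: ID.
  have := subringD (subringD (fD _ _ Igx Iy) (fM _ _ (vertex_mem g) Ix)) (subringD (subringM (vertex_mem g) hx) hy).
  by congr (B _); ring.
have RelT x a h : Rel x a -> (forall i, along i x = 'X^n * along i h) ->
    exists h', forall i, along i a = 'X^n * along i h'.
  move=> [Ix hx] /evl_lX xh; rewrite xh mulrC in hx.
  apply: (@vertex_divide n a (evl a * T')); last by rewrite mulrCA TT' mulr1.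
  by have := subringB (fT _ (vertex_mem h)) hx; rewrite opprB addrCA subrr addr0.
have Rel0 g : Rel (l ^+ n * g) 0.
  rewrite /Rel evl0 mul0r subr0 evlM -TlE mulrC; split; first by apply: IM => //; exact: vertex_mem.
  exact/fT/vertex_mem.
have R00 : Rel 0 0 by have := Rel0 0; rewrite mulr0.
have lam0 : lam n 0 = 0 by rewrite /lam big1 // => i _; rewrite /along rmorph0 coef0 mulr0.
pose trunc x (s : 'I_(n + N) * 'I_N.+1) : k := (along s.2 x)`_s.1.
pose G u y := exists x a, [/\ Rel x a, u = trunc x & y = lam n a].
have [|||nu nuE] := @extend_functional k _ G.
- exists 0, 0; split=> //; first by apply/funext => s; rewrite /trunc /along rmorph0 coef0.
- move=> c2 u1 v1 y z [x [a [r -> ->]]] [x' [a' [r' -> ->]]]; exists (c2%:MP * x + x'), (c2%:MP * a + a').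
  split; first exact: RelL.
    by apply/funext => s; rewrite /trunc alongD alongM alongC coefD coefCM.
  rewrite /lam mulr_sumr -big_split; apply: eq_bigr => i _.
  by rewrite alongD alongM alongC coefD coefCM /=; ring.
- move=> y [x [a [r u0 ->]]].
  have [h hE] := lift_multiple (fun i => \poly_(j < size (along i x)) (along i x)`_(n + N + j)).
  have [|h' h'E] := RelT x a h r; last exact: lam_shift h'E.
  move=> i; rewrite hE mulrA -exprD; apply/polyP => t; rewrite coefXnM.
  case: ltnP => [lt|le]; first by have := congr1 (fun z => z (Ordinal lt, i)) u0; rewrite /trunc /= => <-.
  by rewrite coef_poly subnKC //; case: ltnP => // le'; rewrite nth_default // (leq_trans le') ?leq_subr.
pose nn j i := if insub j is Some s then nu (s, i) else 0.
have nnE (j : 'I_(n + N)) i : nn j i = nu (j, i) by rewrite /nn valK.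
have nn0 j i : (n + N <= j)%N -> nn j i = 0 by move=> le; rewrite /nn insubF // ltnNge le.
have sumE x : \sum_s nu s * trunc x s = \sum_i \sum_(j < n + N) nn j i * (along i x)`_j.
  by rewrite exchange_big /= pair_bigA /=; apply: eq_bigr => -[j i] _; rewrite nnE.
have nuL d g : g \is d.-homog -> \sum_i nn (n + d)%N i * g.@[pp i 0] = 0.
  move=> hg; case: (ltnP (n + d) (n + N)) => [lt|le]; last by rewrite big1 // => i _; rewrite nn0 ?mul0r.
  have /nuE : G (trunc (l ^+ n * g)) 0 by exists (l ^+ n * g), 0; split.
  rewrite sumE => E; rewrite [RHS]E; apply: eq_bigr => i _; rewrite (bigD1 (Ordinal lt)) //= big1 ?addr0 => [|j jn].
    by rewrite alongM alongX along_l (along_homog i hg) -scalerAr coefZ -exprD coefXn eqxx mulr1.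
  rewrite alongM alongX along_l (along_homog i hg) -scalerAr coefZ -exprD coefXn.
  by case: eqP => [e|_]; rewrite ?mulr0 //; case/eqP: jn; apply: val_inj.
have high j i : (sg + n < j)%N -> nn j i = 0.
  move=> lt; apply: (@high_degree_nondegenerate (j - n) (nn j)) => [|g hg]; first by lia.
  by have := nuL _ _ hg; rewrite subnKC //; lia.
have bex e : exists2 g, g \is e.-homog & (e <= sg + n)%N -> forall i, nn (sg + n - e)%N i = cc i * g.@[pp i 0].
  case: (leqP e (sg + n)) => le; last by exists 0; rewrite ?rpred0 // leqNgt le.
  have [|g hg gE] := W2 (e := e) (u := nn (sg + n - e)%N); last by exists g.
  by move=> j g je /nuL; rewrite (_ : n + j = sg + n - e)%N //; lia.
pose bb e := s2val (cid2 (bex e)).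
have hbb e : bb e \is e.-homog by rewrite /bb; case: (cid2 _).
have bbE e i : (e <= sg + n)%N -> nn (sg + n - e)%N i = cc i * (bb e).@[pp i 0].
  by rewrite /bb; case: (cid2 _) => g hg h /h.
pose b := \sum_(e < (sg + n).+1) bb e.
have bco i e : (e <= sg + n)%N -> cc i * (along i b)`_e = nn (sg + n - e)%N i.
  move=> le; rewrite (bbE _ _ le) along_sum coef_sum (bigD1 (Ordinal (le : e < (sg + n).+1)%N)) //= big1 ?addr0 => [|j je].
    by rewrite (along_homog i (hbb e)) coefZ coefXn eqxx mulr1.
  rewrite (along_homog i (hbb j)) coefZ coefXn; case: eqP => [ej|_]; last by rewrite mulr0.
  by case/eqP: je; apply: val_inj.
have sum_trunc (F0 : nat -> k) a c0 : (forall j, (a <= j)%N -> F0 j = 0) -> (forall j, (c0 <= j)%N -> F0 j = 0) ->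
    \sum_(j < a) F0 j = \sum_(j < c0) F0 j.
  have one a1 d : (forall j, (a1 <= j)%N -> F0 j = 0) -> \sum_(j < a1 + d) F0 j = \sum_(j < a1) F0 j.
    by move=> h; rewrite big_split_ord /= [X in _ + X]big1 ?addr0 // => j _; rewrite h ?leq_addr.
  by move=> ha hc; rewrite -(one a c0 ha) addnC one.
have lamb x : lam n (b * x) = \sum_s nu s * trunc x s.
  rewrite sumE; apply: eq_bigr => i _; rewrite alongM coefMr mulr_sumr.
  rewrite -(sum_trunc (fun j => nn j i * (along i x)`_j) (sg + n).+1 (n + N)%N).
  - by apply: eq_bigr => j _; rewrite mulrA bco ?leq_subr // subKn // -ltnS.
  - by move=> j lt; rewrite high ?mul0r.
  - by move=> j le; rewrite nn0 ?mul0r.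
exists (evl b * T').
have onR x a : Rel x a -> B (f (evl x) - evl x * (evl b * T')).
  move=> r; have [g|h /evl_lX hE] := @lam_nondegenerate n (a - b * x).
    have /nuE : G (trunc (g * x)) (lam n (g * a)).
      by exists (g * x), (g * a); split=> //; have := RelL g _ _ _ _ r R00; rewrite !addr0.
    by rewrite -lamb mulrBl lamB [a * g]mulrC => ->; rewrite -mulrA [x * g]mulrC subrr.
  have [Ix hx] := r; have := subringD hx (vertex_mem h); congr (B _).
  have -> : evl h = (evl a - evl b * evl x) * T'.
    by rewrite -evlM -evlB hE mulrAC TT' mul1r.
  by ring.
move=> x Ix; have [r [s [s0 e]]] := vertex_frac (IB x Ix); have [t Bt st] := vertex_inv s0.
have Ir : I (evl r) by rewrite -e mulrC; apply: IM => //; exact: vertex_mem.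
have [a /onR ra] := RelE r Ir.
have E : B (evl s * (f x - x * (evl b * T'))).
  have := subringB ra (fM (evl s) x (vertex_mem s) Ix); rewrite -e [evl s * x]mulrC; congr (B _); ring.
by have := subringM Bt E; rewrite mulrA [t * _]mulrC st mul1r.
Qed.

Theorem at_vertex : exists (A : comNzRingType) (phi : {rmorphism points_ring -> A}),
  is_localization P phi /\ finite_injective_dimension (A^o : lmodType A).
Proof.
exists (subr B), (localization inclusionM primeP); split.
  exact: (localizationP primeP vertex_unit vertex_ker).
exact: (subring_injective_dimension vertex_complement vertex_cosyzygy).
Qed.

End Vertex.
Theorem points_ring_gorenstein : gorenstein points_ring.
Proof.
split; first exact: points_ring_noetherian.
move=> P primeP; have [Pl|Pl] := pselect (P (qpts l)); first exact: at_vertex.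
have [[P0 PD PM] P1 Pp] := primeP.
have [i Pi] : exists i, ~ P (qpts (bump i)).
  apply: contrapT => none; have all i : P (qpts (bump i)) by apply: contrapT => h; apply: none; exists i.
  have : P (qpts (l ^+ N)).
    have -> : qpts (l ^+ N) = \sum_i qpts (bump i).
      apply/eqP; rewrite -rmorph_sum -subr_eq0 -rmorphB; apply/eqP/qpts_eq0 => j.
      rewrite alongB alongX along_l along_sum (bigD1 j) //= big1 ?addr0 => [|i ij].
        by rewrite along_bump eqxx scale1r subrr.
      by rewrite along_bump eq_sym (negbTE ij) scale0r.
    by apply: (big_ind P).
  have Pn n : P (qpts (l ^+ n)) -> False; last exact: Pn.
  elim: n => [|n IH]; first by rewrite expr0 rmorph1.
  by rewrite exprS rmorphM => /Pp[].
exact: away_from_vertex Pi.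
Qed.

Theorem points_arithmetically_gorenstein (X : S -> Prop) :
  (forall f, X f <-> forall i d, (pihomog mdeg d f).@[pp i 0] = 0) -> arithmetically_gorenstein X.
Proof.
move=> XE; exists points_ring, qpts; split; [exact: qpts_surj | | exact: points_ring_gorenstein].
move=> f; rewrite qpts_eq0 XE; split=> h i; last by apply/polyP => d; rewrite coef0 along_coef.
by move=> d; rewrite -along_coef h coef0.
Qed.

End Weights.

End PointsRing.

(** * Complementary sets of points are linked *)

Section Linking.
Variables (k : closedFieldType) (l : {mpoly k[4]}).
Hypothesis hl : l \is 1.-homog.
Local Notation S := {mpoly k[4]}.
Local Notation pt := 'rV[k]_4.
Implicit Types (f g h : S) (X Y Z : seq pt) (P : pt) (s t : Defs.frac k 3).

Lemma homogXn n f d : f \is d.-homog -> f ^+ n \is (n * d)%N.-homog.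
Proof. by move=> hf; rewrite mulnC; exact: dhomogMn. Qed.

Definition ideal_of X f : Prop := forall P, P \in X -> forall d, (pihomog mdeg d f).@[P 0] = 0.

Definition through P f := line_poly (fun=> 0) (P 0) f.

Lemma ideal_ofE X f : ideal_of X f <-> forall P, P \in X -> through P f = 0.
Proof.
split=> h P PX; first by apply/polyP => d; rewrite line_coef0 h ?coef0.
by move=> d; rewrite -line_coef0 -/(through P f) h ?coef0.
Qed.

Lemma throughM P f g : through P (f * g) = through P f * through P g.
Proof. exact: line_polyM. Qed.

Lemma ideal_of_homog X f d : f \is d.-homog -> ideal_of X f <-> forall P, P \in X -> f.@[P 0] = 0.
Proof.
move=> hf; split=> h P PX; first by rewrite -(pihomog_dE hf) h.
move=> e; have [->|ne] := eqVneq e d; first by rewrite pihomog_dE // h.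
by rewrite (pihomog_ne0 _ hf) ?meval0 // eq_sym.
Qed.

Lemma ideal_of_ideal X : is_ideal (ideal_of X).
Proof.
split; first by move=> P PX d; rewrite pihomog0 meval0.
  by move=> f g hf hg P PX d; rewrite pihomogD mevalD hf ?hg ?addr0.
move=> f g /ideal_ofE h; apply/ideal_ofE => P PX; by rewrite throughM h ?mulr0.
Qed.

Lemma ideal_of_homogeneous X : is_homogeneous (ideal_of X).
Proof.
move=> f d h; apply/(ideal_of_homog _ (pihomogP mdeg d f)) => P PX; exact: h.
Qed.

Lemma normalized_coord P : l.@[P 0] = 1 -> exists i, P 0 i != 0.
Proof.
move=> lP; apply: contrapT => none; have : l.@[P 0] = 0.
  rewrite (_ : l.@[P 0] = l.@[fun i => 0 * P 0 i]).
    by rewrite (meval_homog _ _ hl) expr1 mul0r.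
  apply: meval_eq => i; rewrite mul0r; apply/eqP/negPn/negP => h; by apply: none; exists i.
by rewrite lP => /eqP; rewrite oner_eq0.
Qed.

Lemma through_X P i : through P 'X_i = P 0 i *: 'X.
Proof. by rewrite /through line_polyE mmapX mmap1U add0r. Qed.

Lemma throughX P f n : through P (f ^+ n) = through P f ^+ n.
Proof. by rewrite /through !line_polyE rmorphXn. Qed.

Lemma ideal_of_subscheme X : (forall P, P \in X -> l.@[P 0] = 1) -> is_subscheme (ideal_of X).
Proof.
move=> lX; split; [exact: ideal_of_ideal | exact: ideal_of_homogeneous |].
move=> f h; apply/ideal_ofE => P PX; have [i Pi] := normalized_coord (lX P PX).
have [e /ideal_ofE/(_ P PX)] := h i; rewrite throughM throughX through_X => /eqP.
by rewrite mulf_eq0 expf_eq0 scaler_eq0 (negbTE Pi) polyX_eq0 /= andbF => /eqP.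
Qed.

Lemma ideal_of_point P : l.@[P 0] = 1 -> is_point (ideal_of [:: P]).
Proof.
move=> lP; have lX P' : P' \in [:: P] -> l.@[P' 0] = 1 by rewrite inE => /eqP->.
have E f : ideal_of [:: P] f <-> through P f = 0.
  rewrite ideal_ofE; split=> [h|h P']; first by apply: h; rewrite mem_head.
  by rewrite inE => /eqP->.
have [i Pi] := normalized_coord lP.
have X0 : ~ ideal_of [:: P] 'X_i.
  by move/E/eqP; rewrite through_X scaler_eq0 (negbTE Pi) polyX_eq0.
split; [split | exact: ideal_of_homogeneous | by exists i].
- exact: ideal_of_ideal.
- move=> h; apply: X0; rewrite -['X_i]mulr1; by have [_ _] := ideal_of_ideal [:: P]; apply.
- by move=> f g /E; rewrite throughM => /eqP; rewrite mulf_eq0 => /orP[/eqP/E|/eqP/E]; [left|right].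
Qed.

(** If no point of X lay on p, a product of forms outside p, one through each point, would lie in p. *)
Lemma point_of_ideal X p : is_point p -> included (ideal_of X) p ->
  exists2 P, P \in X & p = ideal_of [:: P].
Proof.
move=> [[[p0 pD pM] p1 pp] ph [i0 pi0]] sub.
have [P [PX Pp]] : exists P, P \in X /\ included (ideal_of [:: P]) p.
  apply: contrapT => none.
  have ex P : P \in X -> exists f, ideal_of [:: P] f /\ ~ p f.
    move=> PX; apply: contrapT => h; apply: none; exists P; split=> // f hf.
    by apply: contrapT => pf; apply: h; exists f.
  have : forall Y, {subset Y <= X} -> exists f, ideal_of Y f /\ ~ p f.
    elim=> [|P Y IH] YX; first by exists 1; split.
    have [f [hf pf]] := ex P (YX P (mem_head P Y)).
    have [|g [hg pg]] := IH; first by move=> P' h; apply: YX; rewrite inE h orbT.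
    exists (f * g); split; last by move=> /pp[].
    apply/ideal_ofE => P'; rewrite inE throughM => /orP[/eqP->|h].
      by move/ideal_ofE: hf => /(_ P (mem_head _ _)) ->; rewrite mul0r.
    by move/ideal_ofE: hg => /(_ P' h) ->; rewrite mulr0.
  by move=> /(_ X (fun _ => id))[f [/sub]].
exists P => //; apply/funext => f; apply/propext; split; last exact: Pp.
move=> pf P'; rewrite inE => /eqP-> d; set c := _.@[_]; have pfd := ph f d pf.
apply/eqP/negPn/negP => c0; case: pi0; have : p ('X_i0 ^+ d).
  have key : p (c *: 'X_i0 ^+ d - (P 0 i0) ^+ d *: pihomog mdeg d f).
    apply: Pp; have hx : ('X_i0 : S) ^+ d \is d.-homog by have := homogXn d (@mpolyX_homog k 4 i0); rewrite muln1.
    have hd : c *: ('X_i0 : S) ^+ d - (P 0 i0) ^+ d *: pihomog mdeg d f \is d.-homog.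
      by rewrite rpredB // rpredZ // pihomogP.
    apply/(ideal_of_homog _ hd).
    move=> P''; rewrite inE => /eqP->; rewrite mevalB !mevalZ rmorphXn /= mevalXU -/c mulrC subrr //.
  have -> : 'X_i0 ^+ d = (c^-1)%:MP * ((c *: 'X_i0 ^+ d - (P 0 i0) ^+ d *: pihomog mdeg d f)
      + ((P 0 i0) ^+ d)%:MP * pihomog mdeg d f).
    by rewrite [((P 0 i0) ^+ d)%:MP * _]mul_mpolyC subrK mul_mpolyC scalerA mulVf // scale1r.
  by apply: (pM); apply: pD => //; apply: (pM).
by elim: (d) => [|e IH]; rewrite ?expr0 // exprS => /pp[].
Qed.

Lemma ideal_of_pt_sub P P' : l.@[P 0] = 1 -> l.@[P' 0] = 1 ->
  included (ideal_of [:: P]) (ideal_of [:: P']) -> ideal_of [:: P'] = ideal_of [:: P].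
Proof.
by move=> lP lP' /(point_of_ideal (ideal_of_point lP'))[Q]; rewrite inE => /eqP->.
Qed.

Lemma ideal_of_dim X : (forall P, P \in X -> l.@[P 0] = 1) -> X != [::] -> has_dim (ideal_of X) 0.
Proof.
move=> lX X0; split.
  case: X X0 lX => // P X _ lX; have PX := mem_head P X.
  exists (fun=> ideal_of [:: P]); split=> // i _; split; first exact/ideal_of_point/lX.
  by move=> f h P'; rewrite inE => /eqP->; exact: h.
move=> [c [cP cS]]; have [p0 s0] := cP 0%N isT; have [p1 s1] := cP 1%N isT.
have [P PX e0] := point_of_ideal p0 s0; have [P' P'X e1] := point_of_ideal p1 s1.
have [s n] := cS 0%N isT; rewrite e0 e1 in s n; apply: n.
by rewrite (ideal_of_pt_sub (lX _ PX) (lX _ P'X) s).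
Qed.

Lemma ideal_of_scheme X : (forall P, P \in X -> l.@[P 0] = 1) -> X != [::] ->
  [/\ is_subscheme (ideal_of X), equidimensional (ideal_of X) 0 & no_embedded_components (ideal_of X)].
Proof.
move=> lX X0; split; first exact: ideal_of_subscheme.
  split; first exact: ideal_of_dim.
  move=> p [pp sub _]; have [P PX ->] := point_of_ideal pp sub.
  by apply: ideal_of_dim => // P'; rewrite inE => /eqP->; exact: lX.
move=> p [pp [f fE]]; have sub : included (ideal_of X) p.
  by move=> g h; apply/fE; rewrite mulrC; have [_ _] := ideal_of_ideal X; apply.
split=> // p' pp' sub' inc; have [P PX e] := point_of_ideal pp sub.
have [P' P'X e'] := point_of_ideal pp' sub'; rewrite e e' in inc *.
by rewrite (ideal_of_pt_sub (lX _ P'X) (lX _ PX) inc).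
Qed.

(** ** The sheaf isomorphisms *)

Lemma basic_homog f : basic f -> f \is (deg f).-homog.
Proof. by move=> [f0 [d _ hf]]; exact: dhomog_msize hf. Qed.
Lemma basic_deg_gt0 f : basic f -> (0 < deg f)%N.
Proof.
by move=> bf; have [f0 [d d0 hf]] := bf; rewrite -(dhomog_uniq f0 hf (basic_homog bf)).
Qed.
Lemma basicM f g : basic f -> basic g -> basic (f * g) /\ deg (f * g) = (deg f + deg g)%N.
Proof.
move=> bf bg; have fg0 : f * g != 0 by rewrite mulf_neq0 //; [case: bf | case: bg].
have h : f * g \is (deg f + deg g).-homog by apply: (homogM (basic_homog bf) (basic_homog bg)).
have bfg : basic (f * g) by split=> //; exists (deg f + deg g)%N => //; rewrite addn_gt0 basic_deg_gt0.
by split=> //; exact: (dhomog_uniq fg0 (basic_homog bfg) h).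
Qed.

Definition homsec f s : Prop := numer s \is (expo s * deg f).-homog.
Definition value f s P : k := (numer s).@[P 0] / f.@[P 0] ^+ expo s.

(** Over a finite set of points sections are determined by their values. *)
Lemma eqvP (M : S -> Prop) X f s t : basic f -> homsec f s -> homsec f t ->
  @Defs.eqv _ _ (quot_sheaf M (ideal_of X)) f s t <->
  forall P, P \in X -> f.@[P 0] != 0 -> value f s P = value f t P.
Proof.
move=> bf hs ht; have hf := basic_homog bf.
have hd : numer s * f ^+ expo t - numer t * f ^+ expo s \is ((expo s + expo t) * deg f)%N.-homog.
  by rewrite rpredB //; [apply: (homogM hs (homogXn (expo t) hf)) | apply: (homogM ht (homogXn (expo s) hf))]; lia.
have hcd c : f ^+ c * (numer s * f ^+ expo t - numer t * f ^+ expo s) \is (c * deg f + (expo s + expo t) * deg f)%N.-homog.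
  by apply: (homogM (homogXn c hf) hd).
rewrite /=; split=> [[c /(ideal_of_homog _ (hcd c)) h] P PX fP|h].
  have := h P PX; rewrite mevalM !rmorphXn /= mevalB !mevalM !rmorphXn /= => /eqP.
  rewrite mulf_eq0 expf_eq0 (negbTE fP) andbF /= subr_eq0 => /eqP e.
  by apply/eqP; rewrite eqr_div ?expf_neq0 // e.
exists 1%N; apply/(ideal_of_homog _ (hcd 1%N)) => P PX; rewrite expr1 mevalM mevalB !mevalM !rmorphXn /=.
have [->|fP] := eqVneq f.@[P 0] 0; first by rewrite mul0r.
apply/eqP; rewrite mulf_eq0 (negbTE fP) /= subr_eq0 -eqr_div ?expf_neq0 //.
exact/eqP/(h P PX fP).
Qed.

Lemma homsec_add (M J : S -> Prop) f s t : basic f -> homsec f s -> homsec f t ->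
  homsec f (@Defs.add _ _ (quot_sheaf M J) f s t).
Proof.
move=> bf hs ht; have hf := basic_homog bf; rewrite /homsec /=.
by rewrite rpredD //; [apply: (homogM hs (homogXn (expo t) hf)) | apply: (homogM ht (homogXn (expo s) hf))]; lia.
Qed.
Lemma homsec_scale (M J : S -> Prop) f a s : homsec f a -> homsec f s -> homsec f (@Defs.scale _ _ (quot_sheaf M J) f a s).
Proof. by move=> ha hs; apply: (homogM ha hs); rewrite mulnDl. Qed.
Lemma homsec_res (M J : S -> Prop) f h s : basic f -> basic h -> homsec f s -> homsec (f * h) (@Defs.res _ _ (quot_sheaf M J) f h s).
Proof.
move=> bf bh hs; rewrite /homsec /= (basicM bf bh).2.
by apply: (homogM hs (homogXn (expo s) (basic_homog bh))); rewrite mulnDr.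
Qed.

Lemma value_add (M J : S -> Prop) f s t P : f.@[P 0] != 0 ->
  value f (@Defs.add _ _ (quot_sheaf M J) f s t) P = value f s P + value f t P.
Proof.
move=> fP; rewrite /value /= mevalD !mevalM !rmorphXn /= exprD.
by field; rewrite !expf_neq0.
Qed.
Lemma value_scale (M J : S -> Prop) f a s P : value f (@Defs.scale _ _ (quot_sheaf M J) f a s) P = value f a P * value f s P.
Proof. by rewrite /value /= mevalM exprD invfM mulrACA. Qed.
Lemma value_res (M J : S -> Prop) f h s P : h.@[P 0] != 0 ->
  value (f * h) (@Defs.res _ _ (quot_sheaf M J) f h s) P = value f s P.
Proof.
move=> hP; rewrite /value /= !mevalM rmorphXn /= exprMn invfM mulrACA divff ?mulr1 //.
exact: expf_neq0.
Qed.

Definition unit_frac : Defs.frac k 3 := Frac 1 0.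
Lemma unit_homsec f : homsec f unit_frac. Proof. by rewrite /homsec /= mul0n dhomog1. Qed.
Lemma value_unit f P : value f unit_frac P = 1. Proof. by rewrite /value /= meval1 expr0 divr1. Qed.

Lemma mevalM_neq0 f g P : ((f * g).@[P 0] != 0) = (f.@[P 0] != 0) && (g.@[P 0] != 0).
Proof. by rewrite mevalM mulf_eq0 negb_or. Qed.

Section Iso.
Variables Z Q : seq pt.
Hypothesis lZQ : forall P, P \in Z ++ Q -> l.@[P 0] = 1.
Hypothesis disj : forall P, P \in Z -> P \notin Q.
Local Notation W := (Z ++ Q).
Local Notation SZ := (structure_sheaf (ideal_of Z)).
Local Notation SW := (structure_sheaf (ideal_of W)).
Local Notation IQ := (ideal_sheaf (ideal_of Q) (ideal_of W)).

(** Multiplication is well defined because the product of the ideals of Z and Q lies in the ideal of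
    their union. *)
Definition mult_by h s : S -> Defs.frac k 3 -> Defs.frac k 3 :=
  fun h' t => @Defs.scale _ _ SW (h * h') (@Defs.res _ _ SW h h' s) t.

Lemma mult_homsec h h' s t : basic h -> basic h' -> homsec h s -> homsec (h * h') t ->
  homsec (h * h') (mult_by h s h' t).
Proof. by move=> bh bh' hs ht; apply: homsec_scale => //; exact: homsec_res. Qed.

Lemma mult_value h h' s t P : h'.@[P 0] != 0 ->
  value (h * h') (mult_by h s h' t) P = value h s P * value (h * h') t P.
Proof. by move=> h'P; rewrite value_scale value_res. Qed.

Lemma value_Q h s P : basic h -> homsec h s -> ideal_of Q (numer s) -> P \in Q -> value h s P = 0.
Proof. by move=> bh hs /(ideal_of_homog _ hs) h0 PQ; rewrite /value h0 // mul0r. Qed.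

Lemma mult_morphism : is_morphism (F := IQ) (G := hom_sheaf SZ SW) 1 mult_by.
Proof.
move=> h bh; rewrite mul1r; split.
- move=> s [sQ hs] h' bh'; have [bhh _] := basicM bh bh'; split.
  + by move=> t [_ ht]; split=> //; exact: mult_homsec.
  + move=> t t' [_ ht] [_ ht'] /(eqvP _ _ bhh ht ht') e.
    apply/eqvP => //; try exact: mult_homsec.
    move=> P PW; rewrite mevalM_neq0 => /andP[hP h'P]; rewrite !mult_value //.
    move: PW; rewrite mem_cat => /orP[PZ|PQ]; first by rewrite e // mevalM_neq0 hP.
    by rewrite (value_Q bh hs sQ PQ) !mul0r.
  + move=> t t' [_ ht] [_ ht']; apply/eqvP => //.
    * by apply: mult_homsec => //; exact: homsec_add.
    * by apply: homsec_add => //; exact: mult_homsec.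
    move=> P _ hh; have := hh; rewrite mevalM_neq0 => /andP[hP h'P].
    by rewrite value_add // !mult_value // value_add // mulrDr.
  + move=> a0 t [_ ha] [_ ht]; apply/eqvP => //.
    * by apply: mult_homsec => //; exact: homsec_scale.
    * by apply: homsec_scale => //; exact: mult_homsec.
    move=> P _; rewrite mevalM_neq0 => /andP[hP h'P].
    by rewrite mult_value // [in RHS]value_scale [in RHS]mult_value // [in LHS]value_scale mulrCA.
  + move=> g t bg [_ ht]; have [bg' _] := basicM bh' bg; have [bhg _] := basicM bhh bg.
    apply/eqvP => //.
    * by rewrite -mulrA; apply: mult_homsec => //; rewrite mulrA; exact: homsec_res.
    * by apply: homsec_res => //; exact: mult_homsec.
    move=> P _; rewrite !mevalM_neq0 => /andP[/andP[hP h'P] gP].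
    rewrite value_res // mult_value // -mulrA mult_value ?mevalM_neq0 ?h'P // mulrA value_res //.
- move=> s s' [_ hs] [_ hs'] /(eqvP _ _ bh hs hs') e h' t bh' [_ ht]; have [bhh _] := basicM bh bh'.
  apply/eqvP => //; try exact: mult_homsec.
  by move=> P PW; rewrite mevalM_neq0 => /andP[hP h'P]; rewrite !mult_value // e.
- move=> s s' [_ hs] [_ hs'] h' t bh' [_ ht]; have [bhh _] := basicM bh bh'; apply/eqvP => //.
  + by apply: mult_homsec => //; exact: homsec_add.
  + by apply: homsec_add => //; exact: mult_homsec.
  move=> P _ hh; have := hh; rewrite mevalM_neq0 => /andP[hP h'P].
  by rewrite value_add // !mult_value // value_add // mulrDl.
- move=> a0 s [_ ha] [_ hs] h' t bh' [_ ht]; have [bhh _] := basicM bh bh'; apply/eqvP => //.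
  + by apply: mult_homsec => //; exact: homsec_scale.
  + by apply: homsec_scale; [exact: homsec_res | exact: mult_homsec].
  move=> P _; rewrite mevalM_neq0 => /andP[hP h'P].
  rewrite mult_value // [in RHS]value_scale [in RHS]mult_value // [in LHS]value_scale.
  by rewrite [in RHS]value_res // mulrA.
- move=> g s bg [_ hs] h' t bh' [_ ht]; have [bhg _] := basicM bh bg; have [bgh _] := basicM bg bh'.
  have [bhgh _] := basicM bhg bh'.
  change (@Defs.eqv _ _ SW (h * g * h') (mult_by (h * g) (@Defs.res _ _ IQ h g s) h' t) (mult_by h s (g * h') t)).
  have hs1 : homsec (h * g * h') (mult_by (h * g) (@Defs.res _ _ IQ h g s) h' t).
    by apply: mult_homsec => //; exact: homsec_res.
  have hs2 : homsec (h * g * h') (mult_by h s (g * h') t).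
    by rewrite -mulrA in ht *; exact: mult_homsec.
  apply/(eqvP _ _ bhgh hs1 hs2) => P _; rewrite !mevalM_neq0 => /andP[/andP[hP gP] h'P].
  rewrite mult_value // value_res // -mulrA mult_value //.
  by rewrite mevalM_neq0 gP.
Qed.

(** For surjectivity, a homomorphism from functions on Z to functions on the union is determined by
    the image u of 1; forms vanishing on Z but not at a point of Q show that u vanishes on Q. *)
Lemma mult_iso : isomorphic_sheaves IQ (hom_sheaf SZ SW).
Proof.
exists mult_by; first exact: mult_morphism.
move=> h bh; have [bhh degh] := basicM bh bh; split.
  move=> s s' [_ hs] [_ hs'] e; apply/(eqvP _ _ bh hs hs') => P PW hP.
  have /(eqvP _ _ bhh) := e h unit_frac bh (conj I (unit_homsec _)).
  move/(_ (mult_homsec bh bh hs (unit_homsec _)) (mult_homsec bh bh hs' (unit_homsec _)) P PW).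
  by rewrite !mult_value // value_unit !mulr1 mevalM_neq0 hP; apply.
move=> Psi mPsi; have [m1 m2 _ m4 m5] := mPsi h bh.
pose u := Psi h unit_frac; have [_ hu] : @is_section _ _ SW (h * h) u by apply: m1; split=> //; exact: unit_homsec.
have uQ P : P \in Q -> h.@[P 0] != 0 -> value (h * h) u P = 0.
  move=> PQ hP; have PZ : P \notin Z by apply/negP => /disj; rewrite PQ.
  have [|g hg [gP gZ]] := @separate _ l Z P _ PZ.
    split=> // P'; rewrite inE => /orP[/eqP->|h']; apply: lZQ; by rewrite mem_cat ?PQ ?h' ?orbT.
  pose al : Defs.frac k 3 := Frac (g ^+ deg (h * h)) (size Z); pose ze : Defs.frac k 3 := Frac 0 0.
  have hal : homsec (h * h) al by rewrite /homsec /= mulnC; exact: homogXn.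
  have hze : homsec (h * h) ze by rewrite /homsec /= rpred0.
  have h1 := unit_homsec (h * h).
  have hsal := homsec_scale (fun=> True) (ideal_of Z) hal h1.
  have hsze := homsec_scale (fun=> True) (ideal_of Z) hze h1.
  have same : @Defs.eqv _ _ SZ (h * h) (@Defs.scale _ _ SZ (h * h) al unit_frac) (@Defs.scale _ _ SZ (h * h) ze unit_frac).
    apply/eqvP => // P' P'Z _; rewrite !value_scale value_unit !mulr1 /value /= rmorphXn /= gZ // meval0.
    by rewrite expr0n (gtn_eqF (basic_deg_gt0 bhh)) !mul0r.
  have hhP : (h * h).@[P 0] != 0 by rewrite mevalM_neq0 hP.
  have PW : P \in W by rewrite mem_cat PQ orbT.
  have [_ s1] := m1 _ (conj I hsal); have [_ s2] := m1 _ (conj I hsze).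
  have e1 := (eqvP _ _ bhh s1 s2).1 (m2 _ _ (conj I hsal) (conj I hsze) same) P PW hhP.
  have e2 := (eqvP _ _ bhh s1 (homsec_scale _ _ hal hu)).1 (m4 al unit_frac (conj I hal) (conj I h1)) P PW hhP.
  have e3 := (eqvP _ _ bhh s2 (homsec_scale _ _ hze hu)).1 (m4 ze unit_frac (conj I hze) (conj I h1)) P PW hhP.
  move: e1; rewrite e2 e3 !value_scale => /eqP; rewrite [X in _ == X](_ : _ = 0).
    rewrite mulf_eq0 => /orP[|/eqP//]; rewrite /value /= rmorphXn /= mulf_eq0 invr_eq0 !expf_eq0.
    by rewrite (negbTE gP) (negbTE hhP) !andbF.
  by rewrite /value /= meval0 !mul0r.
pose s : Defs.frac k 3 := Frac (numer u * h ^+ 2) (2 * expo u + 2).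
have hs : homsec h s.
  by rewrite /homsec /=; apply: (homogM hu (homogXn 2 (basic_homog bh))); rewrite degh; lia.
have sE P : h.@[P 0] != 0 -> value h s P = value (h * h) u P.
  move=> hP; rewrite /value.
  have -> : (numer s).@[P 0] = (numer u).@[P 0] * h.@[P 0] ^+ 2 by rewrite [LHS]mevalM rmorphXn.
  have -> : (h * h).@[P 0] = h.@[P 0] ^+ 2 by rewrite mevalM expr2.
  rewrite [expo s]/(2 * expo u + 2)%N -exprM exprD invfM mulrACA divff ?mulr1 //.
  exact: expf_neq0.
exists s.
  split=> //; apply/(ideal_of_homog _ hs) => P PQ; rewrite [LHS]mevalM rmorphXn /=.
  have [->|hP] := eqVneq h.@[P 0] 0; first by rewrite expr0n mulr0.
  have /eqP := uQ P PQ hP; rewrite /value mulf_eq0 invr_eq0 expf_eq0 mevalM mulf_eq0 (negbTE hP) andbF orbF.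
  by move=> /eqP->; rewrite mul0r.
move=> h' t bh' [_ ht]; have [bhh' _] := basicM bh bh'; have [n1 n2 _ n4 n5] := mPsi h' bh'.
have h1 := unit_homsec (h * h').
have [_ hv] := n1 _ (conj I h1); have [_ hw] := n1 _ (conj I ht).
have tE : @Defs.scale _ _ SZ (h * h') t unit_frac = t by case: (t) => nt et; rewrite /= mulr1 addn0.
apply/eqvP => //; first exact: mult_homsec.
move=> P PW hh'P; have := hh'P; rewrite mevalM_neq0 => /andP[hP h'P].
have e4 := n4 t unit_frac (conj I ht) (conj I h1); rewrite tE in e4.
have := (eqvP _ _ bhh' hw (homsec_scale _ _ ht hv)).1 e4 P PW hh'P; rewrite value_scale => ->.
rewrite mult_value // sE // mulrC; congr (_ * _).
have [bhhh _] := basicM bhh bh'; have bhhh2 := (basicM bhh' bh).1.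
have r1 : @Defs.res _ _ SZ (h * h) h' unit_frac = unit_frac by rewrite /= expr0 mulr1.
have r2 : @Defs.res _ _ SZ (h * h') h unit_frac = unit_frac by rewrite /= expr0 mulr1.
have q1 := m5 h' unit_frac bh' (conj I (unit_homsec _)); rewrite r1 in q1.
have q2 := n5 h unit_frac bh (conj I h1); rewrite r2 in q2.
have [k1 _ _ _ _] := mPsi (h * h') bhh'; have [_ hk1] := k1 _ (conj I (unit_homsec _)).
rewrite mulrA in hk1; rewrite [h' * h]mulrC mulrAC in q2.
have hhhP : (h * h * h').@[P 0] != 0 by rewrite !mevalM_neq0 hP h'P.
have := (eqvP _ _ bhhh hk1 (homsec_res _ _ bhh bh' hu)).1 q1 P PW hhhP; rewrite value_res // => <-.
have hv2 := homsec_res (fun=> True) (ideal_of W) bhh' bh hv; rewrite mulrAC in hv2.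
have -> := (eqvP _ _ bhhh hk1 hv2).1 q2 P PW hhhP.
by rewrite [h * h * h']mulrAC value_res.
Qed.

End Iso.

Theorem complementary_points_linked Z Q : uniq (Z ++ Q) -> normalized l (Z ++ Q) ->
  Z != [::] -> Q != [::] -> arithmetically_gorenstein (ideal_of (Z ++ Q)) ->
  g_linked (ideal_of Z) (ideal_of Q).
Proof.
move=> uZQ [_ lZQ] Z0 Q0 ag.
have subZ P : P \in Z -> P \in Z ++ Q by rewrite mem_cat => ->.
have subQ P : P \in Q -> P \in Z ++ Q by rewrite mem_cat orbC => ->.
have disj P : P \in Z -> P \notin Q.
  by move: uZQ; rewrite cat_uniq => /and3P[_ /hasPn h _] PZ; apply/negP => /h/negP.
have W0 : Z ++ Q != [::] by case: (Z) Z0.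
exists 0%N; split; first by apply: ideal_of_scheme => // P /subZ/lZQ.
split; first by apply: ideal_of_scheme => // P /subQ/lZQ.
exists (ideal_of (Z ++ Q)); split; first by split=> //; [exact: ideal_of_subscheme | exact: ideal_of_dim].
split.
- by move=> f h P /subZ; exact: h.
- by move=> f h P /subQ; exact: h.
- exact: mult_iso.
have -> : ideal_of (Z ++ Q) = ideal_of (Q ++ Z).
  by apply/funext => f; apply/propext; split=> h P PW; apply: h; rewrite mem_cat orbC -mem_cat.
apply: mult_iso; first by move=> P; rewrite mem_cat orbC -mem_cat; exact: lZQ.
by move=> P PQ; apply/negP => /disj; rewrite PQ.
Qed.

End Linking.

(** * Linkability is a constructible condition *)

Section ConstructibleLinks.
Variables (k : closedFieldType) (F l : {mpoly k[4]}).
Hypothesis hl : l \is 1.-homog.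
Local Notation S := {mpoly k[4]}.
Local Notation pt := 'rV[k]_4.
Implicit Types (f g : S).
Local Notation Mon d := 'X_{1..4 < d.+1}.

(** Quantification over forms becomes quantification over coefficients. *)
Definition hform d (w : Mon d -> k) : S := \sum_(m : Mon d | mdeg m == d) w m *: 'X_[m].

Lemma hform_homog d w : @hform d w \is d.-homog.
Proof. by rewrite rpred_sum // => m md; rewrite rpredZ // dhomogX. Qed.

Lemma hform_surj d f : f \is d.-homog -> exists w : Mon d -> k, f = hform w.
Proof.
move=> hf; exists (fun m => f@_m); rewrite -{1}(pihomog_dE hf).
exact/pihomogwE/homog_msize_le.
Qed.

Lemma hform_polyfun (I : Type) d (w : Mon d -> (I -> k) -> k) (y : 'I_4 -> (I -> k) -> k) :
  (forall m, polyfun (w m)) -> (forall i, polyfun (y i)) ->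
  polyfun (fun u => (hform (fun m => w m u)).@[fun i => y i u]).
Proof.
move=> pw py; apply: (@polyfun_ext _ _ (fun u => \sum_(m : Mon d | mdeg m == d) w m u * \prod_i y i u ^+ m i)).
  move=> u; rewrite /hform (big_morph _ (mevalD _) (meval0 _)); apply: eq_bigr => m _.
  by rewrite mevalZ mevalX.
apply: polyfun_sum => m; apply: polyfun_mul => //; apply: polyfun_prod => i; exact: polyfun_exp.
Qed.

Section Config.
Variables (T : finType) (sg : nat).
Implicit Types (y : T * 'I_4 -> k).

(** The weights condition as a first-order formula in y: from degree sg + 1 on it repeats itself, as
    multiplication by powers of l shows, so finitely many degrees suffice. *)
Definition dual_weights y : Prop := exists c : T -> k,
  (forall w : Mon sg -> k, \sum_t c t * (hform w).@[pnt y t] = 0) /\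
  forall e : 'I_sg.+2, forall v : T -> k,
    (forall j : 'I_sg.+1, (j + e = sg)%N -> forall w : Mon j -> k, \sum_t v t * (hform w).@[pnt y t] = 0) ->
    exists w : Mon e -> k, forall t, v t - c t * (hform w).@[pnt y t] = 0.

Definition linked_config y : Prop :=
  [/\ forall t, l.@[pnt y t] - 1 = 0, forall t t', t = t' \/ exists i, y (t, i) - y (t', i) != 0,
      forall t, F.@[pnt y t] = 0 & dual_weights y].

Lemma dual_weights_constr : constructible dual_weights.
Proof.
have pv (I : Type) (i : I) : polyfun (fun u : I -> k => u i) by exact: polyfun_var.
apply: constr_ex; apply: constr_and.
  apply: constr_all; apply: constr_eq; apply: polyfun_sum => t; apply: polyfun_mul => //.
  exact: (@hform_polyfun _ sg (fun m u => u (inr m)) (fun i u => u (inl (inl (t, i))))).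
apply: constr_forall => e; apply: constr_all; apply: constr_imp.
  apply: constr_forall => j; apply: constr_imp; first exact: constr_const.
  apply: constr_all; apply: constr_eq; apply: polyfun_sum => t; apply: polyfun_mul => //.
  exact: (@hform_polyfun _ j (fun m u => u (inr m)) (fun i u => u (inl (inl (inl (t, i)))))).
apply: constr_ex; apply: constr_forall => t; apply: constr_eq; apply: polyfun_sub => //.
apply: polyfun_mul => //.
exact: (@hform_polyfun _ e (fun m u => u (inr m)) (fun i u => u (inl (inl (inl (t, i)))))).
Qed.

Lemma linked_config_constr : constructible linked_config.
Proof.
apply: (@constr_ext _ _ (fun y => (forall t, l.@[pnt y t] - 1 = 0) /\
   ((forall t, forall t', t = t' \/ ~ forall i, y (t, i) - y (t', i) = 0) /\
   ((forall t, F.@[pnt y t] = 0) /\ dual_weights y)))).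
  move=> y; split=> [[h1 [h2 [h3 h4]]]|[h1 h2 h3 h4]]; split=> //.
    move=> t t'; case: (h2 t t') => [->|h]; [by left | right].
    apply: contrapT => none; apply: h => i; apply/eqP/negPn/negP => n; apply: none; by exists i.
  split=> //; move=> t t'; case: (h2 t t') => [->|[i n]]; [by left | right => h]; by rewrite h eqxx in n.
have pm f t : polyfun (fun y => f.@[pnt y t]) by apply: polyfun_meval => i; exact: polyfun_var.
apply: constr_and; first by apply: constr_forall => t; apply: constr_eq; apply: polyfun_sub => //; exact: polyfun_const.
apply: constr_and.
  apply: constr_forall => t; apply: constr_forall => t'; apply: constr_or; first exact: constr_const.
  apply: constr_not; apply: constr_forall => i; apply: constr_eq; apply: polyfun_sub; exact: polyfun_var.
apply: constr_and; last exact: dual_weights_constr.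
by apply: constr_forall => t; apply: constr_eq.
Qed.

Definition cpoint y t : pt := \row_i y (t, i).

Lemma cpointE y t : cpoint y t 0 = pnt y t.
Proof. by apply/funext => i; rewrite mxE. Qed.

Lemma cpoint_inj y : linked_config y -> injective (cpoint y).
Proof.
move=> [_ h _ _] t t' /rowP e; case: (h t t') => // -[i]; have := e i; rewrite !mxE => ->.
by rewrite subrr eqxx.
Qed.

Lemma linked_config_gorenstein y : (0 < #|T|)%N -> linked_config y ->
  arithmetically_gorenstein (fun f => forall t d, (pihomog mdeg d f).@[cpoint y t 0] = 0).
Proof.
move=> T0 lk; have inj := cpoint_inj lk; have [ly _ _ [c [c1 c2]]] := lk.
have ly1 t : l.@[pnt y t] = 1 by apply/eqP; rewrite -subr_eq0 ly.
have NE : #|T|.-1.+1 = #|T| by rewrite prednK.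
pose phi (i : 'I_#|T|.-1.+1) : T := enum_val (cast_ord NE i).
pose psi (t : T) : 'I_#|T|.-1.+1 := cast_ord (esym NE) (enum_rank t).
have phiK : cancel phi psi by move=> i; rewrite /psi /phi enum_valK cast_ordK.
have psiK : cancel psi phi by move=> t; rewrite /psi /phi cast_ordKV enum_rankK.
have bij : bijective phi by exists psi.
have sumE (G : T -> k) : \sum_t G t = \sum_i G (phi i) by rewrite (reindex phi) //; exact: onW_bij.
have c0 t : c t != 0.
  have [|w /(_ t)] := c2 ord_max (fun t' => (t' == t)%:R).
    by move=> j /= e; exfalso; move: e; have := ltn_ord j; lia.
  by rewrite eqxx => /eqP; rewrite subr_eq0; apply: contraTneq => ->; rewrite mul0r oner_eq0.
have low e v : (e <= sg.+1)%N ->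
    (forall j f, (j + e = sg)%N -> f \is j.-homog -> \sum_t v t * f.@[pnt y t] = 0) ->
    exists2 g, g \is e.-homog & forall t, v t = c t * g.@[pnt y t].
  move=> le h; have [|w wE] := c2 (Ordinal (le : (e < sg.+2)%N)) v.
    by move=> j e' w; apply: h e' _; exact: hform_homog.
  by exists (hform w) => [|t]; [exact: hform_homog | apply/eqP; rewrite -subr_eq0 wE].
apply: (@points_arithmetically_gorenstein k #|T|.-1 (fun i => cpoint y (phi i)) l hl _ _ sg (fun i => c (phi i))).
- by move=> i; rewrite cpointE.
- by move=> i j /inj /(bij_inj bij).
- move=> f /hform_surj[w ->]; rewrite -[RHS](c1 w) sumE; apply: eq_bigr => i _; by rewrite cpointE.
- move=> e u h.
  have h' j f : (j + e = sg)%N -> f \is j.-homog -> \sum_t u (psi t) * f.@[pnt y t] = 0.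
    by move=> je hf; rewrite -[RHS](h j f je hf) sumE; apply: eq_bigr => i _; rewrite phiK cpointE.
  case: (leqP e sg.+1) => le.
    have [g hg gE] := low e (fun t => u (psi t)) le h'; exists g => // i.
    by rewrite cpointE -gE phiK.
  have [|g hg gE] := low sg.+1 (fun t => u (psi t)) (leqnn _).
    by move=> j f e'; exfalso; move: e'; lia.
  exists (l ^+ (e - sg.+1) * g) => [|i]; first by apply: (homogM (homogX _ hl) hg); rewrite subnK // ltnW.
  by rewrite cpointE mevalM rmorphXn /= ly1 expr1n mul1r -gE phiK.
- by [].
- by move=> f; split=> h i d; [exact: h | rewrite -(psiK i); exact: h].
Qed.

End Config.

Section TwoConfigs.
Variables (a b sg : nat).

Definition join_config (u : 'I_a * 'I_4 -> k) (w : 'I_b * 'I_4 -> k) (ti : ('I_a + 'I_b) * 'I_4) : k :=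
  match ti.1 with inl j => u (j, ti.2) | inr j => w (j, ti.2) end.

Definition points_of n (v : 'I_n * 'I_4 -> k) : seq pt := [seq cpoint v j | j <- enum 'I_n].

Lemma points_ofP n (v : 'I_n * 'I_4 -> k) P : reflect (exists j, P = cpoint v j) (P \in points_of v).
Proof.
by apply: (iffP mapP) => [[j _ ->]|[j ->]]; exists j => //; rewrite mem_enum.
Qed.

Lemma linked_config_linked u w : (0 < a)%N -> (0 < b)%N -> linked_config sg (join_config u w) ->
  g_linked (ideal_of (points_of u)) (ideal_of (points_of w)).
Proof.
move=> a0 b0 lk; pose y := join_config u w; have inj := cpoint_inj lk.
have eu j : cpoint u j = cpoint y (inl j) by apply/rowP => i; rewrite !mxE.
have ew j : cpoint w j = cpoint y (inr j) by apply/rowP => i; rewrite !mxE.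
have memE P : P \in points_of u ++ points_of w <-> exists t, P = cpoint y t.
  rewrite mem_cat; split; first by case/orP => /points_ofP[j ->]; [exists (inl j) | exists (inr j)].
  case=> -[j|j] ->; apply/orP; [left | right]; apply/points_ofP; by exists j.
apply: (complementary_points_linked hl).
- have uu : uniq (points_of u) by rewrite map_inj_uniq ?enum_uniq // => i j; rewrite !eu => /inj[].
  have uw : uniq (points_of w) by rewrite map_inj_uniq ?enum_uniq // => i j; rewrite !ew => /inj[].
  rewrite cat_uniq uu uw andbT /=; apply/hasPn => P /points_ofP[j ->]; apply/negP => /points_ofP[i].
  by rewrite eu ew => /inj.
- split=> // P /memE[t ->]; have [h _ _ _] := lk; apply/eqP; rewrite cpointE -subr_eq0; exact/eqP/h.
- by rewrite -size_eq0 size_map size_enum_ord -lt0n.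
- by rewrite -size_eq0 size_map size_enum_ord -lt0n.
have -> : ideal_of (points_of u ++ points_of w) = fun f => forall t d, (pihomog mdeg d f).@[cpoint y t 0] = 0.
  apply/funext => f; apply/propext; split=> [h t|h P /memE[t ->]]; last exact: h.
  by apply: h; apply/memE; exists t.
apply: linked_config_gorenstein lk; rewrite card_sum card_ord; lia.
Qed.

Lemma linkable_linked_config (Z : seq pt) (Q : 'I_b -> pt) : size Z = a ->
  linkable F l sg Z [seq Q j | j <- enum 'I_b] ->
  linked_config sg (join_config (fun ji => (nth 0 Z ji.1) 0 ji.2) (fun ji => (Q ji.1) 0 ji.2)).
Proof.
move=> sZ [uZQ [_ lZQ] FZQ [c [c1 c2]]]; set y := join_config _ _.
pose P (t : 'I_a + 'I_b) : pt := match t with inl j => nth 0 Z j | inr j => Q j end.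
have pE t : pnt y t = P t 0 by case: t.
have PW t : P t \in Z ++ [seq Q j | j <- enum 'I_b].
  rewrite mem_cat; case: t => j /=; first by rewrite mem_nth // sZ.
  by rewrite map_f ?mem_enum ?orbT.
have inj : injective P.
  move: uZQ; rewrite cat_uniq => /and3P[uZ /hasPn dis uQ].
  have QZ i j : nth 0 Z i <> Q j \/ (size Z <= i)%N.
    case: (ltnP i (size Z)) => lt; [left => e | by right].
    by have /dis/negP := map_f Q (mem_enum 'I_b j); apply; rewrite /= -e mem_nth.
  move=> [i|i] [j|j] /= e.
  - have lt (i' : 'I_a) : (i' < size Z)%N by rewrite sZ.
    by congr inl; apply: val_inj; have := nth_uniq 0 (lt i) (lt j) uZ; rewrite e eqxx => /esym/eqP.
  - by case: (QZ i j) => // ; rewrite sZ leqNgt ltn_ord.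
  - by case: (QZ j i) => [/(_ (esym e))//|]; rewrite sZ leqNgt ltn_ord.
  - by congr inr; apply: (elimT (injectiveP Q) uQ).
have sumE (G : pt -> k) : \sum_(R <- Z ++ [seq Q j | j <- enum 'I_b]) G R = \sum_t G (P t).
  by rewrite big_cat big_sumType /= (big_nth 0) big_mkord sZ big_map big_enum.
split.
- by move=> t; rewrite pE lZQ // subrr.
- move=> t t'; have [->|n] := eqVneq t t'; [by left | right].
  apply: contrapT => none; case/eqP: n; apply: inj; apply/rowP => i.
  rewrite -!pE; apply/eqP; rewrite -subr_eq0; apply/negPn/negP => h; by apply: none; exists i.
- by move=> t; rewrite pE FZQ.
exists (fun t => c (P t)); split.
  move=> w; rewrite -[RHS](c1 _ (hform_homog w)) sumE; apply: eq_bigr => t _; by rewrite pE.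
move=> e v h; pose vv R := if [pick t | P t == R] is Some t then v t else 0.
have vvE t : vv (P t) = v t.
  by rewrite /vv; case: pickP => [t' /eqP/inj->//|/(_ t)]; rewrite eqxx.
have [|g hg gE] := c2 e vv.
  move=> j f je /hform_surj[w ->]; have jl : (j < sg.+1)%N by lia.
  rewrite -[RHS](h (Ordinal jl) je w) sumE; apply: eq_bigr => t _; by rewrite vvE pE.
have [w gw] := hform_surj hg; exists w => t.
by rewrite -gw pE -vvE gE ?subrr.
Qed.

End TwoConfigs.
End ConstructibleLinks.

(** * Single points *)

Section OnePoint.
Variables (k : closedFieldType) (l : {mpoly k[4]}).
Hypothesis hl : l \is 1.-homog.
Local Notation S := {mpoly k[4]}.
Local Notation pt := 'rV[k]_4.
Implicit Types (f g : S).

(** Modulo the linear forms vanishing at P, f is its restriction to the line through P, which is 0. *)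
Lemma point_complete_intersection (P : pt) : l.@[P 0] = 1 ->
  @complete_intersection k 3 (ideal_of [:: P]).
Proof.
move=> lP; have lX P' : P' \in [:: P] -> l.@[P' 0] = 1 by rewrite inE => /eqP->.
split; first exact: (ideal_of_subscheme hl lX).
have [i0 Pi0] := normalized_coord hl lP.
pose x (j : 'I_3) : S := 'X_(lift i0 j) - (P 0 (lift i0 j) / P 0 i0) *: 'X_i0.
have hx j : x j \is 1.-homog by rewrite rpredB ?rpredZ // mpolyX_homog.
pose s := [seq x j | j <- enum 'I_3].
have ss : size s = 3 by rewrite size_map size_enum_ord.
have sE (j : 'I_3) : s`_j = x j by rewrite (nth_map j) ?size_enum_ord // nth_ord_enum.
have genE f : gen_ideal s f <-> exists c : 'I_3 -> S, f = \sum_j c j * x j.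
  rewrite /gen_ideal; split=> [[c ->]|[c ->]].
    exists (fun j => c (cast_ord (esym ss) j)).
    rewrite (reindex (cast_ord (esym ss))) /=; last by exists (cast_ord ss) => ? _; rewrite ?cast_ordK ?cast_ordKV.
    by apply: eq_bigr => j _; rewrite -sE.
  exists (fun j => c (cast_ord ss j)).
  rewrite (reindex (cast_ord ss)) /=; last by exists (cast_ord (esym ss)) => ? _; rewrite ?cast_ordK ?cast_ordKV.
  by apply: eq_bigr => j _; rewrite -sE.
exists s, 0%N; split=> //.
- by move=> f /mapP[j _ ->]; exists 1%N.
- move=> f; rewrite genE; split=> [hf|[c ->]]; last first.
    have [I0 ID IM] := ideal_of_ideal [:: P].
    apply: (big_ind (ideal_of [:: P])) => // j _; apply: IM; apply/(ideal_of_homog _ (hx j)) => P'.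
    rewrite inE => /eqP->; rewrite mevalB mevalZ !mevalXU divfK // subrr //.
  pose phi g : S := mmap (@mpolyC 4 k) (fun j => (P 0 j / P 0 i0) *: 'X_i0) g.
  pose R g := exists c : 'I_3 -> S, g - phi g = \sum_j c j * x j.
  have phiM g h : phi (g * h) = phi g * phi h by exact: rmorphM.
  have phiD g h : phi (g + h) = phi g + phi h by exact: rmorphD.
  have RD g h : R g -> R h -> R (g + h).
    move=> [c e] [d e']; exists (fun j => c j + d j); rewrite phiD opprD addrACA e e' -big_split.
    by apply: eq_bigr => j _; rewrite mulrDl.
  have RM g h : R g -> R h -> R (g * h).
    move=> [c e] [d e']; exists (fun j => h * c j + phi g * d j).
    have -> : g * h - phi (g * h) = h * (g - phi g) + phi g * (h - phi h) by rewrite phiM; ring.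
    rewrite e e' !mulr_sumr -big_split; apply: eq_bigr => j _ /=; ring.
  have RC c : R c%:MP by exists (fun=> 0); rewrite /phi mmapC subrr big1 // => j _; rewrite mul0r.
  have RX j : R 'X_j.
    have phiX : phi 'X_j = (P 0 j / P 0 i0) *: 'X_i0 by rewrite /phi mmapX mmap1U.
    rewrite /R phiX; case: (unliftP i0 j) => [j' ->|->].
      exists (fun j1 => (j1 == j')%:R); rewrite (bigD1 j') //= eqxx mul1r big1 ?addr0 // => j1 /negbTE->.
      by rewrite mul0r.
    by exists (fun=> 0); rewrite divff // scale1r subrr big1 // => j1 _; rewrite mul0r.
  have RM2 := RM.
  have [c fE] : R f.
    rewrite (mpolyE f); apply: (big_ind R) => [|f1 f2|m _]; first by rewrite -mpolyC0.
      exact: RD.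
    rewrite -mul_mpolyC; apply: RM => //; rewrite mpolyXE_id; apply: (big_ind R) => [|f1 f2|i _].
    - by rewrite -mpolyC1.
    - exact: RM2.
    - by elim: (m i) => [|j IH]; rewrite ?expr0 -?mpolyC1 // exprS; apply: RM2.
  exists c; rewrite -fE; suff -> : phi f = 0 by rewrite subr0.
  apply/eqP/negPn/negP => /mpoly_nonroot[u]; apply/negP; rewrite negbK.
  have -> : (phi f).@[u] = f.@[fun j => 0 + P 0 j * (u i0 / P 0 i0)].
    rewrite rmorph_mmap; apply: eq_mmap => [c1|j] /=; rewrite ?mevalC // mevalZ mevalXU; ring.
  move/ideal_ofE: hf => /(_ P (mem_head _ _)) h.
  by rewrite -horner_line -/(through P f) h horner0.
- exact: (ideal_of_dim hl lX).
Qed.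

Lemma point_glicci (P : pt) : l.@[P 0] = 1 -> @glicci k 3 (ideal_of [:: P]).
Proof.
by move=> /point_complete_intersection h; exists (ideal_of [:: P]) => //; exact: rst_refl.
Qed.

End OnePoint.

(** * Induction on the number of points *)

Section Induction.
Variables (k : closedFieldType) (F : {mpoly k[4]}).
Hypothesis hF : smooth_cubic_surface F.
Variable l : {mpoly k[4]}.
Hypothesis hl : l \is 1.-homog.
Local Notation S := {mpoly k[4]}.
Local Notation pt := 'rV[k]_4.
Local Notation config n := ('I_n * 'I_4 -> k).

Definition rescale n (c : 'I_n -> k) (v : config n) : config n := fun ji => c ji.1 * v ji.

Lemma cpoint_rescale n c (v : config n) j : cpoint (rescale c v) j = c j *: cpoint v j.
Proof. by apply/rowP => i; rewrite !mxE. Qed.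

Lemma ideal_of_rescale n c (v : config n) : (forall j, c j != 0) ->
  ideal_of (points_of (rescale c v)) = ideal_of (points_of v).
Proof.
move=> c0; apply/funext => f; apply/propext.
have E j d : (pihomog mdeg d f).@[cpoint (rescale c v) j 0] = c j ^+ d * (pihomog mdeg d f).@[cpoint v j 0].
  rewrite -(meval_homog _ _ (pihomogP mdeg d f)); apply: meval_eq => i; by rewrite !mxE.
split=> h P /points_ofP[j ->] d; last by rewrite E h ?mulr0 //; apply/points_ofP; exists j.
apply: (mulfI (expf_neq0 d (c0 j))); rewrite mulr0 -E; apply: h; apply/points_ofP; by exists j.
Qed.

Lemma linear_at0 u : (forall i, u i = 0) -> l.@[u] = 0.
Proof.
move=> u0; rewrite (_ : l.@[u] = l.@[fun i => 0 * u i]); first by rewrite (meval_homog _ _ hl) expr1 mul0r.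
by apply: meval_eq => i; rewrite u0 mul0r.
Qed.

Definition distinct_config n (v : config n) : Prop := (forall j, cpoint v j != 0) /\
  forall i j, i != j -> forall c : k, cpoint v i <> c *: cpoint v j.

Definition good_config n (v : config n) : Prop :=
  distinct_config v /\ @glicci k 3 (ideal_of (points_of v)).

Definition general_glicci n : Prop := exists D : config n -> Prop,
  [/\ constructible D, forall c v, (forall j, c j != 0) -> D v -> D (rescale c v),
      generically (@on_cubic k F 'I_n) D & forall v, D v -> good_config v].

Section Step.
Variables (a n n' sg : nat) (D : config n -> Prop).
Local Notation linked b := (@linked_config k F l ('I_a + 'I_b)%type sg).

(** Two links through a common residual set. *)
Definition step_config (v : config n') : Prop := exists u : config a, exists w : config n, exists c : 'I_n' -> k,
  D w /\ (linked n (join_config u w) /\ ((forall j, c j <> 0) /\ linked n' (join_config u (rescale c v)))).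

Lemma step_constr : constructible D -> constructible step_config.
Proof.
move=> cD; apply: constr_ex; apply: constr_ex; apply: constr_ex; apply: constr_and.
  by apply: (constr_comp (g := fun s U => U (inl (inr s))) _ cD) => s; exact: polyfun_var.
apply: constr_and.
  apply: (constr_comp (g := fun ti U => join_config (fun s => U (inl (inl (inr s)))) (fun s => U (inl (inr s))) ti)
    _ (linked_config_constr F l _ sg)).
  by move=> [[j|j] i]; exact: polyfun_var.
apply: constr_and; first by apply: constr_forall => j; apply/constr_not/constr_eq; exact: polyfun_var.
apply: (constr_comp (g := fun ti U => join_config (fun s => U (inl (inl (inr s))))
   (rescale (fun j => U (inr j)) (fun s => U (inl (inl (inl s))))) ti) _ (linked_config_constr F l _ sg)).
move=> [[j|j] i]; first exact: polyfun_var.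
by apply: polyfun_mul; exact: polyfun_var.
Qed.

Lemma step_rescale c v : (forall j, c j != 0) -> step_config v -> step_config (rescale c v).
Proof.
move=> c0 [u [w [d [Dw [l1 [d0 l2]]]]]]; exists u, w, (fun j => d j / c j); split=> //; split=> //; split.
  by move=> j /eqP; rewrite mulf_eq0 invr_eq0 (negbTE (c0 j)) orbF => /eqP; exact: d0.
suff -> : rescale (fun j => d j / c j) (rescale c v) = rescale d v by [].
by apply/funext => -[j i]; rewrite /rescale /= mulrA divfK.
Qed.

Lemma step_good v : (0 < a)%N -> (0 < n)%N -> (0 < n')%N -> (forall w, D w -> good_config w) ->
  step_config v -> good_config v.
Proof.
move=> a0 n0 n0' hD [u [w [c [Dw [l1 [c0' l2]]]]]].
have c0 j : c j != 0 by exact/eqP/c0'.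
have e j : cpoint (join_config u (rescale c v)) (inr j) = c j *: cpoint v j.
  by apply/rowP => i; rewrite !mxE.
have inj := cpoint_inj l2; have [lv _ _ _] := l2.
have lv1 j : l.@[(c j *: cpoint v j) 0] = 1.
  by apply/eqP; rewrite -e cpointE -subr_eq0; exact/eqP/lv.
have lvE j : c j * l.@[cpoint v j 0] = 1.
  have := meval_homog (c j) (cpoint v j 0) hl; rewrite expr1 => <-.
  by rewrite -[RHS](lv1 j); apply: meval_eq => i; rewrite !mxE.
split.
  split=> [j|i j ij c1 E].
    apply/eqP => v0; have := lvE j; rewrite v0 linear_at0 ?mulr0; last by move=> i; rewrite mxE.
    by move/esym/eqP; rewrite oner_eq0.
  have : c i *: cpoint v i = c j *: cpoint v j.
    have h : l.@[cpoint v i 0] = c1 * l.@[cpoint v j 0].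
      have := meval_homog c1 (cpoint v j 0) hl; rewrite expr1 => <-.
      by apply: meval_eq => s; rewrite E mxE.
    rewrite E scalerA; congr (_ *: _); apply: (@mulIf _ l.@[cpoint v j 0]).
      by apply: contra_eq_neq (lvE j) => ->; rewrite mulr0 eq_sym oner_neq0.
    by rewrite -mulrA -h !lvE.
  by rewrite -!e => /inj[/eqP]; rewrite (negbTE ij).
have [_ [C CI liC]] := hD w Dw; exists C => //.
rewrite -(ideal_of_rescale v c0); apply: (rst_trans _ _ _ (ideal_of (points_of u))).
  by apply: rst_sym; apply: rst_step; exact: (linked_config_linked hl a0 n0' l2).
by apply: rst_trans liC; apply: rst_step; exact: (linked_config_linked hl a0 n0 l1).
Qed.

End Step.

Section NearPoints.
Variables (q m e n : nat).
Hypotheses (q0 : (0 < q)%N) (m0 : (0 < m)%N) (n0 : (0 < n)%N) (na : (n < 3 * q * m)%N).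
Hypothesis near : generically (@on_cubic k F 'I_(n + e)) (@nearable _ F l q m e n).
Let irr b := @on_cubic_irreducible k F hF 'I_b.
Let sg := (q + m).-1.
Let a := (3 * q * m - n)%N.
Let a0 : (0 < a)%N. Proof. by rewrite /a; lia. Qed.

Definition left_config (v : config (n + e)) : config n := fun ji => v (lshift e ji.1, ji.2).

Let left_polyfun f : polyfun f -> polyfun (fun v : config (n + e) => f (left_config v)).
Proof. by move=> pf; apply: (polyfun_comp pf) => j; exact: polyfun_var. Qed.

Let left_generic (D : config n -> Prop) : generically (@on_cubic k F 'I_n) D ->
  generically (@on_cubic k F 'I_(n + e)) (fun v => D (left_config v)).
Proof.
move=> [f [pf [w wF fw] hf]]; have [v vF _] := generically_ex near.
exists (fun v => f (left_config v)); split; first exact: left_polyfun.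
  exists (fun ji => match split ji.1 with inl i => w (i, ji.2) | inr _ => v ji end).
    by move=> j /=; case: (split j) => i; [exact: wF | exact: vF].
  rewrite (_ : left_config _ = w) //; apply/funext => -[j i] /=; rewrite /left_config /=.
  by case: splitP => [j' e'|j' e']; [congr (w (_, _)); apply: val_inj | have := ltn_ord j; rewrite /= in e'; lia].
by move=> v' v'F; apply: hf => j; exact: (v'F (lshift e j)).
Qed.

Let scaled v (x : config (n + e)) : config (n + e) := fun ji => l.@[pnt v ji.1] * x ji.

Let scaled_polyfun v f : polyfun f -> polyfun (fun x => f (scaled v x)).
Proof.
by move=> pf; apply: (polyfun_comp pf) => j; apply: polyfun_mul; [exact: polyfun_const | exact: polyfun_var].
Qed.

Let scaled_nrm v : (forall j, l.@[pnt v j] != 0) -> scaled v (fun ji => nrm l v ji.1 0 ji.2) = v.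
Proof. by move=> lv; apply/funext => -[j i]; rewrite /scaled /nrm !mxE /= mulVKf. Qed.

Let scaled_on_cubic v (Q : 'I_(n + e) -> pt) Z : linkable F l sg Z [seq Q j | j <- enum 'I_(n + e)] ->
  on_cubic F (scaled v (fun ji => (Q ji.1) 0 ji.2)).
Proof.
move=> [_ _ FZ _] j; rewrite [LHS](meval_homog l.@[pnt v j] (Q j 0) (cubic_homog hF)) FZ ?mulr0 //.
by rewrite mem_cat map_f ?mem_enum ?orbT.
Qed.

(** Links lead from the n first points of a nearable configuration to sets dense among those of n + e
    points. *)
Lemma general_up : general_glicci n -> general_glicci (n + e).
Proof.
move=> [D [cD sD gD goodD]]; exists (@step_config a n (n + e) sg D); split.
- exact: step_constr.
- exact: step_rescale.
- apply: (generically_dense (@irr _)); last 1 first.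
  + move=> f pf f0.
    have gf : generically (@on_cubic k F 'I_(n + e)) (fun v => f v != 0) by exists f.
    have [v vF [[[lv [Z [sZ L1 L2]]] Dv] fv]] :=
      generically_ex (generically_and (@irr _) (generically_and (@irr _) near (left_generic gD)) gf).
    have [|Q hQ L3] := L2 _ (scaled_polyfun v pf); first by rewrite scaled_nrm.
    exists (scaled v (fun ji => (Q ji.1) 0 ji.2)); split=> //; first exact: scaled_on_cubic L3.
    exists (fun ji : 'I_a * 'I_4 => (nth 0 Z ji.1) 0 ji.2), (fun ji => (nrm l v (lshift e ji.1)) 0 ji.2), (fun j => (l.@[pnt v j])^-1).
    split.
      have -> : (fun ji => (nrm l v (lshift e ji.1)) 0 ji.2) =
          rescale (fun j => (l.@[pnt v (lshift e j)])^-1) (left_config v).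
        by apply/funext => -[j i]; rewrite /nrm !mxE.
      by apply: sD => // j; rewrite invr_eq0.
    split; first exact: (@linkable_linked_config k F l hl a n sg Z (fun i => nrm l v (lshift e i)) sZ L1).
    split; first by move=> j /eqP; rewrite invr_eq0 (negbTE (lv j)).
    have -> : rescale (fun j => (l.@[pnt v j])^-1) (scaled v (fun ji => (Q ji.1) 0 ji.2)) = fun ji => (Q ji.1) 0 ji.2.
      by apply/funext => -[j i]; rewrite /rescale /scaled /= mulKf.
    exact: (@linkable_linked_config k F l hl a (n + e) sg Z Q sZ L3).
  + by have [v vF _] := generically_ex near; exists v.
  + exact: step_constr.
- move=> v; apply: step_good => //; lia.
Qed.

(** The same two links, read backwards. *)
Lemma general_down : general_glicci (n + e) -> general_glicci n.
Proof.
move=> [D [cD sD [f0 [pf0 n0f hf0]] goodD]]; exists (@step_config a (n + e) n sg D); split.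
- exact: step_constr.
- exact: step_rescale.
- have [v1 v1F _] := generically_ex near.
  apply: (generically_dense (@irr _)); last 1 first.
  + move=> f pf fn.
    have gf : generically (@on_cubic k F 'I_n) (fun v => f v != 0) by exists f.
    have gf0 : generically (@on_cubic k F 'I_(n + e)) (fun v => f0 v != 0) by exists f0.
    have [v vF [[[lv [Z [sZ L1 L2]]] fv] f0v]] :=
      generically_ex (generically_and (@irr _) (generically_and (@irr _) near (left_generic gf)) gf0).
    have [|Q hQ L3] := L2 _ (scaled_polyfun v pf0); first by rewrite scaled_nrm.
    exists (left_config v); split=> //; first by move=> j; exact: (vF (lshift e j)).
    exists (fun ji : 'I_a * 'I_4 => (nth 0 Z ji.1) 0 ji.2), (fun ji => (Q ji.1) 0 ji.2), (fun j => (l.@[pnt v (lshift e j)])^-1).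
    split.
      have -> : (fun ji => (Q ji.1) 0 ji.2) =
          rescale (fun j => (l.@[pnt v j])^-1) (scaled v (fun ji => (Q ji.1) 0 ji.2)).
        by apply/funext => -[j i]; rewrite /rescale /scaled /= mulKf.
      apply: sD => [j|]; first by rewrite invr_eq0.
      by apply: hf0 => //; exact: scaled_on_cubic L3.
    split; first exact: (@linkable_linked_config k F l hl a (n + e) sg Z Q sZ L3).
    split; first by move=> j /eqP; rewrite invr_eq0 (negbTE (lv _)).
    have -> : rescale (fun j => (l.@[pnt v (lshift e j)])^-1) (left_config v) = fun ji => (nrm l v (lshift e ji.1)) 0 ji.2.
      by apply/funext => -[j i]; rewrite /nrm !mxE.
    exact: (@linkable_linked_config k F l hl a n sg Z (fun i => nrm l v (lshift e i)) sZ L1).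
  + by exists (left_config v1) => j; exact: (v1F (lshift e j)).
  + exact: step_constr.
- move=> v; apply: step_good => //; lia.
Qed.

End NearPoints.

Hypothesis near : forall q m e n, (0 < q)%N -> (0 < m)%N -> (m + e = q.+1)%N ->
  (e = 1%N /\ (hpoly q.-1 <= n)%N /\ (n + 2 <= hpoly q)%N) \/ (e = 2 /\ n.+1 = hpoly q.-1) ->
  generically (@on_cubic k F 'I_(n + e)) (@nearable _ F l q m e n).

Lemma general_one : general_glicci 1.
Proof.
pose lf (v : config 1) := l.@[pnt v ord0].
have plf : polyfun lf by apply: polyfun_meval => i; exact: polyfun_var.
exists (fun v => lf v != 0); split.
- exact: constr_neq.
- move=> c v c0 lv; rewrite /lf (meval_homog (c ord0) (pnt v ord0) hl) mulf_neq0 // expf_neq0 //.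
- exists lf; split=> //.
  have [||||v vF [lv _]] := generically_ex (@near 1 1 1 1 _ _ _ _) => //; first by left.
  by exists (fun ji => v (lshift 1 ji.1, ji.2)) => [j|]; [exact: (vF (lshift 1 j)) | exact: (lv (lshift 1 ord0))].
- move=> v lv; have v0 j : cpoint v j != 0.
    rewrite (ord1 j); apply: contraNneq lv => v0; apply/eqP; rewrite /lf.
    by apply: linear_at0 => i; have := congr1 (fun A : pt => A 0 i) v0; rewrite !mxE.
  split; first by split=> // i j; rewrite (ord1 i) (ord1 j) eqxx.
  have c0 (j : 'I_1) : (lf v)^-1 != 0 by rewrite invr_eq0.
  rewrite -(ideal_of_rescale v c0); have -> : points_of (rescale (fun=> (lf v)^-1) v) = [:: (lf v)^-1 *: cpoint v ord0].
    by rewrite /points_of enum_ordSl enum_ord0 /= cpoint_rescale.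
  apply: (point_glicci hl).
  rewrite -[RHS](mulVf lv) -[in RHS](expr1 (lf v)^-1) -(meval_homog (lf v)^-1 (pnt v ord0) hl).
  by apply: meval_eq => i; rewrite !mxE.
Qed.

(** Between two values of the Hilbert function one point is added at a time; the value h = hpoly q.+1
    itself is reached from h - 1 points through h + 1. *)
Lemma general_all n : (0 < n)%N -> general_glicci n.
Proof.
elim: n => // -[_ _|n IH _]; first exact: general_one.
have {}IH := IH isT.
have step q : (hpoly q < hpoly q.+1)%N.
  by have := hpolyE q; have := hpolyE q.+1; rewrite -!mulnn; lia.
have [q [lo hi]] : exists q, (hpoly q <= n.+1)%N /\ (n.+1 < hpoly q.+1)%N.
  have ex : exists q, (n.+1 < hpoly q)%N.
    exists n.+1; elim: n.+1 => [|i h]; first by [].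
    exact: leq_ltn_trans h (step i).
  case: (ex_minnP ex) => -[|q] hq mn; first by [].
  by exists q; split=> //; rewrite leqNgt; apply/negP => /mn; rewrite ltnn.
have hq := hpolyE q; have hq1 := hpolyE q.+1; have hq2 := hpolyE q.+2; rewrite -!mulnn in hq hq1 hq2.
have sq : (q.+1 <= q.+1 * q.+1)%N by rewrite leq_pmull.
case: (leqP (n.+1 + 2) (hpoly q.+1)) => hn.
  rewrite -[n.+2]addn1; have na : (n.+1 < 3 * q.+1 * q.+1)%N by rewrite -mulnA; lia.
  apply: (general_up (q := q.+1) (m := q.+1) (e := 1) (n := n.+1) isT isT isT na _ IH); apply: near => //; first by rewrite addn1.
  by left.
have nE : n.+2 = hpoly q.+1 by lia.
have na1 : (n.+1 < 3 * q.+2 * q.+1)%N by lia.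
have na2 : (n.+2 < 3 * q.+2 * q.+2)%N by lia.
have G1 : general_glicci (n.+1 + 2).
  apply: (general_up (q := q.+2) (m := q.+1) (e := 2) (n := n.+1) isT isT isT na1 _ IH); apply: near => //; first by rewrite addn2.
  by right.
apply: (general_down (q := q.+2) (m := q.+2) (e := 1) (n := n.+2) isT isT isT na2).
  apply: near => //; first by rewrite addn1.
  by left; split=> //=; lia.
by rewrite (_ : n.+2 + 1 = n.+1 + 2)%N //; lia.
Qed.

End Induction.

(** * Multihomogeneous polynomials *)

Section Multihomogeneous.
Variables (k : closedFieldType) (n : nat).
Local Notation T := {mpoly k[n * 4]}.
Local Notation idx := (@mxvec_index n 4).
Implicit Types (g : T) (p : 'M[k]_(n, 4)) (m : 'X_{1..n * 4}).

Lemma index_inverse : exists r : 'I_(n * 4) -> 'I_n * 'I_4,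
  (forall i j, r (idx i j) = (i, j)) /\ forall x, idx (r x).1 (r x).2 = x.
Proof.
have [r rK Kr] := curry_mxvec_bij n 4; exists r; split=> [i j|x].
  exact: (rK (i, j) isT).
by have := Kr x isT; case: (r x).
Qed.

Definition monomial m p : k := \prod_i \prod_j p i j ^+ m (idx i j).

Lemma meval_monomials g p : g.@[mxvec p 0] = \sum_(m <- msupp g) g@_m * monomial m p.
Proof.
rewrite mevalE; apply: eq_bigr => m _; congr (_ * _).
rewrite (reindex _ (curry_mxvec_bij n 4)) /= /monomial pair_bigA /=.
by apply: eq_bigr => -[i j] _ /=; rewrite mxvecE.
Qed.

Definition row_degree m i : nat := (\sum_(j < 4) m (idx i j))%N.

Lemma monomial_scale m p (c : 'I_n -> k) :
  monomial m (\matrix_(i, j) (c i * p i j)) = (\prod_i c i ^+ row_degree m i) * monomial m p.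
Proof.
rewrite /monomial -big_split /=; apply: eq_bigr => i _.
rewrite /row_degree -prodrXr -big_split /=; apply: eq_bigr => j _.
by rewrite mxE exprMn.
Qed.

Lemma mcoeff_sum_monomials (r : seq 'X_{1..n * 4}) (P : pred 'X_{1..n * 4}) (c : 'X_{1..n * 4} -> k)
    (h : 'X_{1..n * 4} -> 'X_{1..n * 4}) u :
  u \in msupp (\sum_(m <- r | P m) c m *: 'X_[h m] : T) -> exists m, [/\ m \in r, P m & u = h m].
Proof.
rewrite mcoeff_msupp => u0; apply: contrapT => none; case/eqP: u0.
rewrite linear_sum big_seq_cond big1 // => m /andP[mr Pm] /=.
rewrite mcoeffZ mcoeffX; case: eqP => [e|_]; last by rewrite mulr0.
by case: none; exists m.
Qed.

Lemma meval_sum_monomials (r : seq 'X_{1..n * 4}) (P : pred 'X_{1..n * 4}) (c : 'X_{1..n * 4} -> k)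
    (h : 'X_{1..n * 4} -> 'X_{1..n * 4}) p :
  (\sum_(m <- r | P m) c m *: 'X_[h m] : T).@[mxvec p 0] = \sum_(m <- r | P m) c m * monomial (h m) p.
Proof.
rewrite (big_morph _ (mevalD _) (meval0 _)); apply: eq_bigr => m _; rewrite mevalZ; congr (_ * _).
rewrite mevalX (reindex _ (curry_mxvec_bij n 4)) /= /monomial pair_bigA /=.
by apply: eq_bigr => -[i j] _ /=; rewrite mxvecE.
Qed.

Lemma permute_rows (s : 'S_n) g : multihomogeneous g -> exists2 g' : T, multihomogeneous g' &
  forall p, g'.@[mxvec p 0] = g.@[mxvec (row_perm s^-1%g p) 0].
Proof.
move=> [e eP]; have [r [rE rK]] := index_inverse.
pose h m : 'X_{1..n * 4} := [multinom m (idx (s (r x).1) (r x).2) | x < n * 4].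
have hE m i j : h m (idx i j) = m (idx (s i) j) by rewrite mnmE rE.
exists (\sum_(m <- msupp g) g@_m *: 'X_[h m]).
  exists (fun i => e (s i)) => u /mcoeff_sum_monomials[m [mg _ ->]] i.
  by rewrite -(eP m mg (s i)); apply: eq_bigr => j _; rewrite hE.
move=> p; rewrite meval_sum_monomials meval_monomials; apply: eq_bigr => m _; congr (_ * _).
rewrite /monomial [RHS](reindex_inj (@perm_inj _ s)) /=; apply: eq_bigr => i _; apply: eq_bigr => j _.
by rewrite hE mxE permK.
Qed.

(** Under rescaling of the rows of p, g becomes a polynomial in the scaling factors whose
    coefficients are the values at p of the multihomogeneous components of g. *)
Lemma multihomogeneous_component g p1 : g.@[mxvec p1 0] != 0 -> exists g' : T,
  [/\ multihomogeneous g', g'.@[mxvec p1 0] != 0 & forall p, g'.@[mxvec p 0] != 0 ->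
     exists c : 'I_n -> k, (forall i, c i != 0) /\ g.@[mxvec (\matrix_(i, j) (c i * p i j)) 0] != 0].
Proof.
move=> gp1; pose b := msize g.
pose rd m : {ffun 'I_n -> 'I_b.+1} := [ffun i => inord (row_degree m i)].
have rdE m i : m \in msupp g -> row_degree m i = rd m i.
  move=> mg; rewrite ffunE inordK // ltnS; apply: leq_trans (ltnW (msize_mdeg_lt mg)).
  rewrite mdegE (reindex _ (curry_mxvec_bij n 4)) /=.
  have -> : (\sum_j m (uncurry idx j) = \sum_i' \sum_j m (idx i' j))%N.
    by rewrite pair_bigA /=; apply: eq_bigr => -[i' j].
  by rewrite (bigD1 i) //= leq_addr.
pose comp (J : {ffun 'I_n -> 'I_b.+1}) : T := \sum_(m <- msupp g | rd m == J) g@_m *: 'X_[m].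
have compE J p : (comp J).@[mxvec p 0] = \sum_(m <- msupp g | rd m == J) g@_m * monomial m p.
  exact: (meval_sum_monomials _ _ _ id).
have gE p : g.@[mxvec p 0] = \sum_J (comp J).@[mxvec p 0].
  rewrite meval_monomials (partition_big rd xpredT) //=; apply: eq_bigr => J _; by rewrite compE.
have [J Jp1] : exists J, (comp J).@[mxvec p1 0] != 0.
  apply: contrapT => none; case/eqP: gp1; rewrite gE big1 // => J _.
  apply/eqP/negPn/negP => h; by apply: none; exists J.
exists (comp J); split=> //.
  exists (fun i => J i) => u /(@mcoeff_sum_monomials _ _ _ id)[m [mg /eqP mJ ->]] i.
  by rewrite -mJ -rdE.
move=> p pJ; pose mon (J' : {ffun 'I_n -> 'I_b.+1}) : 'X_{1..n} := [multinom (J' i : nat) | i < n].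
have mon_inj : injective mon.
  move=> J1 J2 /mnmP e; apply/ffunP => i; apply: val_inj; have := e i; by rewrite !mnmE.
pose La : {mpoly k[n]} := \sum_J' (comp J').@[mxvec p 0] *: 'X_[mon J'].
have La0 : La != 0.
  apply: contraNneq pJ => L0; have := congr1 (mcoeff (mon J)) L0.
  rewrite mcoeff0 linear_sum (bigD1 J) //= big1 ?addr0 => [|J' n1]; rewrite mcoeffZ mcoeffX.
    by rewrite eqxx mulr1 => ->.
  by rewrite (inj_eq mon_inj) (negbTE n1) mulr0.
have [|c] := @mpoly_nonroot k n (La * \prod_(i < n) 'X_i).
  rewrite mulf_neq0 //; apply/prodf_neq0 => i _; apply/eqP => e.
  by have := congr1 (mcoeff U_(i)) e; rewrite mcoeffX eqxx mcoeff0 => /eqP; rewrite oner_eq0.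
rewrite mevalM mulf_eq0 negb_or => /andP[Lc Xc]; exists c; split.
  move=> i; move: Xc; rewrite (big_morph _ (mevalM c) (meval1 c)) => /prodf_neq0/(_ i isT).
  by rewrite mevalXU.
rewrite gE; move: Lc; rewrite (big_morph _ (mevalD c) (meval0 c)); congr (_ != 0).
apply: eq_bigr => J' _; rewrite mevalZ mevalX !compE mulr_suml big_seq_cond [RHS]big_seq_cond.
apply: eq_bigr => m /andP[mg /eqP mJ]; rewrite monomial_scale -mulrA; congr (_ * _); rewrite mulrC.
by congr (_ * _); apply: eq_bigr => i _; rewrite mnmE -mJ -rdE.
Qed.

End Multihomogeneous.

Theorem corollary2p5 (k : closedFieldType) (F : {mpoly k[4]})
  (hF : smooth_cubic_surface F) (n : nat) (hn : (1 <= n)%N) :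
  holds_for_general_point_set n F (@glicci k 3).
Proof.
have [l hl near] := nearable_generic hF.
have [D [_ scaleD [f [pf [v1 v1F fv1] hf]] goodD]] := general_all hF hl near hn.
pose conf (p : 'M[k]_(n, 4)) (ji : 'I_n * 'I_4) := p ji.1 ji.2.
have idealE p : points_ideal p = ideal_of (points_of (conf p)).
  apply/funext => g; apply/propext; split=> h.
    move=> P /points_ofP[j ->] d; rewrite -[RHS](h j d); apply: meval_eq => i; by rewrite mxE.
  move=> j d; rewrite -[RHS](h (cpoint (conf p) j) _ d); last by apply/points_ofP; exists j.
  by apply: meval_eq => i; rewrite mxE.
pose good (g : {mpoly k[n * 4]}) := multihomogeneous g /\ forall p : 'M[k]_(n, 4),
  (forall i, F.@[p i] = 0) -> g.@[mxvec p 0] != 0 -> @glicci k 3 (points_ideal p).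
exists (fun p => exists2 g, good g & g.@[mxvec p 0] != 0); split.
- by exists good => // g [].
- move=> s p _ [g [mg gg] gp]; have [g' mg' g'E] := permute_rows s mg; exists g'; last first.
    rewrite g'E (_ : row_perm s^-1%g (row_perm s p) = p) //.
    by apply/matrixP => i j; rewrite !mxE permKV.
  split=> // p' p'F; rewrite g'E => /gg h.
  have -> : points_ideal p' = points_ideal (row_perm s^-1%g p').
    apply/funext => x; apply/propext; split=> H i d.
      by rewrite -[RHS](H (s^-1%g i) d); apply: meval_eq => j; rewrite mxE.
    by rewrite -[RHS](H (s i) d); apply: meval_eq => j; rewrite mxE permK.
  apply: h => i; rewrite -[RHS](p'F (s^-1%g i)); apply: meval_eq => j; by rewrite mxE.
- have [G GE] : exists G : {mpoly k[n * 4]}, forall p, f (conf p) = G.@[mxvec p 0].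
    have [|G GE] := @polyfun_mpoly k (n * 4) (fun w => f (fun ji => w (mxvec_index ji.1 ji.2))).
      by apply: polyfun_comp => // j; exact: polyfun_var.
    exists G => p; rewrite -GE; congr f; apply/funext => -[i j]; by rewrite /conf mxvecE.
  pose p1 : 'M[k]_(n, 4) := \matrix_(i, j) v1 (i, j).
  have cp1 : conf p1 = v1 by apply/funext => -[i j]; rewrite /conf mxE.
  have [|g' [mg' g'p1 g'E]] := @multihomogeneous_component k n G p1; first by rewrite -GE cp1.
  exists p1; last first.
    exists g' => //; split=> // p pF /g'E[c [c0]]; rewrite -GE => fc.
    have ce : conf (\matrix_(i, j) (c i * p i j)) = rescale c (conf p).
      by apply/funext => -[i j]; rewrite /conf /rescale mxE.
    rewrite idealE -(ideal_of_rescale (conf p) c0) -ce.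
    have onF : on_cubic F (conf (\matrix_(i, j) (c i * p i j))).
      by move=> j; rewrite ce [LHS](meval_homog (c j) (p j) (cubic_homog hF)) pF mulr0.
    exact: (goodD _ (hf _ onF fc)).2.
  have [[nz dis] _] := goodD v1 (hf v1 v1F fv1).
  have rE i : row i p1 = cpoint v1 i by apply/rowP => j; rewrite !mxE.
  split=> [i|i j ij c]; rewrite ?rE; last exact: dis.
  by split=> //; rewrite -[RHS](v1F i); apply: meval_eq => j; rewrite mxE.
- by move=> p [pd _] [g [_ gg] gp]; apply: gg gp => i; case: (pd i).
Qed.
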